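(* Let $\Omega\subseteq\mathbb{R}^2$ be a bounded Lipschitz domain, $V:=H^1_0(\Omega;\mathbb{R}^2)$, $H:=L^2(\Omega;\mathbb{R}^2)$, $V^*=H^{-1}(\Omega;\mathbb{R}^2)$, and let $\varepsilon>0$. Let $\hat\delta:\mathbb{R}^{2\times2}\to(0,\infty)$ be either of the two functions $$\hat\delta(z)=\delta^{\varepsilon,\bullet}_p(z):=\min\{\delta_p^\varepsilon(z),\delta^\bullet\}\qquad\text{or}\qquad \hat\delta(z)=\delta^\varepsilon(z):=\min\{\delta^\bullet,\max\{\delta_\bullet,\delta_p^\varepsilon(z)\}\},$$ where $\delta_p^\varepsilon(z)=\sqrt{\varepsilon+\lambda|\mathrm{Dev}\,z|^2+(\mathrm{tr}\,z)^2}$, and set $$\hat\sigma(P,Du)=\frac P2\left[\frac{\lambda\,\mathrm{Dev}\,Du+(\mathrm{div}\,u)\,\mathrm{Id}}{\hat\delta(Du)}-\mathrm{Id}\right].$$ Let $T>0$ and $u_0\in H$ be given, and assume that $U_{\mathrm{ocean}}\in L^\infty(0,T;H)\cap L^2(0,T;L^4(\Omega;\mathbb{R}^2))$, $h\in L^2(0,T;V^* )$ and $P\in L^\infty(0,T;L^\infty(\Omega;[P_\bullet,\infty)))$ for some $P_\bullet>0$. Then there exists a unique weak solution $$u\in C([0,T];H)\cap L^2(0,T;V),\qquad \dot u\in L^2(0,T;V^* ),$$ of $$\mathrm{m}\,\dot u-\mathrm{div}\,\hat\sigma(P,Du)=\mathrm{m}\,\omega\,u^\perp+\tau_{\mathrm{ocean}}(u)+h\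 \text{ in }(0,T)\times\Omega,\qquad u=0\ \text{ on }(0,T)\times\partial\Omega,$$ with initial value $u(0)=u_0$.
   Context: Constants: mass $\mathrm{m}>0$, Coriolis parameter $\omega\in\mathbb{R}$, $\lambda=2/\bar e^2$ with $\bar e>0$ (so $\lambda>0$), $c_{\mathrm{ocean}}\ge 0$, water turning angle $\theta$ with $0\le\theta\le\pi/4$, cut-off values $0<\delta_\bullet<\delta^\bullet<\infty$. For $v=(v_1,v_2)^\top\in\mathbb{R}^2$: $v^\perp=(-v_2,v_1)^\top$ and $v_\theta=\cos\theta\, v+\sin\theta\, v^\perp$. For $z\in\mathbb{R}^{2\times2}$: $\mathrm{tr}\,z=z_{11}+z_{22}$, $\mathrm{Dev}\,z=\frac12\begin{pmatrix}z_{11}-z_{22}&z_{12}+z_{21}\\ z_{12}+z_{21}&z_{22}-z_{11}\end{pmatrix}$; $z:\tilde z=\sum_{i,j}z_{ij}\tilde z_{ij}$ and $|z|$ is the Frobenius norm. $Du=\frac12(\nabla u+(\nabla u)^\top)$. The oceanic force is $\tau_{\mathrm{ocean}}(u)=c_{\mathrm{ocean}}|U_{\mathrm{ocean}}-u|(U_{\mathrm{ocean}}-u)_\theta$. Here $V\hookrightarrow H\simeq H^*\hookrightarrow V^*$ is the Gelfand triple and $\langle\cdot,\cdot\rangle$ is the dual pairing on $V^*\times V$. A weak solution is a function $u$ in the stated regularity class such that, for almost all $t\in(0,T)$ and all $v\in V$, $$\langle \mathrm{m}\dot u(t),v\rangle+\int_\Omega\hat\sigma(P(t),Du(t)):Dv\,dx-\int_\Omega\tau_{\mathrm{ocean}}(u(t))\cdot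 v\,dx-\int_\Omega \mathrm{m}\,\omega\,u(t)^\perp\cdot v\,dx=\langle h(t),v\rangle,$$ where $\tau_{\mathrm{ocean}}(u(t))$ is formed with $U_{\mathrm{ocean}}(t)$. *)

(* Defs.v *)
From mathcomp Require Import all_boot all_order all_algebra.
From mathcomp Require Import all_classical all_reals all_analysis.

Set Implicit Arguments.
Unset Strict Implicit.
Unset Printing Implicit Defensive.

Import Order.TTheory GRing.Theory Num.Theory.
Import numFieldNormedType.Exports.

Local Open Scope classical_set_scope.
Local Open Scope ring_scope.

(* Points of the plane are pairs, values of fields are column vectors or
   matrices.  All Lebesgue classes are handled through Borel representatives,
   so that equality in a function space is equality almost everywhere. *)

Notation plane R := (measurableTypeR R * measurableTypeR R)%type.
Notation vfield R := (plane R -> 'cV[R]_2).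
Notation mfield R := (plane R -> 'M[R]_2).

Definition leb1 (R : realType) : {measure set (measurableTypeR R) -> \bar R} :=
  @lebesgue_measure R.

Definition leb2 (R : realType) : {measure set (plane R) -> \bar R} :=
  (@lebesgue_measure R \x @lebesgue_measure R)%E.

Definition unit_dir (R : realType) (j : 'I_2) : plane R :=
  if j == 0 then (1, 0) else (0, 1).

Definition mxdot (R : realType) m n (z w : 'M[R]_(m, n)) : R :=
  \sum_i \sum_j z i j * w i j.

Definition frob (R : realType) m n (z : 'M[R]_(m, n)) : R :=
  Num.sqrt (mxdot z z).

(* Near each boundary point, in orthonormal coordinates rotated by the angle
   whose cosine and sine are c and s, the set is the part of a ball lying above
   the graph of a Lipschitz function. *)
Definition bounded_lipschitz_domain (R : realType) (Om : set (plane R)) :=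
  [/\ Om !=set0, open Om, connected Om, bounded_set Om &
   forall x0, (closure Om `\` Om) x0 ->
    exists r c s : R, exists g : R -> R,
    [/\ 0 < r, c ^+ 2 + s ^+ 2 = 1, [lipschitz g y | y in [set: R]] &
     forall x, ball x0 r x ->
      (Om x <-> g (c * x.1 + s * x.2) < - s * x.1 + c * x.2)]].

Fixpoint is_Ck (R : realType) (E : normedModType R) (k : nat) (f : E -> R) :=
  continuous f /\
  if k is k'.+1 then
    forall v : E, (forall x, derivable f x v) /\ is_Ck k' (fun x => 'D_v f x)
  else True.

Definition test_fun (R : realType) (E : normedModType R) (A : set E)
    (phi : E -> R) :=
  (forall k, is_Ck k phi) /\
  exists K, [/\ compact K, K `<=` A & forall x, ~ K x -> phi x = 0].

Definition LpO_norm (R : realType) (Om : set (plane R)) (p : \bar R)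
    (f : plane R -> R) : \bar R :=
  'N[@leb2 R]_p[(EFin \o f) \_ Om]%E.

Definition in_LpO (R : realType) (Om : set (plane R)) (p : \bar R) m n
    (f : plane R -> 'M[R]_(m, n)) :=
  (forall i j, measurable_fun Om (fun x => f x i j : measurableTypeR R)) /\
  (LpO_norm Om p (fun x => frob (f x)) < +oo)%E.

Definition is_weak_grad (R : realType) (Om : set (plane R)) (u : vfield R)
    (G : mfield R) :=
  in_LpO Om 2%:E G /\
  forall phi : plane R -> R, test_fun Om phi -> forall i j,
    \int[@leb2 R]_(x in Om) (u x i 0 * 'D_(unit_dir R j) phi x) =
    - \int[@leb2 R]_(x in Om) (G x i j * phi x).

(* A representative of the gradient; arbitrary if there is no weak gradient
   in L^2. *)
Definition weak_grad (R : realType) (Om : set (plane R)) (u : vfield R) :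
  mfield R := get [set G | is_weak_grad Om u G].

Definition in_H1 (R : realType) (Om : set (plane R)) (u : vfield R) :=
  in_LpO Om 2%:E u /\ exists G, is_weak_grad Om u G.

Definition H1_norm (R : realType) (Om : set (plane R)) (u : vfield R) : \bar R :=
  LpO_norm Om 2%:E (fun x =>
    Num.sqrt (frob (u x) ^+ 2 + frob (weak_grad Om u x) ^+ 2)).

(* H^1_0: the closure of the smooth compactly supported fields in H^1. *)
Definition in_H10 (R : realType) (Om : set (plane R)) (u : vfield R) :=
  in_H1 Om u /\
  forall e : R, 0 < e -> exists phi : vfield R,
    (forall i, test_fun Om (fun x => phi x i 0)) /\
    (H1_norm Om (u - phi)%R < e%:E)%E.

(* A normed space presented by representatives: the members of a linear space
   lying in [nmem], identified when the norm of their difference vanishes.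
   [nnorm] is meaningful on [nmem] only. *)
Record nspace (R : realType) := NSpace {
  nsort : lmodType R;
  nmem : set nsort;
  nnorm : nsort -> \bar R }.
Arguments nmem {R}.
Arguments nnorm {R}.

Definition LpO (R : realType) (Om : set (plane R)) (p : \bar R) : nspace R :=
  @NSpace R (vfield R) [set u | in_LpO Om p u] (fun u => LpO_norm Om p (fun x => frob (u x))).

Definition LinfO (R : realType) (Om : set (plane R)) : nspace R :=
  @NSpace R (plane R -> R)
    [set f | measurable_fun Om (f : plane R -> measurableTypeR R) /\
             (LpO_norm Om +oo f < +oo)%E]
    (LpO_norm Om +oo).

Definition H10 (R : realType) (Om : set (plane R)) : nspace R :=
  @NSpace R (vfield R) (in_H10 Om) (H1_norm Om).

Definition dual_norm (R : realType) (X : nspace R) (F : nsort X -> R) : \bar R :=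
  ereal_sup [set `|F v|%:E | v in [set v | nmem X v /\ (nnorm X v <= 1)%E]].

(* Functionals are functions on the whole carrier, of which only the values on
   [nmem X] matter. *)
Definition dual (R : realType) (X : nspace R) : nspace R :=
  @NSpace R (nsort X -> R)
    [set F | (forall (a : R) v w, nmem X v -> nmem X w ->
                F (a *: v + w) = a * F v + F w) /\
             (dual_norm F < +oo)%E]
    (@dual_norm R X).

(* The map H -> V^* of the Gelfand triple. *)
Definition gelfand (R : realType) (Om : set (plane R)) (u : vfield R) :
    nsort (dual (H10 Om)) :=
  fun v => \int[@leb2 R]_(x in Om) mxdot (u x) (v x).
Arguments gelfand {R} Om u.

Record step_fun (R : realType) (X : nspace R) := StepFun {
  step_size : nat;
  step_set : 'I_step_size -> set (measurableTypeR R);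
  step_val : 'I_step_size -> nsort X;
  step_setP : forall i, measurable (step_set i);
  step_valP : forall i, nmem X (step_val i) }.
Arguments step_set {R X} s i : rename.
Arguments step_val {R X} s i : rename.

Definition step_eval (R : realType) (X : nspace R) (s : step_fun X) (t : R) :
  nsort X := \sum_i \1_(step_set s i) t *: step_val s i.

Definition step_int (R : realType) (X : nspace R) (T : R) (s : step_fun X) :
  nsort X :=
  \sum_i fine (@leb1 R (step_set s i `&` `]0, T[)) *: step_val s i.

Definition strongly_measurable (R : realType) (T : R) (X : nspace R)
    (f : R -> nsort X) :=
  (\forall t \ae @leb1 R, 0 < t < T -> nmem X (f t)) /\
  exists s : nat -> step_fun X, \forall t \ae @leb1 R, 0 < t < T ->
    nnorm X (f t - step_eval (s n) t) @[n --> \oo] --> 0%E.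

(* The Bochner space L^p(0, T; X). *)
Definition in_bochner (R : realType) (T : R) (p : \bar R) (X : nspace R)
    (f : R -> nsort X) :=
  strongly_measurable T f /\
  ('N[@leb1 R]_p[(fun t => nnorm X (f t)) \_ `]0%R, T[] < +oo)%E.

Arguments in_bochner {R} T p X f.

(* I is the Bochner integral of f over (0, T). *)
Definition is_bochner_int (R : realType) (T : R) (X : nspace R)
    (f : R -> nsort X) (I : nsort X) :=
  [/\ strongly_measurable T f, nmem X I &
   exists s : nat -> step_fun X,
     (\int[@leb1 R]_(t in `]0%R, T[) nnorm X (f t - step_eval (s n) t)%R)%E
       @[n --> \oo] --> 0%E /\
     nnorm X (step_int T (s n) - I) @[n --> \oo] --> 0%E].

(* w is the derivative of u in the sense of V^*-valued distributions on
   (0, T). *)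
Definition is_time_deriv (R : realType) (Om : set (plane R)) (T : R)
    (u : R -> vfield R) (w : R -> nsort (dual (H10 Om))) :=
  forall phi : R -> R, test_fun `]0, T[ phi ->
  exists I : nsort (dual (H10 Om)),
    is_bochner_int T (fun t => derive1 phi t *: gelfand Om (u t)) I /\
    is_bochner_int T (fun t => phi t *: w t) (- I).
Arguments is_time_deriv {R} Om T u w.

Definition in_C (R : realType) (T : R) (X : nspace R) (f : R -> nsort X) :=
  forall t, 0 <= t <= T -> nmem X (f t) /\
    nnorm X (f s - f t) @[s --> within `[0, T] (nbhs t)] --> 0%E.
Arguments in_C {R} T X f.

Definition perp (R : realType) (v : 'cV[R]_2) : 'cV[R]_2 :=
  \col_i (if i == 0 then - v 1 0 else v 0 0).

Definition turn (R : realType) (theta : R) (v : 'cV[R]_2) : 'cV[R]_2 :=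
  cos theta *: v + sin theta *: perp v.

Definition Dev (R : realType) (z : 'M[R]_2) : 'M[R]_2 :=
  2^-1 *: \matrix_(i, j)
    (if i == j then (if i == 0 then z 0 0 - z 1 1 else z 1 1 - z 0 0)
     else z 0 1 + z 1 0).

Definition sym_grad (R : realType) (Om : set (plane R)) (u : vfield R) :
  mfield R := fun x => 2^-1 *: (weak_grad Om u x + (weak_grad Om u x)^T).

Definition delta_p (R : realType) (eps lambda : R) (z : 'M[R]_2) : R :=
  Num.sqrt (eps + lambda * frob (Dev z) ^+ 2 + (\tr z) ^+ 2).

Definition delta_above (R : realType) (eps lambda dsup : R) (z : 'M[R]_2) : R :=
  Num.min (delta_p eps lambda z) dsup.

Definition delta_both (R : realType) (eps lambda dinf dsup : R)
    (z : 'M[R]_2) : R :=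
  Num.min dsup (Num.max dinf (delta_p eps lambda z)).

(* The trace of D u is div u. *)
Definition stress (R : realType) (lambda : R) (dhat : 'M[R]_2 -> R) (P : R)
    (z : 'M[R]_2) : 'M[R]_2 :=
  (P / 2) *: ((dhat z)^-1 *: (lambda *: Dev z + (\tr z)%:M) - 1%:M).

Definition tau_ocean (R : realType) (c theta : R) (U u : 'cV[R]_2) : 'cV[R]_2 :=
  (c * frob (U - u)) *: turn theta (U - u).

Definition weak_solution (R : realType) (m omega lambda c theta : R)
    (dhat : 'M[R]_2 -> R) (Om : set (plane R)) (T : R)
    (U : R -> vfield R) (h : R -> nsort (dual (H10 Om))) (P : R -> plane R -> R)
    (u0 : vfield R) (u : R -> vfield R) :=
  [/\ in_C T (LpO Om 2%:E) u,
      in_bochner T 2%:E (H10 Om) u,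
      (exists du : R -> nsort (dual (H10 Om)),
        [/\ in_bochner T 2%:E (dual (H10 Om)) du,
            is_time_deriv Om T u du &
            \forall t \ae @leb1 R, 0 < t < T ->
            forall v : vfield R, in_H10 Om v ->
              m * du t v
              + \int[@leb2 R]_(x in Om)
                  mxdot (stress lambda dhat (P t x) (sym_grad Om (u t) x))
                        (sym_grad Om v x)
              - \int[@leb2 R]_(x in Om)
                  mxdot (tau_ocean c theta (U t x) (u t x)) (v x)
              - \int[@leb2 R]_(x in Om)
                  mxdot ((m * omega) *: perp (u t x)) (v x)
              = h t v]) &
      \forall x \ae @leb2 R, Om x -> u 0 x = u0 x].
Arguments weak_solution {R} m omega lambda c theta dhat Om T U h P u0 u.

(* Main.v *)
(* Put [V = H^1_0], [H = L^2].  The stress is [P / 2] times [A z / delta (z) - Id], where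
   [A z = lambda Dev z + (tr z) Id] is the gradient of half the square of the seminorm
   [q z = (lambda |Dev z|^2 + (tr z)^2)^(1/2)] and [delta] is a clamped [(eps + q^2)^(1/2)].
   As [r / delta r] has a slope bounded from below and [q] controls symmetric matrices, the
   stress is Lipschitz and strongly monotone, hence so is its form on [V] by the inequalities
   of Korn and Poincare, which on [H^1_0] follow from integration by parts.  For
   [0 <= theta <= pi / 4] one has [sin theta <= cos theta], which makes [w |-> |w| w_theta]
   monotone, and the Coriolis term is skew.

   When the factor [|U - u|] is truncated at level [k], the operator is Lipschitz on [V].  The
   equation [u' + mu u = g] is solvable because the data with a solution that is affine in
   time on the pieces of a partition are dense and the energy identity is an a priori bound;
   the monotone Lipschitz equation follows by a contraction in [L^2(0,T;V)].  The truncated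
   solutions form a Cauchy sequence in [C(0,T;H)] and [L^2(0,T;V)]: by monotonicity only the
   truncation errors matter, and these are bounded by the tail of [U] in [L^4] and, through
   the inequality of Ladyzhenskaya [|v|_4^2 <= 4 |v|_H |v|_V], by a negative power of [k].
   Uniqueness is the energy identity for the difference of two solutions together with
   monotonicity.

   Time derivatives are handled through their Riesz representatives in [V]; the lemma of du
   Bois-Reymond turns the distributional derivative into the integrated equation. *)

(* No weak compactness enters: every limit is taken along a Cauchy sequence, whose estimates come
   from strong monotonicity, so completeness and the Riesz theorem carry the functional analysis.

   It is computed by hand for solutions whose time derivative is a step function and survives limits
   ([Wsol_lim]). It reaches an arbitrary [Wsol] only because the linear equation with the same data
   has a solution obtained as such a limit, and [Wsol_uniq], proved without energy, makes the two
   coincide ([Wsol_good]).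

   Without truncation the drag is Lipschitz on [V] only on sets that are bounded in [H]. The
   constants of the passage to the limit therefore depend on a bound [B] of the [H] norm, and the
   energy identity provides such a bound uniformly in the truncation level. *)
Require Import Defs.
From HB Require Import structures.
From mathcomp Require Import all_boot all_order all_algebra.
From mathcomp Require Import all_classical all_reals all_analysis.
From mathcomp Require Import measurable_realfun zify ring lra.
Import Order.TTheory GRing.Theory Num.Theory.
Import numFieldNormedType.Exports.
Set Implicit Arguments.
Unset Strict Implicit.
Unset Printing Implicit Defensive.
Local Open Scope classical_set_scope.
Local Open Scope ring_scope.

(** * Inner product spaces *)

(* The inner product is only semidefinite: functions equal almost everywhere are not
   identified, and uniqueness takes the form [hn (x - y) = 0]. *)
Record phs (R : realType) := Phs {
  hsort :> lmodType R;
  ip : hsort -> hsort -> R;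
  ipDl : forall x y z, ip (x + y) z = ip x z + ip y z;
  ipZl : forall a x z, ip (a *: x) z = a * ip x z;
  ipC : forall x y, ip x y = ip y x;
  ip_ge0 : forall x, 0 <= ip x x }.

(** Evaluation at the vertex [- b / a]. The case [a = 0] must be included because inner products are
    only semidefinite; there the affine function is tested where it takes the value [-1]. *)
Lemma quad_discr (R : realFieldType) (a b c : R) :
  0 <= a -> (forall t, 0 <= a * t ^+ 2 + 2 * b * t + c) -> b ^+ 2 <= a * c.
Proof.
move=> a0 h; move: a0; rewrite le_eqVlt => /orP[/eqP a0|a0].
  rewrite -a0 mul0r; have [->|b0] := eqVneq b 0; first by rewrite expr0n.
  have := h (- (c + 1) / (2 * b)); rewrite -a0 mul0r add0r.
  have -> : 2 * b * (- (c + 1) / (2 * b)) = - (c + 1) by field.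
  lra.
have := h (- b / a).
have -> : a * (- b / a) ^+ 2 + 2 * b * (- b / a) + c = (a * c - b ^+ 2) / a.
  by field; rewrite gt_eqF.
by rewrite ler_pdivlMr // mul0r; lra.
Qed.

(** * Convergence of real sequences *)

Section Sequences.
Variable R : realType.
Implicit Types (a b : nat -> R) (l m : R).

(* A record rather than a definition, so that implicit arguments are not
   inferred through the filter. *)
Record cv a l : Prop := Cv { cv_cvg : a @ \oo --> l }.

Lemma cvP a l : cv a l <->
  forall e, 0 < e -> exists N, forall n, (N <= n)%N -> `|a n - l| < e.
Proof.
split=> [[/cvgr_dist_lt h] e /h [N _ hN]|h].
  by exists N => n /hN /=; rewrite distrC.
constructor; apply/cvgrPdist_lt => e /h [N hN]; exists N => // n /= /hN.
by rewrite distrC.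
Qed.

Lemma cvD a b l m : cv a l -> cv b m -> cv (fun n => a n + b n) (l + m).
Proof. by move=> [ha] [hb]; constructor; apply: cvgD. Qed.

Lemma cvB a b l m : cv a l -> cv b m -> cv (fun n => a n - b n) (l - m).
Proof. by move=> [ha] [hb]; constructor; apply: cvgB. Qed.

Lemma cvM a b l m : cv a l -> cv b m -> cv (fun n => a n * b n) (l * m).
Proof. by move=> [ha] [hb]; constructor; apply: cvgM. Qed.

Lemma cvN a l : cv a l -> cv (fun n => - a n) (- l).
Proof. by move=> [ha]; constructor; apply: cvgN. Qed.

Lemma cvC l : cv (fun=> l) l.
Proof. by constructor; exact: cvg_cst. Qed.

Lemma cvZ k a l : cv a l -> cv (fun n => k * a n) (k * l).
Proof. by move=> ha; apply: cvM => //; exact: cvC. Qed.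

Lemma cv_uniq a l m : cv a l -> cv a m -> l = m.
Proof. by move=> [h1] [h2]; apply: (cvg_unique _ h1 h2). Qed.

Lemma cv_abs a l : cv a l -> cv (fun n => `|a n|) `|l|.
Proof. by move=> [h]; constructor; apply: cvg_norm. Qed.

Lemma cv_sqrt a l : cv a l -> cv (fun n => Num.sqrt (a n)) (Num.sqrt l).
Proof.
by move=> [h]; constructor; apply: continuous_cvg => //; exact: sqrt_continuous.
Qed.

Lemma cv_squeeze a b : (forall n, `|a n| <= b n) -> cv b 0 -> cv a 0.
Proof.
move=> hab /cvP hb; apply/cvP => e /hb [N hN]; exists N => n /hN.
rewrite !subr0; apply: le_lt_trans; apply: le_trans (hab n) (ler_norm _).
Qed.

Lemma cv_squeeze0 a b : (forall n, 0 <= a n <= b n) -> cv b 0 -> cv a 0.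
Proof.
move=> hab; apply: cv_squeeze => n; have /andP[h1 h2] := hab n.
by rewrite ger0_norm.
Qed.

Lemma cv_dist a b l : (forall n, `|a n - l| <= b n) -> cv b 0 -> cv a l.
Proof.
move=> hab hb; have h : cv (fun n => a n - l) 0 by exact: cv_squeeze hb.
have := cvD h (cvC l); rewrite add0r.
by under eq_fun do rewrite subrK.
Qed.

Lemma cv_le a b l m : (forall n, a n <= b n) -> cv a l -> cv b m -> l <= m.
Proof.
move=> hab ha hb; rewrite leNgt; apply/negP => ml.
have e0 : 0 < (l - m) / 2 by lra.
move/cvP: ha => /(_ _ e0)[N hN]; move/cvP: hb => /(_ _ e0)[M hM].
have := hN _ (leq_maxl N M); have := hM _ (leq_maxr N M); have := hab (maxn N M).
by rewrite !ltr_norml => h /andP[h1 h2] /andP[h3 h4]; lra.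
Qed.

Lemma cv_sub a (f : nat -> nat) l : (forall n, (n <= f n)%N) -> cv a l ->
  cv (fun n => a (f n)) l.
Proof.
move=> hf /cvP h; apply/cvP => e /h [N hN]; exists N => n Nn.
by apply: hN; exact: leq_trans Nn (hf n).
Qed.

Lemma cv_harmonic : cv (fun n => n.+1%:R^-1) 0.
Proof. by constructor; exact: cvg_harmonic. Qed.

Lemma cv_sum I (s : seq I) (F : nat -> I -> R) (G : I -> R) :
  (forall i, cv (F^~ i) (G i)) ->
  cv (fun n => \sum_(i <- s) F n i) (\sum_(i <- s) G i).
Proof.
move=> h; elim: s => [|i s IH].
  by rewrite big_nil; under eq_fun do rewrite big_nil; exact: cvC.
by rewrite big_cons; under eq_fun do rewrite big_cons; exact: cvD.
Qed.

Lemma cv_sqr0 a : cv (fun n => a n ^+ 2) 0 -> cv a 0.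
Proof.
move=> /cv_sqrt; rewrite sqrtr0; under eq_fun do rewrite sqrtr_sqr.
by apply: cv_squeeze => n.
Qed.

End Sequences.

(** * Semidefinite inner products, convergence, Riesz representation *)

Section PreHilbert.
Variables (R : realType) (E : phs R).
Implicit Types x y z : E.

Definition hn x : R := Num.sqrt (ip x x).

Definition hcvg (u : nat -> E) (l : E) : Prop :=
  cv (fun n => hn (u n - l)) 0.

Definition hcauchy (u : nat -> E) : Prop :=
  forall e : R, 0 < e -> exists N, forall n m, (N <= n)%N -> (N <= m)%N ->
    hn (u n - u m) < e.

Definition hcomplete : Prop := forall u, hcauchy u -> exists l, hcvg u l.

Lemma ipDr x y z : ip z (x + y) = ip z x + ip z y.
Proof. by rewrite ipC ipDl !(ipC z). Qed.

Lemma ipZr a x z : ip z (a *: x) = a * ip z x.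
Proof. by rewrite ipC ipZl ipC. Qed.

Lemma ipNl x z : ip (- x) z = - ip x z.
Proof. by rewrite -scaleN1r ipZl mulN1r. Qed.

Lemma ipNr x z : ip z (- x) = - ip z x.
Proof. by rewrite ipC ipNl ipC. Qed.

Lemma ipBl x y z : ip (x - y) z = ip x z - ip y z.
Proof. by rewrite ipDl ipNl. Qed.

Lemma ipBr x y z : ip z (x - y) = ip z x - ip z y.
Proof. by rewrite ipDr ipNr. Qed.

Lemma ip0l z : ip 0 z = 0.
Proof. by rewrite -(scale0r 0) ipZl mul0r. Qed.

Lemma ip0r z : ip z 0 = 0.
Proof. by rewrite ipC ip0l. Qed.

Lemma ip_suml I (s : seq I) (P : pred I) (F : I -> E) z :
  ip (\sum_(i <- s | P i) F i) z = \sum_(i <- s | P i) ip (F i) z.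
Proof.
elim/big_rec2: _ => [|i x y _ <-]; first exact: ip0l.
by rewrite ipDl.
Qed.

Lemma ip_sqD x y : ip (x + y) (x + y) = ip x x + 2 * ip x y + ip y y.
Proof. by rewrite ipDl !ipDr (ipC y x); ring. Qed.

Lemma ip_sqB x y : ip (x - y) (x - y) = ip x x - 2 * ip x y + ip y y.
Proof. by rewrite ip_sqD ipNl !ipNr; ring. Qed.

Lemma ip_CS2 x y : ip x y ^+ 2 <= ip x x * ip y y.
Proof.
rewrite mulrC; apply: quad_discr; first exact: ip_ge0.
move=> t; have := ip_ge0 (x + t *: y); rewrite ip_sqD ipZl !ipZr.
by move=> h; rewrite (_ : _ + _ = ip x x + 2 * (t * ip x y) + t * (t * ip y y)) //; ring.
Qed.

Lemma hn_ge0 x : 0 <= hn x.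
Proof. exact: sqrtr_ge0. Qed.

Lemma hn_sq x : hn x ^+ 2 = ip x x.
Proof. by rewrite sqr_sqrtr // ip_ge0. Qed.

Lemma ip_CS x y : `|ip x y| <= hn x * hn y.
Proof.
rewrite -ler_sqr ?nnegrE ?normr_ge0 ?mulr_ge0 ?hn_ge0 //.
by rewrite exprMn !hn_sq -normrX ger0_norm ?sqr_ge0 // ip_CS2.
Qed.

Lemma ip_le x y : ip x y <= hn x * hn y.
Proof. exact: le_trans (ler_norm _) (ip_CS x y). Qed.

Lemma hnD x y : hn (x + y) <= hn x + hn y.
Proof.
rewrite -ler_sqr ?nnegrE ?hn_ge0 ?addr_ge0 ?hn_ge0 // hn_sq ip_sqD.
by rewrite sqrrD !hn_sq mulr2n; have := ip_le x y; lra.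
Qed.

Lemma hnZ a x : hn (a *: x) = `|a| * hn x.
Proof.
by rewrite /hn ipZl ipZr mulrA -expr2 sqrtrM ?sqr_ge0 // sqrtr_sqr.
Qed.

Lemma hnN x : hn (- x) = hn x.
Proof. by rewrite /hn ipNl ipNr opprK. Qed.

Lemma hnBC x y : hn (x - y) = hn (y - x).
Proof. by rewrite -hnN opprB. Qed.

Lemma hn0 : hn 0 = 0.
Proof. by rewrite /hn ip0l sqrtr0. Qed.

Lemma hn_triB x y z : hn (x - z) <= hn (x - y) + hn (y - z).
Proof. by rewrite -[x - z](subrKA y); exact: hnD. Qed.

Lemma hnB_le x y : hn (x - y) <= hn x + hn y.
Proof. by rewrite -(hnN y); exact: hnD. Qed.

Lemma hn_distl x y : `|hn x - hn y| <= hn (x - y).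
Proof.
have h1 := hnD (x - y) y; have h2 := hnD (y - x) x.
rewrite !subrK in h1 h2; rewrite (hnBC y) in h2.
by rewrite ler_norml; apply/andP; split; lra.
Qed.

Lemma hn_sum I (s : seq I) (F : I -> E) :
  hn (\sum_(i <- s) F i) <= \sum_(i <- s) hn (F i).
Proof.
elim/big_rec2: _ => [|i a x _ h]; first by rewrite hn0.
by apply: le_trans (hnD _ _) _; rewrite lerD2l.
Qed.

Lemma ip_hn0 x y : hn x = 0 -> ip x y = 0.
Proof. by move=> h; apply/eqP; rewrite -normr_le0; apply: le_trans (ip_CS _ _) _; rewrite h mul0r. Qed.

Lemma hcvg_const x : hcvg (fun=> x) x.
Proof. by rewrite /hcvg subrr hn0; exact: cvC. Qed.

Lemma hcvg_le u x (b : nat -> R) : (forall n, hn (u n - x) <= b n) -> cv b 0 ->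
  hcvg u x.
Proof. by move=> h; apply: cv_squeeze0 => n; rewrite hn_ge0 h. Qed.

Lemma hcvgD u v x y : hcvg u x -> hcvg v y -> hcvg (fun n => u n + v n) (x + y).
Proof.
move=> hu hv; have hs := cvD hu hv; rewrite addr0 in hs.
by apply: hcvg_le hs => n; rewrite opprD addrACA; exact: hnD.
Qed.

Lemma hcvgZ (a : R) u x : hcvg u x -> hcvg (fun n => a *: u n) (a *: x).
Proof.
move=> hu; have hs := cvZ `|a| hu; rewrite mulr0 in hs.
by apply: hcvg_le hs => n; rewrite -scalerBr hnZ lexx.
Qed.

Lemma hcvgN u x : hcvg u x -> hcvg (fun n => - u n) (- x).
Proof. by apply: hcvg_le => n; rewrite -opprD hnN. Qed.

Lemma hcvgB u v x y : hcvg u x -> hcvg v y -> hcvg (fun n => u n - v n) (x - y).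
Proof. by move=> hu hv; apply: hcvgD => //; exact: hcvgN. Qed.

Lemma hcvg_sub u (f : nat -> nat) x :
  (forall n, (n <= f n)%N) -> hcvg u x -> hcvg (fun n => u (f n)) x.
Proof. by move=> hf; exact: cv_sub. Qed.

Lemma hcvg_hn u x : hcvg u x -> cv (fun n => hn (u n)) (hn x).
Proof. by apply: cv_dist => n; exact: hn_distl. Qed.

Lemma hcvg_ip u v x y : hcvg u x -> hcvg v y ->
  cv (fun n => ip (u n) (v n)) (ip x y).
Proof.
move=> hu hv.
have h1 := cvD (cvM hu (hcvg_hn hv)) (cvZ (hn x) hv).
rewrite mul0r mulr0 addr0 in h1; apply: cv_dist h1 => n.
have -> : ip (u n) (v n) - ip x y = ip (u n - x) (v n) + ip x (v n - y).
  by rewrite ipBl ipBr; ring.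
by apply: le_trans (ler_normD _ _) _; apply: lerD; exact: ip_CS.
Qed.

Lemma hcvg_cauchy u x : hcvg u x -> hcauchy u.
Proof.
move=> hu e e0; have e2 : 0 < e / 2 by lra.
have [N hN] := (cvP _ _).1 hu _ e2; exists N => n m Nn Nm.
apply: le_lt_trans (hn_triB _ x _) _; rewrite (hnBC x).
have := hN n Nn; have := hN m Nm.
by rewrite /= !subr0 !ger0_norm ?hn_ge0 //; lra.
Qed.

Lemma hcvg_uniq u x y : hcvg u x -> hcvg u y -> hn (x - y) = 0.
Proof.
move=> hx hy; have := hcvg_hn (hcvgB hx hy).
under eq_fun do rewrite subrr hn0.
by move/cv_uniq/(_ (cvC _)).
Qed.

Lemma hcvg_eq u x y : hcvg u x -> hn (x - y) = 0 -> hcvg u y.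
Proof.
move=> hu hxy; apply: hcvg_le hu => n.
by apply: le_trans (hn_triB _ x _) _; rewrite hxy addr0.
Qed.

Lemma hcauchy_hcvg_sub u (f : nat -> nat) x :
  (forall n, (n <= f n)%N) -> hcauchy u -> hcvg (fun n => u (f n)) x -> hcvg u x.
Proof.
move=> hf hc hx; apply/cvP => e e0; have e2 : 0 < e / 2 by lra.
have [N hN] := hc _ e2; have [M hM] := (cvP _ _).1 hx _ e2.
exists (maxn N M) => n; rewrite geq_max => /andP[Nn Mn].
have := hM n Mn; rewrite !subr0 !ger0_norm ?hn_ge0 // => h.
apply: le_lt_trans (hn_triB _ (u (f n)) _) _.
by have := hN n (f n) Nn (leq_trans Nn (hf n)); lra.
Qed.

Section Minimization.
Variables (M : E -> Prop) (f : E -> R) (C : R).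
Hypothesis M0 : M 0.
Hypothesis Ml : forall a x y, M x -> M y -> M (a *: x + y).
Hypothesis fl : forall a x y, M x -> M y -> f (a *: x + y) = a * f x + f y.
Hypothesis fC : forall x, M x -> `|f x| <= C * hn x.

(* Minimising sequence of [|m|^2 - 2 f m] over the subspace. *)
Lemma riesz_sequence : exists m : nat -> E,
  [/\ forall n, M (m n), hcauchy m &
      forall v, M v -> cv (fun n => ip (m n) v) (f v)].
Proof.
pose J x := ip x x - 2 * f x.
have Jlb x : M x -> - C ^+ 2 <= J x.
  move=> Mx; rewrite /J -hn_sq; have := fC Mx; have := ler_norm (f x).
  by have := sqr_ge0 (hn x - C); nra.
pose S := [set J x | x in M].
have hS : has_inf S.
  split; first by exists (J 0), 0.
  by exists (- C ^+ 2) => _ [x Mx <-]; exact: Jlb.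
have hinf x : M x -> inf S <= J x.
  by move=> Mx; apply: ge_inf; [case: hS|exists x].
have hex n : exists x, M x /\ J x < inf S + n.+1%:R^-1.
  have e0 : (0 : R) < n.+1%:R^-1 by rewrite invr_gt0.
  by have [_ [x Mx <-] hx] := inf_adherent e0 hS; exists x.
have [m hm] := choice hex.
have f0 : f 0 = 0.
  have := fl 1 M0 M0; rewrite scale1r addr0 mul1r; lra.
have fZ a x : M x -> f (a *: x) = a * f x.
  by move=> Mx; rewrite -[a *: x]addr0 fl // f0 addr0.
exists m; split.
- by move=> n; have [] := hm n.
(* Parallelogram identity: the midpoint of two near minimisers cannot go below [inf S]. *)
- have hd n k : ip (m n - m k) (m n - m k) <= 2 * n.+1%:R^-1 + 2 * k.+1%:R^-1.
    have [Mn Jn] := hm n; have [Mk Jk] := hm k.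
    have Mh : M (2^-1 *: m n + 2^-1 *: m k).
      by apply: Ml => //; rewrite -[_ *: _]addr0; apply: Ml.
    have := hinf _ Mh.
    rewrite {1}/J fl //; last by rewrite -[_ *: _]addr0; apply: Ml.
    rewrite !fZ // (ip_sqD (2^-1 *: m n)) !ipZl !ipZr ip_sqB; move: Jn Jk.
    rewrite /J.
    set i1 := n.+1%:R^-1; set i2 := k.+1%:R^-1.
    by move=> Jn Jk; lra.
  move=> e e0; have e2 : 0 < e ^+ 2 / 4 by rewrite divr_gt0 // exprn_gt0.
  have [N hN] := (cvP _ _).1 (@cv_harmonic R) _ e2.
  exists N => n k Nn Nk.
  rewrite -ltr_sqr ?nnegrE ?hn_ge0 ?(ltW e0) // hn_sq.
  have := hN n Nn; have := hN k Nk.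
  rewrite /= !subr0 !ger0_norm ?invr_ge0 // => h1 h2.
  apply: le_lt_trans (hd n k) _; move: h1 h2.
  by set i1 := n.+1%:R^-1; set i2 := k.+1%:R^-1; lra.
- move=> v Mv.
  (* Comparing [m n] with [t *: v + m n] for all [t] gives a nonnegative quadratic in [t] whose
     constant term is [n.+1%:R^-1]. *)
  have hq n : (ip (m n) v - f v) ^+ 2 <= ip v v * n.+1%:R^-1.
    apply: quad_discr; first exact: ip_ge0.
    move=> t; have [Mn Jn] := hm n.
    have := hinf _ (Ml t Mv Mn); rewrite {1}/J fl // ip_sqD !ipZl !ipZr (ipC v).
    move: Jn; rewrite /J; set i1 := n.+1%:R^-1; lra.
  have h1 := cvZ (ip v v) (@cv_harmonic R); rewrite mulr0 in h1.
  have h0 : cv (fun n => ip (m n) v - f v) 0.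
    by apply: cv_sqr0; apply: cv_squeeze0 h1 => n; rewrite sqr_ge0 hq.
  by have := cv_abs h0; rewrite normr0; apply: cv_dist.
Qed.

End Minimization.

Lemma riesz (f : E -> R) (C : R) : hcomplete ->
  (forall a x y, f (a *: x + y) = a * f x + f y) ->
  (forall x, `|f x| <= C * hn x) ->
  exists p, forall v, f v = ip p v.
Proof.
move=> hE fl fC; have [//|//|//|//|m [_ mc mf]] := @riesz_sequence (fun=> True) f C.
have [p mp] := hE _ mc; exists p => v.
exact: cv_uniq (mf v I) (hcvg_ip mp (hcvg_const v)).
Qed.

(** The sequence representing [ip x] on [M] stays in [M] and converges to the orthogonal projection
    [p] of [x]; the residual [p - x] is orthogonal to [M], hence null. Density is thus reduced to
    the computation of an orthogonal complement. *)
Lemma orth_dense (M : E -> Prop) : hcomplete -> M 0 ->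
  (forall a x y, M x -> M y -> M (a *: x + y)) ->
  (forall p, (forall v, M v -> ip p v = 0) -> hn p = 0) ->
  forall x, exists m : nat -> E, (forall n, M (m n)) /\ hcvg m x.
Proof.
move=> hE M0 Ml hM x.
have [//|//|||m [Mm mc mf]] := @riesz_sequence M (ip x) (hn x).
- by move=> a y z _ _; rewrite ipDr ipZr.
- by move=> y _; exact: ip_CS.
have [p mp] := hE _ mc; exists m; split=> //; apply: (hcvg_eq mp).
apply: hM => v Mv; rewrite ipBl.
by rewrite (cv_uniq (mf v Mv) (hcvg_ip mp (hcvg_const v))) subrr.
Qed.

End PreHilbert.

(** * Square integrable functions with values in a Hilbert space *)

Section RealIntegral.
Context d (S : measurableType d) (R : realType)
  (nu : {measure set S -> \bar R}) (D : set S) (mD : measurable D).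
Implicit Types f g : S -> R.

Definition itg f : Prop := nu.-integrable D (EFin \o f).
Local Notation Int f := (Rintegral nu D f).

Lemma itg_meas f : itg f -> measurable_fun D f.
Proof. by move=> /measurable_int /measurable_EFinP. Qed.

Lemma itg_le f g : measurable_fun D f -> itg g ->
  (forall t, D t -> `|f t| <= g t) -> itg f.
Proof.
move=> mf ig fg; apply: (le_integrable mD _ _ ig); first exact/measurable_EFinP.
by move=> t Dt; rewrite /= lee_fin; apply: le_trans (fg t Dt) (ler_norm _).
Qed.

Lemma itg_eq f g : (forall t, D t -> f t = g t) -> itg f -> itg g.
Proof.
move=> fg; apply: eq_integrable => // t /set_mem Dt /=; by rewrite fg.
Qed.

Lemma itgD f g : itg f -> itg g -> itg (fun t => f t + g t).
Proof. exact: integrableD. Qed.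

Lemma itgZ k f : itg f -> itg (fun t => k * f t).
Proof. exact: integrableZl. Qed.

Lemma itgN f : itg f -> itg (fun t => - f t).
Proof. by move=> h; apply: itg_eq (itgZ (-1) h) => t _; rewrite mulN1r. Qed.

Lemma itgB f g : itg f -> itg g -> itg (fun t => f t - g t).
Proof. by move=> hf hg; apply: itgD => //; exact: itgN. Qed.

Lemma itg0 : itg (fun=> 0).
Proof. exact: integrable0. Qed.

Lemma itg_sum I (s : seq I) (F : I -> S -> R) :
  (forall i, itg (F i)) -> itg (fun t => \sum_(i <- s) F i t).
Proof.
move=> h; elim: s => [|i s IH].
  by apply: itg_eq itg0 => t _; rewrite big_nil.
by apply: itg_eq (itgD (h i) IH) => t _; rewrite big_cons.
Qed.

Lemma itg_abs f : itg f -> itg (fun t => `|f t|).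
Proof. exact: integrable_norm. Qed.

Lemma itg_cst (k : R) : (nu D < +oo)%E -> itg (fun=> k).
Proof.
move=> fD; apply/integrableP; split; first exact: measurable_cst.
by rewrite /= integral_cst //= lte_mul_pinfty.
Qed.

Lemma IntD f g : itg f -> itg g -> Int (fun t => f t + g t) = Int f + Int g.
Proof. by move=> hf hg; rewrite RintegralD. Qed.

Lemma IntB f g : itg f -> itg g -> Int (fun t => f t - g t) = Int f - Int g.
Proof. by move=> hf hg; rewrite RintegralB. Qed.

Lemma IntZ k f : itg f -> Int (fun t => k * f t) = k * Int f.
Proof. by move=> hf; rewrite RintegralZl. Qed.

Lemma Int_eq f g : (forall t, D t -> f t = g t) -> Int f = Int g.
Proof. by move=> h; apply: eq_Rintegral => t /set_mem; exact: h. Qed.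

Lemma Int0 : Int (fun=> 0) = 0.
Proof. by rewrite /Rintegral integral0. Qed.

Lemma Int_sum I (s : seq I) (F : I -> S -> R) : (forall i, itg (F i)) ->
  Int (fun t => \sum_(i <- s) F i t) = \sum_(i <- s) Int (F i).
Proof.
move=> h; elim: s => [|i s IH].
  by rewrite big_nil -[RHS]Int0; apply: Int_eq => t _; rewrite big_nil.
rewrite big_cons -IH -IntD //; last exact: itg_sum.
by apply: Int_eq => t _; rewrite big_cons.
Qed.

Lemma Int_le f g : itg f -> itg g -> (forall t, D t -> f t <= g t) ->
  Int f <= Int g.
Proof. exact: le_Rintegral. Qed.

Lemma Int_ge0 f : (forall t, D t -> 0 <= f t) -> 0 <= Int f.
Proof. exact: Rintegral_ge0. Qed.

Lemma Int_abs f : itg f -> `|Int f| <= Int (fun t => `|f t|).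
Proof. exact: le_normr_Rintegral. Qed.

Lemma Int_abs_le f g : itg f -> itg g -> (forall t, D t -> `|f t| <= g t) ->
  `|Int f| <= Int g.
Proof.
move=> hf hg h; apply: le_trans (Int_abs hf) _.
by apply: Int_le => //; exact: itg_abs.
Qed.

Lemma Int_cst (k : R) : Int (fun=> k) = k * fine (nu D).
Proof. exact: Rintegral_cst. Qed.

Lemma itg_EFin f : itg f -> (\int[nu]_(t in D) (f t)%:E)%E = (Int f)%:E.
Proof. by move=> hf; rewrite /Rintegral fineK //; exact: integrable_fin_num. Qed.

Lemma itg_ge0P f : measurable_fun D f -> (forall t, D t -> 0 <= f t) ->
  (\int[nu]_(t in D) (f t)%:E < +oo)%E -> itg f.
Proof.
move=> mf f0 h; apply/integrableP; split; first exact/measurable_EFinP.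
apply: le_lt_trans h; rewrite le_eqVlt; apply/orP; left; apply/eqP.
by apply: eq_integral => t /set_mem Dt /=; rewrite ger0_norm // f0.
Qed.

Lemma meas_cv (fn : nat -> S -> R) f : (forall n, measurable_fun D (fn n)) ->
  (forall t, D t -> cv (fn^~ t) (f t)) -> measurable_fun D f.
Proof.
move=> mf h; apply: (measurable_fun_cvg mf) => t Dt.
exact: (cv_cvg (h t Dt)).
Qed.

Lemma Int_dct (fn : nat -> S -> R) f g : (forall n, measurable_fun D (fn n)) ->
  itg g -> (forall n t, D t -> `|fn n t| <= g t) ->
  (forall t, D t -> cv (fn^~ t) (f t)) ->
  itg f /\ cv (fun n => Int (fn n)) (Int f).
Proof.
move=> mf ig hb hc.
have [|||||h1 _ h2] := @dominated_convergence _ _ _ nu D mD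
    (fun n => EFin \o fn n) (EFin \o f) (EFin \o g).
- by move=> n; exact/measurable_EFinP.
- by apply/measurable_EFinP; exact: meas_cv hc.
- apply: aeW => t Dt /=; apply: cvg_EFin; last exact: (cv_cvg (hc t Dt)).
  by near=> n.
- exact: ig.
- by apply: aeW => t n Dt /=; rewrite lee_fin hb.
split=> //; constructor.
have hn n : itg (fn n) by exact: itg_le (mf n) ig (hb n).
move: h2 => /=; under eq_fun do rewrite itg_EFin //.
by rewrite itg_EFin // => /fine_cvg.
Unshelve. all: by end_near. Qed.

Lemma fatou_le (fn : nat -> S -> R) f (c : R) :
  (forall n, measurable_fun D (fn n)) ->
  (forall n t, D t -> 0 <= fn n t) ->
  (forall t, D t -> cv (fn^~ t) (f t)) ->
  (forall n, (\int[nu]_(t in D) (fn n t)%:E <= c%:E)%E) ->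
  itg f /\ Int f <= c.
Proof.
move=> mf f0 hc hb.
have mfl : measurable_fun D f by exact: meas_cv hc.
have fl0 t : D t -> 0 <= f t.
  by move=> Dt; apply: cv_le (cvC 0) (hc t Dt) => n; exact: f0.
have h : (\int[nu]_(t in D) (f t)%:E <= c%:E)%E.
  have -> : (\int[nu]_(t in D) (f t)%:E =
     \int[nu]_(t in D) limn_einf (fun n => (fn n t)%:E))%E.
    apply: eq_integral => t /set_mem Dt.
    have : (fun n => (fn n t)%:E) @ \oo --> (f t)%:E.
      apply: cvg_EFin; last exact: (cv_cvg (hc t Dt)).
      by near=> n.
    by move/cvg_limn_einf_sup => [-> _].
  apply: le_trans (fatou nu mD _ _) _.
  - by move=> n; exact/measurable_EFinP.
  - by move=> n t Dt; rewrite lee_fin f0.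
  rewrite limn_einf_lim; apply: lime_le; first exact: is_cvg_einfs.
  near=> n; apply: le_trans (hb n); apply: ereal_inf_lbound.
  by exists n => /=.
have ifl : itg f by apply: itg_ge0P => //; apply: le_lt_trans h (ltry _).
by split=> //; rewrite -lee_fin -itg_EFin.
Unshelve. all: by end_near. Qed.

(* Borel-Cantelli in integrated form. *)
Lemma ae_summable (f : nat -> S -> R) (C : R) : (forall n, itg (f n)) ->
  (forall n t, D t -> 0 <= f n t) -> (forall n, Int (f n) <= C * 2^-1 ^+ n) ->
  exists N, [/\ measurable N, N `<=` D, nu N = 0%E &
   forall t, D t -> ~ N t -> exists M : R, forall n, \sum_(k < n) f k t <= M].
Proof.
move=> fi f0 fC.
pose g : S -> \bar R := fun t => (\sum_(0 <= k <oo) (f k t)%:E)%E.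
have mg : measurable_fun D g.
  apply: ge0_emeasurable_sum => [n t Dt _|n _]; first by rewrite lee_fin f0.
  by apply/measurable_EFinP; exact: itg_meas.
have g0 t : D t -> (0 <= g t)%E.
  by move=> Dt; apply: nneseries_ge0 => n _ _; rewrite lee_fin f0.
have C0 : 0 <= C.
  by have := fC 0; rewrite expr0 mulr1; apply: le_trans; apply: Int_ge0 => t; exact: f0.
have gi : nu.-integrable D g.
  apply/integrableP; split=> //.
  have -> : (\int[nu]_(t in D) `|g t| = \int[nu]_(t in D) g t)%E.
    by apply: eq_integral => t /set_mem Dt; rewrite gee0_abs // g0.
  rewrite integral_nneseries //; last first.
    by move=> n; apply/measurable_EFinP; exact: itg_meas.
  apply: le_lt_trans (_ : (\sum_(0 <= k <oo) (C * 2^-1 ^+ k)%:E < +oo)%E).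
    apply: lee_nneseries => n _; last by rewrite itg_EFin // lee_fin.
    by move=> _; apply: integral_ge0 => t Dt; rewrite lee_fin f0.
  have : (\sum_(0 <= k <oo) (C * 2^-1 ^+ k)%:E <= (2 * C)%:E)%E.
    apply: lime_le.
      by apply: is_cvg_nneseries => n _ _; rewrite lee_fin mulr_ge0 // exprn_ge0.
    near=> n; rewrite sumEFin lee_fin -mulr_sumr big_mkord.
    rewrite [X in _ <= X]mulrC ler_wpM2l //.
    have -> : \sum_(i < n) 2^-1 ^+ i = 2 * (1 - 2^-1 ^+ n) :> R.
      elim: (n) => [|k IH]; first by rewrite big_ord0 expr0 subrr mulr0.
      by rewrite big_ord_recr /= IH exprS; field.
    have : 0 <= 2^-1 ^+ n :> R by rewrite exprn_ge0.
    lra.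
  by move=> /le_lt_trans; apply; exact: ltry.
have [N [mN N0 hN]] := integrable_ae mD gi.
exists (N `&` D); split.
- exact: measurableI.
- by move=> t [].
- apply: (subset_measure0 _ mN _ N0); first exact: measurableI.
  by move=> t [].
move=> t Dt Nt; exists (fine (g t)) => n.
have gf : g t \is a fin_num.
  by apply: contrapT => h; apply: Nt; split=> //; apply: hN => /= /(_ Dt).
rewrite -lee_fin fineK // -sumEFin -(big_mkord predT (fun k => (f k t)%:E)).
by apply: nneseries_lim_ge => k _; rewrite lee_fin f0.
Unshelve. all: by end_near. Qed.

Lemma Int_eq0_ae f : itg f -> (forall t, D t -> 0 <= f t) -> Int f = 0 ->
  \forall t \ae nu, D t -> f t = 0.
Proof.
move=> fi f0 h.
have := (ae_eq_integral_abs nu mD (measurable_int nu fi)).1.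
have -> : (\int[nu]_(t in D) `|(EFin \o f) t| = 0)%E.
  rewrite -[RHS]/(0%R%:E) -h -itg_EFin //; apply: eq_integral => t /set_mem Dt /=.
  by rewrite ger0_norm // f0.
by move=> /(_ erefl); apply: filterS => t /= H Dt; have := H Dt => -[].
Qed.

Lemma Int_ae f g : itg f -> itg g -> (\forall t \ae nu, D t -> f t = g t) ->
  Int f = Int g.
Proof.
move=> hf hg h; rewrite /Rintegral; congr fine; apply: ae_eq_integral => //.
- by apply/measurable_EFinP; exact: itg_meas.
- by apply/measurable_EFinP; exact: itg_meas.
by apply: filterS h => t h Dt; rewrite h.
Qed.

End RealIntegral.

(** * Linear subspaces as modules *)

Record submod (R : realType) (E : lmodType R) := Submod {
  sm_pred :> E -> Prop;
  sm0 : sm_pred 0;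
  smL : forall (a : R) x y, sm_pred x -> sm_pred y -> sm_pred (a *: x + y) }.

Section SubmodType.
Variables (R : realType) (E : lmodType R) (M : submod E).

(** Membership is made boolean so that [val] is injective, which lifts the module axioms from
    [E]. *)
Definition sub_of : Type := {x : E | `[< M x >]}.

HB.instance Definition _ := Choice.on sub_of.

Lemma sub_ofP (x : sub_of) : M (val x).
Proof. by apply/asboolP; exact: (svalP x). Qed.

Definition mkSub x (Mx : M x) : sub_of := exist _ x (introT (asboolP _) Mx).

Lemma sm_Z a x : M x -> M (a *: x).
Proof. by move=> Mx; rewrite -[_ *: _]addr0; apply: smL => //; exact: sm0. Qed.

Lemma sm_D x y : M x -> M y -> M (x + y).
Proof. by move=> Mx My; rewrite -[x]scale1r; exact: smL. Qed.

Lemma sm_N x : M x -> M (- x).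
Proof. by move=> Mx; rewrite -scaleN1r; exact: sm_Z. Qed.

Definition sub_add (x y : sub_of) : sub_of := mkSub (sm_D (sub_ofP x) (sub_ofP y)).
Definition sub_zero : sub_of := mkSub (sm0 M).
Definition sub_opp (x : sub_of) : sub_of := mkSub (sm_N (sub_ofP x)).
Definition sub_scale (a : R) (x : sub_of) : sub_of := mkSub (sm_Z a (sub_ofP x)).

Fact sub_addA : associative sub_add.
Proof. by move=> x y z; apply: val_inj; rewrite /= addrA. Qed.
Fact sub_addC : commutative sub_add.
Proof. by move=> x y; apply: val_inj; rewrite /= addrC. Qed.
Fact sub_add0 : left_id sub_zero sub_add.
Proof. by move=> x; apply: val_inj; rewrite /= add0r. Qed.
Fact sub_addN : left_inverse sub_zero sub_opp sub_add.
Proof. by move=> x; apply: val_inj; rewrite /= addNr. Qed.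
HB.instance Definition _ :=
  GRing.isZmodule.Build sub_of sub_addA sub_addC sub_add0 sub_addN.

Fact sub_scaleA a b x : sub_scale a (sub_scale b x) = sub_scale (a * b) x.
Proof. by apply: val_inj; rewrite /= scalerA. Qed.
Fact sub_scale1 : left_id 1 sub_scale.
Proof. by move=> x; apply: val_inj; rewrite /= scale1r. Qed.
Fact sub_scaleDr : right_distributive sub_scale +%R.
Proof. by move=> a x y; apply: val_inj; rewrite /= scalerDr. Qed.
Fact sub_scaleDl x : {morph sub_scale^~ x : a b / a + b}.
Proof. by move=> a b; apply: val_inj; rewrite /= scalerDl. Qed.
HB.instance Definition _ :=
  GRing.Zmodule_isLmodule.Build R sub_of sub_scaleA sub_scale1 sub_scaleDr sub_scaleDl.

End SubmodType.

(** * Step functions over measurable partitions *)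

Section Steps.
Context d (S : measurableType d).

(** The factorisation through a finite index type makes sense for a bare type [E], so steps can be
    paired and composed with arbitrary maps. The pieces are arbitrary measurable sets, not
    intervals. *)
Definition is_step (E : Type) (s : S -> E) : Prop :=
  exists (I : finType) (k : S -> I) (v : I -> E),
    (forall i, measurable (k @^-1` [set i])) /\ (forall t, s t = v (k t)).

Lemma step_cst (E : Type) (x : E) : is_step (fun=> x).
Proof.
exists unit, (fun=> tt), (fun=> x); split=> // -[].
rewrite (_ : _ @^-1` _ = setT) //; exact/seteqP.
Qed.

Lemma step_comp (E F : Type) (f : E -> F) (s : S -> E) :
  is_step s -> is_step (fun t => f (s t)).
Proof.
by move=> [I [k [v [mk hs]]]]; exists I, k, (fun i => f (v i)); split=> // t; rewrite hs.
Qed.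

Lemma step_pair (E F : Type) (s : S -> E) (s' : S -> F) :
  is_step s -> is_step s' -> is_step (fun t => (s t, s' t)).
Proof.
move=> [I [k [v [mk hs]]]] [J [l [w [ml hs']]]].
exists (I * J)%type, (fun t => (k t, l t)), (fun p => (v p.1, w p.2)).
split=> [[i j]|t]; last by rewrite hs hs'.
rewrite (_ : _ @^-1` _ = k @^-1` [set i] `&` l @^-1` [set j]); first exact: measurableI.
by apply/seteqP; split=> t /= => [[-> ->]|[-> ->]].
Qed.

Lemma step_comp2 (E F G : Type) (f : E -> F -> G) (s : S -> E) (s' : S -> F) :
  is_step s -> is_step s' -> is_step (fun t => f (s t) (s' t)).
Proof. by move=> h h'; apply: (step_comp (fun p => f p.1 p.2)) (step_pair h h'). Qed.

Lemma step_mem (A : set S) : measurable A -> is_step (fun t => `[< A t >]).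
Proof.
move=> mA; exists bool, (fun t => `[< A t >]), id; split=> // -[].
  rewrite (_ : _ @^-1` _ = A) //.
  by apply/seteqP; split=> t /=; [move/asboolP|move=> h; exact/asboolP].
rewrite (_ : _ @^-1` _ = ~` A); first exact: measurableC.
by apply/seteqP; split=> t /=; [move/asboolPn|move=> h; exact/asboolPn].
Qed.

Lemma step_if (E : Type) (A : set S) (s s' : S -> E) : measurable A ->
  is_step s -> is_step s' -> is_step (fun t => if `[< A t >] then s t else s' t).
Proof.
move=> mA h h'.
exact: (step_comp2 (fun (b : bool) (p : E * E) => if b then p.1 else p.2)
  (step_mem mA) (step_pair h h')).
Qed.

Lemma step_preimage (E : Type) (s : S -> E) (Y : set E) : is_step s ->
  measurable (s @^-1` Y).
Proof.
move=> [I [k [v [mk hs]]]].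
rewrite (_ : s @^-1` Y = \bigcup_(i in [set i | Y (v i)]) (k @^-1` [set i])).
  by apply: fin_bigcup_measurable => //; exact: finite_finset.
apply/seteqP; split=> t /=; first by rewrite hs => h; exists (k t).
by move=> [i /= h hk]; rewrite hs hk.
Qed.

Lemma step_meas (R : realType) (s : S -> R) D : is_step s -> measurable_fun D s.
Proof.
by move=> h mD Y mY; apply: measurableI => //; exact: step_preimage.
Qed.

Lemma step_bounded (R : realType) (s : S -> R) : is_step s ->
  exists M : R, forall t, `|s t| <= M.
Proof.
move=> [I [k [v [mk hs]]]]; exists (\sum_i `|v i|) => t.
by rewrite hs (bigD1 (k t)) //= lerDl sumr_ge0.
Qed.

End Steps.

(** * Strong measurability *)

Section Clean.
Context d (S : measurableType d) (D : set S).

(* Strong measurability, with convergence everywhere on [D] so that no completion of the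
   measure is needed. *)
Definition clean_for (E : Type) (conv : (nat -> E) -> E -> Prop) (u : S -> E) : Prop :=
  exists s : nat -> S -> E, (forall n, is_step (s n)) /\
    forall t, D t -> conv (s^~ t) (u t).

Lemma clean_comp (E F : Type) (cE : (nat -> E) -> E -> Prop)
    (cF : (nat -> F) -> F -> Prop) (f : E -> F) u :
  (forall a x, cE a x -> cF (fun n => f (a n)) (f x)) ->
  clean_for cE u -> clean_for cF (fun t => f (u t)).
Proof.
move=> hf [s [ss hs]]; exists (fun n t => f (s n t)); split=> [n|t Dt].
  exact: step_comp.
exact: hf (hs t Dt).
Qed.

Lemma clean_pair (E F : Type) (cE : (nat -> E) -> E -> Prop)
    (cF : (nat -> F) -> F -> Prop) u v :
  clean_for cE u -> clean_for cF v ->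
  clean_for (fun a x => cE (fun n => (a n).1) x.1 /\ cF (fun n => (a n).2) x.2)
    (fun t => (u t, v t)).
Proof.
move=> [s [ss hs]] [s' [ss' hs']]; exists (fun n t => (s n t, s' n t)); split.
  by move=> n; exact: step_pair.
by move=> t Dt; split; [exact: hs|exact: hs'].
Qed.

Lemma clean_comp2 (E F G : Type) (cE : (nat -> E) -> E -> Prop)
    (cF : (nat -> F) -> F -> Prop) (cG : (nat -> G) -> G -> Prop)
    (f : E -> F -> G) u v :
  (forall a x b y, cE a x -> cF b y -> cG (fun n => f (a n) (b n)) (f x y)) ->
  clean_for cE u -> clean_for cF v -> clean_for cG (fun t => f (u t) (v t)).
Proof.
move=> hf hu hv; apply: (clean_comp (f := fun p => f p.1 p.2)) (clean_pair hu hv).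
by move=> a x [h1 h2]; exact: hf.
Qed.

Lemma clean_eq (E : Type) (cE : (nat -> E) -> E -> Prop) u v :
  (forall t, D t -> u t = v t) -> clean_for cE u -> clean_for cE v.
Proof.
by move=> huv [s [ss hs]]; exists s; split=> // t Dt; rewrite -huv //; exact: hs.
Qed.

Lemma clean_if (E : Type) (cE : (nat -> E) -> E -> Prop) (A : set S) u v :
  measurable A -> clean_for cE u -> clean_for cE v ->
  clean_for cE (fun t => if `[< A t >] then u t else v t).
Proof.
move=> mA [s [ss hs]] [s' [ss' hs']].
exists (fun n t => if `[< A t >] then s n t else s' n t); split.
  by move=> n; exact: step_if.
by move=> t Dt; case: asboolP => _; [exact: hs|exact: hs'].
Qed.

End Clean.

Section CleanHilbert.
Context d (S : measurableType d) (R : realType) (D : set S).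
Variable E : phs R.
Implicit Types u v : S -> E.

Definition clean u : Prop := clean_for D (@hcvg R E) u.

Lemma step_clean u : is_step u -> clean u.
Proof. by move=> h; exists (fun=> u); split=> // t _; exact: hcvg_const. Qed.

Lemma cleanD u v : clean u -> clean v -> clean (fun t => u t + v t).
Proof. by apply: clean_comp2 => a x b y; exact: hcvgD. Qed.

Lemma cleanZ (a : R) u : clean u -> clean (fun t => a *: u t).
Proof. by apply: clean_comp => b x; exact: hcvgZ. Qed.

Lemma clean_ip u v : clean u -> clean v ->
  clean_for D (@cv R) (fun t => ip (u t) (v t)).
Proof. by apply: clean_comp2 => a x b y; exact: hcvg_ip. Qed.

Lemma clean_real_meas (f : S -> R) : measurable D ->
  clean_for D (@cv R) f -> measurable_fun D f.
Proof.
move=> mD [s [ss hs]]; apply: meas_cv hs => n; exact: step_meas.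
Qed.

Lemma meas_ip u v : measurable D -> clean u -> clean v ->
  measurable_fun D (fun t => ip (u t) (v t)).
Proof. by move=> mD hu hv; apply: clean_real_meas => //; exact: clean_ip. Qed.

Lemma meas_hn u : measurable D -> clean u -> measurable_fun D (fun t => hn (u t)).
Proof.
move=> mD hu; apply: clean_real_meas => //.
by apply: clean_comp hu => a x; exact: hcvg_hn.
Qed.

End CleanHilbert.

(** * Summable increments and rapidly converging subsequences *)

Section SummableSequences.
Variable R : realType.

Lemma bounded_series_cvg (a : nat -> R) M : (forall k, 0 <= a k) ->
  (forall n, \sum_(k < n) a k <= M) ->
  exists l, cv (fun n => \sum_(k < n) a k) l.
Proof.
move=> a0 aM; exists (limn (fun n => \sum_(k < n) a k)); constructor.
apply: nondecreasing_is_cvgn.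
  by apply/nondecreasing_seqP => n; rewrite big_ord_recr /= lerDl.
by exists M => _ [n _ <-]; exact: aM.
Qed.

Lemma bounded_series_cv0 (a : nat -> R) M : (forall k, 0 <= a k) ->
  (forall n, \sum_(k < n) a k <= M) -> cv a 0.
Proof.
move=> a0 aM; have [l hl] := bounded_series_cvg a0 aM.
have h : cv (fun n => \sum_(k < n.+1) a k) l by exact: (cv_sub (f := S)) hl.
have := cvB h hl; rewrite subrr.
by under eq_fun do rewrite big_ord_recr /= addrAC subrr add0r.
Qed.

Lemma bounded_series_hcauchy (E : phs R) (u : nat -> E) M :
  (forall n, \sum_(k < n) hn (u k.+1 - u k) <= M) -> hcauchy u.
Proof.
move=> hM.
have [l hl] := bounded_series_cvg (fun k => hn_ge0 (u k.+1 - u k)) hM.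
have key n m : (n <= m)%N -> hn (u m - u n) <=
    \sum_(k < m) hn (u k.+1 - u k) - \sum_(k < n) hn (u k.+1 - u k).
  move=> /subnK <-; elim: (m - n)%N => [|k IH]; first by rewrite add0n !subrr hn0.
  rewrite addSn big_ord_recr /=; apply: le_trans (hn_triB _ (u (k + n)%N) _) _.
  by lra.
move=> e e0; have e2 : 0 < e / 2 by lra.
have [N hN] := (cvP _ _).1 hl _ e2; exists N => n m.
wlog nm : n m / (n <= m)%N => [hw Nn Nm|Nn Nm].
  by case/orP: (leq_total n m) => h; [|rewrite hnBC]; exact: hw.
rewrite hnBC; apply: le_lt_trans (key _ _ nm) _.
by have := hN n Nn; have := hN m Nm; rewrite !ltr_norml => /andP[? ?] /andP[? ?]; lra.
Qed.

(** The ratio [4^-1] is chosen so that in [L2_complete] the squared increments stay summable after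
    multiplication by [2 ^ n]. *)
Lemma rapid_subseq (E : phs R) (u : nat -> E) : hcauchy u ->
  exists f : nat -> nat, (forall n, (n <= f n)%N) /\
    forall n, hn (u (f n.+1) - u (f n)) <= 4^-1 ^+ n.
Proof.
move=> hu.
have hN n : exists N, forall p q, (N <= p)%N -> (N <= q)%N -> hn (u p - u q) < 4^-1 ^+ n.
  by apply: hu; rewrite exprn_gt0.
have [N {}hN] := choice hN.
(* Summing the successors of the thresholds makes [f] monotone, at least [N n] and at least [n] at
   once. *)
pose f n := (\sum_(k < n.+1) (N k).+1)%N.
have fN n : (N n <= f n)%N by rewrite /f big_ord_recr /=; lia.
have fS n : (f n <= f n.+1)%N by rewrite [f n.+1]big_ord_recr /= leq_addr.
exists f; split=> [n|n].
  elim: n => // n IH; rewrite /f big_ord_recr /=; rewrite -/(f n); lia.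
by apply/ltW/hN => //; apply: leq_trans (fS n).
Qed.

End SummableSequences.

(** * The space L^2 of functions with values in a Hilbert space *)

Section L2Space.
Context d (S : measurableType d) (R : realType) (nu : {measure set S -> \bar R})
  (D : set S) (mD : measurable D) (fD : (nu D < +oo)%E) (E : phs R).
Implicit Types u v : S -> E.
Local Notation Int f := (Rintegral nu D f).

Definition L2mem u : Prop := clean D u /\ itg nu D (fun t => ip (u t) (u t)).

Lemma L2mem_ip u v : L2mem u -> L2mem v -> itg nu D (fun t => ip (u t) (v t)).
Proof.
move=> [cu iu] [cv' iv]; apply: (itg_le mD _ (itgD mD iu iv)).
  exact: meas_ip.
move=> t _; apply: le_trans (ip_CS _ _) _; rewrite -!hn_sq.
by have := sqr_ge0 (hn (u t) - hn (v t)); have := hn_ge0 (u t); have := hn_ge0 (v t); nra.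
Qed.

Lemma L2mem0 : L2mem (0 : S -> E).
Proof.
split; first by apply: step_clean; exact: step_cst.
by apply: (itg_eq mD _ (itg0 nu D)) => t _; rewrite /= ip0l.
Qed.

Lemma L2memL a u v : L2mem u -> L2mem v -> L2mem (a *: u + v).
Proof.
move=> hu hv; have [cu iu] := hu; have [cv' iv] := hv; split.
  by apply: cleanD => //; exact: cleanZ.
have h := itgD mD (itgZ mD (a ^+ 2) iu) (itgD mD (itgZ mD (2 * a) (L2mem_ip hu hv)) iv).
apply: (itg_eq mD _ h) => t _; rewrite ip_sqD !ipZl !ipZr; ring.
Qed.

Definition L2sub : submod (S -> E) := Submod L2mem0 L2memL.

Definition L2ip (x y : sub_of L2sub) : R := Int (fun t => ip (val x t) (val y t)).

Lemma L2val (x : sub_of L2sub) : L2mem (val x). Proof. by have := sub_ofP x. Qed.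

Fact L2ipDl x y z : L2ip (x + y) z = L2ip x z + L2ip y z.
Proof.
rewrite /L2ip -IntD //; try by apply: L2mem_ip; exact: L2val.
by apply: Int_eq => t _; rewrite -ipDl.
Qed.
Fact L2ipZl a x z : L2ip (a *: x) z = a * L2ip x z.
Proof.
rewrite /L2ip -IntZ //; last by apply: L2mem_ip; exact: L2val.
by apply: Int_eq => t _; rewrite -ipZl.
Qed.
Fact L2ipC x y : L2ip x y = L2ip y x.
Proof. by apply: Int_eq => t _; rewrite ipC. Qed.
Fact L2ip_ge0 x : 0 <= L2ip x x.
Proof. by apply: Int_ge0 => t _; exact: ip_ge0. Qed.

Definition L2 : phs R := Phs L2ipDl L2ipZl L2ipC L2ip_ge0.

Definition mkL2 u (hu : L2mem u) : L2 := @mkSub R (S -> E) L2sub u hu.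

Lemma L2ipE (x y : L2) : ip x y = Int (fun t => ip (val x t) (val y t)).
Proof. by []. Qed.

Lemma L2_itg (x y : L2) : itg nu D (fun t => ip (val x t) (val y t)).
Proof. by apply: L2mem_ip; exact: L2val. Qed.

Lemma L2_clean (x : L2) : clean D (val x : S -> E).
Proof. by have [] := L2val x. Qed.

Lemma L2_subE (x y : L2) t : val (x - y) t = val x t - val y t. Proof. by []. Qed.

Lemma L2_hn_itg (x : L2) : itg nu D (fun t => hn (val x t)).
Proof.
apply: (itg_le mD (g := fun t => ip (val x t) (val x t) + 1)).
- by apply: meas_hn => //; exact: L2_clean.
- by apply: itgD => //; [exact: L2_itg|exact: itg_cst].
move=> t _; rewrite ger0_norm ?hn_ge0 // -hn_sq.
by have := sqr_ge0 (hn (val x t) - 1); nra.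
Qed.

(* AM-GM, so that no square root of the total mass is needed. *)
Lemma Int_hn_le (x : L2) (k : R) : 0 < k ->
  Int (fun t => hn (val x t)) <= k^-1 * ip x x + k * fine (nu D).
Proof.
move=> k0.
rewrite L2ipE -IntZ //; last exact: L2_itg.
rewrite -Int_cst // -IntD //; last 2 first.
- by apply: itgZ => //; exact: L2_itg.
- exact: itg_cst.
apply: Int_le => //.
- exact: L2_hn_itg.
- by apply: itgD => //; [apply: itgZ => //; exact: L2_itg|exact: itg_cst].
move=> t _; rewrite -hn_sq; set h := hn _.
have -> : k^-1 * h ^+ 2 + k = (h ^+ 2 + k ^+ 2) / k by field; rewrite gt_eqF.
rewrite ler_pdivlMr //; have := sqr_ge0 (h - k); have : 0 <= h by exact: hn_ge0.
by nra.
Qed.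

Lemma L2mem_step u : is_step u -> L2mem u.
Proof.
move=> su; split; first exact: step_clean.
have h : is_step (fun t => ip (u t) (u t)) by exact: (step_comp (fun x => ip x x)).
have [M hM] := step_bounded h.
apply: (itg_le mD _ (itg_cst mD M fD)) => //; exact: step_meas.
Qed.

Lemma L2mem_dom u (g : S -> R) : clean D u -> itg nu D g ->
  (forall t, D t -> ip (u t) (u t) <= g t) -> L2mem u.
Proof.
move=> cu ig hg; split=> //; apply: (itg_le mD _ ig); first exact: meas_ip.
by move=> t Dt; rewrite ger0_norm ?ip_ge0 // hg.
Qed.

(** The steps that converge pointwise need not be dominated. Setting [s n] to zero where its norm
    exceeds twice that of [x] keeps the pointwise convergence and bounds the squared error by
    [9 |x|^2], so that dominated convergence applies. *)
Lemma step_dense (x : L2) : exists s : nat -> L2,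
  [/\ forall n, is_step (val (s n)), hcvg s x &
      forall t, D t -> hcvg (fun n => val (s n) t) (val x t)].
Proof.
have [[s [ss hs]] ix] := L2val x.
pose A n := D `&` [set t | hn (s n t) <= 2 * hn (val x t)].
have mA n : measurable (A n).
  have h1 : measurable_fun D (fun t => hn (s n t)) by apply: step_meas; exact: step_comp.
  have h2 : measurable_fun D (fun t => 2 * hn (val x t)).
    by apply: measurable_funM => //; apply: meas_hn => //; exact: L2_clean.
  exact: (measurable_fun_ler h1 h2 mD (Y := [set true])).
pose s' n t := if `[< A n t >] then s n t else 0.
have ss' n : is_step (s' n) by apply: step_if => //; exact: step_cst.
pose sn n : L2 := mkL2 (L2mem_step (ss' n)).
have hpt t : D t -> hcvg (fun n => s' n t) (val x t).
  move=> Dt; have := hs t Dt; rewrite /hcvg => hst.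
  have := hn_ge0 (val x t); rewrite le_eqVlt => /orP[/eqP x0|x0].
    apply: cv_squeeze0 hst => n; rewrite hn_ge0 /= /s'.
    by case: asboolP => // _; rewrite sub0r hnN -x0 hn_ge0.
  apply/cvP => e e0; have [N hN] := (cvP _ _).1 hst _ e0.
  have [M hM] := (cvP _ _).1 (hcvg_hn hst) _ x0.
  exists (maxn N M) => n; rewrite geq_max => /andP[/hN Nn /hM Mn].
  rewrite /s'; case: asboolP => // hA; exfalso; apply: hA; split=> //=.
  by move: Mn; rewrite ltr_norml => /andP[_]; lra.
exists sn; split=> //.
have hdom n t : D t -> ip (s' n t - val x t) (s' n t - val x t) <= 9 * ip (val x t) (val x t).
  move=> Dt; rewrite -!hn_sq.
  have h : hn (s' n t - val x t) <= 3 * hn (val x t).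
    apply: le_trans (hnB_le _ _) _; rewrite /s'; case: asboolP => [[_ /=]|_].
      by lra.
    by rewrite hn0; have := hn_ge0 (val x t); lra.
  by have := hn_ge0 (s' n t - val x t); nra.
have [||||_ h] := @Int_dct _ _ _ nu D mD
  (fun n t => ip (s' n t - val x t) (s' n t - val x t)) (fun=> 0)
  (fun t => 9 * ip (val x t) (val x t)).
- move=> n; apply: (meas_ip (E := E)) => //; exact: (L2_clean (sn n - x)).
- by apply: itgZ.
- by move=> n t Dt; rewrite ger0_norm ?ip_ge0 // hdom.
- move=> t Dt; have := hcvgB (hpt t Dt) (hcvg_const (val x t)); rewrite subrr => h.
  by have := hcvg_ip h h; rewrite ip0l.
apply: cv_sqr0; rewrite Int0 in h; apply: cv_squeeze0 h => n.
by rewrite sqr_ge0 hn_sq /=; exact: lexx.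
Qed.

Lemma L2_ae_subseq (u : nat -> L2) x : hcvg u x ->
  exists f : nat -> nat, (forall n, (n <= f n)%N) /\
    \forall t \ae nu, D t -> hcvg (fun n => val (u (f n)) t) (val x t).
Proof.
move=> hu.
have hN n : exists N, forall k, (N <= k)%N -> ip (u k - x) (u k - x) <= 2^-1 ^+ n.
  have h2 := cvM hu hu; rewrite mulr0 in h2.
  have e0 : (0 : R) < 2^-1 ^+ n by rewrite exprn_gt0.
  have [N hN] := (cvP _ _).1 h2 _ e0; exists N => k /hN.
  by rewrite subr0 -expr2 hn_sq ger0_norm ?ip_ge0 // => /ltW.
have [N {}hN] := choice hN.
exists (fun n => maxn n (N n)); split; first by move=> n; exact: leq_maxl.
have [|||A [mA AD A0 hA]] := @ae_summable _ _ _ nu D mD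
  (fun n t => ip (val (u (maxn n (N n)) - x) t) (val (u (maxn n (N n)) - x) t)) 1.
- by move=> n; exact: L2_itg.
- by move=> n t _; exact: ip_ge0.
- by move=> n; rewrite mul1r -L2ipE; apply: hN; exact: leq_maxr.
exists A; split=> // t /= /not_implyP[Dt ht]; apply: contrapT => At; apply: ht.
have [M hM] := hA t Dt At.
apply: cv_sqr0; under eq_fun do rewrite hn_sq.
by apply: bounded_series_cv0 hM => k; exact: ip_ge0.
Qed.

(** Riesz-Fischer. The Cauchy sequence is first replaced by steps, which makes the pointwise limit
    strongly measurable by construction; on the exceptional null set the steps are set to zero, so
    that convergence holds everywhere on [D]. Convergence in norm then comes from Fatou's lemma. *)
Lemma L2_complete : hcomplete E -> hcomplete L2.
Proof.
move=> hE u hu.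
have [f [fn hf]] := rapid_subseq hu.
have hs n : exists s : L2, is_step (val s) /\ hn (s - u (f n)) <= 4^-1 ^+ n.
  have [s [ss hs _]] := step_dense (u (f n)).
  have e0 : (0 : R) < 4^-1 ^+ n by rewrite exprn_gt0.
  have [N hN] := (cvP _ _).1 hs _ e0; exists (s N); split=> //.
  by have := hN N (leqnn N); rewrite subr0 ger0_norm ?hn_ge0 // => /ltW.
have [s {}hs] := choice hs.
have hss n : hn (s n.+1 - s n) <= 3 * 4^-1 ^+ n.
  apply: le_trans (hn_triB _ (u (f n.+1)) _) _.
  have := hn_triB (u (f n.+1)) (u (f n)) (s n); rewrite (hnBC (u (f n))).
  have [_ h1] := hs n; have [_ h2] := hs n.+1; have := hf n.
  move: h1 h2; rewrite exprS; set q := 4^-1 ^+ n.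
  have : 0 <= q by rewrite exprn_ge0.
  set a1 := hn (s n.+1 - _); set a2 := hn (s n - _); set a3 := hn (u _ - s n).
  by move=> *; lra.
have [|||N [mN ND N0 hN]] := @ae_summable _ _ _ nu D mD
  (fun n t => hn (val (s n.+1 - s n) t)) (9 + fine (nu D)).
- by move=> n; exact: L2_hn_itg.
- by move=> n t _; exact: hn_ge0.
(* With the weight [2^-n] both terms are geometric: at most [9 * 8^-n], and [2^-n] times the total
   mass. *)
- move=> n; apply: le_trans (Int_hn_le (s n.+1 - s n) (k := 2^-1 ^+ n) _) _.
    by rewrite exprn_gt0.
  rewrite mulrDl mulrC -hn_sq; apply: lerD; last by rewrite mulrC.
  have e4 : 4^-1 ^+ n = 2^-1 ^+ n * 2^-1 ^+ n :> R by rewrite -exprMn; congr (_ ^+ _); field.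
  have := hss n; have := hn_ge0 (s n.+1 - s n); rewrite e4.
  have : 0 < 2^-1 ^+ n :> R by rewrite exprn_gt0.
  have : 2^-1 ^+ n <= 1 :> R by rewrite exprn_ile1 //; lra.
  set q := 2^-1 ^+ n; set h := hn _ => q1 q0 h0 hq.
  have hh : h ^+ 2 <= 9 * q ^+ 4.
    have -> : 9 * q ^+ 4 = (3 * (q * q)) ^+ 2 by ring.
    by rewrite ler_sqr ?nnegrE //; nra.
  rewrite ler_pdivrMr //; apply: le_trans hh _.
  have -> : 9 * q ^+ 4 = 9 * q * q * (q * q) by ring.
  have -> : 9 * q * q = 9 * q * q * 1 by rewrite mulr1.
  rewrite mulr1; apply: ler_piMr; [by nra|by nra].
have hlim t : exists l, D t -> ~ N t -> hcvg (fun n => val (s n) t) l.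
  have [[Dt Nt]|h] := pselect (D t /\ ~ N t); last first.
    by exists 0 => Dt Nt; case: h.
  have [M hM] := hN t Dt Nt.
  by have [l hl] := hE _ (bounded_series_hcauchy (u := fun n => val (s n) t) hM); exists l.
have [x0 hx0] := choice hlim.
pose x t := if `[< N t >] then 0 else x0 t.
pose s' n t := if `[< N t >] then 0 else val (s n) t.
have ss' n : is_step (s' n).
  by apply: step_if => //; [exact: step_cst|have [] := hs n].
have s'x t : D t -> hcvg (fun n => s' n t) (x t).
  move=> Dt; rewrite /s' /x; case: asboolP => Nt; first exact: hcvg_const.
  exact: hx0.
have cx : clean D x by exists s'.
pose sn n : L2 := mkL2 (L2mem_step (ss' n)).
have nN : \forall t \ae nu, ~ N t.
  by exists N; split=> // t /= /contrapT.
have snE n : hn (sn n - s n) = 0.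
  apply/eqP; rewrite -sqrf_eq0 hn_sq L2ipE -[X in _ == X](Int0 nu D); apply/eqP.
  apply: Int_ae => //; [exact: L2_itg|exact: itg0|].
  apply: filterS nN => t Nt _; rewrite L2_subE /= /s'.
  by case: asboolP => // _; rewrite subrr ip0l.
have snc : hcauchy sn.
  have : hcauchy s.
    move=> e e0.
    have h0 : cv (fun n => 2 * 4^-1 ^+ n : R) 0.
      rewrite -[X in cv _ X](mulr0 2); apply: cvZ; constructor.
      by apply: cvg_expr; rewrite ger0_norm; lra.
    have e4 : 0 < e / 4 by lra.
    have [N1 hN1] := (cvP _ _).1 h0 _ e4; have [N2 hN2] := hu _ e4.
    exists (maxn N1 N2) => n m; rewrite !geq_max => /andP[n1 n2] /andP[m1 m2].
    apply: le_lt_trans (hn_triB _ (u (f n)) _) _.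
    have := hn_triB (u (f n)) (u (f m)) (s m); rewrite (hnBC (u (f m))).
    have := hN2 _ _ (leq_trans n2 (fn n)) (leq_trans m2 (fn m)).
    have [_ h1] := hs n; have [_ h2] := hs m.
    have := hN1 _ n1; have := hN1 _ m1; rewrite !subr0 !ger0_norm ?mulr_ge0 ?exprn_ge0 //.
    move: h1 h2; set q1 := 4^-1 ^+ n; set q2 := 4^-1 ^+ m.
    set a1 := hn (s n - _); set a2 := hn (s m - _); set a3 := hn (u _ - u _).
    set a4 := hn (u _ - _) => *.
    by lra.
  move=> h e e0; have [N1 hN1] := h e e0; exists N1 => n m n1 m1.
  apply: le_lt_trans (hn_triB _ (s n) _) _; rewrite snE add0r.
  apply: le_lt_trans (hn_triB _ (s m) _) _; rewrite (hnBC (s m)) snE addr0.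
  exact: hN1.
(* For fixed [n], Fatou's lemma in [m] bounds the distance from [s' n] to the limit by the Cauchy
   modulus. *)
have hfat (e : R) : 0 < e -> exists K, forall n, (K <= n)%N ->
    itg nu D (fun t => ip (s' n t - x t) (s' n t - x t)) /\
    Int (fun t => ip (s' n t - x t) (s' n t - x t)) <= e ^+ 2.
  move=> e0; have [K hK] := snc e e0; exists K => n Kn.
  apply: (@fatou_le _ _ _ nu D mD (fun m t => ip (val (sn n - sn (m + K)%N) t) (val (sn n - sn (m + K)%N) t))).
  - by move=> m; apply: itg_meas; exact: L2_itg.
  - by move=> m t _; exact: ip_ge0.
  - move=> t Dt.
    have h1 : hcvg (fun m => s' n t - s' (m + K)%N t) (s' n t - x t).
      apply: hcvgB; first exact: hcvg_const.
      by apply: (hcvg_sub (f := fun m => (m + K)%N)) (s'x t Dt) => m; exact: leq_addr.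
    exact: (hcvg_ip h1 h1).
  - move=> m; rewrite itg_EFin //; last exact: L2_itg.
    rewrite lee_fin -L2ipE -hn_sq ler_sqr ?nnegrE ?hn_ge0 ?(ltW e0) //.
    by apply/ltW/hK => //; exact: leq_addl.
have xL2 : L2mem x.
  have [K hK] := hfat 1 ltr01; have [iK _] := hK K (leqnn K).
  apply: (L2mem_dom cx (itgD mD (itgZ mD 2 iK) (itgZ mD 2 (L2_itg (sn K) (sn K))))).
  move=> t Dt /=.
  have := ip_ge0 (2 *: s' K t - x t); move: (s' K t) (x t) => y z.
  by rewrite !ip_sqB !ipZl !ipZr; lra.
exists (mkL2 xL2); apply: (hcauchy_hcvg_sub fn hu).
have hsx : hcvg sn (mkL2 xL2).
  apply/cvP => e e0; have e2 : 0 < e / 2 by lra.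
  have [K hK] := hfat _ e2; exists K => n /hK [_ h].
  rewrite subr0 ger0_norm ?hn_ge0 //; apply: le_lt_trans (_ : _ <= e / 2) _; last by lra.
  by rewrite -ler_sqr ?nnegrE ?hn_ge0 ?(ltW e2) // hn_sq.
have h4 : cv (fun n => 4^-1 ^+ n : R) 0.
  by constructor; apply: cvg_expr; rewrite ger0_norm; lra.
have := cvD hsx h4; rewrite addr0; apply: hcvg_le => n.
apply: le_trans (hn_triB _ (s n) _) _; rewrite addrC; apply: lerD; last first.
  by rewrite hnBC; have [] := hs n.
by apply: le_trans (hn_triB _ (sn n) _) _; rewrite hnBC snE add0r.
Qed.

Lemma L2_hn0P (x : L2) : hn x = 0 <-> \forall t \ae nu, D t -> hn (val x t) = 0.
Proof.
split=> h.
  have := Int_eq0_ae mD (L2_itg x x) (fun t _ => ip_ge0 _).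
  rewrite -L2ipE -hn_sq h expr0n => /(_ erefl); apply: filterS => t H Dt.
  by apply/eqP; rewrite -sqrf_eq0 hn_sq H.
apply/eqP; rewrite -sqrf_eq0 hn_sq L2ipE -[X in _ == X](Int0 nu D); apply/eqP.
apply: Int_ae => //; [exact: L2_itg|exact: itg0|].
by apply: filterS h => t H Dt; rewrite -hn_sq H // expr0n.
Qed.

End L2Space.

(** * The evolution equation *)

Section TimeIntegral.
Variable R : realType.
Implicit Types (f g : R -> R) (s t T : R).

Definition Iv t : set (measurableTypeR R) := `]0%R, t[.

Notation IntT t f := (Rintegral (leb1 R) (Iv t) f).
Notation itgT t f := (itg (leb1 R) (Iv t) f).

Lemma mIv t : measurable (Iv t).
Proof. exact: measurable_itv. Qed.

Lemma IvP t s : Iv t s <-> 0 < s < t.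
Proof. by rewrite /Iv /= in_itv. Qed.

Lemma leb1_itv (i : interval R) :
  leb1 R ([set` i] : set (measurableTypeR R)) = (if i.1 < i.2 then (i.2 : \bar R) - i.1 else 0)%E.
Proof. exact: lebesgue_measure_itv. Qed.

Lemma leb_Iv t : leb1 R (Iv t) = (Num.max 0 t)%:E.
Proof.
rewrite /Iv leb1_itv /= lte_fin; case: ltP => h; first by rewrite sube0.
by [].
Qed.

Lemma Iv_fin t : (leb1 R (Iv t) < +oo)%E.
Proof. by rewrite leb_Iv ltry. Qed.

Lemma Iv_sub s t : s <= t -> Iv s `<=` Iv t.
Proof. by move=> st r /IvP /andP[r0 rs]; apply/IvP; rewrite r0 (lt_le_trans rs). Qed.

Lemma itgT_sub s t f : s <= t -> itgT t f -> itgT s f.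
Proof. by move=> st; apply: integrableS; [exact: mIv|exact: mIv|exact: Iv_sub]. Qed.

(** Writes an integral over [(0, t)] on the fixed interval [(0, T)], on which the spaces [L2] are
    built. *)
Lemma IntT_cut t T f : t <= T ->
  IntT t f = IntT T (fun s => (s < t)%R%:R * f s).
Proof.
move=> tT; rewrite [LHS]Rintegral_mkcond [RHS]Rintegral_mkcond; congr Rintegral.
apply/funext => s; rewrite !patchE.
case: ifPn => [/set_mem/IvP /andP[s0 st]|hs].
  rewrite mem_set; last by apply/IvP; rewrite s0 (lt_le_trans st).
  by rewrite st mul1r.
case: ifPn => // /set_mem/IvP /andP[s0 sT].
case: ltP => st; last by rewrite mul0r.
by exfalso; apply/negP: hs; rewrite negbK mem_set //; apply/IvP; rewrite s0.
Qed.

Lemma meas_cut t D f : measurable_fun D f ->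
  measurable_fun D (fun s => (s < t)%R%:R * f s).
Proof.
move=> mf; apply: measurable_funM => //.
have h : measurable_fun D (\1_(`]-oo, t[%classic) : measurableTypeR R -> R).
  exact: measurable_indic.
by apply: eq_measurable_fun h => s _; rewrite indicE mem_setE in_itv.
Qed.

Lemma itgT_cut t T f : itgT T f -> itgT T (fun s => (s < t)%R%:R * f s).
Proof.
move=> h; apply: (itg_le (mIv T) _ (itg_abs h)).
  by apply: meas_cut; exact: itg_meas h.
by move=> s _; rewrite normrM; case: ltP; rewrite ?normr1 ?mul1r // normr0 mul0r.
Qed.

Lemma IntT_abs_le t T f : t <= T -> itgT T f -> `|IntT t f| <= IntT T (fun s => `|f s|).
Proof.
move=> tT h; rewrite (IntT_cut _ tT); apply: Int_abs_le; first exact: mIv.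
- exact: itgT_cut.
- by apply: itg_abs => //; exact: mIv.
by move=> s _; rewrite normrM; case: ltP; rewrite ?normr1 ?mul1r // normr0 mul0r.
Qed.

Lemma IntT_subE s t f : 0 <= s -> s <= t -> itgT t f ->
  IntT t f - IntT s f = Rintegral (leb1 R) (`]s, t[%classic : set (measurableTypeR R)) f.
Proof.
move=> s0; rewrite le_eqVlt => /orP[/eqP ->|st] hf.
  rewrite subrr set_itv_ge ?Rintegral_set0 //.
  by rewrite -leNgt bnd_simp.
have hs := itgT_sub (ltW st) hf.
rewrite /Iv (Rintegral_itv_bndo_bndc hs).
by rewrite Rintegral_itvB // ?bnd_simp.
Qed.

Lemma IntT_Lipschitz s t T f (C : R) : 0 <= s -> s <= t -> t <= T -> itgT T f ->
  (forall r, Iv T r -> `|f r| <= C) -> `|IntT t f - IntT s f| <= C * (t - s).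
Proof.
move=> s0 st tT hf hC; rewrite (IntT_subE s0 st); last exact: itgT_sub hf.
have msub : measurable (`]s, t[%classic : set (measurableTypeR R)) by exact: measurable_itv.
have sub : (`]s, t[%classic : set (measurableTypeR R)) `<=` Iv T.
  move=> r /=; rewrite in_itv /= => /andP[sr rt]; apply/IvP.
  by rewrite (le_lt_trans s0 sr) (lt_le_trans rt tT).
have lebst : fine (leb1 R (`]s, t[%classic : set (measurableTypeR R))) = t - s.
  rewrite leb1_itv /= lte_fin; case: ltP => //= h.
  by apply/eqP; rewrite eq_sym subr_eq0 eq_le h st.
have lf : (leb1 R (`]s, t[%classic : set (measurableTypeR R)) < +oo)%E.
  rewrite leb1_itv /=; case: ifP => _; last by rewrite ltry.
  by rewrite -EFinB ltry.
rewrite -lebst -Int_cst //; apply: Int_abs_le => //.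
- by apply: integrableS hf => //; exact: mIv.
- exact: itg_cst.
by move=> r hr; apply: hC; exact: sub.
Qed.

Local Notation leb := (@lebesgue_measure R).

Lemma IntT_patch t f : IntT t f = Rintegral leb setT (f \_ (Iv t)).
Proof. by rewrite Rintegral_mkcond. Qed.

Lemma itgT_patch t f : itgT t f <-> itg leb setT (f \_ (Iv t)).
Proof.
rewrite /itg -restrict_EFin; exact: integrable_mkcond (mIv t).
Qed.

Lemma IntT_closed r f : itgT r f ->
  Rintegral leb (`]0%R, r]%classic : set (measurableTypeR R)) f = IntT r f.
Proof. by move=> h; rewrite /Iv (Rintegral_itv_bndo_bndc h). Qed.

(* Fubini for [f s * g r] on the square, split along the diagonal. *)
Lemma IntT_mul t f g : itgT t f -> itgT t g ->
  [/\ itgT t (fun s => f s * IntT s g), itgT t (fun s => g s * IntT s f) &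
  IntT t f * IntT t g =
    IntT t (fun s => f s * IntT s g) + IntT t (fun s => g s * IntT s f)].
Proof.
move=> hf hg.
pose F := f \_ (Iv t); pose G := g \_ (Iv t).
have iF : itg leb setT F by exact/itgT_patch.
have iG : itg leb setT G by exact/itgT_patch.
have mF : measurable_fun setT (F : measurableTypeR R -> R) by exact: itg_meas iF.
have mG : measurable_fun setT (G : measurableTypeR R -> R) by exact: itg_meas iG.
pose A (z : measurableTypeR R * measurableTypeR R) : R := F z.1 * G z.2.
pose Slo := [set z : measurableTypeR R * measurableTypeR R | (z.2 < z.1)%R].
pose lo (z : measurableTypeR R * measurableTypeR R) : R := \1_Slo z.
have loE s r : lo (s, r) = (r < s)%R%:R.
  rewrite /lo indicE; congr (nat_of_bool _)%:R.
  by apply/idP/idP => [/set_mem|h] //; exact/mem_set.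
have mA : measurable_fun setT A.
  by apply: measurable_funM; exact: measurableT_comp.
have mlo : measurable_fun setT lo.
  have h := @measurable_fun_ltr _ _ R setT (fun z : measurableTypeR R * measurableTypeR R => z.2 : R) (fun z => z.1 : R)
     measurable_snd measurable_fst.
  have mS : measurable Slo by have := h measurableT [set true] I; rewrite setTI.
  exact: measurable_indic.
have iA : (leb \x leb)%E.-integrable setT (EFin \o A).
  apply/integrable12ltyP; first exact/measurable_EFinP.
  apply: le_lt_trans (_ : (Rintegral leb setT (fun s => `|F s| * Rintegral leb setT (fun r => `|G r|)))%:E < +oo)%E; last exact: ltry.
  rewrite -itg_EFin //; last first.
    apply: (itg_eq _ _ (itgZ _ (Rintegral leb setT (fun r => `|G r|)) (itg_abs iF))) => // s _.
    by rewrite mulrC.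
  rewrite le_eqVlt; apply/orP; left; apply/eqP; apply: eq_integral => s _.
  rewrite -IntZ //; last exact: itg_abs.
  rewrite -itg_EFin //; last by apply: itgZ => //; exact: itg_abs.
  by apply: eq_integral => r _; rewrite /A /= normrM.
have iL : (leb \x leb)%E.-integrable setT (EFin \o (fun z => A z * lo z)).
  apply: (le_integrable _ _ _ iA) => //.
    by apply/measurable_EFinP; exact: measurable_funM.
  move=> [z1 z2] _; rewrite /= lee_fin normrM loE; case: ltP => _.
    by rewrite normr1 mulr1.
  by rewrite normr0 mulr0.
have iU : (leb \x leb)%E.-integrable setT (EFin \o (fun z => A z * (1 - lo z))).
  have : itg (leb \x leb)%E setT (fun z => A z - A z * lo z) by exact: itgB.
  by apply: itg_eq => // z _; rewrite mulrBr mulr1.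
have iGl s : itg leb setT (fun r => G r * (r < s)%R%:R).
  apply: (itg_le _ _ (itg_abs iG)) => //.
    apply: eq_measurable_fun (meas_cut s mG) => r _; exact: mulrC.
  by move=> r _; rewrite normrM; case: ltP => _; rewrite ?normr1 ?mulr1 // normr0 mulr0.
have iFl r : itg leb setT (fun s => F s * (1 - (r < s)%R%:R)).
  apply: (itg_le _ _ (itg_abs iF)) => //.
    apply: measurable_funM => //; apply: measurable_funB => //.
    have h : measurable_fun setT (\1_(`]r, +oo[%classic) : measurableTypeR R -> R).
      exact: measurable_indic.
    by apply: eq_measurable_fun h => s _; rewrite indicE mem_setE in_itv /= andbT.
  move=> s _; rewrite normrM; case: ltP => _; rewrite ?subrr ?subr0 ?normr1 ?mulr1 //.
  by rewrite normr0 mulr0.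
have IG s : Iv t s -> Rintegral leb setT (fun r => G r * (r < s)%R%:R) = IntT s g.
  move=> /IvP /andP[s0 st]; rewrite [RHS]IntT_patch; congr Rintegral.
  apply/funext => r; rewrite /G !patchE.
  have -> : (r \in Iv s) = (r \in Iv t) && (r < s).
    apply/idP/idP.
      by move=> /set_mem/IvP/andP[r0 rs]; rewrite rs andbT mem_set //; apply/IvP; rewrite r0 (lt_trans rs).
    by move=> /andP[/set_mem/IvP/andP[r0 rt] rs]; rewrite mem_set //; apply/IvP; rewrite r0.
  by case: (r \in Iv t); rewrite ?mul0r //=; case: (r < s); rewrite ?mulr1 ?mulr0.
(* The complement [s <= r] of the strict triangle contains the endpoint, hence the detour through
   [IntT_closed]. *)
have IF r : Iv t r -> Rintegral leb setT (fun s => F s * (1 - (r < s)%R%:R)) = IntT r f.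
  move=> /IvP /andP[r0 rt]; rewrite -IntT_closed; last by exact: itgT_sub (ltW rt) hf.
  rewrite [RHS]Rintegral_mkcond; congr Rintegral.
  apply/funext => s; rewrite /F !patchE !mem_setE !in_itv /=.
  case: (ltP 0 s) => s0 /=; last by rewrite mul0r.
  case: (ltP r s) => rs; first by rewrite subrr mulr0.
  by rewrite (le_lt_trans rs rt) subr0 mulr1.
have FL s : fubini_F leb (EFin \o (fun z => A z * lo z)) s =
    (((fun s => f s * IntT s g) \_ (Iv t)) s)%:E.
  rewrite /fubini_F /=.
  have -> : (\int[leb]_y (A (s, y) * lo (s, y))%:E = (F s * Rintegral leb setT (fun r => G r * (r < s)%R%:R))%:E)%E.
    rewrite -IntZ // -itg_EFin //; last exact: itgZ.
    by apply: eq_integral => r _; rewrite loE /A /= mulrA.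
  congr EFin; rewrite /F !patchE; case: ifPn => [/set_mem hs|_]; last by rewrite mul0r.
  by rewrite IG.
have GU r : fubini_G leb (EFin \o (fun z => A z * (1 - lo z))) r =
    (((fun s => g s * IntT s f) \_ (Iv t)) r)%:E.
  rewrite /fubini_G /=.
  have -> : (\int[leb]_x (A (x, r) * (1 - lo (x, r)))%:E = (G r * Rintegral leb setT (fun s => F s * (1 - (r < s)%R%:R)))%:E)%E.
    rewrite -IntZ // -itg_EFin //; last exact: itgZ.
    by apply: eq_integral => s _; rewrite loE /A /= -mulrA mulrCA.
  congr EFin; rewrite /G !patchE; case: ifPn => [/set_mem hs|_]; last by rewrite mul0r.
  by rewrite IF.
have i1 : itgT t (fun s => f s * IntT s g).
  apply/itgT_patch; rewrite /itg.
  by apply: eq_integrable (integrable_fubini_F iL) => // s _; rewrite FL.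
have i2 : itgT t (fun s => g s * IntT s f).
  apply: (@itg_le _ _ _ _ _ (mIv t) _ (fun s => IntT t (fun r => `|f r|) * `|g s|)).
  - have mGU : measurable_fun (Iv t) (fubini_G leb (EFin \o (fun z => A z * (1 - lo z)))).
      by apply: measurable_funTS; exact: (measurable_fubini_G iU).
    apply/measurable_EFinP; apply: eq_measurable_fun mGU => s hs.
    by rewrite GU patchE hs.
  - by apply: itgZ; [exact: mIv|exact: itg_abs].
  - move=> s /IvP /andP[s0 st]; rewrite normrM mulrC ler_wpM2r //.
    exact: IntT_abs_le (ltW st) hf.
split=> //; apply: EFin_inj; rewrite EFinD.
have -> : ((IntT t f * IntT t g)%:E = \int[leb \x leb]_z (A z)%:E)%E.
  rewrite -(integral12_prod_meas1 iA) /fubini_F !IntT_patch mulrC.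
  rewrite -IntZ // -itg_EFin //; last exact: itgZ.
  apply: eq_integral => s _; rewrite mulrC -IntZ // -itg_EFin //.
  exact: itgZ.
rewrite !IntT_patch -!itg_EFin //; try exact/itgT_patch.
have -> : (\int[leb]_s (((fun s => (f s * IntT s g)%R) \_ (Iv t)) s)%:E =
   \int[leb \x leb]_z (A z * lo z)%:E)%E.
  by rewrite -(integral12_prod_meas1 iL); apply: eq_integral => s _; rewrite FL.
have -> : (\int[leb]_s (((fun s => (g s * IntT s f)%R) \_ (Iv t)) s)%:E =
   \int[leb \x leb]_z (A z * (1 - lo z))%:E)%E.
  by rewrite -(integral21_prod_meas1 iU); apply: eq_integral => s _; rewrite GU.
rewrite -integralD //; apply: eq_integral => z _.
by rewrite -EFinD -mulrDr addrC subrK mulr1.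
Qed.

End TimeIntegral.
Notation IntT t f := (Rintegral (leb1 _) (Iv t) f).
Notation itgT t f := (itg (leb1 _) (Iv t) f).

Import HBSimple.

(** * Products of inner product spaces *)

Section ProductSpace.
Variables (R : realType) (E F : phs R).

Let P : lmodType R := (E * F)%type.
Definition prod_ip (x y : P) : R := ip x.1 y.1 + ip x.2 y.2.
Fact prod_ipDl x y z : prod_ip (x + y) z = prod_ip x z + prod_ip y z.
Proof. by rewrite /prod_ip !ipDl; ring. Qed.
Fact prod_ipZl a x z : prod_ip (a *: x) z = a * prod_ip x z.
Proof. by rewrite /prod_ip !ipZl; ring. Qed.
Fact prod_ipC x y : prod_ip x y = prod_ip y x.
Proof. by rewrite /prod_ip ipC (ipC x.2). Qed.
Fact prod_ip_ge0 x : 0 <= prod_ip x x.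
Proof. by rewrite /prod_ip addr_ge0 ?ip_ge0. Qed.

Definition prod_phs : phs R := Phs prod_ipDl prod_ipZl prod_ipC prod_ip_ge0.

Lemma prod_hn1 (x : prod_phs) : hn x.1 <= hn x.
Proof. by rewrite /hn ler_wsqrtr // /= /prod_ip lerDl ip_ge0. Qed.

Lemma prod_hn2 (x : prod_phs) : hn x.2 <= hn x.
Proof. by rewrite /hn ler_wsqrtr // /= /prod_ip lerDr ip_ge0. Qed.

Lemma prod_hn_le (x : prod_phs) : hn x <= hn x.1 + hn x.2.
Proof.
rewrite -ler_sqr ?nnegrE ?hn_ge0 ?addr_ge0 ?hn_ge0 // hn_sq.
rewrite sqrrD !hn_sq [X in _ <= X]addrAC lerDl mulrn_wge0 // mulr_ge0 ?hn_ge0 //.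
Qed.

Lemma prod_hcvg (u : nat -> prod_phs) l :
  hcvg (fun n => (u n).1) l.1 -> hcvg (fun n => (u n).2) l.2 -> hcvg u l.
Proof.
move=> h1 h2; have := cvD h1 h2; rewrite addr0; apply: hcvg_le => n.
exact: prod_hn_le.
Qed.

Lemma prod_complete : hcomplete E -> hcomplete F -> hcomplete prod_phs.
Proof.
move=> hE hF u hu.
have [|l1 h1] := hE (fun n => (u n).1).
  move=> e /hu [N hN]; exists N => n m Nn Nm.
  exact: le_lt_trans (prod_hn1 (u n - u m)) (hN _ _ Nn Nm).
have [|l2 h2] := hF (fun n => (u n).2).
  move=> e /hu [N hN]; exists N => n m Nn Nm.
  exact: le_lt_trans (prod_hn2 (u n - u m)) (hN _ _ Nn Nm).
by exists (l1, l2); exact: prod_hcvg.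
Qed.

End ProductSpace.

(** * Measurable scalar functions as limits of steps *)

Section ScalarClean.
Context d (S : measurableType d) (R : realType) (D : set S).

Lemma sfun_step (f : {sfun S >-> R}) : is_step (HBSimple.SimpleFun.sort f).
Proof.
have fin : finite_set (range f) by exact: fimfunP.
pose I := seq_sub (finmap.enum_fset (fset_set (range f))).
have memf t : f t \in finmap.enum_fset (fset_set (range f)).
  by rewrite in_fset_set //; exact/mem_set/imageT.
exists I, (fun t => SeqSub (memf t)), (fun i => ssval i); split=> // i.
rewrite (_ : _ @^-1` _ = f @^-1` [set ssval i]); first exact: measurable_sfunP.
apply/seteqP; split=> t /= h; first by rewrite -h.
exact/val_inj.
Qed.

Lemma meas_clean_real (f : S -> R) : measurable D -> measurable_fun D f ->
  clean_for D (@cv R) f.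
Proof.
move=> mD mf.
have /(approximation_sfun mD) [g hg] : measurable_fun D (EFin \o f) by exact/measurable_EFinP.
exists (fun n => HBSimple.SimpleFun.sort (g n)); split; first by move=> n; exact: sfun_step.
by move=> t Dt; constructor; have /fine_cvg := hg t Dt.
Qed.

Lemma clean_scale (E : phs R) (f : S -> R) (v : E) : measurable D ->
  measurable_fun D f -> clean D (fun t => f t *: v).
Proof.
move=> mD mf; apply: (clean_comp (f := fun a => a *: v)) (meas_clean_real mD mf).
move=> a x h; apply: (hcvg_le (b := fun n => `|a n - x| * hn v)).
  by move=> n; rewrite -scalerBl hnZ.
have := cvM (cv_abs (cvB h (cvC x))) (cvC (hn v)).
by rewrite subrr normr0 mul0r.
Qed.

Lemma clean_ext (E : phs R) (u v : S -> E) : (forall t, D t -> u t = v t) ->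
  clean D u -> clean D v.
Proof. by move=> h; exact: clean_eq. Qed.

Lemma clean_sum (E : phs R) I (s : seq I) (F : I -> S -> E) :
  (forall i, clean D (F i)) -> clean D (fun t => \sum_(i <- s) F i t).
Proof.
move=> h; elim: s => [|i s IH].
  have h0 : clean D (fun _ : S => 0 : E) by apply: step_clean; exact: step_cst.
  by apply: (clean_ext _ h0) => t _; rewrite big_nil.
by apply: (clean_ext _ (cleanD (h i) IH)) => t _; rewrite big_cons.
Qed.

End ScalarClean.

(** * Primitives of step functions *)

Section Primitive.
Variables (R : realType) (T : R) (T0 : 0 < T) (V : phs R).
Local Notation D := (Iv T).

(** Instantiated both by [ip] on [V] and by the form [ip (i x) (i y)] pulled back from [H], so that
    each computation with primitives is made once. *)
Definition bilin (b : V -> V -> R) : Prop :=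
  (forall a x y z, b (a *: x + y) z = a * b x z + b y z) /\
  (forall x y, b x y = b y x).

Lemma bilin0 b z : bilin b -> b 0 z = 0.
Proof.
move=> [bl _]; have := bl 1 0 0 z; rewrite scaler0 add0r mul1r.
by move=> h; lra.
Qed.

Lemma bilin_sum b (I : finType) (a : I -> R) (v : I -> V) z : bilin b ->
  b (\sum_i a i *: v i) z = \sum_i a i * b (v i) z.
Proof.
move=> hb; have [bl _] := hb; elim: (index_enum I) => [|i s IH].
  by rewrite !big_nil bilin0.
by rewrite !big_cons bl IH.
Qed.

Lemma bilinD b x y z : bilin b -> b (x + y) z = b x z + b y z.
Proof. by move=> [bl _]; rewrite -[x]scale1r bl mul1r scale1r. Qed.

Lemma bilin_ip : bilin (@ip R V).
Proof. by split; [move=> a x y z; rewrite ipDl ipZl|exact: ipC]. Qed.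

(* The primitive of a step function, as a finite combination. *)
Definition is_primitive (y Y : R -> V) : Prop :=
  forall b, bilin b -> forall t w, 0 <= t <= T ->
    itgT T (fun s => b (y s) w) /\ b (Y t) w = IntT t (fun s => b (y s) w).

(** The last clause is the chain rule for [b (Y, Y)]; by bilinearity it reduces to [IntT_mul] for
    the indicators of the pieces. As these are arbitrary measurable sets, [Y] is Lipschitz rather
    than piecewise affine. *)
Lemma primitive_ex (y : measurableTypeR R -> V) : is_step y -> exists Y : R -> V,
  [/\ is_primitive y Y, L2mem (leb1 R) D (Y : measurableTypeR R -> V),
   exists C : R, forall s t, 0 <= s <= T -> 0 <= t <= T -> hn (Y t - Y s) <= C * `|t - s| &
   forall b, bilin b -> forall t, 0 <= t <= T ->
     itgT t (fun s => b (y s) (Y s)) /\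
     b (Y t) (Y t) = 2 * IntT t (fun s => b (y s) (Y s))].
Proof.
move=> [I [k [v [mk hy]]]].
pose chi i (s : measurableTypeR R) : R := \1_(k @^-1` [set i]) s.
pose psi i t := IntT t (chi i).
have mchi i : measurable_fun D (chi i) by exact: measurable_indic.
have chi1 i s : `|chi i s| <= 1.
  by rewrite /chi indicE; case: (_ \in _); rewrite ?normr1 ?normr0.
have ichi t i : itgT t (chi i).
  apply: (itg_le (mIv t) _ (itg_cst (mIv t) 1 (Iv_fin t))) => //; exact: measurable_indic.
have yE s : y s = \sum_i chi i s *: v i.
  rewrite hy (bigD1 (k s)) //= big1 => [|i ik]; last first.
    rewrite /chi indicE memNset ?scale0r // => /= h; by rewrite h eqxx in ik.
  by rewrite addr0 /chi indicE mem_set // scale1r.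
pose Y t := \sum_i psi i t *: v i.
have psiL i s t : 0 <= s <= T -> 0 <= t <= T -> `|psi i t - psi i s| <= `|t - s|.
  wlog st : s t / s <= t => [hw hs ht|/andP[s0 sT] /andP[t0 tT]].
    case/orP: (le_total s t) => h; first exact: hw.
    by rewrite distrC (distrC t); exact: hw.
  rewrite (ger0_norm (_ : 0 <= t - s)) ?subr_ge0 // -[t - s]mul1r.
  exact: IntT_Lipschitz (ichi T i) _.
(* Measurability of the primitive comes from Fubini: [1 * psi i] is one of the integrands in
   [IntT_mul]. *)
have mpsi i : measurable_fun D (psi i).
  have [h _ _] := IntT_mul (ichi T i) (ichi T i).
  have [_ h2 _] := IntT_mul (itg_cst (mIv T) 1 (Iv_fin T)) (ichi T i).
  have [h3 _ _] := IntT_mul (itg_cst (mIv T) 1 (Iv_fin T)) (ichi T i).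
  apply: eq_measurable_fun (itg_meas h3) => s _; exact: mul1r.
have psi0 i : psi i 0 = 0.
  by rewrite /psi /Iv set_itv_ge ?Rintegral_set0 // -leNgt bnd_simp.
have prim : is_primitive y Y.
  move=> b hb t w tT.
  have yb s : b (y s) w = \sum_i b (v i) w * chi i s.
    by rewrite yE bilin_sum //; apply: eq_bigr => i _; rewrite mulrC.
  split.
    apply: (itg_eq (mIv T) (fun s _ => esym (yb s))).
    by apply: itg_sum; [exact: mIv|move=> i; apply: itgZ => //; exact: mIv].
  rewrite /Y bilin_sum // (Int_eq _ (fun s _ => yb s)) Int_sum; last 2 first.
  - exact: mIv.
  - by move=> i; apply: itgZ => //; exact: mIv.
  by apply: eq_bigr => i _; rewrite IntZ 1?mulrC //; exact: mIv.
exists Y; split=> //.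
- apply: (L2mem_dom (mIv T) (g := fun=> (T * \sum_i hn (v i)) ^+ 2)).
  + by apply: clean_sum => i; apply: clean_scale => //; exact: mIv.
  + by apply: itg_cst; [exact: mIv|exact: Iv_fin].
  move=> t /IvP /andP[t0 tT]; rewrite -hn_sq ler_sqr ?nnegrE ?hn_ge0 //; last first.
    by rewrite mulr_ge0 ?(ltW T0) // sumr_ge0 // => i _; exact: hn_ge0.
  apply: le_trans (hn_sum _ _) _; rewrite mulr_sumr; apply: ler_sum => i _.
  rewrite hnZ ler_wpM2r ?hn_ge0 //.
  have := psiL i 0 t; rewrite psi0 !subr0 lexx (ltW T0) (ltW t0) (ltW tT) => /(_ isT isT).
  by move=> h; apply: le_trans h _; rewrite ger0_norm ?(ltW t0) // ltW.
- exists (\sum_i hn (v i)) => s t hs ht.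
  rewrite /Y -sumrB; apply: le_trans (hn_sum _ _) _; rewrite mulr_suml.
  apply: ler_sum => i _; rewrite -scalerBl hnZ mulrC ler_wpM2l ?hn_ge0 //.
  exact: psiL.
- move=> b hb t tT; have [bl bC] := hb.
  have ex s : b (y s) (Y s) = \sum_i \sum_j b (v i) (v j) * (chi i s * psi j s) :> R.
    rewrite yE bilin_sum //; apply: eq_bigr => i _.
    rewrite bC /Y bilin_sum // mulr_sumr; apply: eq_bigr => j _.
    by rewrite (bC (v j)); ring.
  have ii i j : itgT t (fun s => chi i s * psi j s).
    by have [h _ _] := IntT_mul (ichi t i) (ichi t j).
  have isum i : itgT t (fun s => \sum_j b (v i) (v j) * (chi i s * psi j s)).
    by apply: itg_sum; [exact: mIv|move=> j; apply: itgZ => //; exact: mIv].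
  split.
    apply: (itg_eq (mIv t) (fun s _ => esym (ex s))).
    by apply: itg_sum => //; exact: mIv.
  rewrite (Int_eq _ (fun s _ => ex s)) Int_sum //; last exact: mIv.
  have -> : \sum_i IntT t (fun s => \sum_j b (v i) (v j) * (chi i s * psi j s)) =
    \sum_i \sum_j b (v i) (v j) * IntT t (fun s => chi i s * psi j s).
    apply: eq_bigr => i _; rewrite Int_sum; last 2 first.
    - exact: mIv.
    - by move=> j; apply: itgZ => //; exact: mIv.
    by apply: eq_bigr => j _; rewrite IntZ //; exact: mIv.
  have -> : b (Y t) (Y t) = \sum_i \sum_j b (v i) (v j) *
      (IntT t (fun s => chi i s * psi j s) + IntT t (fun s => chi j s * psi i s)).
    rewrite {1}/Y bilin_sum //; apply: eq_bigr => i _.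
    rewrite bC /Y bilin_sum // mulr_sumr; apply: eq_bigr => j _.
    have [_ _ <-] := IntT_mul (ichi t i) (ichi t j).
    by rewrite (bC (v j)) /psi; ring.
  under eq_bigr do under eq_bigr do rewrite mulrDr.
  under eq_bigr do rewrite big_split.
  rewrite big_split /= mulr2n mulrDl mul1r; congr (_ + _).
  rewrite exchange_big; apply: eq_bigr => i _; apply: eq_bigr => j _.
  by rewrite bC.
Qed.

End Primitive.

Lemma hn_ip_eq (R : realType) (E : phs R) (x y : E) : hn (x - y) = 0 -> ip x x = ip y y.
Proof.
move=> h; rewrite -!hn_sq; congr (_ ^+ 2); apply/eqP; rewrite -subr_eq0 -normr_le0.
by rewrite -h; exact: hn_distl.
Qed.

Lemma hn_ipl_eq (R : realType) (E : phs R) (x y z : E) : hn (x - y) = 0 -> ip x z = ip y z.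
Proof. by move=> h; have := ip_hn0 z h; rewrite ipBl => /eqP; rewrite subr_eq0 => /eqP. Qed.

Lemma subr3 (M : zmodType) (a b c a' b' c' : M) :
  a - b - c - (a' - b' - c') = (a - a') - (b - b') - (c - c').
Proof. by rewrite !opprD addrACA (addrACA a). Qed.

(** The minimum of [f] and [g] equals [f] almost everywhere and lies below [g] everywhere. *)
Lemma Int_le_ae d (S : measurableType d) (R : realType) (nu : {measure set S -> \bar R})
    (D : set S) (f g : S -> R) : measurable D -> itg nu D f -> itg nu D g ->
  (\forall t \ae nu, D t -> f t <= g t) -> Rintegral nu D f <= Rintegral nu D g.
Proof.
move=> mD hf hg h.
have im : itg nu D (fun t => Num.min (f t) (g t)).
  apply: (itg_le mD _ (itgD mD (itg_abs hf) (itg_abs hg))).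
    exact: (measurable_minr (itg_meas hf) (itg_meas hg)).
  move=> t _; case: (leP (f t) (g t)) => _.
    by rewrite lerDl.
  by rewrite lerDr.
rewrite (@Int_ae _ _ _ _ _ mD f (fun t => Num.min (f t) (g t))) //.
  by apply: Int_le => // t _; rewrite ge_min lexx orbT.
by apply: filterS h => t ht Dt; rewrite min_l // ht.
Qed.

#[local] Hint Resolve mIv : core.

(** * The evolution equation in an abstract Gelfand triple *)

Section Evolution.
Variables (R : realType) (T : R) (T0 : 0 < T) (V H : phs R).
Variables (cV : hcomplete V) (cH : hcomplete H) (i : V -> H) (Ci : R).
Hypothesis iL : forall (a : R) x y, i (a *: x + y) = a *: i x + i y.
Hypothesis iC : forall x, hn (i x) <= Ci * hn x.
Hypothesis iinj : forall x, hn (i x) = 0 -> hn x = 0.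
Hypothesis idense : forall xi, (forall v, ip xi (i v) = 0) -> hn xi = 0.

Local Notation D := (Iv T).
Let mD : measurable D := mIv T.
Let fD : (leb1 R D < +oo)%E := Iv_fin T.
Local Notation X := (L2 (leb1 R) mD V).
Local Notation XH := (L2 (leb1 R) mD H).

Let b (x y : V) : R := ip (i x) (i y).

Lemma i_bilin : bilin b.
Proof. by split=> [a x y z|x y]; rewrite /b ?iL ?ipDl ?ipZl // ipC. Qed.

Lemma i0 : i 0 = 0.
Proof.
have := iL 1 0 0; rewrite scaler0 scale1r add0r => /eqP; rewrite -subr_eq0.
by rewrite opprD addrA subrr sub0r oppr_eq0 => /eqP.
Qed.

Lemma iD x y : i (x + y) = i x + i y.
Proof. by rewrite -[x]scale1r iL !scale1r. Qed.

Lemma iZ a x : i (a *: x) = a *: i x.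
Proof. by rewrite -[_ *: x]addr0 iL i0 addr0. Qed.

Lemma iB x y : i (x - y) = i x - i y.
Proof. by rewrite iD -scaleN1r iZ scaleN1r. Qed.

Lemma Ci_ge0 (x : V) : 0 <= Ci * hn x.
Proof. exact: le_trans (hn_ge0 _) (iC x). Qed.

Lemma i_hcvg u x : hcvg u x -> hcvg (fun n => i (u n)) (i x).
Proof.
move=> h; have := cvZ Ci h; rewrite mulr0; apply: hcvg_le => n.
by rewrite -iB.
Qed.

Lemma cstX_mem (w : V) : L2mem (leb1 R) D (fun _ : measurableTypeR R => w).
Proof. by apply: (L2mem_step mD fD); exact: step_cst. Qed.
Definition cstX w : X := mkL2 mD (cstX_mem w).

Lemma cstX_hn w : hn (cstX w) = Num.sqrt T * hn w.
Proof.
rewrite /hn L2ipE /= Int_cst // leb_Iv /= max_r ?(ltW T0) // mulrC.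
by rewrite sqrtrM ?(ltW T0).
Qed.

Lemma cutX_mem t (z : X) :
  L2mem (leb1 R) D (fun s => if `[< Iv t s >] then val z s else 0).
Proof.
apply: (L2mem_dom mD (g := fun s => ip (val z s) (val z s))).
- apply: clean_if; [exact: mIv|exact: L2_clean|].
  by apply: step_clean; exact: step_cst.
- exact: L2_itg.
by move=> s _; case: asboolP => // _; rewrite ip0l ip_ge0.
Qed.
(** For [t <= T], pairing over [(0, t)] is the inner product of [X] with the cut function, from
    which it inherits Cauchy-Schwarz and continuity. *)
Definition cutX t (z : X) : X := mkL2 mD (cutX_mem t z).

Definition pairT t (z u : X) : R := IntT t (fun s => ip (val z s) (val u s)).

Lemma pairT_cut t z u : t <= T -> pairT t z u = ip (cutX t z) u.
Proof.
move=> tT; rewrite L2ipE /pairT (IntT_cut _ tT); apply: Int_eq => s /IvP /andP[s0 _] /=.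
case: asboolP => [/IvP/andP[_ ->]|h]; first by rewrite mul1r.
rewrite ip0l; case: ltP => st; last by rewrite mul0r.
by case: h; apply/IvP; rewrite s0.
Qed.

Lemma cutX_le t z : hn (cutX t z) <= hn z.
Proof.
rewrite /hn ler_wsqrtr // !L2ipE; apply: Int_le; [exact: mD|exact: L2_itg|exact: L2_itg|].
by move=> s _ /=; case: asboolP => // _; rewrite ip0l ip_ge0.
Qed.

Lemma pairT_le t z u : t <= T -> `|pairT t z u| <= hn z * hn u.
Proof.
move=> tT; rewrite pairT_cut //; apply: le_trans (ip_CS _ _) _.
by rewrite ler_wpM2r ?hn_ge0 // cutX_le.
Qed.

Lemma pairT_itg t (z u : X) : t <= T -> itgT t (fun s => ip (val z s) (val u s)).
Proof. by move=> tT; apply: itgT_sub tT _; exact: L2_itg. Qed.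

Lemma pairTBl t z z' u : t <= T -> pairT t (z - z') u = pairT t z u - pairT t z' u.
Proof.
move=> tT; rewrite /pairT -IntB //; try exact: pairT_itg.
by apply: Int_eq => s _; rewrite L2_subE ipBl.
Qed.

Lemma pairTBr t z u u' : t <= T -> pairT t z (u - u') = pairT t z u - pairT t z u'.
Proof.
move=> tT; rewrite /pairT -IntB //; try exact: pairT_itg.
by apply: Int_eq => s _; rewrite L2_subE ipBr.
Qed.

Lemma pairTL t a z z' u : t <= T -> pairT t (a *: z + z') u = a * pairT t z u + pairT t z' u.
Proof.
move=> tT; have h1 := pairT_itg z u tT; have h2 := pairT_itg z' u tT.
rewrite /pairT -IntZ // -IntD //; last by apply: itgZ => //; exact: mIv.
by apply: Int_eq => s _; rewrite -ipZl -ipDl.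
Qed.

Lemma pairT_T z u : pairT T z u = ip z u. Proof. by []. Qed.

Lemma pairT_cv t (z_ u_ : nat -> X) z u : t <= T -> hcvg z_ z -> hcvg u_ u ->
  cv (fun n => pairT t (z_ n) (u_ n)) (pairT t z u).
Proof.
move=> tT hz hu.
have h1 := cvD (cvM hz (hcvg_hn hu)) (cvZ (hn z) hu).
rewrite mul0r mulr0 addr0 in h1; apply: cv_dist h1 => n.
have -> : pairT t (z_ n) (u_ n) - pairT t z u =
    pairT t (z_ n - z) (u_ n) + pairT t z (u_ n - u).
  by rewrite pairTBl // pairTBr //; ring.
by apply: le_trans (ler_normD _ _) _; apply: lerD; exact: pairT_le.
Qed.

Lemma pairT_hn0l t z u : t <= T -> hn z = 0 -> pairT t z u = 0.
Proof.
by move=> tT h; apply/eqP; rewrite -normr_le0; apply: le_trans (pairT_le _ _ tT) _; rewrite h mul0r.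
Qed.

Lemma pairT_hn0r t z u : t <= T -> hn u = 0 -> pairT t z u = 0.
Proof.
by move=> tT h; apply/eqP; rewrite -normr_le0; apply: le_trans (pairT_le _ _ tT) _; rewrite h mulr0.
Qed.

(* [U] is the representative, continuous into [H], of [i \o u], and [z] is the
   Riesz representative in [V] of its time derivative. *)
Definition Wsol (u z : X) (U : R -> H) : Prop :=
  (forall t, 0 <= t <= T -> forall w,
     ip (U t) (i w) = ip (U 0) (i w) + pairT t z (cstX w)) /\
  (\forall t \ae leb1 R, D t -> hn (U t - i (val u t)) = 0).

Definition energy (u z : X) (U : R -> H) : Prop :=
  forall t, 0 <= t <= T -> ip (U t) (U t) = ip (U 0) (U 0) + 2 * pairT t z u.

Definition Hcont (U : R -> H) : Prop :=
  forall t, 0 <= t <= T -> forall e, 0 < e -> exists2 dl, 0 < dl &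
    forall s, 0 <= s <= T -> `|s - t| < dl -> hn (U s - U t) < e.

Lemma WsolL a u z U u' z' U' : Wsol u z U -> Wsol u' z' U' ->
  Wsol (a *: u + u') (a *: z + z') (fun t => a *: U t + U' t).
Proof.
move=> [h1 h2] [h1' h2']; split.
  move=> t /[dup] tT /andP[_ tT'] w; rewrite !ipDl !ipZl h1 // h1' // pairTL //; ring.
apply: filterS2 h2 h2' => t k k' Dt.
have -> : a *: U t + U' t - i (val (a *: u + u') t) =
    a *: (U t - i (val u t)) + (U' t - i (val u' t)).
  by rewrite /= iL scalerBr opprD addrACA.
apply/eqP; rewrite eq_le hn_ge0 andbT; apply: le_trans (hnD _ _) _.
by rewrite hnZ k // k' // mulr0 addr0.
Qed.

Lemma WsolB u z U u' z' U' : Wsol u z U -> Wsol u' z' U' ->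
  Wsol (u - u') (z - z') (fun t => U t - U' t).
Proof.
move=> h h'; have := WsolL (-1) h' h.
have -> : (fun t => -1 *: U' t + U t) = (fun t => U t - U' t).
  by apply/funext => t; rewrite scaleN1r addrC.
by rewrite !scaleN1r addrC [- z' + z]addrC.
Qed.

(** The energy identity of the differences turns convergence of [u_], of [z_] and of the initial
    values into uniform convergence of [U_] on [[0, T]], which carries continuity over to the
    limit. *)
Lemma Wsol_lim (u_ z_ : nat -> X) (U_ : nat -> R -> H) u z h :
  (forall n, Wsol (u_ n) (z_ n) (U_ n)) -> (forall n, Hcont (U_ n)) ->
  (forall n, energy (u_ n) (z_ n) (U_ n)) ->
  (forall n m, energy (u_ n - u_ m) (z_ n - z_ m) (fun t => U_ n t - U_ m t)) ->
  hcvg u_ u -> hcvg z_ z -> hcvg (fun n => U_ n 0) h ->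
  exists U, [/\ Wsol u z U, energy u z U, Hcont U & hn (U 0 - h) = 0].
Proof.
move=> hW hC hE hEB hu hz hh.
have unif e : 0 < e -> exists N, forall n m, (N <= n)%N -> (N <= m)%N ->
    forall t, 0 <= t <= T -> hn (U_ n t - U_ m t) < e.
  move=> e0; have e2 : 0 < e / 2 by lra.
  have [N1 h1] := hcvg_cauchy hu e2; have [N2 h2] := hcvg_cauchy hz e2.
  have [N3 h3] := hcvg_cauchy hh e2.
  exists (maxn N1 (maxn N2 N3)) => n m; rewrite !geq_max.
  move=> /and3P[n1 n2 n3] /and3P[m1 m2 m3] t tT.
  rewrite -ltr_sqr ?nnegrE ?hn_ge0 ?(ltW e0) // hn_sq hEB // -hn_sq.
  have := pairT_le (z_ n - z_ m) (u_ n - u_ m) (andP tT).2.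
  move=> /(le_trans (ler_norm _)).
  have := h1 _ _ n1 m1; have := h2 _ _ n2 m2; have := h3 _ _ n3 m3.
  have := hn_ge0 (z_ n - z_ m); have := hn_ge0 (u_ n - u_ m); have := hn_ge0 (U_ n 0 - U_ m 0).
  set a1 := hn (U_ n 0 - _); set a2 := hn (z_ n - _); set a3 := hn (u_ n - _).
  set p := pairT _ _ _ => p1 p2 p3 q1 q2 q3 hp.
  have : a2 * a3 <= (e / 2) * (e / 2) by apply: ler_pM => //; exact: ltW.
  have : a1 ^+ 2 < (e / 2) ^+ 2 by rewrite ltr_sqr ?nnegrE //; exact: ltW.
  by nra.
have hlim t : exists l, 0 <= t <= T -> hcvg (fun n => U_ n t) l.
  have [tT|tT] := pselect (0 <= t <= T); last by exists 0 => ?; case: tT.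
  have [|l hl] := cH (u := fun n => U_ n t); last by exists l.
  by move=> e /unif [N hN]; exists N => n m Nn Nm; exact: hN.
have [U hU] := choice hlim.
have unifU e : 0 < e -> exists N, forall n, (N <= n)%N ->
    forall t, 0 <= t <= T -> hn (U_ n t - U t) <= e.
  move=> e0; have [N hN] := unif e e0; exists N => n Nn t tT.
  have hc := hcvg_hn (hcvgB (hcvg_const (U_ n t)) (hU t tT)).
  have hc' := cv_sub (f := fun k => (k + N)%N) (fun k => leq_addr _ _) hc.
  apply: cv_le hc' (cvC e) => k; apply/ltW/hN => //; exact: leq_addl.
have T00 : 0 <= (0 : R) <= T by apply/andP; split=> //; exact: ltW.
exists U; split.
- split.
    move=> t tT w; apply: (cv_uniq (a := fun n => ip (U_ n t) (i w))).
      exact: hcvg_ip (hU t tT) (hcvg_const _).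
    have h1 := hcvg_ip (hU 0 T00) (hcvg_const (i w)).
    have h2 := pairT_cv (andP tT).2 hz (hcvg_const (cstX w)).
    have := cvD h1 h2; congr cv; apply/funext => n.
    by have [hn1 _] := hW n; rewrite (hn1 t).
  have [f [fn hf]] := L2_ae_subseq hu.
  have hall : \forall t \ae leb1 R, forall n, D t -> hn (U_ n t - i (val (u_ n) t)) = 0.
    by apply: ae_foralln => n; have [] := hW n.
  apply: filterS2 hf hall => t k1 k2 Dt.
  have tT : 0 <= t <= T by move/IvP: Dt => /andP[/ltW -> /ltW ->].
  have h1 := hcvg_sub fn (hU t tT); have h2 := i_hcvg (k1 Dt).
  have := hcvg_hn (hcvgB h1 h2).
  under eq_fun do rewrite k2 //.
  by move/cv_uniq/(_ (cvC _)).
- move=> t tT; apply: (cv_uniq (a := fun n => ip (U_ n t) (U_ n t))).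
    exact: hcvg_ip (hU t tT) (hU t tT).
  have h1 := hcvg_ip (hU 0 T00) (hU 0 T00).
  have h2 := cvZ 2 (pairT_cv (andP tT).2 hz hu).
  by have := cvD h1 h2; congr cv; apply/funext => n; rewrite (hE n t tT).
- move=> t tT e e0; have e3 : 0 < e / 4 by lra.
  have [N hN] := unifU _ e3; have [dl dl0 hdl] := hC N t tT _ e3.
  exists dl => // s sT sd; apply: le_lt_trans (hn_triB _ (U_ N s) _) _.
  have := hn_triB (U_ N s) (U_ N t) (U t); have := hdl s sT sd.
  have := hN N (leqnn N) s sT; have := hN N (leqnn N) t tT; rewrite (hnBC _ (U s)).
  set a1 := hn (U s - _); set a2 := hn (U_ N t - _); set a3 := hn (U_ N s - U_ N t).
  set a4 := hn _ => *; lra.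
- exact: hcvg_uniq (hU 0 T00) hh.
Qed.

(** * Solutions whose derivative is a step function *)

Section Regular.

Lemma prim_lin a y Y y' Y' : is_primitive T y Y -> is_primitive T y' Y' ->
  is_primitive T (fun t => a *: y t + y' t : V) (fun t => a *: Y t + Y' t).
Proof.
move=> h h' c hc t w tT; have [bl _] := hc.
have [i1 e1] := h c hc t w tT; have [i2 e2] := h' c hc t w tT.
have ii : itgT T (fun s => a * c (y s) w + c (y' s) w) by apply: itgD => //; apply: itgZ.
split; first by apply: (itg_eq mD _ ii) => s _; rewrite bl.
have [j1 j2] := (itgT_sub (andP tT).2 i1, itgT_sub (andP tT).2 i2).
rewrite bl e1 e2 -IntZ // -IntD //; last by apply: itgZ => //; exact: mIv.
by apply: Int_eq => s _; rewrite bl.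
Qed.

(** A primitive is determined only through its pairings, so the identity is transferred from the
    primitive that [primitive_ex] builds. *)
Lemma prim_quad (y : measurableTypeR R -> V) Y c : is_step y -> is_primitive T y Y -> bilin c ->
  forall t, 0 <= t <= T -> itgT t (fun s => c (y s) (Y s)) /\
    c (Y t) (Y t) = 2 * IntT t (fun s => c (y s) (Y s)).
Proof.
move=> sy hY hc t tT; have [Y0 [hY0 _ _ hq]] := primitive_ex T0 sy.
have [_ cC] := hc.
have eY s w : 0 <= s <= T -> c (Y s) w = c (Y0 s) w.
  by move=> sT; have [_ ->] := hY c hc s w sT; have [_ ->] := hY0 c hc s w sT.
have eq s : Iv t s -> c (y s) (Y0 s) = c (y s) (Y s).
  move=> /IvP/andP[s0 st]; rewrite cC [RHS]cC eY // (ltW s0) /=.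
  by rewrite (le_trans (ltW st)) // (andP tT).2.
have [i1 e1] := hq c hc t tT.
split; first by apply: (itg_eq _ _ i1).
by rewrite eY // cC eY // e1; congr (_ * _); exact: Int_eq.
Qed.

(** Here [u = c + Y] where [Y] is a primitive of the step [y], and [z t] is the Riesz representative
    in [V] of the functional [b (y t)]. For such triples the equation and the energy identity are
    direct computations. *)
Definition Reg (u z : X) (U : R -> H) : Prop :=
  exists (y : measurableTypeR R -> V) (Y : R -> V) (c : V),
  [/\ is_step y, is_primitive T y Y,
    (forall t, val u t = c + Y t),
    (forall t, D t -> forall w, ip (val z t) w = b (y t) w) &
    (forall t, U t = i (c + Y t))].

Lemma Reg_lin a u z U u' z' U' : Reg u z U -> Reg u' z' U' ->
  Reg (a *: u + u') (a *: z + z') (fun t => a *: U t + U' t).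
Proof.
move=> [y [Y [c [sy hY hu hz hU]]]] [y' [Y' [c' [sy' hY' hu' hz' hU']]]].
exists (fun t => a *: y t + y' t), (fun t => a *: Y t + Y' t), (a *: c + c'); split.
- exact: (step_comp2 (fun p q => a *: p + q)).
- exact: prim_lin.
- by move=> t; rewrite /= [LHS](_ : _ = a *: val u t + val u' t) // hu hu' scalerDr addrACA.
- move=> t Dt w; rewrite [LHS](_ : _ = ip (a *: val z t + val z' t) w) // ipDl ipZl hz // hz' //.
  by have [bl _] := i_bilin; rewrite bl.
- by move=> t; rewrite hU hU' -iL; congr i; rewrite scalerDr addrACA.
Qed.

Lemma b0_prim y Y w : is_primitive T y Y -> b (Y 0) w = 0.
Proof.
move=> h; have T00 : 0 <= (0 : R) <= T by apply/andP; split=> //; exact: ltW.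
have [_ ->] := h b i_bilin 0 w T00.
by rewrite /Iv set_itv_ge ?Rintegral_set0 // -leNgt bnd_simp.
Qed.

Lemma prim_pair y Y (yX : X) t w : 0 <= t <= T -> is_primitive T y Y ->
  (forall s, val yX s = y s) -> ip (Y t) w = pairT t yX (cstX w).
Proof.
move=> tT h hy; have [_ ->] := h (@ip R V) (bilin_ip V) t w tT.
by apply: Int_eq => s _; rewrite hy.
Qed.

Lemma Reg_Wsol u z U : Reg u z U -> Wsol u z U.
Proof.
move=> [y [Y [c [sy hY hu hz hU]]]]; split.
  move=> t tT w; rewrite !hU !iD !ipDl -addrA; congr (_ + _).
  rewrite -/(b (Y 0) w) (b0_prim _ hY) add0r.
  rewrite -/(b (Y t) w); have [_ ->] := hY b i_bilin t w tT.
  apply: Int_eq => s hs /=; rewrite hz //; exact: Iv_sub (andP tT).2 _ hs.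
by apply: aeW => t _; rewrite hU hu subrr hn0.
Qed.

Lemma Reg_energy u z U : Reg u z U -> energy u z U.
Proof.
move=> [y [Y [c [sy hY hu hz hU]]]] t tT.
have T00 : 0 <= (0 : R) <= T by apply/andP; split=> //; exact: ltW.
have [bl bC] := i_bilin.
have [j1 j2] := hY b i_bilin t c tT.
have [k1 k2] := prim_quad sy hY i_bilin tT.
have j1' := itgT_sub (andP tT).2 j1.
have -> : pairT t z u = IntT t (fun s => b (y s) c + b (y s) (Y s)).
  apply: Int_eq => s hs; rewrite hz; last exact: Iv_sub (andP tT).2 _ hs.
  by rewrite hu bC (bilinD _ _ _ i_bilin) bC (bC (Y s)).
rewrite IntD // -j2 mulrDr -k2 !hU !iD !ip_sqD.
rewrite -/(b (Y 0) (Y 0)) -/(b c (Y 0)) (bC c) !(b0_prim _ hY) -/(b (Y t) (Y t)).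
by rewrite -/(b c (Y t)) (bC c); ring.
Qed.

Lemma Reg_cont u z U : Reg u z U -> Hcont U.
Proof.
move=> [y [Y [c [sy hY hu hz hU]]]] t tT e e0.
have [Y0 [hY0 _ [K hK] _]] := primitive_ex T0 sy.
have eY s w : 0 <= s <= T -> ip (Y s) w = ip (Y0 s) w.
  move=> sT; have [_ ->] := hY _ (bilin_ip V) s w sT.
  by have [_ ->] := hY0 _ (bilin_ip V) s w sT.
have eH s : 0 <= s <= T -> hn (Y s - Y t) = hn (Y0 s - Y0 t).
  move=> sT; rewrite /hn; congr Num.sqrt.
  rewrite ipBl !eY // -ipBl ipC ipBl !eY // -ipBl; done.
have K1 : 0 < `|Ci| * `|K| + 1 by rewrite ltr_pwDr ?mulr_ge0.
exists (e / (`|Ci| * `|K| + 1)); first by rewrite divr_gt0.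
move=> s sT hs; rewrite !hU -iB opprD addrACA subrr add0r.
apply: le_lt_trans (iC _) _; rewrite eH //.
have h1 : Ci * hn (Y0 s - Y0 t) <= `|Ci| * (`|K| * `|s - t|).
  apply: le_trans (ler_wpM2r (hn_ge0 _) (ler_norm Ci)) _; rewrite ler_wpM2l //.
  by apply: le_trans (hK _ _ tT sT) _; rewrite ler_wpM2r // ler_norm.
apply: le_lt_trans h1 _; rewrite mulrA.
move: hs; rewrite ltr_pdivlMr // => hs; apply: le_lt_trans hs.
by rewrite mulrC ler_wpM2l // lerDl.
Qed.

Lemma Reg_ex (y : measurableTypeR R -> V) c : is_step y -> exists u z U Y,
  [/\ Reg u z U, is_primitive T y Y, (forall t, val u t = c + Y t),
     forall t, D t -> forall w, ip (val z t) w = b (y t) w & U 0 = i (c + Y 0)].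
Proof.
move=> sy; have [Y [hY mY _ _]] := primitive_ex T0 sy.
have hB x : exists p, forall w, b x w = ip p w.
  apply: (riesz (C := Ci * Ci * hn x) cV) => [a v w|w].
    by have [bl bC] := i_bilin; rewrite bC bl bC (bC w).
  apply: le_trans (ip_CS _ _) _; have := iC x; have := iC w; have := hn_ge0 (i x); have := hn_ge0 (i w).
  move=> h1 h2 h3 h4; have -> : Ci * Ci * hn x * hn w = (Ci * hn x) * (Ci * hn w) by ring.
  exact: ler_pM.
have [B hB'] := choice hB.
have mu' : L2mem (leb1 R) D ((cst c + Y : measurableTypeR R -> V)).
  by rewrite -[cst c]scale1r; apply: (L2memL mD) => //; exact: cstX_mem.
have mz : L2mem (leb1 R) D (fun t : measurableTypeR R => B (y t)).
  by apply: (L2mem_step mD fD); exact: step_comp.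
exists (mkL2 mD mu'), (mkL2 mD mz), (fun t => i (c + Y t)), Y; split=> //.
  by exists y, Y, c; split=> // t _ w; rewrite /= -hB'.
Qed.

End Regular.

Lemma iX_mem (u : X) : L2mem (leb1 R) D (fun t => i (val u t)).
Proof.
apply: (L2mem_dom mD (g := fun t => Ci ^+ 2 * ip (val u t) (val u t))).
- by apply: clean_comp (L2_clean u) => a x; exact: i_hcvg.
- by apply: itgZ => //; exact: L2_itg.
move=> t _; rewrite -!hn_sq -exprMn ler_sqr ?nnegrE ?hn_ge0 //.
exact: Ci_ge0.
Qed.
Definition iX (u : X) : XH := mkL2 mD (iX_mem u).

Lemma iX_le u : hn (iX u) <= `|Ci| * hn u.
Proof.
rewrite -[X in _ <= X]ger0_norm ?mulr_ge0 ?hn_ge0 // -sqrtr_sqr /hn ler_wsqrtr //.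
rewrite exprMn real_normK ?num_real // hn_sq !L2ipE -IntZ //; last exact: L2_itg.
apply: Int_le => //; [exact: L2_itg|by apply: itgZ => //; exact: L2_itg|].
move=> t _ /=; rewrite -!hn_sq -exprMn ler_sqr ?nnegrE ?hn_ge0 //.
exact: Ci_ge0.
Qed.

Lemma iX_sub u v : iX (u - v) = iX u - iX v.
Proof. by apply: val_inj; apply/funext => t; exact: iB. Qed.

Lemma iX_hcvg (u_ : nat -> X) u : hcvg u_ u -> hcvg (fun n => iX (u_ n)) (iX u).
Proof.
move=> h; have := cvZ `|Ci| h; rewrite mulr0; apply: hcvg_le => n.
by rewrite -iX_sub iX_le.
Qed.

Lemma iX_inj u : hn (iX u) = 0 -> hn u = 0.
Proof.
move=> /L2_hn0P h; apply/L2_hn0P; apply: filterS h => t h Dt.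
by apply: iinj; exact: h.
Qed.

(** The primitive is paired with the function constantly equal to [Y t], whose norm in [X] is
    [Num.sqrt T * hn (Y t)]; one factor is then divided out. *)
Lemma prim_bound (y : X) Y t : 0 <= t <= T -> is_primitive T (val y) Y ->
  hn (Y t) <= Num.sqrt T * hn y.
Proof.
move=> tT hY; have := hn_ge0 (Y t); rewrite le_eqVlt => /orP[/eqP <-|Yt0].
  by rewrite mulr_ge0 ?hn_ge0 ?sqrtr_ge0.
rewrite -(ler_pM2r Yt0) -expr2 hn_sq (prim_pair (yX := y) (Y t) tT hY) //.
apply: le_trans (ler_norm _) _; apply: le_trans (pairT_le _ _ (andP tT).2) _.
by rewrite cstX_hn mulrA (mulrC (hn y)).
Qed.

Lemma prim_bound_X (y YX : X) Y : is_primitive T (val y) Y ->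
  (forall t, val YX t = Y t) -> hn YX <= T * hn y.
Proof.
move=> hY hE; have Ty : 0 <= T * hn y by rewrite mulr_ge0 ?hn_ge0 ?ltW.
rewrite -ler_sqr ?nnegrE ?hn_ge0 // hn_sq L2ipE.
have -> : (T * hn y) ^+ 2 = Rintegral (leb1 R) D (fun=> T * hn y ^+ 2).
  by rewrite Int_cst // leb_Iv /= max_r ?(ltW T0) //; ring.
apply: Int_le => //; [exact: L2_itg|exact: itg_cst|].
move=> t /IvP/andP[t0 tT]; rewrite hE -hn_sq.
have -> : T * hn y ^+ 2 = (Num.sqrt T * hn y) ^+ 2.
  have sT : Num.sqrt T ^+ 2 = T by rewrite sqr_sqrtr // (ltW T0).
  by rewrite exprMn sT.
rewrite ler_sqr ?nnegrE ?hn_ge0 ?mulr_ge0 ?sqrtr_ge0 ?hn_ge0 //.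
by apply: prim_bound => //; rewrite (ltW t0) ltW.
Qed.

(** * The linear equation *)

Section Linear.
Variables (mu : R) (mu0 : 0 < mu).

(** Right-hand sides of [u' + mu u = g], together with initial values, that admit a regular
    solution. *)
Definition regM (p : prod_phs X H) : Prop :=
  exists u z U, [/\ Reg u z U, p.1 = z + mu *: u & p.2 = U 0].

Lemma Reg0 : Reg 0 0 (fun=> 0).
Proof.
exists (fun=> 0), (fun=> 0), 0; split.
- exact: step_cst.
- move=> c hc t w tT; split.
    by apply: (itg_eq _ _ (itg0 _ _)) => // s _; rewrite bilin0.
  by rewrite bilin0 // Int0.
- by move=> t; rewrite addr0.
- by move=> t _ w; rewrite ip0l /b i0 ip0l.
- by move=> t; rewrite addr0 i0.
Qed.

(** Let [(phi, xi)] be orthogonal to all regular data. Solutions vanishing at [0] with a step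
    derivative [y] and primitive [Y] give [(i y, i phi) = - mu (phi, Y)]. As [y] tends to [phi] the
    right side becomes [- mu (y, Y)] up to an error that vanishes, and [2 (y, Y) = |Y T|^2] is
    nonnegative. Hence [i phi = 0], so [phi] is null, and solutions constant in time then give
    [xi = 0]. *)
Lemma regM_dense (g : X) (h : H) : exists p : nat -> prod_phs X H,
  (forall n, regM (p n)) /\ hcvg p (g, h).
Proof.
have cXH : hcomplete (prod_phs X H).
  by apply: prod_complete => //; exact: L2_complete.
apply: (orth_dense cXH) => [|a p q|].
- by exists 0, 0, (fun=> 0); split; [exact: Reg0|rewrite scaler0 addr0|].
- move=> [u [z [U [r1 e1 e2]]]] [u' [z' [U' [r1' e1' e2']]]].
  exists (a *: u + u'), (a *: z + z'), (fun t => a *: U t + U' t); split.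
  + exact: Reg_lin.
  + by rewrite /= e1 e1' !scalerDr !scalerA (mulrC a) addrACA.
  + by rewrite /= e2 e2'.
move=> [phi xi] horth.
have T00 : 0 <= (0 : R) <= T by apply/andP; split=> //; exact: ltW.
have TT : 0 <= T <= T by rewrite lexx ltW.
(* The step is [0]: its primitive is null and [u] is the constant [c] up to norm zero. *)
have orth0 c : mu * ip phi (cstX c) + ip xi (i c) = 0.
  have sc : is_step (fun _ : measurableTypeR R => 0 : V) by exact: step_cst.
  have [u [z [U [Y [hR hY hu hz hU]]]]] := Reg_ex c sc.
  have Y0 t w : 0 <= t <= T -> ip (Y t) w = 0.
    move=> tT; have [_ ->] := hY _ (bilin_ip V) t w tT.
    by rewrite -[RHS](Int0 (leb1 R) (Iv t)); apply: Int_eq => s _; rewrite ip0l.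
  have hh : ip phi (z + mu *: u) + ip xi (U 0) = 0.
    by apply: (horth (z + mu *: u, U 0)); exists u, z, U.
  rewrite -hh.
  rewrite ipDr ipZr; congr (_ + _).
    have -> : ip phi z = 0.
      rewrite L2ipE -[RHS](Int0 (leb1 R) D); apply: Int_eq => s Ds.
      by rewrite ipC hz // /b i0 ip0l.
    rewrite add0r; congr (_ * _); rewrite !L2ipE; apply: Int_eq => s /IvP/andP[s0 sT].
    by rewrite hu /= ipDr [ip _ (Y s)]ipC Y0 ?addr0 // (ltW s0) ltW.
  rewrite hU; apply/eqP; rewrite -subr_eq0 -ipBr -iB opprD addrA subrr sub0r -scaleN1r iZ ipZr.
  have hn0Y : hn (Y 0) = 0 by apply/eqP; rewrite -sqrf_eq0 hn_sq Y0.
  have : hn (i (Y 0)) = 0.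
    by apply/eqP; rewrite eq_le hn_ge0 andbT; apply: le_trans (iC _) _; rewrite hn0Y mulr0.
  by move=> /ip_hn0 hh0; rewrite ipC hh0 mulr0.
have orthy (y : X) : is_step (val y) -> exists Y YX,
    [/\ is_primitive T (val y) Y, (forall t, val YX t = Y t) &
     ip (iX y) (iX phi) = - mu * ip phi YX].
  move=> sy; have [u [z [U [Y [hR hY hu hz hU]]]]] := Reg_ex 0 sy.
  exists Y, u; split=> //; first by move=> t; rewrite hu add0r.
  have hh : ip phi (z + mu *: u) + ip xi (U 0) = 0.
    by apply: (horth (z + mu *: u, U 0)); exists u, z, U.
  have e0 : ip xi (U 0) = 0.
    rewrite hU add0r ipC; apply: ip_hn0; apply/eqP; rewrite -sqrf_eq0 hn_sq.
    by rewrite -/(b (Y 0) (Y 0)) (b0_prim _ hY).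
  have e1 : ip phi z = ip (iX y) (iX phi).
    by rewrite !L2ipE; apply: Int_eq => s Ds; rewrite ipC hz.
  by move: hh; rewrite e0 addr0 ipDr ipZr e1 mulNr => /eqP; rewrite addr_eq0 => /eqP.
have phi0 : hn phi = 0.
  have [y [sy hy _]] := step_dense fD phi.
  have key n : ip (iX (y n)) (iX phi) <= mu * (T * hn (y n) * hn (y n - phi)).
    have [Y [YX [hY hE ->]]] := orthy (y n) (sy n).
    have [q1 q2] := prim_quad (sy n) hY (bilin_ip V) TT.
    (* Twice this pairing is the squared norm of the primitive at time [T]. *)
    have pos : 0 <= ip (y n) YX.
      have -> : ip (y n) YX = IntT T (fun s => ip (val (y n) s) (Y s)).
        by rewrite L2ipE; apply: Int_eq => s _; rewrite hE.
      by have := ip_ge0 (Y T); rewrite q2; lra.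
    rewrite mulNr -mulrN ler_pM2l //.
    have -> : - ip phi YX = ip (y n - phi) YX - ip (y n) YX by rewrite ipBl; ring.
    apply: le_trans (_ : ip (y n - phi) YX <= _); first by lra.
    apply: le_trans (ip_le _ _) _; rewrite mulrC ler_wpM2r ?hn_ge0 //.
    exact: prim_bound_X hY hE.
  have l1 := hcvg_ip (iX_hcvg hy) (hcvg_const (iX phi)).
  have l2 := cvZ mu (cvM (cvZ T (hcvg_hn hy)) hy); rewrite mulr0 mulr0 in l2.
  have := cv_le key l1 l2 => h0.
  apply: iX_inj; apply/eqP; rewrite -sqrf_eq0 hn_sq; apply/eqP; apply/le_anti.
  by rewrite h0 ip_ge0.
have xi0 : hn xi = 0.
  by apply: idense => c; have := orth0 c; rewrite (ip_hn0 _ phi0) mulr0 add0r.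
apply/eqP; rewrite eq_le hn_ge0 andbT; apply: le_trans (prod_hn_le _) _.
by rewrite phi0 xi0 addr0.
Qed.

Lemma energy_apriori u z U : energy u z U ->
  mu * hn u ^+ 2 <= hn (U 0) ^+ 2 + mu^-1 * hn (z + mu *: u) ^+ 2.
Proof.
move=> hE; have TT : 0 <= T <= T by rewrite lexx ltW.
have := hE T TT; rewrite pairT_T.
have -> : ip z u = ip (z + mu *: u) u - mu * hn u ^+ 2 by rewrite ipDl ipZl hn_sq; ring.
have := ip_le (z + mu *: u) u; have := ip_ge0 (U T); rewrite -!hn_sq.
set g := hn (z + _); set x := hn u; set p := ip _ _; set a := hn (U 0); set c := hn (U T).
move=> c0 hp he.
have h1 : 2 * (g * x) <= mu * x ^+ 2 + mu^-1 * g ^+ 2.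
  have -> : mu * x ^+ 2 + mu^-1 * g ^+ 2 = ((mu * x) ^+ 2 + g ^+ 2) / mu by field; rewrite gt_eqF.
  by rewrite ler_pdivlMr //; have := sqr_ge0 (mu * x - g); nra.
by have := sqr_ge0 a; lra.
Qed.

Lemma linear_ex (g : X) (h : H) : exists u U,
  [/\ Wsol u (g - mu *: u) U, energy u (g - mu *: u) U, Hcont U & hn (U 0 - h) = 0].
Proof.
have [p [hp pc]] := regM_dense g h.
have [u hu] := choice hp; have [z hz] := choice hu; have [U hU] := choice hz.
have pg : hcvg (fun n => (p n).1) g.
  by apply: hcvg_le pc => n; exact: prod_hn1 (p n - (g, h)).
have ph : hcvg (fun n => (p n).2) h.
  by apply: hcvg_le pc => n; exact: prod_hn2 (p n - (g, h)).
have hR n : Reg (u n) (z n) (U n) by have [] := hU n.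
have hRB n m : Reg (u n - u m) (z n - z m) (fun t => U n t - U m t).
  have := Reg_lin (-1) (hR m) (hR n); rewrite !scaleN1r ![- _ + _]addrC.
  by congr Reg; apply/funext => t; rewrite scaleN1r addrC.
have pgE n : (p n).1 = z n + mu *: u n by have [] := hU n.
have phE n : (p n).2 = U n 0 by have [] := hU n.
have uc : hcauchy u.
  (* By [energy_apriori], solutions whose data differ by less than [dl] are at squared distance at
     most [K * dl ^+ 2], and [e = (K + 1) * dl]. *)
  move=> e e0; pose K := mu^-1 * (1 + mu^-1); pose dl := e / (K + 1).
  have im0 : 0 < mu^-1 by rewrite invr_gt0.
  have K0 : 0 < K by rewrite mulr_gt0 // addr_gt0.
  have dl0 : 0 < dl by rewrite divr_gt0 // addr_gt0.
  have [N1 h1] := hcvg_cauchy pg dl0; have [N2 h2] := hcvg_cauchy ph dl0.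
  exists (maxn N1 N2) => n m; rewrite !geq_max => /andP[n1 n2] /andP[m1 m2].
  have := energy_apriori (Reg_energy (hRB n m)).
  have -> : z n - z m + mu *: (u n - u m) = (p n).1 - (p m).1.
    by rewrite !pgE scalerBr opprD addrACA.
  rewrite -!phE; have := h1 n m n1 m1; have := h2 n m n2 m2.
  have := hn_ge0 ((p n).1 - (p m).1); have := hn_ge0 ((p n).2 - (p m).2).
  set a1 := hn _; set a2 := hn _; set x := hn _ => q1 q2 r1 r2 hx.
  rewrite -ltr_sqr ?nnegrE ?hn_ge0 ?(ltW e0) //.
  have x2 : x ^+ 2 <= K * dl ^+ 2.
    have : x ^+ 2 <= mu^-1 * (a1 ^+ 2 + mu^-1 * a2 ^+ 2) by rewrite -ler_pdivrMl // invrK.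
    move=> /le_trans; apply; rewrite /K -mulrA ler_pM2l // mulrDl mul1r.
    apply: lerD; first by rewrite ler_sqr ?nnegrE ?(ltW dl0) ?(ltW r1).
    by rewrite ler_pM2l // ler_sqr ?nnegrE ?(ltW dl0) ?(ltW r2).
  apply: le_lt_trans x2 _.
  have -> : e = (K + 1) * dl by rewrite /dl mulrC divfK // gt_eqF // addr_gt0.
  have d2 : 0 < dl ^+ 2 by rewrite exprn_gt0.
  have k1 : 0 < K ^+ 2 + K + 1 by rewrite !addr_gt0 // exprn_gt0.
  by have := mulr_gt0 k1 d2; clearbody dl K; rewrite exprMn; lra.
have [ul hul] := L2_complete fD cV uc.
have zc : hcvg z (g - mu *: ul).
  have -> : z = fun n => (p n).1 - mu *: u n by apply/funext => n; rewrite pgE addrK.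
  by apply: hcvgB => //; exact: hcvgZ.
have U0c : hcvg (fun n => U n 0) h by move: ph; under eq_fun do rewrite phE.
have [V' [W1 W2 W3 W4]] := Wsol_lim (fun n => Reg_Wsol (hR n)) (fun n => Reg_cont (hR n))
   (fun n => Reg_energy (hR n)) (fun n m => Reg_energy (hRB n m)) hul zc U0c.
by exists ul, V'.
Qed.

(* The equation is integrated against a step function approximating [u]. *)
Lemma Wsol_uniq u z U : Wsol u z U -> hn (z + mu *: u) = 0 -> hn (U 0) = 0 -> hn u = 0.
Proof.
move=> [hW hae] hz hU0.
have TT : 0 <= T <= T by rewrite lexx ltW.
have [y [sy hy _]] := step_dense fD u.
have zE t w : t <= T -> pairT t z w = - mu * pairT t u w.
  move=> tT; have := pairT_hn0l w tT hz; rewrite addrC pairTL //.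
  by move=> /eqP; rewrite addrC addr_eq0 mulNr => /eqP.
have sT := sqrtr_ge0 T.
(* At almost every time [s] the inner product with [i (y n s)] is [- mu * pairT s u (cstX (y n s))].
   Replacing [u] by [y n] under [pairT] costs [hn (u - y n)]; what remains,
   [- mu * ip (Y s) (y n s)], has a nonpositive integral. *)
have key n : ip (iX u) (iX (y n)) <=
    mu * (Num.sqrt T * hn (u - y n) * (ip (y n) (y n) + fine (leb1 R D))).
  have [Y [hY mY _ _]] := primitive_ex T0 (sy n).
  have [q1 q2] := prim_quad (sy n) hY (bilin_ip V) TT.
  pose A := Num.sqrt T * hn (u - y n).
  have A0 : 0 <= A by rewrite mulr_ge0 ?hn_ge0.
  have i2 : itgT T (fun s => mu * (A * hn (val (y n) s) - ip (val (y n) s) (Y s))).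
    apply: itgZ => //; apply: itgB => //; apply: itgZ => //; exact: L2_hn_itg.
  rewrite L2ipE; apply: le_trans (_ : IntT T (fun s => mu * (A * hn (val (y n) s) - ip (val (y n) s) (Y s))) <= _).
    apply: Int_le_ae => //; first exact: L2_itg.
    apply: filterS hae => s hs Ds; have /IvP/andP[s0 sT'] := Ds.
    have ss : 0 <= s <= T by rewrite !ltW.
    rewrite /= -(hn_ipl_eq _ (hs Ds)) hW // (ip_hn0 _ hU0) add0r zE ?(ltW sT') //.
    rewrite mulNr -mulrN ler_pM2l //.
    have -> : pairT s u (cstX (val (y n) s)) =
        pairT s (u - y n) (cstX (val (y n) s)) + ip (Y s) (val (y n) s).
      rewrite (prim_pair (yX := y n) _ ss hY) //.
      have e : u = 1 *: (u - y n) + y n by rewrite scale1r subrK.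
      by rewrite {1}e pairTL ?(ltW sT') // mul1r.
    rewrite (ipC (Y s)) opprD lerD2r.
    apply: le_trans (ler_norm _) _; rewrite normrN.
    apply: le_trans (pairT_le _ _ (ltW sT')) _; rewrite cstX_hn /A.
    by rewrite mulrCA mulrA.
  rewrite IntZ //; last first.
    by apply: itgB => //; apply: itgZ => //; exact: L2_hn_itg.
  rewrite IntB //; last by apply: itgZ => //; exact: L2_hn_itg.
  rewrite ler_pM2l // IntZ //; last exact: L2_hn_itg.
  have pos : 0 <= IntT T (fun s => ip (val (y n) s) (Y s)).
    by have := ip_ge0 (Y T); rewrite q2; lra.
  apply: le_trans (_ : A * IntT T (fun s => hn (val (y n) s)) <= _); first by lra.
  rewrite ler_wpM2l //.
  by have := Int_hn_le fD (y n) ltr01; rewrite invr1 !mul1r.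
have l1 := hcvg_ip (hcvg_const (iX u)) (iX_hcvg hy).
have yu : cv (fun n => hn (u - y n)) 0 by apply: cv_squeeze0 hy => n; rewrite hn_ge0 hnBC /=.
have l2 := cvZ mu (cvM (cvZ (Num.sqrt T) yu) (cvD (hcvg_ip hy hy) (cvC (fine (leb1 R D))))).
rewrite mulr0 mul0r mulr0 in l2.
have h0 := cv_le key l1 l2.
apply: iX_inj; apply/eqP; rewrite -sqrf_eq0 hn_sq; apply/eqP; apply/le_anti.
by rewrite h0 ip_ge0.
Qed.

End Linear.

(** The linear equation with [mu = 1] and right-hand side [z + u] has a solution that satisfies the
    energy identity, and [Wsol_uniq] identifies it with [u]. Both conclusions thereby pass to an
    arbitrary solution. *)
Lemma Wsol_good u z U : Wsol u z U -> energy u z U /\ Hcont U.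
Proof.
move=> hW.
have [u' [U' [W1 E1 C1 h0]]] := linear_ex ltr01 (z + u) (U 0).
have hB := WsolB hW W1.
have dz : hn (z - (z + u - 1 *: u') + 1 *: (u - u')) = 0.
  by rewrite !scale1r -(addrA z u) opprD (addrA z (- z)) subrr sub0r addNr hn0.
have d0 : hn (U 0 - U' 0) = 0 by rewrite hnBC.
have du := Wsol_uniq ltr01 hB dz d0.
have dz' : hn (z - (z + u - 1 *: u')) = 0.
  by rewrite scale1r -(addrA z u) opprD (addrA z (- z)) subrr sub0r hnN.
have dU t : 0 <= t <= T -> hn (U t - U' t) = 0.
  move=> tT; apply: idense => v; have [hb _] := hB.
  by rewrite hb // (ip_hn0 _ d0) add0r pairT_hn0l // (andP tT).2.
have T00 : 0 <= (0 : R) <= T by apply/andP; split=> //; exact: ltW.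
split.
  move=> t tT; rewrite (hn_ip_eq (dU t tT)) (hn_ip_eq (dU 0 T00)) E1 //; congr (_ + _ * _).
  have tT' := (andP tT).2.
  apply/eqP; rewrite -subr_eq0; apply/eqP.
  have -> : pairT t (z + u - 1 *: u') u' - pairT t z u =
      - (pairT t (z - (z + u - 1 *: u')) u' + pairT t z (u - u')).
    by rewrite (pairTBl z _ _ tT') (pairTBr z _ _ tT'); ring.
  by rewrite pairT_hn0l // pairT_hn0r // addr0 oppr0.
move=> t tT e e0; have [dl dl0 hdl] := C1 t tT e e0; exists dl => // s sT hs.
apply: le_lt_trans (hn_triB _ (U' s) _) _; rewrite dU // add0r.
apply: le_lt_trans (hn_triB _ (U' t) _) _; rewrite (hnBC (U' t)) dU // addr0.
exact: hdl.
Qed.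

Lemma Wsol_limit (u_ z_ : nat -> X) (U_ : nat -> R -> H) u z h :
  (forall n, Wsol (u_ n) (z_ n) (U_ n)) ->
  hcvg u_ u -> hcvg z_ z -> hcvg (fun n => U_ n 0) h ->
  exists U, Wsol u z U /\ hn (U 0 - h) = 0.
Proof.
move=> hW hu hz hh.
have [U [W1 _ _ W2]] := Wsol_lim hW (fun n => (Wsol_good (hW n)).2)
  (fun n => (Wsol_good (hW n)).1) (fun n m => (Wsol_good (WsolB (hW n) (hW m))).1) hu hz hh.
by exists U.
Qed.

Lemma Wsol_eq u z z' U : Wsol u z U -> hn (z - z') = 0 -> Wsol u z' U.
Proof.
move=> [h1 h2] hz; split=> // t tT w; rewrite h1 //; congr (_ + _).
apply/eqP; rewrite -subr_eq0 -pairTBl ?(andP tT).2 //; apply/eqP.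
by apply: pairT_hn0l => //; exact: (andP tT).2.
Qed.

(** * Strongly monotone Lipschitz operators *)

Section Nonlinear.
Variables (G : X -> X) (al L : R).
Hypothesis al0 : 0 < al.
Hypothesis Gmon : forall u v, al * hn (u - v) ^+ 2 <= ip (G u - G v) (u - v).
Hypothesis Glip : forall u v, hn (G u - G v) <= L * hn (u - v).

(* Contraction [w -> u], [(i u)' + mu u = mu w - G w], for large [mu]. *)
Lemma nonlinear_ex (h : H) : exists u U, Wsol u (- G u) U /\ hn (U 0 - h) = 0.
Proof.
have L1 : 0 < L ^+ 2 + 1 by rewrite ltr_pwDr ?sqr_ge0.
(* The squared contraction factor is [(mu^2 - 2 mu al + L^2) / mu^2]; for this [mu] it is at most
   [1 - al^2 / (L^2 + 1)]. Adding [1] keeps [mu] positive when [L = 0]. *)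
pose mu := (L ^+ 2 + 1) / al.
have mu0 : 0 < mu by rewrite divr_gt0.
have [S hS] := choice (fun w => linear_ex mu0 (mu *: w - G w) h).
have [US hUS] := choice hS.
pose q2 := 1 - al ^+ 2 / (L ^+ 2 + 1).
have q21 : q2 < 1 by rewrite /q2 ltrBlDr ltrDl divr_gt0 // exprn_gt0.
have step w w' : hn (S w - S w') ^+ 2 <= q2 * hn (w - w') ^+ 2.
  have [W1 _ _ h1] := hUS w; have [W2 _ _ h2] := hUS w'.
  have [hE _] := Wsol_good (WsolB W1 W2).
  have TT : 0 <= T <= T by rewrite lexx ltW.
  have := hE T TT; rewrite pairT_T.
  have h0 : hn (US w 0 - US w' 0) = 0.
    apply/eqP; rewrite eq_le hn_ge0 andbT; apply: le_trans (hn_triB _ h _) _.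
    by rewrite h1 hnBC h2 addr0.
  rewrite -[ip (US w 0 - _) _]hn_sq h0 expr0n add0r.
  set x := S w - S w'; set dw := w - w'; set dG := G w - G w'.
  have -> : mu *: w - G w - mu *: S w - (mu *: w' - G w' - mu *: S w') =
      (mu *: dw - dG) - mu *: x.
    by rewrite !scalerBr subr3.
  rewrite [ip (_ - mu *: x) x]ipBl [ip (mu *: x) x]ipZl => hE'.
  have hx : mu * hn x ^+ 2 <= hn (mu *: dw - dG) * hn x.
    rewrite hn_sq; apply: le_trans (ip_le _ _).
    by have := ip_ge0 (US w T - US w' T); rewrite hE'; lra.
  have hx2 : mu * hn x <= hn (mu *: dw - dG).
    have := hn_ge0 x; rewrite le_eqVlt => /orP[/eqP <-|x0]; first by rewrite mulr0 hn_ge0.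
    by rewrite -(ler_pM2r x0) -mulrA -expr2.
  have hd : hn (mu *: dw - dG) ^+ 2 <= (mu ^+ 2 - 2 * mu * al + L ^+ 2) * hn dw ^+ 2.
    rewrite hn_sq ip_sqB !ipZl !ipZr -!hn_sq (ipC dw).
    have := Gmon w w'; have := Glip w w'; rewrite -/dw -/dG.
    have := hn_ge0 dG; have := hn_ge0 dw => d0 g0 hl hm.
    have : hn dG ^+ 2 <= L ^+ 2 * hn dw ^+ 2 by rewrite -exprMn ler_sqr ?nnegrE //; exact: le_trans hl.
    have : mu * (al * hn dw ^+ 2) <= mu * ip dG dw by rewrite ler_pM2l.
    by lra.
  have : (mu * hn x) ^+ 2 <= hn (mu *: dw - dG) ^+ 2.
    by rewrite ler_sqr ?nnegrE ?hn_ge0 // mulr_ge0 ?hn_ge0 ?ltW.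
  move=> /le_trans /(_ hd); rewrite exprMn -ler_pdivlMl ?exprn_gt0 // mulrA => /le_trans; apply.
  rewrite ler_wpM2r ?sqr_ge0 //.
  rewrite ler_pdivrMl ?exprn_gt0 // /q2 mulrBr mulr1.
  have -> : mu ^+ 2 * (al ^+ 2 / (L ^+ 2 + 1)) = L ^+ 2 + 1 by rewrite /mu; field; rewrite !gt_eqF.
  have -> : 2 * mu * al = 2 * (L ^+ 2 + 1) by rewrite /mu; field; rewrite gt_eqF.
  by lra.
(* The sign of [q2] is not known, hence the maximum under the square root. *)
pose q := Num.sqrt (Num.max 0 q2).
have q0 : 0 <= q by exact: sqrtr_ge0.
have qle : q2 <= q ^+ 2 by rewrite sqr_sqrtr ?le_max ?lexx ?orbT.
have q1 : q < 1.
  by rewrite -sqrtr1 /q ltr_sqrt // gt_max ltr01.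
have stepq w w' : hn (S w - S w') <= q * hn (w - w').
  rewrite -ler_sqr ?nnegrE ?hn_ge0 ?mulr_ge0 ?hn_ge0 // exprMn.
  by apply: le_trans (step w w') _; rewrite ler_wpM2r ?sqr_ge0.
pose u_ n := iter n S 0.
have dn n : hn (u_ n.+1 - u_ n) <= q ^+ n * hn (u_ 1%N - u_ 0%N).
  elim: n => [|n IH]; first by rewrite expr0 mul1r.
  by apply: le_trans (stepq _ _) _; rewrite exprS -mulrA ler_wpM2l.
have uc : hcauchy u_.
  apply: (@bounded_series_hcauchy _ _ _ (hn (u_ 1%N - u_ 0%N) / (1 - q))) => n.
  apply: (@le_trans _ _ (\sum_(k < n) q ^+ k * hn (u_ 1%N - u_ 0%N))).
    by apply: ler_sum => k _; exact: dn.
  rewrite -mulr_suml mulrC ler_wpM2l ?hn_ge0 //.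
  have -> : \sum_(k < n) q ^+ k = (1 - q ^+ n) / (1 - q).
    have q1' : 1 - q != 0 by rewrite subr_eq0 gt_eqF.
    elim: n => [|n IH]; first by rewrite big_ord0 expr0 subrr mul0r.
    by rewrite big_ord_recr /= IH exprS; field.
  rewrite -[X in _ <= X]mul1r ler_wpM2r ?invr_ge0 ?subr_ge0 ?(ltW q1) //.
  by rewrite lerBlDr lerDl exprn_ge0.
have [u hu] := L2_complete fD cV uc.
have Su : hn (S u - u) = 0.
  have h1 : hcvg (fun n => u_ n.+1) u by apply: (hcvg_sub (f := succn)) hu => n.
  have h2 : hcvg (fun n => u_ n.+1) (S u).
    have := cvZ q hu; rewrite mulr0; apply: hcvg_le => n; exact: stepq.
  exact: hcvg_uniq h2 h1.
have [W1 _ _ h1] := hUS u; exists (S u), (US u); split=> //.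
apply: (Wsol_eq W1).
have -> : mu *: u - G u - mu *: S u - - G (S u) = (G (S u) - G u) - mu *: (S u - u).
  by rewrite scalerBr opprB opprK addrC [mu *: u - _]addrC -!addrA.
apply/eqP; rewrite eq_le hn_ge0 andbT; apply: le_trans (hnB_le _ _) _.
by rewrite hnZ Su mulr0 addr0; apply: le_trans (Glip _ _) _; rewrite Su mulr0.
Qed.

End Nonlinear.

End Evolution.

(** * Test functions on the plane *)

Section IsCk.
Variables (R : realType) (E : normedModType R).
Implicit Types f g : E -> R.

Lemma Ck_cont k f : is_Ck k f -> continuous f.
Proof. by case: k => [|k] []. Qed.

Lemma CkS k f : is_Ck k.+1 f -> is_Ck k f.
Proof.
elim: k f => [|k IH] f [cf hf]; first by split.
split=> // v; have [d1 h1] := hf v; split=> //; exact: IH.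
Qed.

Lemma Ck_derivable k f x v : is_Ck k.+1 f -> derivable f x v.
Proof. by move=> [_ /(_ v) [h _]]; exact: h. Qed.

Lemma Ck_derive k f v : is_Ck k.+1 f -> is_Ck k (fun x => 'D_v f x).
Proof. by move=> [_ /(_ v) [_ h]]. Qed.

Lemma Ck_cst k (c : R) : is_Ck k (fun _ : E => c).
Proof.
elim: k c => [|k IH] c; first by split=> // x; exact: cvg_cst.
split=> [x|v]; first exact: cvg_cst.
split=> [x|]; first exact: derivable_cst.
have -> : (fun x => 'D_v (fun _ : E => c) x) = (fun=> 0).
  by apply/funext => x; exact: derive_cst.
exact: IH.
Qed.

Lemma CkD k f g : is_Ck k f -> is_Ck k g -> is_Ck k (fun x => f x + g x).
Proof.
elim: k f g => [|k IH] f g [cf hf] [cg hg].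
  by split=> // x; apply: cvgD; [exact: cf|exact: cg].
split=> [x|v]; first by apply: cvgD; [exact: cf|exact: cg].
have [df hf'] := hf v; have [dg hg'] := hg v; split=> [x|]; first exact: derivableD.
have -> : (fun x => 'D_v (fun x => f x + g x) x) = (fun x => 'D_v f x + 'D_v g x).
  by apply/funext => x; exact: deriveD.
exact: IH.
Qed.

Lemma CkM k f g : is_Ck k f -> is_Ck k g -> is_Ck k (fun x => f x * g x).
Proof.
elim: k f g => [|k IH] f g Ff Fg; have cf := Ck_cont Ff; have cg := Ck_cont Fg.
  by split=> // x; apply: cvgM; [exact: cf|exact: cg].
split=> [x|v]; first by apply: cvgM; [exact: cf|exact: cg].
split=> [x|]; first by apply: derivableM; exact: (Ck_derivable (k := k)).
have -> : (fun x => 'D_v (fun x => f x * g x) x) =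
    (fun x => f x * 'D_v g x + g x * 'D_v f x).
  apply/funext => x.
  by apply: deriveM; exact: (Ck_derivable (k := k)).
by apply: CkD; apply: IH; [exact: CkS|exact: Ck_derive|exact: CkS|exact: Ck_derive].
Qed.

Lemma CkZ k (c : R) f : is_Ck k f -> is_Ck k (fun x => c * f x).
Proof. by move=> hf; apply: CkM => //; exact: Ck_cst. Qed.

End IsCk.

Section Pullback.
Variables (R : realType) (E F : normedModType R) (L l : E -> F).
Hypothesis cL : continuous L.
Hypothesis hL : forall (h : R) v x, L (h *: v + x) = h *: l v + L x.

(** By [hL] the map [L] is affine with linear part [l], so the difference quotients of [f \o L]
    along [v] are literally those of [f] along [l v]. This serves dilations, coordinates and lines
    alike. *)
Lemma pull_derive (f : F -> R) v x : 'D_v (fun y => f (L y)) x = 'D_(l v) f (L x).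
Proof.
rewrite /derive; have -> // : (fun h : R => h^-1 *: ((f \o shift (L x)) (h *: l v) - f (L x))) =
  (fun h => h^-1 *: (((fun y : E => f (L y)) \o shift x) (h *: v) - f (L x))).
by apply/funext => h /=; rewrite hL.
Qed.

Lemma pull_derivable (f : F -> R) v x : derivable f (L x) (l v) ->
  derivable (fun y => f (L y)) x v.
Proof.
rewrite /derivable => hf; move: hf; have -> // : (fun h : R => h^-1 *: ((f \o shift (L x)) (h *: l v) - f (L x))) =
  (fun h => h^-1 *: (((fun y : E => f (L y)) \o shift x) (h *: v) - f (L x))).
by apply/funext => h /=; rewrite hL.
Qed.

Lemma Ck_pull k (f : F -> R) : is_Ck k f -> is_Ck k (fun y => f (L y)).
Proof.
elim: k f => [|k IH] f Ff; have cf := Ck_cont Ff.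
  split=> // x.
  by apply: continuous_comp; [exact: cL|exact: cf].
split=> [x|v]; first by apply: continuous_comp; [exact: cL|exact: cf].
split=> [x|]; first by apply: pull_derivable; exact: (Ck_derivable (k := k)).
have -> : (fun x => 'D_v (fun y => f (L y)) x) = (fun x => 'D_(l v) f (L x)).
  by apply/funext => x; exact: pull_derive.
by apply: (IH (fun y => 'D_(l v) f y)); exact: Ck_derive.
Qed.

End Pullback.

(** * Smooth bump functions *)

Section Flat.
Variable R : realType.

(** The family of functions [p (1 / x) exp (- 1 / x)] is closed under differentiation, with
    [flat_next p] as the new polynomial; smoothness follows by induction over all [p] at once. *)
Definition flat (p : {poly R}) (x : R) : R :=
  if 0 < x then p.[x^-1] * expR (- x^-1) else 0.

Lemma poly_expR_bound (p : {poly R}) : exists2 C : R, 0 <= C &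
  forall y, 0 <= y -> `|p.[y]| <= C * expR y.
Proof.
exists (\sum_(i < size p) `|p`_i| * i`!%:R).
  by apply: sumr_ge0 => i _; rewrite mulr_ge0.
move=> y y0; rewrite horner_coef mulr_suml; apply: le_trans (ler_norm_sum _ _ _) _.
apply: ler_sum => i _; rewrite normrM -mulrA ler_wpM2l // normrX ger0_norm //.
case: (nat_of_ord i) => [|n].
  by rewrite expr0 fact0 mul1r -expR0 ler_expR.
have f0 : 0 < n.+1`!%:R :> R by rewrite ltr0n fact_gt0.
have := expR_ge1Dxn n y0; rewrite -ler_pdivrMl // mulrC => h.
by apply: le_trans h; rewrite mulrC lerDr.
Qed.

(** With [y = 1 / x] this says that [y ^+ 2 * p y] is bounded by a multiple of [exp y]. Quadratic
    order at [0] is what makes the difference quotient there vanish. *)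
Lemma flat_bound p : exists2 C : R, 0 <= C & forall x, `|flat p x| <= C * x ^+ 2.
Proof.
have [C C0 hC] := poly_expR_bound ('X^2 * p).
exists C => // x; rewrite /flat; case: ltP => x0; last first.
  by rewrite normr0 mulr_ge0 ?sqr_ge0.
have y0 : 0 <= x^-1 by rewrite invr_ge0 ltW.
have := hC _ y0; rewrite hornerM hornerXn !normrM -expr2 [`|expR _|]ger0_norm ?expR_ge0 //.
rewrite [`|x^-1|]ger0_norm // expRN => h.
have x2 : 0 < x ^+ 2 by rewrite exprn_gt0.
rewrite ler_pdivrMr ?expR_gt0 // mulrAC -ler_pdivrMr //.
by apply: le_trans h; rewrite exprVn mulrC.
Qed.

Definition flat_next (p : {poly R}) : {poly R} := 'X^2 * (p - p^`()).

Lemma flat_is_derive p (x : R) : is_derive x 1 (flat p) (flat (flat_next p) x).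
Proof.
have [x0|x0|x0] := ltgtP 0 x; last subst x.
- have nx : \forall y \near x, (fun y => p.[y^-1] * expR (- y^-1)) y = flat p y.
    near=> y; rewrite /flat; case: ltP => // y0; exfalso.
    suff : 0 < y by rewrite ltNge y0.
    by near: y; exact: lt_nbhsr.
  apply: near_eq_is_derive nx _.
  have xn0 : x != 0 by rewrite gt_eqF.
  have d1 : is_derive x 1 (fun y : R => y^-1) (- x ^- 2).
    by have := @is_deriveV R id x 1 1 xn0 (is_derive_id x 1); rewrite /GRing.scale /= mulr1.
  have d2 : is_derive x 1 (fun y => p.[y^-1]) (p^`().[x^-1] * (- x ^- 2)).
    by have := is_derive1_comp (is_derive_poly p x^-1) d1.
  have d3 : is_derive x 1 (fun y => expR (- y^-1)) (expR (- x^-1) * x ^- 2).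
    have d4 : is_derive x 1 (fun y : R => - y^-1) (x ^- 2).
      by rewrite -[x ^- 2]opprK; exact: is_deriveN.
    by have := @is_derive1_comp R expR (fun y => - y^-1) x _ _ (is_derive_expR (- x^-1)) d4.
  have h := is_deriveM d2 d3; have e : forall a b : R, a = b -> is_derive x 1 (fun y : R => p.[y^-1] * expR (- y^-1)) a ->
    is_derive x 1 (fun y : R => p.[y^-1] * expR (- y^-1)) b by move=> a b ->.
  apply: e h.
  rewrite /flat x0 /flat_next hornerM hornerXn hornerD hornerN /=.
  rewrite /GRing.scale /= -exprVn; ring.
- have nx : \forall y \near x, cst 0 y = flat p y.
    near=> y; rewrite /flat; case: ltP => // y0; exfalso.
    suff : y < 0 by rewrite ltNge (ltW y0).
    by near: y; exact: lt_nbhsl.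
  apply: near_eq_is_derive nx _.
  by rewrite /flat ltNge (ltW x0) /=; exact: is_derive_cst.
have [C C0 hC] := flat_bound p.
have f0 : flat p 0 = 0 by rewrite /flat ltxx.
have f0' : flat (flat_next p) 0 = 0 by rewrite /flat ltxx.
rewrite f0'.
have lim0 : (fun h : R => h^-1 *: ((flat p \o shift 0) (h *: 1) - flat p 0)) @ 0^' --> (0 : R).
  apply/cvgr0Pnorm_le => e e0; near=> h.
  rewrite /= addr0 f0 subr0 [_ *: 1]mulr1 normrZ normfV.
  have hn0 : h != 0 by near: h; exact: nbhs_dnbhs_neq.
  rewrite ler_pdivrMl ?normr_gt0 //; apply: le_trans (hC h) _.
  rewrite -[h ^+ 2]real_normK ?num_real // expr2 mulrA [X in X <= _]mulrC ler_wpM2l //.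
  have : `|h| <= e / (C + 1).
    by near: h; apply: dnbhs0_le; rewrite divr_gt0 // ltr_pwDr.
  rewrite ler_pdivlMr ?ltr_pwDr // mulrDr mulr1 mulrC => h1; apply: le_trans h1.
  by rewrite lerDl.
apply: DeriveDef; first by apply/cvg_ex; exists 0.
exact/cvg_lim.
Unshelve. all: by end_near. Qed.

Lemma is_derive_dir (f : R -> R) (x v df : R) : is_derive x 1 f df -> is_derive x v f (v * df).
Proof.
move=> [d1 <-]; have df1 : differentiable f x by apply/derivable1_diffP.
apply: DeriveDef; first exact: diff_derivable.
by rewrite deriveE // deriv1E // derive1E.
Qed.

Lemma Ck_step (k : nat) (f f' : R -> R) : (forall x : R, is_derive x 1 f (f' x)) ->
  is_Ck k f' -> is_Ck k.+1 f.
Proof.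
move=> hf hf'.
have cf : continuous f.
  move=> x; apply: differentiable_continuous; apply/derivable1_diffP.
  by have [] := hf x.
split=> // v; split=> [x|]; first by have [] := is_derive_dir v (hf x).
have -> : (fun x => 'D_v f x) = (fun x => v * f' x); last exact: CkZ.
by apply/funext => x; have [_ ->] := is_derive_dir v (hf x).
Qed.

Lemma flat_Ck k p : is_Ck k (flat p).
Proof.
elim: k p => [|k IH] p; last exact: Ck_step (flat_is_derive p) (IH _).
split=> // x; apply: differentiable_continuous; apply/derivable1_diffP.
by have [] := flat_is_derive p x.
Qed.

(** Vanishes outside []a, b[]; the dilation by [n.+1] makes the edges steeper, so that the bumps
    converge pointwise to the indicator of []a, b[] while staying in [[0, 1]]. Indicators are thus
    reached from test functions by dominated convergence. *)
Definition ebump (n : nat) (a b x : R) : R :=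
  flat 1 (n.+1%:R * (x - a)) * flat 1 (n.+1%:R * (b - x)).

Lemma ebump_Ck k n a b : is_Ck k (ebump n a b).
Proof.
apply: CkM.
  apply: (@Ck_pull R R R (fun x => n.+1%:R * (x - a)) (fun x => n.+1%:R * x)) (flat_Ck k 1).
    by move=> x; apply: cvgM; [exact: cvg_cst|apply: cvgB => //; exact: cvg_cst].
  by move=> h v x; rewrite /GRing.scale /=; ring.
apply: (@Ck_pull R R R (fun x => n.+1%:R * (b - x)) (fun x => - (n.+1%:R * x))) (flat_Ck k 1).
  by move=> x; apply: cvgM; [exact: cvg_cst|apply: cvgB => //; exact: cvg_cst].
by move=> h v x; rewrite /GRing.scale /=; ring.
Qed.

Lemma flat1_ge0 x : 0 <= flat 1 x.
Proof. by rewrite /flat; case: ltP => // _; rewrite hornerC mul1r expR_ge0. Qed.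

Lemma flat1_le1 x : flat 1 x <= 1.
Proof.
rewrite /flat; case: ltP => // x0; rewrite hornerC mul1r -expR0 ler_expR oppr_le0.
by rewrite invr_ge0 ltW.
Qed.

Lemma ebump_ge0 n a b x : 0 <= ebump n a b x.
Proof. by rewrite mulr_ge0 // flat1_ge0. Qed.

Lemma ebump_le1 n a b x : ebump n a b x <= 1.
Proof. by rewrite mulr_ile1 // ?flat1_ge0 ?flat1_le1. Qed.

Lemma ebump_out n a b x : ~~ (a < x < b) -> ebump n a b x = 0.
Proof.
rewrite negb_and -!leNgt /ebump => /orP[h|h].
  by rewrite {1}/flat pmulr_rgt0 // subr_gt0 ltNge h /= mul0r.
by rewrite [X in _ * X]/flat pmulr_rgt0 // subr_gt0 ltNge h /= mulr0.
Qed.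

Lemma flat1_cv y : 0 < y -> cv (fun n => flat 1 (n.+1%:R * y)) 1.
Proof.
move=> y0.
have h := cvN (cvZ y^-1 (@cv_harmonic R)); rewrite mulr0 oppr0 in h.
have -> : (fun n => flat 1 (n.+1%:R * y)) = (fun n => expR (- (y^-1 * n.+1%:R^-1))).
  by apply/funext => n; rewrite /flat pmulr_rgt0 // y0 hornerC mul1r invfM mulrC.
by have := @continuous_cvg nat R R \oo _ _ expR 0 (@continuous_expR R 0) (cv_cvg h); rewrite expR0 => h'; apply: Cv; exact: h'.
Qed.

Lemma ebump_cv a b x : cv (fun n => ebump n a b x) (a < x < b)%R%:R.
Proof.
case: (boolP (a < x < b)) => h; last first.
  by under eq_fun do rewrite ebump_out //; exact: cvC.
have /andP[ax xb] := h.
by rewrite -[X in cv _ X](mulr1 1); apply: cvM; apply: flat1_cv; rewrite subr_gt0.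
Qed.

Lemma ebump_test n a b (A : set R) : `[a, b]%classic `<=` A -> test_fun A (ebump n a b).
Proof.
move=> sub; split; first by move=> k; exact: ebump_Ck.
exists `[a, b]%classic; split=> //; first exact: segment_compact.
move=> x /= hx; apply: ebump_out; apply/negP => /andP[ax xb]; apply: hx.
by rewrite in_itv /= !ltW.
Qed.

Lemma ebump_meas n a b : measurable_fun setT (ebump n a b : measurableTypeR R -> measurableTypeR R).
Proof. by apply: continuous_measurable_fun; exact: Ck_cont (ebump_Ck 0 n a b). Qed.

Definition ebump2 (n : nat) (a b c d : R) (z : plane R) : R :=
  ebump n a b z.1 * ebump n c d z.2.

Lemma ebump2_test n a b c d (A : set (plane R)) :
  (`[a, b]%classic `*` `[c, d]%classic `<=` A) -> test_fun A (ebump2 n a b c d).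
Proof.
move=> sub; split.
  move=> k; apply: CkM.
    apply: (@Ck_pull R (plane R) R fst fst) (ebump_Ck k n a b) => //.
    by move=> z; exact: cvg_fst.
  apply: (@Ck_pull R (plane R) R snd snd) (ebump_Ck k n c d) => //.
  by move=> z; exact: cvg_snd.
exists (`[a, b]%classic `*` `[c, d]%classic); split=> //.
  by apply: compact_setX; exact: segment_compact.
move=> [x y] /= hx; rewrite /ebump2 /=.
have [h1|h1] := boolP (a < x < b); last by rewrite ebump_out ?mul0r.
have [h2|h2] := boolP (c < y < d); last by rewrite (ebump_out _ h2) mulr0.
by exfalso; apply: hx; move/andP: h1 => [? ?]; move/andP: h2 => [? ?]; split; rewrite /= in_itv /= !ltW.
Qed.

End Flat.

Section TestGeneric.
Variables (R : realType) (E : normedModType R) (Om : set E).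
Implicit Types phi : E -> R.

Lemma test_out phi z : test_fun Om phi -> ~ Om z -> phi z = 0.
Proof. by move=> [_ [K [_ sub h]]] nO; apply: h => /sub. Qed.

Lemma test_cont phi : test_fun Om phi -> continuous phi.
Proof. by move=> [/(_ 0%N) h _]; exact: Ck_cont h. Qed.

Lemma test_bounded phi : test_fun Om phi -> exists2 C : R, 0 <= C & forall z, `|phi z| <= C.
Proof.
move=> h; have cp := test_cont h; have [_ [K [cK _ hK]]] := h.
have /compact_bounded : compact (phi @` K) by apply: continuous_compact => //; exact: continuous_subspaceT.
move=> /pinfty_ex_gt0[C C0 hC]; exists C; first exact: ltW.
move=> z; have [Kz|nK] := pselect (K z); last by rewrite hK // normr0 ltW.
by apply: hC; exists z.
Qed.

Lemma test_derive phi v : test_fun Om phi -> test_fun Om (fun z => 'D_v phi z).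
Proof.
move=> [h [K [cK sub hK]]]; split; first by move=> k; exact: Ck_derive (h k.+1).
exists K; split=> // z nK.
have oK : open (~` K) by apply: closed_openC; apply: compact_closed => //; exact: norm_hausdorff.
have nz : \forall y \near z, cst 0 y = phi y.
  by apply: filterS (open_nbhs_nbhs (conj oK nK)) => y ny; rewrite hK.
by have [_ ->] := near_eq_is_derive nz (is_derive_cst 0 z v).
Qed.

End TestGeneric.

Lemma Int_CS d (S : measurableType d) (R : realType) (nu : {measure set S -> \bar R})
    (D : set S) (f g : S -> R) : measurable D -> measurable_fun D f -> measurable_fun D g ->
  itg nu D (fun x => f x ^+ 2) -> itg nu D (fun x => g x ^+ 2) ->
  itg nu D (fun x => f x * g x) /\
  `|Rintegral nu D (fun x => f x * g x)| <=
    Num.sqrt (Rintegral nu D (fun x => f x ^+ 2)) * Num.sqrt (Rintegral nu D (fun x => g x ^+ 2)).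
Proof.
move=> mD mf mg hf hg.
have hfg : itg nu D (fun x => f x * g x).
  apply: (itg_le mD (g := fun x => f x ^+ 2 + g x ^+ 2) _ (itgD mD hf hg)).
    exact: measurable_funM.
  move=> x _; rewrite normrM -[f x ^+ 2]real_normK ?num_real // -[g x ^+ 2]real_normK ?num_real //.
  by move: `|f x| `|g x| (normr_ge0 (f x)) (normr_ge0 (g x)) => a b a0 b0; nra.
split=> //.
have f0 : 0 <= Rintegral nu D (fun x => f x ^+ 2) by apply: Int_ge0 => // x _; exact: sqr_ge0.
have g0 : 0 <= Rintegral nu D (fun x => g x ^+ 2) by apply: Int_ge0 => // x _; exact: sqr_ge0.
rewrite -sqrtrM // -[X in X <= _]ger0_norm // -sqrtr_sqr ler_sqrt ?mulr_ge0 // real_normK ?num_real //.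
apply: quad_discr => // t.
have -> : Rintegral nu D (fun x => f x ^+ 2) * t ^+ 2 + 2 * Rintegral nu D (fun x => f x * g x) * t +
    Rintegral nu D (fun x => g x ^+ 2) = Rintegral nu D (fun x => (t * f x + g x) ^+ 2).
  rewrite [RHS](@Int_eq _ _ _ _ _ _ (fun x => t ^+ 2 * f x ^+ 2 + (2 * t) * (f x * g x) + g x ^+ 2)); last first.
    by move=> x _; move: (f x) (g x) => a b; ring.
  rewrite !(IntD mD) ?(IntZ mD) //; try exact: itgZ; last first.
  - by apply: (itgD mD); exact: itgZ.
  by ring.
by apply: Int_ge0 => // x _; exact: sqr_ge0.
Qed.

(** * The fundamental lemma of the calculus of variations *)

Section Dynkin.
Context d (S : measurableType d) (R : realType) (nu : {measure set S -> \bar R}).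
Variables (D : set S) (mD : measurable D) (g : S -> R).
Hypothesis ig : itg nu D g.
Local Notation Int f := (Rintegral nu D f).

Lemma itg_indic d' (T : measurableType d') (h : S -> T) (B : set T) :
  measurable_fun D h -> measurable B -> itg nu D (fun x => \1_B (h x) * g x).
Proof.
move=> mh mB; apply: (itg_le mD _ (itg_abs ig)).
  apply: measurable_funM; last exact: itg_meas ig.
  by apply: measurableT_comp (mh); exact: measurable_indic.
move=> x _; rewrite normrM ler_piMl // indicE.
by case: (_ \in _); rewrite ?normr1 ?normr0.
Qed.

(** The sets whose preimage under [h] has no mass for the signed measure of density [g] form a
    Dynkin system; the vanishing total integral gives stability under complements, dominated
    convergence that under disjoint unions. *)
Lemma Int_dynkin d' (T : measurableType d') (G : set (set T)) (h : S -> T) :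
  measurable_fun D h -> @measurable _ T = <<s G >> -> setI_closed G -> Int g = 0 ->
  (forall A, G A -> Int (fun x => \1_A (h x) * g x) = 0) ->
  forall A, measurable A -> Int (fun x => \1_A (h x) * g x) = 0.
Proof.
move=> mh EG IG g0 hG A; rewrite EG; move: A.
have ib (B : set T) : measurable B -> itg nu D (fun x => \1_B (h x) * g x).
  exact: itg_indic.
apply: (dynkin_induction (G := G)) => //.
- by rewrite -[RHS]g0; apply: Int_eq => x _; rewrite indicT mul1r.
- move=> B mB hB.
  rewrite (@Int_eq _ _ _ _ _ _ (fun x => g x - \1_B (h x) * g x)); last first.
    by move=> x _; rewrite !indicE in_setC; case: (_ \in _); rewrite /= ?mul0r ?mul1r ?subrr ?subr0.
  by rewrite IntB // ?hB ?g0 ?subrr //; exact: ib.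
- move=> F mF tF hF.
  pose s n x := \sum_(k < n) \1_(F k) (h x) * g x.
  (* [N] is one plus the index of the only [F k] containing [y], and [0] if there is none; the
     partial sum at [n] is [1] exactly when [0 < N <= n]. *)
  have sE y : exists2 N : nat, (N = 0 -> \1_(\bigcup_k F k) y = 0 :> R) /\
      ((0 < N)%N -> \1_(\bigcup_k F k) y = 1 :> R) &
      forall n, \sum_(k < n) \1_(F k) y = ((0 < N <= n)%N)%:R :> R.
    have [[k _ Fk]|nF] := pselect ((\bigcup_k F k) y).
      have jk j : F j y -> j = k by move=> Fj; apply: tF => //; exists y.
      exists k.+1; first by split=> // _; rewrite indicE mem_set //; exists k.
      move=> n; rewrite /=; have [kn|kn] := ltnP k n.
        rewrite (bigD1 (Ordinal kn)) //= indicE mem_set // big1 ?addr0 // => j jn.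
        rewrite indicE memNset // => /jk e; move: jn; rewrite -val_eqE /= e eqxx.
        by [].
      rewrite big1 // => j _; rewrite indicE memNset // => /jk e.
      by move: (ltn_ord j); rewrite e ltnNge kn.
    exists 0%N; first by split=> // _; rewrite indicE memNset.
    move=> n; rewrite big1 // => j _; rewrite indicE memNset // => Fj; apply: nF; by exists j.
  have [_ hc] : itg nu D (fun x => \1_(\bigcup_k F k) (h x) * g x) /\
      cv (fun n => Int (s n)) (Int (fun x => \1_(\bigcup_k F k) (h x) * g x)).
    apply: (Int_dct mD _ (itg_abs ig)).
    - move=> n; apply: (@itg_meas _ _ _ nu); apply: itg_sum => // k; exact: ib (mF k).
    - move=> n x _; rewrite /s -mulr_suml; have [N _ ->] := sE (h x).
      by case: (_ && _); rewrite ?mul1r // mul0r normr0.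
    - move=> x _; rewrite /s; have [N [h1 h2] hN] := sE (h x).
      under eq_fun do rewrite -mulr_suml hN; apply: cvM; last exact: cvC.
      apply/cvP => e e0; exists N => n Nn; case: N h1 h2 hN Nn => [|N] h1 h2 _ Nn.
        by rewrite h1 //= subrr normr0.
      by rewrite h2 //= Nn subrr normr0.
  apply: cv_uniq hc _.
  have -> : (fun n => Int (s n)) = (fun=> 0); last exact: cvC.
  apply/funext => n; rewrite Int_sum //; last by move=> k; exact: ib.
  by rewrite big1.
Qed.

End Dynkin.

Section PlaneSets.
Variable R : realType.

Definition qrect (q : (rat * rat) * (rat * rat)) : set (plane R) :=
  `]ratr q.1.1, ratr q.1.2[%classic `*` `]ratr q.2.1, ratr q.2.2[%classic.

Definition qcrect (q : (rat * rat) * (rat * rat)) : set (plane R) :=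
  `[ratr q.1.1, ratr q.1.2]%classic `*` `[ratr q.2.1, ratr q.2.2]%classic.

Lemma mqrect q : measurable (qrect q).
Proof. by apply: measurableX; exact: measurable_itv. Qed.

Lemma open_qrect (Om : set (plane R)) z : open Om -> Om z ->
  exists q, qrect q z /\ qcrect q `<=` Om.
Proof.
move=> oO Oz; have [[A B] /= [nA nB] sub] := open_nbhs_nbhs (conj oO Oz).
have key (y : R) (C : set R) : nbhs y C -> exists q : rat * rat,
    (`]ratr q.1, ratr q.2[%classic : set R) y /\ `[ratr q.1, ratr q.2]%classic `<=` C.
  move=> /nbhs_ballP[e /= e0 he].
  have [a] : exists q : rat, ratr q \in `]y - e, y[ by apply: rat_in_itvoo; lra.
  have [b] : exists q : rat, ratr q \in `]y, y + e[ by apply: rat_in_itvoo; lra.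
  rewrite !in_itv /= => /andP[b1 b2] /andP[a1 a2]; exists (a, b); split; first by rewrite /= in_itv /= a2.
  move=> x /=; rewrite in_itv /= => /andP[x1 x2]; apply: he; rewrite /ball /= ltr_norml; lra.
have [q1 [h1 s1]] := key _ _ nA; have [q2 [h2 s2]] := key _ _ nB.
exists (q1, q2); split; first by split.
by move=> x [x1 x2]; apply: sub; split; [exact: s1|exact: s2].
Qed.

Lemma qrect_enum : exists e : nat -> (rat * rat) * (rat * rat), forall q, exists n, e n = q.
Proof.
exists (fun n => odflt ((0, 0), (0, 0)) (unpickle n)) => q; exists (pickle q).
by rewrite pickleK.
Qed.

(** Only rational rectangles whose closed version lies in [Om] are kept, so that the bumps living on
    them are test functions of [Om]; the others are replaced by the empty set to keep the
    enumeration over [nat]. *)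
Lemma open_plane_cover (Om : set (plane R)) : open Om ->
  exists2 Q : nat -> set (plane R), Om = \bigcup_n Q n &
    forall n, exists q, Q n = if `[< qcrect q `<=` Om >] then qrect q else set0.
Proof.
move=> oO; have [e he] := qrect_enum.
exists (fun n => if `[< qcrect (e n) `<=` Om >] then qrect (e n) else set0); last by move=> n; exists (e n).
apply/seteqP; split=> [z Oz|z [n _]].
  have [q [qz sub]] := open_qrect oO Oz; have [n en] := he q; exists n; first by [].
  by rewrite en; case: asboolP.
case: asboolP => // sub [h1 h2]; apply: sub.
by split; [move: h1|move: h2] => /=; rewrite !in_itv /= => /andP[? ?]; rewrite !ltW.
Qed.

Lemma open_plane_measurable (Om : set (plane R)) : open Om -> measurable Om.
Proof.
move=> /open_plane_cover[Q -> hQ]; apply: bigcupT_measurable => n.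
have [q ->] := hQ n; case: asboolP => _; [exact: mqrect|exact: measurable0].
Qed.

Lemma bounded_plane (Om : set (plane R)) : bounded_set Om ->
  exists2 M : R, 0 < M & forall z, Om z -> `|z.1| < M /\ `|z.2| < M.
Proof.
move=> /pinfty_ex_gt0[M M0 hM]; exists (M + 1); first lra.
move=> z /hM /=; rewrite prod_normE ge_max => /andP[h1 h2]; split; lra.
Qed.

Lemma bounded_plane_fin (Om : set (plane R)) : measurable Om -> bounded_set Om ->
  (leb2 R Om < +oo)%E.
Proof.
move=> mO /bounded_plane[M M0 hM].
apply: (@le_lt_trans _ _ (leb2 R (`]-M, M[%classic `*` `]-M, M[%classic))).
  apply: le_measure; rewrite ?inE //; first by apply: measurableX; exact: measurable_itv.
  by move=> z /hM[]; rewrite /= !ltr_norml !in_itv.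
rewrite /leb2 [X in (X < _)%E](_ : _ = leb1 R `](- M)%R, M[%classic * leb1 R `](- M)%R, M[%classic)%E; last first.
  by apply: (@product_measure1E _ _ _ _ R (@lebesgue_measure R) (@lebesgue_measure R)); exact: measurable_itv.
by rewrite !leb1_itv /=; case: ifP => _; rewrite ?mule0 // -!EFinB -EFinM ltry.
Qed.

(** On a rational rectangle with closure in [Om], bumps converge to indicators of subrectangles, so
    [f] integrates to zero over these. A Dynkin argument in each coordinate and one for products
    extend this to all measurable sets, in particular to those where [f] is positive or negative. *)
Lemma fundamental (Om : set (plane R)) (f : plane R -> R) : open Om ->
  itg (leb2 R) Om f ->
  (forall phi : plane R -> R, test_fun Om phi -> Rintegral (leb2 R) Om (fun z => f z * phi z) = 0) ->
  \forall z \ae leb2 R, Om z -> f z = 0.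
Proof.
move=> oO hf h0; have mO := open_plane_measurable oO.
have [Q OQ hQ'] := open_plane_cover oO.
suff hQ n : \forall z \ae leb2 R, Om z -> Q n z -> f z = 0.
  apply: filterS (ae_foralln hQ) => z hz Oz.
  by move: (Oz); rewrite {1}OQ => -[n _ Qn]; exact: (hz n).
have [q ->] := hQ' n; case: asboolP => [sub|_]; last by apply: aeW.
have mq := mqrect q.
pose g z := \1_(qrect q) z * f z.
have ig : itg (leb2 R) Om g.
  apply: (itg_le mO _ (itg_abs hf)).
    by apply: measurable_funM; [exact: measurable_indic|exact: itg_meas hf].
  by move=> z _; rewrite /g normrM ler_piMl // indicE; case: (_ \in _); rewrite ?normr1 ?normr0.
(* Quadrants unbounded to the left suffice: [g] already carries the indicator of the rational
   rectangle, so the product is [f] on a rectangle with right ends [b] and [c]. *)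
have rect0 x y : Rintegral (leb2 R) Om (fun z => \1_`]-oo, y[%classic z.2 * (\1_`]-oo, x[%classic z.1 * g z)) = 0.
  pose b := Num.min (ratr q.1.2) x; pose c := Num.min (ratr q.2.2) y.
  have tb k : test_fun Om (ebump2 k (ratr q.1.1) b (ratr q.2.1) c).
    apply: ebump2_test => z [z1 z2]; apply: sub; split; [move: z1|move: z2];
    by rewrite /= !in_itv /= le_min => /andP[-> /andP[-> _]].
  have [_ hc] : itg (leb2 R) Om (fun z => \1_`]-oo, y[%classic z.2 * (\1_`]-oo, x[%classic z.1 * g z)) /\
      cv (fun k => Rintegral (leb2 R) Om (fun z => f z * ebump2 k (ratr q.1.1) b (ratr q.2.1) c z))
       (Rintegral (leb2 R) Om (fun z => \1_`]-oo, y[%classic z.2 * (\1_`]-oo, x[%classic z.1 * g z))).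
    apply: (Int_dct mO _ (itg_abs hf)).
    - move=> k; apply: measurable_funM; first exact: itg_meas hf.
      apply: measurable_funM.
        apply: (measurableT_comp (f := ebump k (ratr q.1.1) b)); first exact: ebump_meas.
        exact: measurable_funTS.
      apply: (measurableT_comp (f := ebump k (ratr q.2.1) c)); first exact: ebump_meas.
      exact: measurable_funTS.
    - move=> k z _; rewrite normrM ler_piMr // ger0_norm; last by apply: mulr_ge0; exact: ebump_ge0.
      by apply: mulr_ile1; rewrite ?ebump_ge0 ?ebump_le1.
    - move=> z _; have -> : \1_`]-oo, y[%classic z.2 * (\1_`]-oo, x[%classic z.1 * g z) =
         f z * ((ratr q.1.1 < z.1 < b)%R%:R * (ratr q.2.1 < z.2 < c)%R%:R).
        rewrite /g !indicE /qrect in_setX !mem_setE /= !in_itv /= /b /c !lt_min.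
        by do ![case: (_ < _)%R => //=]; ring.
      by apply: cvM; [exact: cvC|apply: cvM; exact: ebump_cv].
  by apply: cv_uniq hc _; under eq_fun do rewrite h0 //; exact: cvC.
(* The Dynkin argument asks for the total integral, which is the limit of the integrals over the
   half-lines []-oo, k[]. *)
have lim1 (h : plane R -> R) (p : plane R -> R) : itg (leb2 R) Om h -> measurable_fun Om p ->
    (forall x, Rintegral (leb2 R) Om (fun z => \1_`]-oo, x[%classic (p z) * h z) = 0) ->
    Rintegral (leb2 R) Om h = 0.
  move=> ih mp hx.
  have [_ hc] : itg (leb2 R) Om h /\ cv (fun k : nat => Rintegral (leb2 R) Om
      (fun z => \1_`]-oo, k%:R[%classic (p z) * h z)) (Rintegral (leb2 R) Om h).
    apply: (Int_dct mO _ (itg_abs ih)).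
    - move=> k; apply: measurable_funM; last exact: itg_meas ih.
      apply: measurableT_comp (mp); apply: measurable_indic; exact: measurable_itv.
    - move=> k z _; rewrite normrM ler_piMl // indicE.
      by case: (_ \in _); rewrite ?normr1 ?normr0.
    - move=> z _; rewrite -[X in cv _ X]mul1r; apply: cvM; last exact: cvC.
      apply/cvP => e e0; exists (Num.bound `|p z|) => k hn.
      suff pk : p z < k%:R by rewrite indicE mem_setE in_itv /= pk subrr normr0.
      apply: le_lt_trans (ler_norm _) _; apply: lt_le_trans (_ : (Num.bound `|p z|)%:R <= _); last by rewrite ler_nat.
      exact: archi_boundP.
  by apply: cv_uniq hc _; under eq_fun do rewrite hx; exact: cvC.
have EG := RGenInftyO.measurableE R.
have IG : setI_closed (@RGenInftyO.G R).
  move=> _ _ [x ->] [y ->]; exists (Num.min x y); apply/seteqP; split=> z /=; rewrite !in_itv /= lt_min.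
    by move=> [-> ->].
  by move=> /andP[].
have m1 : measurable_fun setT (fst : plane R -> R) by exact: measurable_fst.
have m2 : measurable_fun setT (snd : plane R -> R) by exact: measurable_snd.
have s1 A y : measurable A ->
    Rintegral (leb2 R) Om (fun z => \1_A z.1 * (\1_`]-oo, y[%classic z.2 * g z)) = 0.
  have iy : itg (leb2 R) Om (fun z => \1_`]-oo, y[%classic z.2 * g z).
    by apply: itg_indic => //; exact: measurable_funTS.
  apply: (Int_dynkin mO iy (measurable_funTS m1) EG IG).
    apply: (lim1 _ fst iy (measurable_funTS m1)) => x; rewrite -[RHS](rect0 x y).
    by apply: Int_eq => z _; ring.
  by move=> _ [x ->]; rewrite -[RHS](rect0 x y); apply: Int_eq => z _; ring.
have s2 A B : measurable A -> measurable B ->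
    Rintegral (leb2 R) Om (fun z => \1_B z.2 * (\1_A z.1 * g z)) = 0.
  move=> mA; have iA : itg (leb2 R) Om (fun z => \1_A z.1 * g z).
    by apply: itg_indic => //; exact: measurable_funTS.
  move: B; apply: (Int_dynkin mO iA (measurable_funTS m2) EG IG).
    apply: (lim1 _ snd iA (measurable_funTS m2)) => y; rewrite -[RHS](s1 A y mA).
    by apply: Int_eq => z _; ring.
  by move=> _ [y ->]; rewrite -[RHS](s1 A y mA); apply: Int_eq => z _; ring.
have s3 A : measurable A -> Rintegral (leb2 R) Om (fun z => \1_A z * g z) = 0.
  apply: (Int_dynkin (h := id) mO ig _ (measurable_prod_measurableType _ _)) => //.
  - move=> _ _ [A1 mA1 [B1 mB1 <-]] [A2 mA2 [B2 mB2 <-]].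
    exists (A1 `&` A2); first exact: measurableI.
    by exists (B1 `&` B2); [exact: measurableI|rewrite setXI].
  - rewrite -[RHS](s2 setT setT measurableT measurableT); apply: Int_eq => z _.
    by rewrite !indicT !mul1r.
  - move=> _ [A1 mA1 [B1 mB1 <-]]; rewrite -[RHS](s2 A1 B1 mA1 mB1); apply: Int_eq => z _.
    by rewrite [in LHS]indicE in_setX !indicE -mulnb natrM; ring.
have mg := itg_meas ig.
have half (g' : plane R -> R) : itg (leb2 R) Om g' ->
    (forall A, measurable A -> Rintegral (leb2 R) Om (fun z => \1_A z * g' z) = 0) ->
    \forall z \ae leb2 R, Om z -> g' z <= 0.
  move=> ig' h'; pose A := Om `&` [set z | 0 < g' z].
  have mA : measurable A.
    rewrite /A -[[set z | 0 < g' z]]/(g' @^-1` [set x | 0 < x]).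
    apply: (itg_meas ig' mO); rewrite (_ : [set x | 0 < x] = `]0, +oo[%classic); first exact: measurable_itv.
    by apply/seteqP; split=> x /=; rewrite in_itv /= andbT.
  have iA : itg (leb2 R) Om (fun z => \1_A z * g' z) by exact: (@itg_indic _ _ _ _ _ mO _ ig' _ _ id).
  have pA z : Om z -> 0 <= \1_A z * g' z.
    move=> Oz; rewrite indicE; have [/set_mem[_ /ltW h]|] := boolP (z \in A); first by rewrite mul1r.
    by rewrite mul0r.
  apply: filterS (Int_eq0_ae mO iA pA (h' _ mA)) => z hz Oz; have := hz Oz.
  rewrite indicE leNgt; case: (boolP (z \in A)) => [/set_mem[_ p]|nA _].
    by rewrite mul1r => e; move: p; rewrite /= e ltxx.
  by apply/negP => p; move: nA; rewrite mem_set.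
have hN : \forall z \ae leb2 R, Om z -> - g z <= 0.
  apply: (half _ (itgN mO ig)) => A mA.
  rewrite (@Int_eq _ _ _ _ _ _ (fun z => -1 * (\1_A z * g z))); last by move=> z _; ring.
  by rewrite IntZ // ?s3 ?mulr0 //; exact: (@itg_indic _ _ _ _ _ mO _ ig _ _ id).
apply: filterS2 (half _ ig s3) hN => z h1 h2 Oz qz; have := h1 Oz; have := h2 Oz.
rewrite /g indicE mem_set // mul1r oppr_le0 => h3 h4; apply/eqP; rewrite eq_le h4 h3.
by [].
Qed.

End PlaneSets.

Lemma I2P (j : 'I_2) : j = 0 \/ j = 1.
Proof. by case: j => -[|[|]] // p; [left|right]; exact: val_inj. Qed.

Lemma convex_lt (R : realFieldType) (a b x y d : R) : 0 <= x -> 0 <= y -> 0 < a -> 0 < b ->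
  a * (x + y + 1) < d -> b * (x + y + 1) < d -> a * x + b * y < d.
Proof.
move=> x0 y0 a0 b0 ha hb; have [ab|/ltW ba] := leP a b.
  have := ler_wpM2r x0 ab; lra.
have := ler_wpM2r y0 ba; lra.
Qed.

Lemma pos_common (R : realFieldType) (a b : R) : 0 < a -> 0 < b ->
  exists r : R, 0 < r /\ forall x, 0 < x < r -> (0 < x < a) /\ (0 < x < b).
Proof.
move=> a0 b0; exists (Num.min a b); split; first by rewrite lt_min a0.
by move=> x /andP[->]; rewrite lt_min => /andP[-> ->].
Qed.

(** * Compactly supported functions on a line *)

Section LineIntegrals.
Variables (R : realType) (g g' : R -> R) (M : R).
Hypotheses (M0 : 0 < M) (hg : forall x : R, is_derive x 1 g (g' x)) (cg : continuous g').
Hypotheses (g0 : forall x, M <= `|x| -> g x = 0) (g0' : forall x, M <= `|x| -> g' x = 0).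
Local Notation leb := (@lebesgue_measure R).

Lemma line_cont : continuous g.
Proof.
move=> x; apply: differentiable_continuous; apply/derivable1_diffP.
by have [] := hg x.
Qed.

Lemma line_FTC2 a b : a < b -> (\int[leb]_(x in `[a, b]) (g' x)%:E)%E = ((g b)%:E - (g a)%:E)%E.
Proof.
move=> ab; apply: continuous_FTC2 => //.
- exact: continuous_subspaceT.
- split.
  + by move=> x _; have [] := hg x.
  + by apply: cvg_at_right_filter; exact: line_cont.
  + by apply: cvg_at_left_filter; exact: line_cont.
- by move=> x _; rewrite derive1E; have [_ ->] := hg x.
Qed.

Lemma line_out x : ~ (`[- M, M]%classic : set R) x -> M <= `|x|.
Proof.
move=> /= h; rewrite leNgt; apply/negP; rewrite ltr_norml => /andP[h1 h2]; apply: h.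
by rewrite in_itv /= !ltW.
Qed.

Lemma line_patch (F : R -> R) : (forall x, M <= `|x| -> F x = 0) ->
  (\int[leb]_x (F x)%:E = \int[leb]_(x in `[(- M)%R, M]) (F x)%:E)%E.
Proof.
move=> F0; rewrite [RHS]integral_mkcond; apply: eq_integral => x _; rewrite patchE.
case: ifPn => // /negP; rewrite inE => h; rewrite F0 //; exact: line_out.
Qed.

Lemma line_int0 : (\int[leb]_x (g' x)%:E = 0)%E.
Proof.
have MM : - M < M by apply: lt_trans M0; rewrite oppr_lt0.
rewrite line_patch // line_FTC2 //.
by rewrite !g0 ?subee // ?normrN ger0_norm // ltW.
Qed.

Lemma line_pw x : ((`|g x|)%:E <= \int[leb]_s (`|g' s|)%:E)%E.
Proof.
have mg' : measurable_fun setT (g' : measurableTypeR R -> measurableTypeR R).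
  exact: continuous_measurable_fun.
have ma : measurable_fun setT (fun s : measurableTypeR R => (`|g' s|)%:E).
  by apply/measurable_EFinP; exact: measurableT_comp.
have [Mx|Mx] := leP M `|x|; first by rewrite g0 // normr0; apply: integral_ge0.
move: Mx; rewrite ltr_norml => /andP[x1 x2].
have e : (g x)%:E = (\int[leb]_(s in `[(- M)%R, x]) (g' s)%:E)%E.
  by rewrite line_FTC2 // [g (- M)]g0 ?sube0 // normrN ger0_norm // ltW.
rewrite -abse_EFin e; apply: le_trans (le_abse_integral _ _ _) _.
- exact: measurable_itv.
- by apply/measurable_EFinP; exact: measurable_funTS.
- by apply: ge0_subset_integral => //; exact: measurable_itv.
Qed.

End LineIntegrals.

(** * Integration by parts and inequalities for test functions *)

Section TestFunctions.
Variable R : realType.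
Implicit Types (phi psi : plane R -> R).
Local Notation P := (plane R).

Lemma plane_cont_meas (f : P -> R) : continuous f ->
  measurable_fun setT (f : P -> measurableTypeR R).
Proof.
move=> cf; apply: (@measurability _ _ P (measurableTypeR R) setT f (@RGenInftyO.G R) (RGenInftyO.measurableE R)).
move=> _ [_ [x ->] <-]; rewrite setTI; apply: open_plane_measurable.
by move/continuousP: cf; apply; exact: interval_open.
Qed.

Variables (Om : set P) (oO : open Om) (M : R) (M0 : 0 < M).
Hypothesis OM : forall z, Om z -> `|z.1| < M /\ `|z.2| < M.

Lemma test_meas phi : test_fun Om phi -> measurable_fun setT (phi : P -> measurableTypeR R).
Proof. by move=> h; apply: plane_cont_meas; exact: test_cont h. Qed.

Lemma testM phi psi : test_fun Om phi -> test_fun Om psi -> test_fun Om (fun z => phi z * psi z).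
Proof.
move=> [h [K [cK sub hK]]] [h' _]; split; first by move=> k; apply: CkM.
by exists K; split=> // z nK; rewrite hK // mul0r.
Qed.

Lemma testD phi psi : test_fun Om phi -> test_fun Om psi -> test_fun Om (fun z => phi z + psi z).
Proof.
move=> [h [K [cK sub hK]]] [h' [K' [cK' sub' hK']]]; split; first by move=> k; apply: CkD.
exists (K `|` K'); split; first exact: compactU.
- by move=> z [/sub|/sub'].
- by move=> z nK; rewrite hK ?hK' ?addr0 // => h1; apply: nK; [right|left].
Qed.

Lemma testZ a phi : test_fun Om phi -> test_fun Om (fun z => a * phi z).
Proof.
move=> [h [K [cK sub hK]]]; split; first by move=> k; apply: CkZ.
by exists K; split=> // z nK; rewrite hK // mulr0.
Qed.

Lemma test_derivable phi v z : test_fun Om phi -> derivable phi z v.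
Proof. by move=> [/(_ 1%N) h _]; exact: (Ck_derivable (k := 0)). Qed.

(** Parametrises by its own coordinate the line through [z] parallel to axis [j]. *)
Definition ln (j : 'I_2) (z : P) (s : R) : P := if j == 0 then (s, z.2) else (z.1, s).

Lemma ln_derive phi j z (s : R) : test_fun Om phi ->
  is_derive s 1 (fun r => phi (ln j z r)) ('D_(unit_dir R j) phi (ln j z s)).
Proof.
move=> h; pose l (r : R) : P := if j == 0 then (r, 0) else (0, r).
have hL (k : R) v x : ln j z (k *: v + x) = k *: l v + ln j z x.
  rewrite /ln /l; case: ifP => _; apply/pair_equal_spec; split=> /=; rewrite ?scaler0 ?add0r //.
have e : unit_dir R j = l 1 by rewrite /unit_dir /l.
rewrite e; apply: DeriveDef; last exact: (pull_derive hL).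
by apply: (pull_derivable hL); exact: test_derivable.
Qed.

Lemma ln_cont (j : 'I_2) z : continuous (ln j z : R -> P).
Proof.
rewrite /ln; case: (j == 0) => s.
  move=> A [[B C] /= [nB nC] sub]; apply: filterS nB => r Br; apply: sub.
  by split=> //; exact: nbhs_singleton nC.
move=> A [[B C] /= [nB nC] sub]; apply: filterS nC => r Cr; apply: sub.
by split=> //; exact: nbhs_singleton nB.
Qed.

Lemma test_ln_cont phi j z : test_fun Om phi -> continuous (fun s : R => phi (ln j z s)).
Proof.
move=> h s; have h1 := @continuous_comp _ _ _ (ln j z) phi s (@ln_cont j z s).
have cp := test_cont h; have h2 := h1 (cp _); exact: h2.
Qed.

Lemma ln_out phi j z s : test_fun Om phi -> M <= `|s| -> phi (ln j z s) = 0.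
Proof.
move=> h Ms; apply: (test_out h) => /OM[]; rewrite /ln; case: ifP => _ /= h1 h2;
  by [move: h1; rewrite ltNge Ms|move: h2; rewrite ltNge Ms].
Qed.

Lemma ln_int0 phi j z : test_fun Om phi ->
  (\int[@lebesgue_measure R]_s ('D_(unit_dir R j) phi (ln j z s))%:E = 0)%E.
Proof.
move=> h; have h' := test_derive (unit_dir R j) h.
apply: (@line_int0 R (fun s => phi (ln j z s)) _ M M0).
- by move=> s; exact: ln_derive.
- have h2 := @test_ln_cont _ j z h'; exact: h2.
- by move=> s; exact: ln_out.
- by move=> s; exact: (ln_out _ _ h').
Qed.

Lemma ln_pw phi j z s : test_fun Om phi ->
  ((`|phi (ln j z s)|)%:E <= \int[@lebesgue_measure R]_r (`|'D_(unit_dir R j) phi (ln j z r)|)%:E)%E.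
Proof.
move=> h; have h' := test_derive (unit_dir R j) h.
apply: (@line_pw R (fun s => phi (ln j z s)) (fun s => 'D_(unit_dir R j) phi (ln j z s)) M M0).
- by move=> r; exact: ln_derive.
- have h2 := @test_ln_cont _ j z h'; exact: h2.
- by move=> r; exact: ln_out.
Qed.

Let mO : measurable Om := open_plane_measurable oO.

Lemma Om_fin : (leb2 R Om < +oo)%E.
Proof.
apply: bounded_plane_fin => //; exists M; split; first exact: num_real.
move=> x Mx z /OM[h1 h2] /=; rewrite prod_normE ge_max; apply/andP; split; lra.
Qed.

Lemma Om_patch (F : P -> R) (c : R -> \bar R) : c 0 = 0%E -> (forall z, ~ Om z -> F z = 0) ->
  (\int[leb2 R]_(z in Om) c (F z) = \int[leb2 R]_z c (F z))%E.
Proof.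
move=> c0 F0; rewrite [LHS]integral_mkcond; apply: eq_integral => z _; rewrite patchE.
by case: ifPn => // /negP; rewrite inE => h; rewrite F0.
Qed.

Lemma test_itg phi : test_fun Om phi -> itg (leb2 R) Om phi.
Proof.
move=> h; have [C C0 hC] := test_bounded h.
apply: (itg_le mO (g := fun=> C)) => //; first by apply: measurable_funTS; exact: test_meas.
by apply: itg_cst => //; exact: Om_fin.
Qed.

Lemma test_int0 phi j : test_fun Om phi ->
  Rintegral (leb2 R) Om (fun z => 'D_(unit_dir R j) phi z) = 0.
Proof.
move=> h; set f := fun z => _; have h' : test_fun Om f by exact: test_derive.
have f0 z : ~ Om z -> f z = 0 by exact: test_out.
have iT : (leb2 R).-integrable setT (EFin \o f).
  have := itg_abs (test_itg h').
  have mf := test_meas h'.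
  move=> /integrableP[_ hf]; apply/integrableP; split; first exact/measurable_EFinP.
  rewrite -(@Om_patch f (fun x => `|x%:E|)%E) ?abse0 //.
  by move: hf; under eq_integral do rewrite /= normr_id.
rewrite /Rintegral (@Om_patch f EFin) //.
have [j0|j1] := I2P j.
  rewrite -[X in fine X](fubini2 iT) integral0_eq // => y _; rewrite /fubini_G /=.
  by have := ln_int0 j (0, y) h; rewrite /ln /f j0.
rewrite -[X in fine X](fubini1 iT) integral0_eq // => x _; rewrite /fubini_F /=.
by have := ln_int0 j (x, 0) h; rewrite /ln /f j1.
Qed.

Lemma test_ibp phi psi j : test_fun Om phi -> test_fun Om psi ->
  Rintegral (leb2 R) Om (fun z => phi z * 'D_(unit_dir R j) psi z) =
  - Rintegral (leb2 R) Om (fun z => 'D_(unit_dir R j) phi z * psi z).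
Proof.
move=> h k; have := test_int0 j (testM h k).
rewrite (@Int_eq _ _ _ _ _ _ (fun z => phi z * 'D_(unit_dir R j) psi z + 'D_(unit_dir R j) phi z * psi z)); last first.
  move=> z _; have -> := @deriveM _ _ phi psi z (unit_dir R j) (@test_derivable _ _ _ h) (@test_derivable _ _ _ k).
  by rewrite /GRing.scale /= ['D_ _ phi z * _]mulrC.
rewrite (IntD mO); last 2 first.
- by apply: test_itg; apply: testM => //; exact: test_derive.
- by apply: test_itg; apply: testM => //; exact: test_derive.
by move=> /eqP; rewrite addr_eq0 => /eqP.
Qed.

Local Notation leb := (@lebesgue_measure R).
Local Notation Int f := (Rintegral (leb2 R) Om f).
Let e0 := unit_dir R 0.
Let e1 := unit_dir R 1.

(** The shape that arises when one factor is bounded by an integral along horizontal lines, a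
    function of [z.2], and the other by an integral along vertical lines, a function of [z.1]. *)
Lemma tensor (A B : measurableTypeR R -> \bar R) : measurable_fun setT A -> measurable_fun setT B ->
  (forall x, 0 <= A x)%E -> (forall x, 0 <= B x)%E ->
  (\int[leb2 R]_z (A z.2 * B z.1) = (\int[leb]_y A y) * \int[leb]_x B x)%E.
Proof.
move=> mA mB A0 B0; rewrite fubini_tonelli1; last 2 first.
- by apply: emeasurable_funM; apply: measurableT_comp.
- by move=> z; apply: mule_ge0.
rewrite /fubini_F /=; under eq_integral do rewrite ge0_integralZr //.
by rewrite ge0_integralZl //; apply: integral_ge0.
Qed.

Lemma test_abs_int phi : test_fun Om phi ->
  (\int[leb2 R]_z (`|phi z|)%:E = (Int (fun z => `|phi z|))%:E)%E.
Proof.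
move=> h; rewrite -(itg_EFin mO); last exact: itg_abs (test_itg h).
by rewrite (@Om_patch phi (fun x => (`|x|)%:E)) ?normr0 // => z; exact: test_out.
Qed.

Lemma test_sq_derive phi j : test_fun Om phi ->
  Int (fun z => `|'D_(unit_dir R j) (fun z => phi z * phi z) z|) <=
  2 * (Num.sqrt (Int (fun z => phi z ^+ 2)) * Num.sqrt (Int (fun z => 'D_(unit_dir R j) phi z ^+ 2))).
Proof.
move=> h; set d := fun z => 'D_(unit_dir R j) phi z.
have hd : test_fun Om d := test_derive _ h.
rewrite (@Int_eq _ _ _ _ _ _ (fun z => 2 * (`|phi z| * `|d z|))); last first.
  move=> z _; have -> := @deriveM _ _ phi phi z (unit_dir R j) (@test_derivable _ _ _ h) (@test_derivable _ _ _ h).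
  by rewrite /GRing.scale /= -mulr2n -[_ *+ 2]mulr_natl !normrM normr_nat.
have sq (f : P -> R) : Int (fun z => f z ^+ 2) = Int (fun z => `|f z| ^+ 2).
  by apply: Int_eq => z _; rewrite real_normK ?num_real.
have isq (f : P -> R) : test_fun Om f -> itg (leb2 R) Om (fun z => `|f z| ^+ 2).
  move=> hf; apply: (itg_eq mO _ (test_itg (testM hf hf))) => z _.
  by rewrite real_normK ?num_real.
have [i le] := @Int_CS _ _ _ (leb2 R) Om (fun z => `|phi z|) (fun z => `|d z|) mO
  (itg_meas (itg_abs (test_itg h))) (itg_meas (itg_abs (test_itg hd))) (isq _ h) (isq _ hd).
rewrite (IntZ mO) // ler_pM2l // (sq phi) (sq d); apply: le_trans le; exact: ler_norm.
Qed.

Lemma test_pw0 phi (z : P) : test_fun Om phi ->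
  ((`|phi z|)%:E <= fubini_G leb (fun z => (`|'D_e0 phi z|)%:E) z.2)%E.
Proof. by move=> h; have := ln_pw 0 z z.1 h; rewrite /ln /= -surjective_pairing. Qed.

Lemma test_pw1 phi (z : P) : test_fun Om phi ->
  ((`|phi z|)%:E <= fubini_F leb (fun z => (`|'D_e1 phi z|)%:E) z.1)%E.
Proof. by move=> h; have := ln_pw 1 z z.2 h; rewrite /ln /= -surjective_pairing. Qed.

Lemma test_abs_meas phi : test_fun Om phi ->
  measurable_fun setT (fun z : P => (`|phi z|)%:E).
Proof. by move=> h; apply/measurable_EFinP; apply: measurableT_comp => //; exact: test_meas. Qed.

Lemma test_abs_G phi : test_fun Om phi ->
  (\int[leb2 R]_z (`|phi z|)%:E = \int[leb]_y fubini_G leb (fun z => (`|phi z|)%:E) y)%E.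
Proof. by move=> h; apply: fubini_tonelli2 => //; exact: test_abs_meas. Qed.

Lemma test_abs_F phi : test_fun Om phi ->
  (\int[leb2 R]_z (`|phi z|)%:E = \int[leb]_x fubini_F leb (fun z => (`|phi z|)%:E) x)%E.
Proof. by move=> h; apply: fubini_tonelli1 => //; exact: test_abs_meas. Qed.

(** Ladyzhenskaya's argument: one factor [|chi|] is bounded by an integral along the horizontal
    line, the other by one along the vertical line, and the integral of the product of the two
    bounds separates. *)
Lemma lady_core chi d0 d1 : test_fun Om chi -> test_fun Om d0 -> test_fun Om d1 ->
  (forall z : P, (`|chi z|)%:E <= fubini_G leb (fun z => (`|d0 z|)%:E) z.2)%E ->
  (forall z : P, (`|chi z|)%:E <= fubini_F leb (fun z => (`|d1 z|)%:E) z.1)%E ->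
  Int (fun z => `|chi z * chi z|) <= Int (fun z => `|d0 z|) * Int (fun z => `|d1 z|).
Proof.
move=> hc h0 h1 p0 p1; have m0 := test_abs_meas h0; have m1 := test_abs_meas h1.
rewrite -lee_fin EFinM -(test_abs_int (testM hc hc)) -(test_abs_int h0) -(test_abs_int h1).
rewrite (test_abs_G h0) (test_abs_F h1) -tensor; last first.
- by move=> x; apply: integral_ge0.
- by move=> x; apply: integral_ge0.
- exact: measurable_fun_fubini_tonelli_F.
- exact: measurable_fun_fubini_tonelli_G.
apply: ge0_le_integral => //.
- by apply: test_abs_meas; exact: testM.
- apply: emeasurable_funM; apply: measurableT_comp => //.
    exact: measurable_fun_fubini_tonelli_G.
  exact: measurable_fun_fubini_tonelli_F.
- move=> z _; rewrite normrM EFinM; apply: lee_pmul; rewrite ?lee_fin //.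
    exact: p0.
  exact: p1.
Qed.

(** [Om] lies in a strip of width [2 * M], over which the horizontal line bound is constant in the
    first coordinate. *)
Lemma poincare_core chi d0 : test_fun Om chi -> test_fun Om d0 ->
  (forall z : P, (`|chi z|)%:E <= fubini_G leb (fun z => (`|d0 z|)%:E) z.2)%E ->
  Int (fun z => `|chi z|) <= 2 * M * Int (fun z => `|d0 z|).
Proof.
move=> hc h0 p0; have m0 := test_abs_meas h0.
rewrite -lee_fin mulrC EFinM -(test_abs_int hc) -(test_abs_int h0) (test_abs_G h0).
have -> : ((2 * M)%:E = \int[leb]_x (\1_(`]- M, M[%classic : set (measurableTypeR R)) x)%:E :> \bar R)%E.
  rewrite integral_indic ?setIT; [|exact: measurableT|exact: measurable_itv].
  rewrite -[RHS]/(leb1 R _) leb1_itv /= ifT; last by rewrite lte_fin gtrN.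
  by rewrite -EFinB; congr EFin; ring.
have mI : measurable_fun setT (fun x : measurableTypeR R => (\1_(`]- M, M[%classic : set (measurableTypeR R)) x)%:E : \bar R).
  by apply/measurable_EFinP; apply: measurable_indic; exact: measurable_itv.
have I1 x : (0 <= (\1_(`]- M, M[%classic : set (measurableTypeR R)) x)%:E :> \bar R)%E by rewrite lee_fin.
rewrite -tensor //; last first.
- by move=> x; apply: integral_ge0.
- exact: measurable_fun_fubini_tonelli_G.
apply: ge0_le_integral => //.
- exact: test_abs_meas.
- apply: emeasurable_funM.
    by apply: (measurableT_comp (f := fubini_G leb _)) => //; exact: measurable_fun_fubini_tonelli_G.
  have m1 : measurable_fun setT (fst : P -> measurableTypeR R) by exact: measurable_fst.
  have m2 := measurableT_comp mI m1; exact: m2.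
- move=> z _; case: (pselect (Om z)) => [Oz|nO]; last first.
    by rewrite (test_out hc nO) normr0; apply: mule_ge0 => //; apply: integral_ge0.
  have [zM _] := OM Oz; rewrite indicE mem_set; last by move: zM; rewrite /= in_itv /= ltr_norml.
  have -> : (true%:R = 1 :> R) by [].
  rewrite mule1; exact: p0.
Qed.

Lemma Int_sq_ge0 (f : P -> R) : 0 <= Int (fun z => f z ^+ 2).
Proof. by apply: Int_ge0 => z _; exact: sqr_ge0. Qed.

(** [lady_core] for the square of [phi]: its derivatives [2 phi D phi] are estimated by
    Cauchy-Schwarz, and the two factors [2] give the [4]. *)
Lemma test_ladyzhenskaya phi : test_fun Om phi ->
  Int (fun z => phi z ^+ 4) <= 4 * Int (fun z => phi z ^+ 2) *
    (Num.sqrt (Int (fun z => 'D_(unit_dir R 0) phi z ^+ 2)) *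
     Num.sqrt (Int (fun z => 'D_(unit_dir R 1) phi z ^+ 2))).
Proof.
move=> h; have hc := testM h h.
have le1 := lady_core hc (test_derive e0 hc) (test_derive e1 hc)
  (fun z => test_pw0 z hc) (fun z => test_pw1 z hc).
rewrite (@Int_eq _ _ _ _ _ _ (fun z => `|phi z * phi z * (phi z * phi z)|)); last first.
  by move=> z _; rewrite ger0_norm; [ring|rewrite -!expr2 sqr_ge0].
apply: le_trans le1 _; have le0 := test_sq_derive 0 h; have le1 := test_sq_derive 1 h.
apply: le_trans (ler_pM _ _ le0 le1) _; [exact: Int_ge0|exact: Int_ge0|].
rewrite -[X in 4 * X](sqr_sqrtr (Int_sq_ge0 phi)).
have alg (s a b : R) : 2 * (s * a) * (2 * (s * b)) <= 4 * s ^+ 2 * (a * b).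
  by rewrite le_eqVlt; apply/orP; left; apply/eqP; ring.
exact: alg.
Qed.

(** Applied to the square of [phi], [poincare_core] gives [a ^+ 2 <= 4 M a b] for the norms [a] of
    [phi] and [b] of its derivative; one factor [a] is divided out. *)
Lemma test_poincare phi : test_fun Om phi ->
  Int (fun z => phi z ^+ 2) <= (4 * M) ^+ 2 * Int (fun z => 'D_(unit_dir R 0) phi z ^+ 2).
Proof.
move=> h; have hc := testM h h.
have le1 := poincare_core hc (test_derive e0 hc) (fun z => test_pw0 z hc).
have M2 : 0 <= 2 * M by apply: mulr_ge0 => //; exact: ltW.
have := le_trans le1 (ler_wpM2l M2 (test_sq_derive 0 h)).
rewrite [X in X <= _ -> _](@Int_eq _ _ _ _ _ _ (fun z => phi z ^+ 2)); last first.
  by move=> z _; rewrite -expr2 ger0_norm // sqr_ge0.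
rewrite -[X in X <= 2 * M * _ -> _](sqr_sqrtr (Int_sq_ge0 phi)) -[X in _ -> X <= _](sqr_sqrtr (Int_sq_ge0 phi)).
rewrite -[X in _ -> _ <= _ * X](sqr_sqrtr (Int_sq_ge0 _)).
set a := Num.sqrt _; set b := Num.sqrt _; have a0 : 0 <= a := sqrtr_ge0 _; have b0 : 0 <= b := sqrtr_ge0 _.
move=> h2; have h3 : a <= 4 * M * b.
  have [a00|ap] := leP a 0; first by apply: le_trans a00 _; rewrite !mulr_ge0 // ltW.
  rewrite -(ler_pM2l ap) -expr2; apply: le_trans h2 _; rewrite le_eqVlt; apply/orP; left; apply/eqP; ring.
by rewrite -exprMn ler_sqr // nnegrE mulr_ge0 // mulr_ge0 // ltW.
Qed.

Lemma test_line_derive phi (v : P) (z : P) (s : R) : test_fun Om phi ->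
  is_derive s 1 (fun r : R => phi (z + r *: v)) ('D_v phi (z + s *: v)).
Proof.
move=> h; pose l (r : R) : P := r *: v.
have hL (k : R) a x : z + (k *: a + x) *: v = k *: l a + (z + x *: v).
  by rewrite /l scalerDl -[(k *: a : R)]/(k * a) -scalerA addrCA.
have e : v = l 1 by rewrite /l scale1r.
rewrite [X in 'D_X _ _]e; apply: DeriveDef; last first.
  exact: (@pull_derive R R P (fun r : R => z + r *: v) l hL phi 1 s).
apply: (@pull_derivable R R P (fun r : R => z + r *: v) l hL); exact: test_derivable.
Qed.

Lemma line_MVT (f df : R -> R) (b : R) : 0 < b -> (forall x : R, is_derive x 1 f (df x)) ->
  exists2 c, 0 < c < b & f b - f 0 = df c * b.
Proof.
move=> b0 hf; have cf : {within `[0, b], continuous f}.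
  apply: continuous_subspaceT => x; apply: differentiable_continuous; apply/derivable1_diffP.
  by have [] := hf x.
have [c cI e] := MVT b0 (fun x _ => hf x) cf.
by move: cI e; rewrite in_itv /= subr0 => hc e; exists c.
Qed.

(* Both mixed derivatives are limits of the same second difference, by two applications
   of the mean value theorem in either order. *)
Lemma test_mixed phi (v w z : P) (r : R) : test_fun Om phi -> 0 < r ->
  exists a b : R, [/\ 0 < a < r, 0 < b < r &
   phi (z + r *: v + r *: w) - phi (z + r *: v) - phi (z + r *: w) + phi z =
   r ^+ 2 * 'D_w ('D_v phi) (z + a *: v + b *: w)].
Proof.
move=> h r0.
have hv : test_fun Om ('D_v phi) by exact: test_derive.
pose f s := phi (z + r *: w + s *: v) - phi (z + s *: v).
have [|a a0 ea] := @line_MVT f (fun s => 'D_v phi (z + r *: w + s *: v) - 'D_v phi (z + s *: v)) r r0.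
  by move=> s; apply: is_deriveB; exact: test_line_derive.
have [|b b0 eb] := @line_MVT (fun s => 'D_v phi (z + a *: v + s *: w))
  (fun s => 'D_w ('D_v phi) (z + a *: v + s *: w)) r r0.
  by move=> s; exact: test_line_derive.
exists a, b; split=> //.
move: ea; rewrite /f !scale0r !addr0 => ea.
move: eb; rewrite !scale0r !addr0 => eb.
rewrite [z + a *: v + r *: w]addrAC in eb; rewrite [z + r *: v + r *: w]addrAC expr2.
move: ea; rewrite eb; move: (phi _) (phi _) (phi _) (phi _) ('D_w _ _) => p1 p2 p3 p4 D e.
by apply: (eq_trans _ (eq_trans e _)); ring.
Qed.

Lemma test_schwarz phi (v w z : P) : test_fun Om phi ->
  'D_w ('D_v phi) z = 'D_v ('D_w phi) z.
Proof.
move=> h; apply/eqP; rewrite eq_sym -subr_eq0; apply/negPn/negP => ne.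
have c1 := test_cont (test_derive w (test_derive v h)).
have c2 := test_cont (test_derive v (test_derive w h)).
pose e := `|'D_v ('D_w phi) z - 'D_w ('D_v phi) z| / 2.
have e0' : 0 < e by rewrite divr_gt0 // normr_gt0.
have key (F : P -> R) : continuous F -> exists2 d : R, 0 < d & forall a b, 0 < a < d -> 0 < b < d ->
    `|F z - F (z + a *: v + b *: w)| < e.
  move=> /(_ z) /cvgrPdist_lt /(_ _ e0') /nbhs_ballP[d /= d0 hd].
  have nv : 0 < `|v| + `|w| + 1 by rewrite ltr_wpDl // addr_ge0.
  exists (d / (`|v| + `|w| + 1)); first by rewrite divr_gt0.
  move=> a b /andP[a0 ad] /andP[b0 bd]; apply: hd; rewrite -ball_normE /ball_ /=.
  rewrite !opprD addrA addNKr -opprD normrN.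
  apply: le_lt_trans (ler_normD _ _) _; rewrite !normrZ !gtr0_norm //.
  move: ad bd; rewrite !ltr_pdivlMr //; move: (normr_ge0 v) (normr_ge0 w).
  by move=> x0 y0 ha hb; exact: convex_lt ha hb.
have [d1 d10 h1] := key _ c1; have [d2 d20 h2] := key _ c2.
have [r [r0 lr]] := pos_common d10 d20.
have [a [b [a1 b1 eab]]] := test_mixed v w z h r0.
have [a' [b' [a2 b2 eab']]] := test_mixed w v z h r0.
have E : 'D_w ('D_v phi) (z + a *: v + b *: w) = 'D_v ('D_w phi) (z + b' *: v + a' *: w).
  apply: (mulfI (_ : r ^+ 2 != 0)); first by rewrite gt_eqF // exprn_gt0.
  have E1 : z + b' *: v + a' *: w = z + a' *: w + b' *: v by rewrite addrAC.
  have E2 : z + r *: w + r *: v = z + r *: v + r *: w by rewrite addrAC.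
  rewrite E1; apply: (etrans (esym eab)); apply: (etrans _ eab'); rewrite E2.
  by congr (_ + _); exact: addrAC.
have k1 := h1 a b (lr _ a1).1 (lr _ b1).1; have k2 := h2 b' a' (lr _ b2).2 (lr _ a2).2.
move: k1 k2; rewrite -E => k1 k2; have := ltrD k2 k1; rewrite /e -splitr.
move: ('D_w ('D_v phi) z) ('D_v ('D_w phi) z) ('D_w _ (z + _ + _)) => p q x.
apply/negP; rewrite -leNgt.
by apply: le_trans (ler_distD x _ _) _; rewrite [`|x - p|]distrC.
Qed.

(** Each side is integrated by parts onto a second derivative of [b], and the second derivatives
    commute. This is the identity behind Korn's inequality. *)
Lemma test_cross (a b : P -> R) : test_fun Om a -> test_fun Om b ->
  Int (fun z => 'D_(unit_dir R 1) a z * 'D_(unit_dir R 0) b z) =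
  Int (fun z => 'D_(unit_dir R 0) a z * 'D_(unit_dir R 1) b z).
Proof.
move=> ha hb; apply: oppr_inj.
have h0 := test_derive (unit_dir R 0) hb; have h1 := test_derive (unit_dir R 1) hb.
apply: (etrans (esym (test_ibp 1 ha h0))); apply: (etrans _ (test_ibp 0 ha h1)).
by apply: Int_eq => z _; rewrite (test_schwarz _ _ _ hb).
Qed.

End TestFunctions.

(** * The spaces L^2 and H^1_0 *)

Section MatrixSpace.
Variables (R : realType) (m n : nat).
Local Notation Mx := 'M[R]_(m, n).

Lemma rcauchy (a : nat -> R) :
  (forall e, 0 < e -> exists N, forall p q, (N <= p)%N -> (N <= q)%N -> `|a p - a q| < e) ->
  exists l, cv a l.
Proof.
move=> h; have : cvg (a @ \oo).
  apply/cauchy_cvgP; apply/cauchy_ballP => e e0; have [N hN] := h _ e0.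
  pose A := [set x | exists2 p, (N <= p)%N & x = a p].
  exists (A, A) => /=; first by split; exists N => // p /= hp; exists p.
  by move=> [x y] [/= [p hp ->] [q hq ->]]; exact: hN.
by move=> /cvg_ex[l hl]; exists l; constructor.
Qed.

Lemma mxdotDl (x y z : Mx) : mxdot (x + y) z = mxdot x z + mxdot y z.
Proof.
rewrite /mxdot -big_split; apply: eq_bigr => i _; rewrite -big_split; apply: eq_bigr => j _.
by rewrite mxE mulrDl.
Qed.

Lemma mxdotZl a (x z : Mx) : mxdot (a *: x) z = a * mxdot x z.
Proof.
rewrite /mxdot mulr_sumr; apply: eq_bigr => i _; rewrite mulr_sumr; apply: eq_bigr => j _.
by rewrite mxE mulrA.
Qed.

Lemma mxdotC (x y : Mx) : mxdot x y = mxdot y x.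
Proof. by apply: eq_bigr => i _; apply: eq_bigr => j _; rewrite mulrC. Qed.

Lemma mxdot_ge0 (x : Mx) : 0 <= mxdot x x.
Proof. by apply: sumr_ge0 => i _; apply: sumr_ge0 => j _; rewrite -expr2 sqr_ge0. Qed.

Definition mxphs : phs R := Phs mxdotDl mxdotZl mxdotC mxdot_ge0.

Lemma entry_le (x : Mx) i j : `|x i j| <= frob x.
Proof.
rewrite -sqrtr_sqr ler_sqrt ?mxdot_ge0 // /mxdot (bigD1 i) //= (bigD1 j) //= expr2 -addrA lerDl.
by rewrite addr_ge0 //; do ?[apply: sumr_ge0 => ? _]; rewrite -expr2 sqr_ge0.
Qed.

Lemma mxdot_delta (x : Mx) i j : mxdot x (delta_mx i j) = x i j.
Proof.
rewrite /mxdot (bigD1 i) //= (bigD1 j) //= mxE !eqxx mulr1.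
rewrite !big1 ?addr0 // => [i' /negPf ne|j' /negPf ne]; last by rewrite mxE ne andbF mulr0.
by rewrite big1 // => j' _; rewrite mxE ne mulr0.
Qed.

Lemma mx_hcvg (u : nat -> mxphs) (l : mxphs) :
  (forall i j, cv (fun k => (u k : Mx) i j) ((l : Mx) i j)) -> hcvg u l.
Proof.
move=> h; rewrite /hcvg /hn -sqrtr0; apply: cv_sqrt.
have -> : (0 : R) = \sum_(i < m) \sum_(j < n) (0 * 0) by rewrite big1 // => i _; rewrite big1 // => j _; rewrite mulr0.
apply: cv_sum => i; apply: cv_sum => j; rewrite -(subrr ((l : Mx) i j)).
under eq_fun do rewrite !mxE.
by apply: cvM; apply: cvB (h i j) (cvC _).
Qed.

Lemma mx_complete : hcomplete mxphs.
Proof.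
move=> u hu; have h i j : exists l, cv (fun k => (u k : Mx) i j) l.
  apply: rcauchy => e e0; have [N hN] := hu _ e0; exists N => p q hp hq.
  apply: le_lt_trans (hN p q hp hq); have := entry_le (u p - u q : Mx) i j.
  by rewrite !mxE.
exists (\matrix_(i, j) xget 0 [set l | cv (fun k => (u k : Mx) i j) l] : Mx).
apply: mx_hcvg => i j; rewrite mxE; exact: (xgetPex 0 (h i j)).
Qed.

Context d (S : measurableType d) (D : set S) (mD : measurable D).

Lemma mx_clean (u : S -> Mx) : (forall i j, measurable_fun D (fun x => u x i j : measurableTypeR R)) ->
  clean D (u : S -> mxphs).
Proof.
move=> mu; apply: (@clean_ext _ _ _ D mxphs (fun x => \sum_i \sum_j (u x i j) *: (delta_mx i j : Mx))).
  by move=> x _; rewrite [RHS]matrix_sum_delta.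
by apply: clean_sum => i; apply: clean_sum => j; apply: clean_scale => //; exact: mu.
Qed.

Lemma mx_cleanE (u : S -> Mx) : clean D (u : S -> mxphs) ->
  forall i j, measurable_fun D (fun x => u x i j : measurableTypeR R).
Proof.
move=> cu i j; under eq_fun do rewrite -mxdot_delta.
apply: (@meas_ip _ _ _ D mxphs u (fun=> delta_mx i j)) => //.
by apply: step_clean; exact: step_cst.
Qed.

End MatrixSpace.

(** The integral of a nonnegative function is a supremum over simple functions below it, so
    monotonicity holds without measurability. It is applied to norms [nnorm X (f t)], whose
    measurability in time is not at hand. *)
Lemma ge0_le_integralW d (S : measurableType d) (R : realType) (nu : {measure set S -> \bar R})
    (D E : set S) (f g : S -> \bar R) : D `<=` E -> (forall t, E t -> 0 <= g t)%E ->
  (forall t, D t -> 0 <= f t)%E -> (forall t, D t -> f t <= g t)%E ->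
  (\int[nu]_(t in D) f t <= \int[nu]_(t in E) g t)%E.
Proof.
move=> DE g0 f0 fg; rewrite !ge0_integralE //.
apply: le_ereal_sup => _ [h /= hh <-]; exists h => // t; apply: le_trans (hh t) _.
rewrite !patchE; case: ifPn => [/set_mem Dt|_]; first by rewrite mem_set ?fg //; exact: DE.
by case: ifPn => // /set_mem /g0.
Qed.

(** * Norms of Lebesgue spaces as integrals *)

Section LpNorms.
Context d (S : measurableType d) (R : realType) (nu : {measure set S -> \bar R}).
Variables (D : set S) (mD : measurable D).
Local Notation Int f := (Rintegral nu D f).

Lemma Lnorm_int (k : nat) (g : S -> \bar R) : (0 < k)%N ->
  'N[nu]_(k%:R%:E)[g \_ D]%E = ((\int[nu]_(t in D) (`|g t| `^ k%:R)) `^ k%:R^-1)%E.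
Proof.
move=> k0; rewrite unlock /Lnorm; congr (_ `^ _)%E; rewrite [RHS]integral_mkcond.
apply: eq_integral => t _; rewrite !patchE; case: ifP => // _.
by rewrite abse0 poweR0r // pnatr_eq0 -lt0n.
Qed.

Lemma Lnorm_lty (k : nat) (g : S -> \bar R) : (0 < k)%N ->
  ('N[nu]_(k%:R%:E)[g \_ D] < +oo)%E <-> (\int[nu]_(t in D) (`|g t| `^ k%:R) < +oo)%E.
Proof.
move=> k0; rewrite Lnorm_int //; have kn : (k%:R : R) != 0 by rewrite pnatr_eq0 -lt0n.
split=> h; last exact: poweR_lty.
rewrite -[X in (X < _)%E](_ : (((\int[nu]_(t in D) (`|g t| `^ k%:R)) `^ k%:R^-1) `^ k%:R)%E = _); first exact: poweR_lty.
rewrite -poweRrM mulVf // poweRe1 //; apply: integral_ge0 => t _; exact: poweR_ge0.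
Qed.

Lemma Lnorm_pow_lty (k : nat) (f : S -> R) : (0 < k)%N -> measurable_fun D f ->
  ('N[nu]_(k%:R%:E)[(EFin \o f) \_ D] < +oo)%E <-> itg nu D (fun t => `|f t| ^+ k).
Proof.
move=> k0 mf; rewrite Lnorm_lty //.
have -> : (\int[nu]_(t in D) (`|(EFin \o f) t| `^ k%:R))%E = (\int[nu]_(t in D) (`|f t| ^+ k)%:E)%E.
  by apply: eq_integral => t _; rewrite [(EFin \o f) t]/= abse_EFin poweR_EFin powR_mulrn.
split=> h.
  by apply: itg_ge0P => //; apply: measurable_funX; exact: measurableT_comp.
by rewrite (itg_EFin mD h) ltry.
Qed.

Lemma Lnorm2_val (f : S -> R) : itg nu D (fun t => f t ^+ 2) ->
  'N[nu]_2%:E[(EFin \o f) \_ D]%E = (Num.sqrt (Int (fun t => f t ^+ 2)))%:E.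
Proof.
move=> h; rewrite (@Lnorm_int 2) //.
have -> : (\int[nu]_(t in D) (`|(EFin \o f) t| `^ 2%:R))%E = (\int[nu]_(t in D) (f t ^+ 2)%:E)%E.
  by apply: eq_integral => t _; rewrite [(EFin \o f) t]/= abse_EFin poweR_EFin powR_mulrn // real_normK ?num_real.
rewrite (itg_EFin mD h) poweR_EFin powR12_sqrt //.
by apply: Int_ge0 => t _; exact: sqr_ge0.
Qed.

Variables (m n : nat).
Local Notation E := (mxphs R m n).

Lemma L2mem_frob (u : S -> E) : L2mem nu D u <->
  (forall i j, measurable_fun D (fun x => (u x : 'M[R]_(m, n)) i j : measurableTypeR R)) /\
  ('N[nu]_2%:E[(EFin \o (fun x => frob (u x : 'M[R]_(m, n)))) \_ D] < +oo)%E.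
Proof.
have hh : itg nu D (fun t => ip (u t) (u t)) <-> itg nu D (fun t => `|frob (u t : 'M[R]_(m, n))| ^+ 2).
  by split; apply: itg_eq => // t _; rewrite real_normK ?num_real // sqr_sqrtr ?mxdot_ge0.
split=> [[cu iu]|[mu nu2]]; have cu' : clean D u by [|exact: mx_clean].
  split; first exact: mx_cleanE.
  by apply/(@Lnorm_pow_lty 2) => //; [exact: (meas_hn mD cu)|exact/hh].
split=> //; apply/hh; apply/(@Lnorm_pow_lty 2) => //; exact: (meas_hn mD cu').
Qed.

Lemma Lnorm_frob (u : L2 nu mD E) :
  'N[nu]_2%:E[(EFin \o (fun x => frob (val u x : 'M[R]_(m, n)))) \_ D]%E = (hn u)%:E.
Proof.
rewrite Lnorm2_val.
  congr (Num.sqrt _)%:E; apply: Int_eq => t _; by rewrite sqr_sqrtr ?mxdot_ge0.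
by apply: (itg_eq mD _ (L2_itg u u)) => t _; rewrite sqr_sqrtr ?mxdot_ge0.
Qed.

Lemma fatou_ae (fn : nat -> S -> R) (f : S -> R) (c : R) : measurable_fun D f ->
  (forall n, measurable_fun D (fn n)) -> (forall t, D t -> 0 <= f t) ->
  (forall n t, D t -> 0 <= fn n t) ->
  (\forall t \ae nu, D t -> cv (fn^~ t) (f t)) ->
  (forall n, itg nu D (fn n) /\ Int (fn n) <= c) ->
  itg nu D f /\ Int f <= c.
Proof.
move=> mf mfn f0 fn0 [N [mN N0 hN]] hc.
pose gn k t := if `[< N t >] then f t else fn k t.
have mg k : measurable_fun D (gn k).
  have -> : gn k = (fun t => \1_N t * f t + (1 - \1_N t) * fn k t).
    apply/funext => t; rewrite /gn indicE; case: asboolP => Nt; first by rewrite mem_set // mul1r subrr mul0r addr0.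
    by rewrite memNset // mul0r add0r subr0 mul1r.
  have mi : measurable_fun D (\1_N : S -> R) by exact: measurable_indic.
  by apply: measurable_funD; apply: measurable_funM => //; apply: measurable_funB.
apply: (@fatou_le _ _ _ nu D mD gn f c) => //.
- by move=> k t Dt; rewrite /gn; case: asboolP => _; [exact: f0|exact: fn0].
- move=> t Dt; rewrite /gn; case: asboolP => nt; first exact: cvC.
  by apply: contrapT => nc; apply: nt; apply: hN => /(_ Dt).
- move=> k; have [ik lk] := hc k.
  rewrite (_ : \int[nu]_(t in D) (gn k t)%:E = \int[nu]_(t in D) (fn k t)%:E)%E; first by rewrite (itg_EFin mD ik) lee_fin.
  apply: ae_eq_integral => //; [exact/measurable_EFinP|exact/measurable_EFinP|].
  exists N; split=> // t /= h; apply: contrapT => nN; apply: h => Dt.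
  by rewrite /gn; case: asboolP.
Qed.

End LpNorms.

Lemma hn0_tri (R : realType) (E : phs R) (x y z : E) :
  hn (x - y) = 0 -> hn (y - z) = 0 -> hn (x - z) = 0.
Proof.
move=> h1 h2; apply/eqP; rewrite eq_le hn_ge0 andbT.
by apply: le_trans (hn_triB x y z) _; rewrite h1 h2 addr0.
Qed.

Lemma hn0_lin (R : realType) (E : phs R) (a : R) (x y x' y' : E) :
  hn (x - x') = 0 -> hn (y - y') = 0 -> hn (a *: x + y - (a *: x' + y')) = 0.
Proof.
move=> h1 h2; apply/eqP; rewrite eq_le hn_ge0 andbT opprD addrACA -scalerBr.
by apply: le_trans (hnD _ _) _; rewrite hnZ h1 h2 mulr0 addr0.
Qed.

Lemma hn_eq0 (R : realType) (E : phs R) (x y : E) : hn (x - y) = 0 -> hn x = hn y.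
Proof. by move=> /hn_ip_eq; rewrite /hn => ->. Qed.

Lemma hcvg_fst (R : realType) (E F : phs R) (u : nat -> prod_phs E F) l : hcvg u l ->
  hcvg (fun n => (u n).1) l.1.
Proof. by apply: cv_squeeze0 => n; rewrite hn_ge0 /=; exact: (prod_hn1 (u n - l)). Qed.

Lemma hcvg_snd (R : realType) (E F : phs R) (u : nat -> prod_phs E F) l : hcvg u l ->
  hcvg (fun n => (u n).2) l.2.
Proof. by apply: cv_squeeze0 => n; rewrite hn_ge0 /=; exact: (prod_hn2 (u n - l)). Qed.

Lemma alg_poincare (R : realFieldType) (a b c d p q C : R) : 0 <= C -> 0 <= b -> 0 <= d ->
  p <= C * a -> q <= C * c -> p + q <= C * (a + b + (c + d)).
Proof. by move=> C0 b0 d0 h1 h2; have := mulr_ge0 C0 b0; have := mulr_ge0 C0 d0; lra. Qed.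

Lemma alg_lady (R : rcfType) (p q a b c e X Y : R) : 0 <= p -> 0 <= q -> 0 <= a -> 0 <= b ->
  0 <= c -> 0 <= e ->
  X <= 4 * p * (Num.sqrt a * Num.sqrt b) -> Y <= 4 * q * (Num.sqrt c * Num.sqrt e) ->
  2 * (X + Y) <= 16 * (p + q) * (a + b + (c + e)).
Proof.
move=> p0 q0 a0 b0 c0 e0 hX hY.
have amgm (x y : R) : 0 <= x -> 0 <= y -> 2 * (Num.sqrt x * Num.sqrt y) <= x + y.
  move=> x0 y0; rewrite -[X in _ <= X + _](sqr_sqrtr x0) -[X in _ <= _ + X](sqr_sqrtr y0).
  rewrite -subr_ge0 (_ : _ - _ = (Num.sqrt x - Num.sqrt y) ^+ 2) ?sqr_ge0 //; ring.
have h1 := ler_wpM2l p0 (amgm _ _ a0 b0); have h2 := ler_wpM2l q0 (amgm _ _ c0 e0).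
have := mulr_ge0 p0 a0; have := mulr_ge0 p0 b0; have := mulr_ge0 p0 c0; have := mulr_ge0 p0 e0.
have := mulr_ge0 q0 a0; have := mulr_ge0 q0 b0; have := mulr_ge0 q0 c0; have := mulr_ge0 q0 e0.
lra.
Qed.

Lemma sum_I2 (V : nmodType) (F : 'I_2 -> V) : \sum_i F i = F 0 + F 1.
Proof. by rewrite big_ord_recl big_ord1; congr (_ + F _); exact: val_inj. Qed.

Lemma cvX (R : realType) k (a : nat -> R) l : cv a l -> cv (fun n => a n ^+ k) (l ^+ k).
Proof.
move=> h; elim: k => [|k IH]; first by rewrite expr0; under eq_fun do rewrite expr0; exact: cvC.
by rewrite exprS; under eq_fun do rewrite exprS; exact: cvM.
Qed.

Section FourFunctions.
Context d (S : measurableType d) (R : realType) (nu : {measure set S -> \bar R}).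
Variables (D : set S) (mD : measurable D) (a b c e : S -> R).
Local Notation Int f := (Rintegral nu D f).

Lemma Int_sq4 : itg nu D (fun z => a z ^+ 2) -> itg nu D (fun z => b z ^+ 2) ->
  itg nu D (fun z => c z ^+ 2) -> itg nu D (fun z => e z ^+ 2) ->
  Int (fun z => a z ^+ 2 + b z ^+ 2 + (c z ^+ 2 + e z ^+ 2)) =
  Int (fun z => a z ^+ 2) + Int (fun z => b z ^+ 2) + (Int (fun z => c z ^+ 2) + Int (fun z => e z ^+ 2)).
Proof.
move=> ia ib ic ie.
by rewrite -(IntD mD ia ib) -(IntD mD ic ie) -(IntD mD (itgD mD ia ib) (itgD mD ic ie)).
Qed.

(** For a gradient with rows [(a, b)] and [(c, e)] the integrand is [grad u : (grad u)^T]; once the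
    integral of [b * c] is exchanged for that of [a * e], it becomes the square of the
    divergence. *)
Lemma Int_cross4 : itg nu D (fun z => a z * a z) -> itg nu D (fun z => e z * e z) ->
  itg nu D (fun z => b z * c z) -> itg nu D (fun z => a z * e z) ->
  Int (fun z => b z * c z) = Int (fun z => a z * e z) ->
  0 <= Int (fun z => a z * a z + b z * c z + (c z * b z + e z * e z)).
Proof.
move=> ia ie ibc iae E.
have i2 := itgZ mD 2 ibc; have i4 := itgZ mD 2 iae.
have -> : Int (fun z => a z * a z + b z * c z + (c z * b z + e z * e z)) =
    Int (fun z => a z * a z + 2 * (b z * c z) + e z * e z).
  by apply: Int_eq => z _; ring.
rewrite (IntD mD (itgD mD ia i2) ie) (IntD mD ia i2) (IntZ mD _ ibc) E -(IntZ mD _ iae).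
rewrite -(IntD mD ia i4) -(IntD mD (itgD mD ia i4) ie); apply: Int_ge0 => z _.
rewrite (_ : _ + _ = (a z + e z) ^+ 2) ?sqr_ge0 //; ring.
Qed.

End FourFunctions.

(** * The spaces H and V, Korn and Ladyzhenskaya *)

Section Spatial.
Variables (R : realType) (Om : set (plane R)) (oO : open Om) (M : R) (M0 : 0 < M).
Hypothesis OM : forall z, Om z -> `|z.1| < M /\ `|z.2| < M.
Local Notation P := (plane R).
Local Notation nu := (leb2 R).
Let mO : measurable Om := open_plane_measurable oO.
Let fO : (nu Om < +oo)%E := Om_fin oO OM.
Definition LL m n : phs R := L2 nu mO (mxphs R m n).
Local Notation H := (LL 2 1).
Local Notation Y := (LL 2 2).
(** Pairs of a field and a candidate for its gradient. Inside this Hilbert space [H^1] is the closed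
    subspace cut out by [wg], with the inherited norm. *)
Definition KK : phs R := prod_phs H Y.
Local Notation Int f := (Rintegral nu Om f).

Lemma LL_complete m n : hcomplete (LL m n).
Proof. by apply: L2_complete => //; exact: mx_complete. Qed.

Lemma KK_complete : hcomplete KK.
Proof. by apply: prod_complete; exact: LL_complete. Qed.

Lemma LpO_mem m n (u : P -> 'M[R]_(m, n)) :
  in_LpO Om 2%:E u <-> L2mem nu Om (u : P -> mxphs R m n).
Proof. by split=> h; apply/(L2mem_frob nu mO). Qed.

Lemma LpO_normE m n (x : LL m n) : LpO_norm Om 2%:E (fun z => frob (val x z : 'M[R]_(m, n))) = (hn x)%:E.
Proof. exact: Lnorm_frob. Qed.

Lemma LL_inj m n (x y : LL m n) : val x = val y -> x = y.
Proof. exact: val_inj. Qed.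

Lemma LL_meas m n (x : LL m n) i j : measurable_fun Om (fun z => (val x z : 'M[R]_(m, n)) i j : measurableTypeR R).
Proof. by apply: mx_cleanE => //; exact: L2_clean. Qed.

Lemma LL_itg m n (x : LL m n) i j : itg nu Om (fun z => (val x z : 'M[R]_(m, n)) i j).
Proof.
apply: (itg_le mO _ (L2_hn_itg fO x)); first exact: LL_meas.
by move=> z _; exact: entry_le.
Qed.

Lemma tst_mem m n (phi : P -> R) (i : 'I_m) (j : 'I_n) : test_fun Om phi ->
  L2mem nu Om (fun z => phi z *: (delta_mx i j : 'M[R]_(m, n)) : mxphs R m n).
Proof.
move=> h; have m1 := test_meas h; split; first by apply: clean_scale => //; exact: measurable_funTS.
apply: (itg_eq mO _ (test_itg oO OM (testM h h))) => z _.
by rewrite ipZl ipZr [ip _ _]mxdot_delta mxE !eqxx mulr1.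
Qed.
Definition tst m n (phi : P -> R) (h : test_fun Om phi) (i : 'I_m) (j : 'I_n) : LL m n :=
  mkL2 mO (tst_mem i j h).

Lemma tst_ip m n (x : LL m n) phi (h : test_fun Om phi) i j :
  ip x (tst h i j) = Int (fun z => (val x z : 'M[R]_(m, n)) i j * phi z).
Proof.
rewrite L2ipE; apply: Int_eq => z _.
rewrite [LHS](ipZr (phi z) (delta_mx i j : mxphs R m n) (val x z)) mulrC; congr (_ * _).
exact: mxdot_delta.
Qed.

Lemma LL_test0 m n (x : LL m n) :
  (forall phi (h : test_fun Om phi) i j, ip x (tst h i j) = 0) -> hn x = 0.
Proof.
move=> h0; apply/L2_hn0P.
have hz i j : \forall z \ae nu, Om z -> (val x z : 'M[R]_(m, n)) i j = 0.
  apply: (fundamental oO); first exact: LL_itg.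
  by move=> phi hphi; rewrite -tst_ip.
have : \forall z \ae nu, forall i j, Om z -> (val x z : 'M[R]_(m, n)) i j = 0.
  by apply: filter_forall => i; apply: filter_forall => j; exact: hz.
apply: filterS => z hz' Oz; rewrite /hn [ip _ _]big1 ?sqrtr0 // => i _.
by rewrite big1 // => j _; rewrite hz' // mulr0.
Qed.

Definition wg (k : KK) : Prop := forall phi (h : test_fun Om phi) (i j : 'I_2),
  ip k.1 (tst (test_derive (unit_dir R j) h) i 0) = - ip k.2 (tst h i j).

Lemma wgP (k : KK) : is_weak_grad Om (val k.1 : vfield R) (val k.2 : mfield R) <-> wg k.
Proof.
split=> [[_ h] phi hp i j|h]; first by rewrite !tst_ip; exact: h.
split; first by apply/LpO_mem; exact: L2val.
by move=> phi hp i j; have := h phi hp i j; rewrite !tst_ip.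
Qed.

Lemma wgL a k l : wg k -> wg l -> wg (a *: k + l).
Proof.
move=> hk hl phi h i j; rewrite [LHS]ipDl [X in - X]ipDl !ipZl hk hl mulrN -opprD.
by [].
Qed.

Lemma wg_cvg (u : nat -> KK) k : (forall n, wg (u n)) -> hcvg u k -> wg k.
Proof.
move=> hu uk phi h i j.
have c1 := hcvg_ip (hcvg_fst uk) (hcvg_const (tst (test_derive (unit_dir R j) h) i 0)).
have c2 := cvN (hcvg_ip (hcvg_snd uk) (hcvg_const (tst h i j))).
apply: cv_uniq c1 _; have -> // : (fun n => ip (u n).1 (tst (test_derive (unit_dir R j) h) i 0)) =
  (fun n => - ip (u n).2 (tst h i j)) by apply/funext => n; exact: hu.
Qed.

(** The gradient component is orthogonal to all test matrices, hence null. This yields uniqueness of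
    weak gradients as well as injectivity of [V] into [H]. *)
Lemma wg0 k : wg k -> hn k.1 = 0 -> hn k = 0.
Proof.
move=> hk k0; apply/eqP; rewrite eq_le hn_ge0 andbT; apply: le_trans (prod_hn_le k) _.
have k2 : hn k.2 = 0; last by rewrite k0 k2 addr0.
apply: LL_test0 => phi h i j.
by apply: oppr_inj; rewrite -hk oppr0; exact: ip_hn0.
Qed.

(** [weak_grad] chooses one representative among gradients that agree almost everywhere, and the
    choice is not linear. Linear relations between the pairs [k] therefore hold only up to norm
    zero. *)
Definition gr (u : vfield R) (k : KK) : Prop :=
  [/\ in_H1 Om u, val k.1 = u & val k.2 = weak_grad Om u].

Lemma gr_ex u : in_H1 Om u -> exists k, gr u k.
Proof.
move=> hu; have [/LpO_mem u2 ex] := hu; have [/LpO_mem g2 _] := getPex ex.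
by exists (mkL2 mO u2, mkL2 mO g2).
Qed.

Lemma gr_wg u k : gr u k -> wg k.
Proof.
move=> [[_ ex] e1 e2]; apply/wgP; rewrite e1 e2; exact: getPex ex.
Qed.

Lemma wg_H1 k : wg k -> in_H1 Om (val k.1 : vfield R).
Proof.
move=> /wgP h; split; last by exists (val k.2).
by apply/LpO_mem; exact: L2val.
Qed.

Lemma gr_uniq u k l : gr u k -> wg l -> val l.1 = u -> hn (k - l) = 0.
Proof.
move=> gk wl e; have [_ e1 _] := gk; apply: wg0.
  have -> : k - l = (-1) *: l + k by rewrite scaleN1r addrC.
  by apply: wgL => //; exact: gr_wg gk.
by rewrite [(k - l).1](_ : _ = 0) ?hn0 //; apply: LL_inj => /=; rewrite e1 e subrr.
Qed.

Lemma gr_lin a u v k l : gr u k -> gr v l -> exists2 m, gr (a *: u + v) m &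
  hn (m - (a *: k + l)) = 0.
Proof.
move=> gu gv; have wm := wgL a (gr_wg gu) (gr_wg gv).
have [[_ eu _] [_ ev _]] := (gu, gv).
have e : val (a *: k + l).1 = a *: u + v by rewrite /= eu ev.
have [m gm] : exists m, gr (a *: u + v) m by apply: gr_ex; rewrite -e; exact: wg_H1.
by exists m => //; exact: gr_uniq gm wm e.
Qed.

Lemma H1_normE u k : gr u k -> H1_norm Om u = (hn k)%:E.
Proof.
move=> [_ e1 e2]; rewrite /H1_norm /LpO_norm -e2 -e1.
have e z : Num.sqrt (frob (val k.1 z : 'cV[R]_2) ^+ 2 + frob (val k.2 z : 'M[R]_2) ^+ 2) ^+ 2 =
    ip (val k.1 z) (val k.1 z) + ip (val k.2 z) (val k.2 z).
  by rewrite sqr_sqrtr ?addr_ge0 ?sqr_ge0 // !sqr_sqrtr ?mxdot_ge0.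
have i1 := L2_itg k.1 k.1; have i2 := L2_itg k.2 k.2.
rewrite Lnorm2_val //; last by apply: (itg_eq mO _ (itgD mO i1 i2)) => z _; rewrite e.
have e3 : ip k k = Int (fun z => ip (val k.1 z) (val k.1 z)) + Int (fun z => ip (val k.2 z) (val k.2 z)) by [].
rewrite /hn e3 -(IntD mO i1 i2); congr (Num.sqrt _)%:E.
by apply: Int_eq => z _; rewrite e.
Qed.

Definition tfield (phi : vfield R) : Prop := forall i, test_fun Om (fun x => phi x i 0).

Lemma tfield_mem (phi : vfield R) : tfield phi -> L2mem nu Om (phi : P -> mxphs R 2 1).
Proof.
move=> h; split.
  by apply: mx_clean => // i j; rewrite ord1; apply: measurable_funTS; exact: test_meas.
have hs : itg nu Om (fun z => \sum_(i < 2) \sum_(j < 1) phi z i j * phi z i j).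
  apply: itg_sum => // i; apply: itg_sum => // j; rewrite ord1.
  by apply: (test_itg oO OM); exact: testM.
exact: hs.
Qed.

Definition tgrad (phi : vfield R) : mfield R :=
  fun z => \matrix_(i, j) 'D_(unit_dir R j) (fun x => phi x i 0) z.

Lemma tgrad_mem (phi : vfield R) : tfield phi -> L2mem nu Om (tgrad phi : P -> mxphs R 2 2).
Proof.
move=> h; have hd i j : test_fun Om (fun z => tgrad phi z i j).
  rewrite (_ : (fun z => tgrad phi z i j) = (fun z => 'D_(unit_dir R j) (fun x => phi x i 0) z)).
    by apply: test_derive; exact: h.
  by apply/funext => z; rewrite mxE.
split; first by apply: mx_clean => // i j; apply: measurable_funTS; exact: test_meas.
have hs : itg nu Om (fun z => \sum_(i < 2) \sum_(j < 2) tgrad phi z i j * tgrad phi z i j).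
  by apply: itg_sum => // i; apply: itg_sum => // j; apply: (test_itg oO OM); exact: testM.
exact: hs.
Qed.

Definition TT := {phi : vfield R | tfield phi}.
Definition tK (s : TT) : KK :=
  (mkL2 mO (tfield_mem (svalP s)), mkL2 mO (tgrad_mem (svalP s))).

Lemma tK_wg s : wg (tK s).
Proof.
move=> psi hp i j; rewrite !tst_ip /= (test_ibp oO M0 OM j (svalP s i) hp).
by congr (- _); apply: Int_eq => z _; rewrite mxE.
Qed.

Lemma tfieldL a phi psi : tfield phi -> tfield psi -> tfield (a *: phi + psi).
Proof.
move=> h k i; rewrite (_ : (fun _ => _) = (fun x => a * phi x i 0 + psi x i 0)).
  by apply: testD; [apply: testZ; exact: h|exact: k].
by apply/funext => z; rewrite !mxE.
Qed.

Lemma tfield_delta phi (i : 'I_2) : test_fun Om phi ->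
  tfield (fun z => phi z *: (delta_mx i 0 : 'cV[R]_2)).
Proof.
move=> h j; rewrite (_ : (fun _ => _) = (fun z => (j == i)%:R * phi z)); first exact: testZ.
by apply/funext => z; rewrite !mxE eqxx andbT mulrC.
Qed.

Lemma in_H10E u k : gr u k -> (in_H10 Om u <->
  forall e : R, 0 < e -> exists s : TT, hn (k - tK s) < e).
Proof.
move=> gk; have [hu _ _] := gk.
have key s : H1_norm Om (u - sval s) = (hn (k - tK s))%:E.
  have [l gl] : exists l, gr (sval s) l.
    by apply: gr_ex; exact: (wg_H1 (tK_wg s)).
  have le := gr_uniq gl (tK_wg s) erefl.
  have [m gm em] := gr_lin (-1) gl gk.
  have e : -1 *: sval s + u = u - sval s by rewrite scaleN1r addrC.
  rewrite -e (H1_normE gm); congr (_%:E); apply: hn_eq0; apply: hn0_tri em _.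
  by rewrite scaleN1r opprB -addrA (addrC k) subrK addrC hnBC.
split=> [[_ h] e e0|h].
  have [phi [hp lt]] := h e e0; exists (exist _ phi hp); rewrite -lte_fin -key; exact: lt.
split=> // e e0; have [s lt] := h e e0; exists (sval s); split; first exact: (svalP s).
by rewrite key lte_fin.
Qed.

Lemma in_H10L a u v : in_H10 Om u -> in_H10 Om v -> in_H10 Om (a *: u + v).
Proof.
move=> hu hv; have [k gk] := gr_ex hu.1; have [l gl] := gr_ex hv.1.
have [m gm em] := gr_lin a gk gl; apply/(in_H10E gm) => e e0.
have e1 : 0 < e / (2 * (`|a| + 1)) by rewrite divr_gt0 // mulr_gt0 // ltr_wpDl.
have e2 : 0 < e / 2 by rewrite divr_gt0.
have [s lp] := (in_H10E gk).1 hu _ e1.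
have [s' lq] := (in_H10E gl).1 hv _ e2.
pose s2 : TT := exist _ _ (tfieldL a (svalP s) (svalP s')); exists s2.
have [r gr' er] : exists2 r, gr (sval s2) r & hn (r - (a *: tK s + tK s')) = 0.
  have w := wgL a (tK_wg s) (tK_wg s').
  have [r gr'] : exists r, gr (sval s2) r by apply: gr_ex; exact: (wg_H1 w).
  exists r; first exact: gr'.
  exact: (gr_uniq gr' w erefl).
have er' := gr_uniq gr' (tK_wg s2) erefl.
apply: le_lt_trans (hn_triB m (a *: k + l) _) _; rewrite em add0r.
apply: le_lt_trans (hn_triB _ (a *: tK s + tK s') _) _.
have -> : hn (a *: tK s + tK s' - tK s2) = 0.
  by apply: hn0_tri er'; rewrite hnBC.
rewrite addr0 opprD addrACA -scalerBr; apply: le_lt_trans (hnD _ _) _.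
rewrite hnZ [X in _ < X]splitr; apply: ltr_leD => //; last exact: ltW.
rewrite -(ltr_pM2l (_ : 0 < (`|a| + 1))) in lp; last by rewrite ltr_wpDl.
apply: le_lt_trans (_ : (`|a| + 1) * hn (k - tK s) < _).
  by rewrite ler_wpM2r ?hn_ge0 // lerDl.
apply: lt_le_trans lp _; rewrite le_eqVlt; apply/orP; left; apply/eqP.
by field; rewrite gt_eqF // ltr_wpDl.
Qed.

Lemma tfield0 : tfield 0.
Proof.
move=> i; rewrite (_ : (fun _ => _) = (fun=> 0)); last by apply/funext => z; rewrite mxE.
split; first by move=> k; exact: Ck_cst.
by exists set0; split=> //; exact: compact0.
Qed.

Lemma tfield_H10 phi : tfield phi -> in_H10 Om phi.
Proof.
move=> h; pose s : TT := exist _ _ h.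
have [k gk] : exists k, gr phi k by apply: gr_ex; exact: (wg_H1 (tK_wg s)).
by apply/(in_H10E gk) => e e0; exists s; rewrite (gr_uniq gk (tK_wg s)).
Qed.

Definition H10sub : submod (P -> 'cV[R]_2) := Submod (tfield_H10 tfield0) in_H10L.

Lemma kk_ex (x : sub_of H10sub) : exists k, gr (val x) k.
Proof. by apply: gr_ex; have [] := sub_ofP x. Qed.
Definition kk (x : sub_of H10sub) : KK := sval (cid (kk_ex x)).
Lemma kk_gr x : gr (val x) (kk x). Proof. exact: svalP (cid (kk_ex x)). Qed.

Lemma kk_val1 x : val (kk x).1 = val x. Proof. by have [] := kk_gr x. Qed.
Lemma kk_val2 x : val (kk x).2 = weak_grad Om (val x). Proof. by have [] := kk_gr x. Qed.

Lemma kkL a x y : hn (kk (a *: x + y) - (a *: kk x + kk y)) = 0.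
Proof.
apply: gr_uniq (kk_gr _) (wgL a (gr_wg (kk_gr x)) (gr_wg (kk_gr y))) _.
by rewrite /= !kk_val1.
Qed.

Definition Vip (x y : sub_of H10sub) : R := ip (kk x) (kk y).
Lemma VipDl x y z : Vip (x + y) z = Vip x z + Vip y z.
Proof.
by have := hn_ipl_eq (kk z) (kkL 1 x y); rewrite !scale1r /Vip => ->; rewrite ipDl.
Qed.
Lemma VipZl a x z : Vip (a *: x) z = a * Vip x z.
Proof.
have z0 : Vip 0 z = 0 by have := VipDl 0 0 z; rewrite addr0 => /eqP; rewrite -subr_eq0 opprD addNKr oppr_eq0 => /eqP.
have := hn_ipl_eq (kk z) (kkL a x 0); rewrite addr0 /Vip => ->.
by rewrite ipDl ipZl -[ip (kk 0) _]/(Vip 0 z) z0 addr0.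
Qed.
Definition VV : phs R := Phs VipDl VipZl (fun x y => ipC (kk x) (kk y)) (fun x => ip_ge0 (kk x)).

Lemma kkB (x y : VV) : hn (kk (x - y) - (kk x - kk y)) = 0.
Proof.
have := kkL (-1) y x; rewrite !scaleN1r [- y + x]addrC [- kk y + kk x]addrC.
by [].
Qed.

Lemma V_of_wg k : wg k -> in_H10 Om (val k.1 : vfield R) -> exists x : VV, hn (kk x - k) = 0.
Proof.
move=> wk h; exists (@mkSub R _ H10sub _ h).
exact: (gr_uniq (kk_gr (@mkSub R _ H10sub _ h)) wk erefl).
Qed.

Lemma kk_hcvg (u : nat -> VV) (x : VV) : hcvg u x <-> hcvg (fun n => kk (u n)) (kk x).
Proof.
have e n : hn (u n - x) = hn (kk (u n) - kk x) by apply: (@hn_eq0 _ KK); exact: kkB.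
by rewrite /hcvg; under eq_fun do rewrite e.
Qed.

Lemma VV_complete : hcomplete VV.
Proof.
move=> u hu; have hk : hcauchy (fun n => kk (u n)).
  move=> e /hu[N hN]; exists N => n m Nn Nm; have := hN n m Nn Nm.
  by rewrite -(hn_eq0 (kkB (u n) (u m))).
have [k uk] := KK_complete hk.
have wk : wg k by apply: wg_cvg uk => n; exact: gr_wg (kk_gr _).
have [l gl] := gr_ex (wg_H1 wk); have ekl := gr_uniq gl wk erefl.
have h10 : in_H10 Om (val k.1 : vfield R).
  apply/(in_H10E gl) => e e0; have e2 : 0 < e / 2 by rewrite divr_gt0.
  have [N hN] := (cvP _ _).1 uk _ e2; have := hN N (leqnn _).
  rewrite subr0 ger0_norm ?hn_ge0 // => lt1.
  have [s lt2] := (in_H10E (kk_gr (u N))).1 (sub_ofP (u N)) _ e2.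
  exists s; apply: le_lt_trans (hn_triB l k _) _; rewrite ekl add0r.
  apply: le_lt_trans (hn_triB k (kk (u N)) _) _; rewrite [hn (k - _)]hnBC [X in _ < X]splitr.
  exact: (ltrD lt1 lt2).
have [x ex] := V_of_wg wk h10; exists x; apply/kk_hcvg; apply: hcvg_eq uk _.
by rewrite hnBC.
Qed.

Definition iV (x : VV) : H := (kk x).1.
Lemma iVL (a : R) (x y : VV) : iV (a *: x + y) = a *: iV x + iV y.
Proof. by apply: LL_inj; rewrite /iV kk_val1 /= !kk_val1. Qed.
Lemma iV_le x : hn (iV x) <= 1 * hn x.
Proof. by rewrite mul1r; exact: prod_hn1. Qed.
Lemma iV_inj (x : VV) : hn (iV x) = 0 -> hn x = 0.
Proof. exact: (wg0 (gr_wg (kk_gr x))). Qed.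

Definition tV phi (h : tfield phi) : VV := @mkSub R _ H10sub phi (tfield_H10 h).
Lemma iV_dense (xi : H) : (forall v, ip xi (iV v) = 0) -> hn xi = 0.
Proof.
move=> h0; apply: LL_test0 => phi h i j; rewrite ord1.
rewrite -[RHS](h0 (tV (tfield_delta i h))); congr (ip _ _); apply: LL_inj.
by rewrite /iV kk_val1.
Qed.

Lemma VV_dense (x : VV) : exists s : nat -> TT, hcvg (fun n => tK (s n)) (kk x).
Proof.
have hx n : exists s : TT, hn (kk x - tK s) < n.+1%:R^-1.
  by apply: (in_H10E (kk_gr x)).1 (sub_ofP x) _ _; rewrite invr_gt0.
have [f hf] := choice hx; exists f.
apply: cv_squeeze0 (@cv_harmonic R) => n; rewrite hn_ge0 hnBC; exact: ltW (hf n).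
Qed.

Lemma trY_mem (g : Y) : L2mem nu Om (fun z => (val g z : 'M[R]_2)^T : mxphs R 2 2).
Proof.
split.
  apply: mx_clean => // i j; rewrite (_ : (fun _ => _) = (fun z => (val g z : 'M[R]_2) j i)); first exact: LL_meas.
  by apply/funext => z; rewrite mxE.
apply: (itg_eq mO _ (L2_itg g g)) => z _; rewrite /= /mxdot [LHS]exchange_big.
by apply: eq_bigr => i _; apply: eq_bigr => j _; rewrite !mxE.
Qed.
Definition trY (g : Y) : Y := mkL2 mO (trY_mem g).

Lemma trY_lin a g h : trY (a *: g + h) = a *: trY g + trY h.
Proof. by apply: LL_inj; apply/funext => z; rewrite /= linearP. Qed.

Lemma trY_ip g h : ip (trY g) (trY h) = ip g h.
Proof.
rewrite !L2ipE; apply: Int_eq => z _; rewrite /= /mxdot [LHS]exchange_big.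
by apply: eq_bigr => i _; apply: eq_bigr => j _; rewrite !mxE.
Qed.

Lemma trY_hn g : hn (trY g) = hn g. Proof. by rewrite /hn trY_ip. Qed.

Lemma trYB g h : trY (g - h) = trY g - trY h.
Proof. by rewrite addrC -scaleN1r trY_lin scaleN1r addrC. Qed.

Lemma trY_hcvg (u : nat -> Y) g : hcvg u g -> hcvg (fun n => trY (u n)) (trY g).
Proof. by rewrite /hcvg; under [in X in _ -> X]eq_fun do rewrite -trYB trY_hn. Qed.

Definition symY (g : Y) : Y := 2^-1 *: (g + trY g).
Definition eV (x : VV) : Y := symY (kk x).2.

Lemma eV_val x : val (eV x) = sym_grad Om (val x).
Proof. by apply/funext => z; rewrite /= !kk_val2. Qed.

Lemma symY_sq g : ip (symY g) (symY g) = 2^-1 * (ip g g + ip g (trY g)).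
Proof. by rewrite /symY ipZl ipZr ip_sqD trY_ip; field. Qed.

Lemma symY_le g : hn (symY g) <= hn g.
Proof.
rewrite /symY hnZ ger0_norm ?invr_ge0 // -(ler_pM2l (_ : (0:R) < 2)) // mulrA divff ?mul1r //.
by apply: le_trans (hnD _ _) _; rewrite trY_hn mulr2n mulrDl mul1r.
Qed.

Lemma symYB g h : symY (g - h) = symY g - symY h.
Proof. by rewrite /symY trYB -scalerBr; congr (_ *: _); rewrite opprD addrACA. Qed.

Lemma eV_le x : hn (eV x) <= hn x.
Proof. by apply: le_trans (symY_le _) _; exact: prod_hn2. Qed.

Section TestField.
Variable h : TT.
Let phi : vfield R := sval h.
Let f i z := phi z i 0.
Let d i j z := 'D_(unit_dir R j) (f i) z.

Lemma tK1_sq : ip (tK h).1 (tK h).1 = Int (fun z => f 0 z ^+ 2) + Int (fun z => f 1 z ^+ 2).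
Proof.
rewrite -(IntD mO); last 2 first.
- by apply: (test_itg oO OM); exact: (testM (svalP h 0) (svalP h 0)).
- by apply: (test_itg oO OM); exact: (testM (svalP h 1) (svalP h 1)).
by rewrite L2ipE; apply: Int_eq => z _; rewrite [LHS]sum_I2 !big_ord1 -!expr2.
Qed.

Lemma d_test i j : test_fun Om (d i j).
Proof. by apply: test_derive; exact: (svalP h). Qed.

Lemma d_itg i j k l : itg nu Om (fun z => d i j z * d k l z).
Proof. by apply: (test_itg oO OM); apply: testM; exact: d_test. Qed.

Lemma tK2_ip : ip (tK h).2 (trY (tK h).2) =
  Int (fun z => d 0 0 z * d 0 0 z + d 0 1 z * d 1 0 z + (d 1 0 z * d 0 1 z + d 1 1 z * d 1 1 z)).
Proof. by rewrite L2ipE; apply: Int_eq => z _; rewrite [LHS]sum_I2 !sum_I2 !mxE. Qed.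

Lemma tK2_sq : ip (tK h).2 (tK h).2 =
  Int (fun z => d 0 0 z ^+ 2) + Int (fun z => d 0 1 z ^+ 2) + (Int (fun z => d 1 0 z ^+ 2) + Int (fun z => d 1 1 z ^+ 2)).
Proof.
have i2 i j : itg nu Om (fun z => d i j z ^+ 2) by exact: d_itg.
rewrite -(Int_sq4 mO (i2 0 0) (i2 0 1) (i2 1 0) (i2 1 1)).
by rewrite L2ipE; apply: Int_eq => z _; rewrite [LHS]sum_I2 !sum_I2 !mxE -!expr2.
Qed.

Lemma tK_korn : 0 <= ip (tK h).2 (trY (tK h).2).
Proof.
rewrite tK2_ip; have e : Int (fun z => d 0 1 z * d 1 0 z) = Int (fun z => d 0 0 z * d 1 1 z).
  exact: (test_cross oO M0 OM (svalP h 0) (svalP h 1)).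
exact: (Int_cross4 mO (d_itg 0 0 0 0) (d_itg 1 1 1 1) (d_itg 0 1 1 0) (d_itg 0 0 1 1) e).
Qed.

Lemma tK_poincare : ip (tK h).1 (tK h).1 <= (4 * M) ^+ 2 * ip (tK h).2 (tK h).2.
Proof.
rewrite tK1_sq tK2_sq; have h0 := test_poincare oO M0 OM (svalP h 0); have h1 := test_poincare oO M0 OM (svalP h 1).
by apply: alg_poincare h0 h1; [exact: sqr_ge0|exact: Int_sq_ge0|exact: Int_sq_ge0].
Qed.

Lemma tK_lady : itg nu Om (fun z => frob (phi z) ^+ 4) /\ Int (fun z => frob (phi z) ^+ 4) <= 16 * ip (tK h).1 (tK h).1 * ip (tK h).2 (tK h).2.
Proof.
have f4 z : frob (phi z) ^+ 4 = (f 0 z ^+ 2 + f 1 z ^+ 2) ^+ 2.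
  by rewrite (exprM _ 2 2) sqr_sqrtr ?mxdot_ge0 // /mxdot sum_I2 !big_ord1 -!expr2.
have i4 i : itg nu Om (fun z => f i z ^+ 4).
  apply: (itg_eq mO _ (test_itg oO OM (testM (testM (svalP h i) (svalP h i)) (testM (svalP h i) (svalP h i))))) => z _.
  by rewrite /f; ring.
have i4s : itg nu Om (fun z => 2 * (f 0 z ^+ 4 + f 1 z ^+ 4)) by apply: itgZ => //; exact: itgD.
have pw z : frob (phi z) ^+ 4 <= 2 * (f 0 z ^+ 4 + f 1 z ^+ 4).
  rewrite f4 -subr_ge0 (_ : _ - _ = (f 0 z ^+ 2 - f 1 z ^+ 2) ^+ 2) ?sqr_ge0 //.
  by move: (f 0 z) (f 1 z) => a b; ring.
have mp : measurable_fun Om (fun z => frob (phi z) ^+ 4).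
  apply: measurable_funX; apply: (@meas_hn _ _ _ Om (mxphs R 2 1) phi mO).
  by have [] := tfield_mem (svalP h).
have ip4 : itg nu Om (fun z => frob (phi z) ^+ 4).
  apply: (itg_le mO mp i4s) => z _; rewrite ger0_norm ?pw // exprn_ge0 //; exact: sqrtr_ge0.
split=> //; apply: le_trans (Int_le mO ip4 i4s (fun z _ => pw z)) _.
rewrite (IntZ mO) ?(IntD mO) //; last exact: itgD.
have l0 := test_ladyzhenskaya oO M0 OM (svalP h 0); have l1 := test_ladyzhenskaya oO M0 OM (svalP h 1).
rewrite tK1_sq tK2_sq; move: l0 l1; rewrite -/(d 0 0) -/(d 0 1).
by apply: alg_lady; exact: Int_sq_ge0.
Qed.

End TestField.

(** The squared norm of the symmetric part of [g] is [(|g|^2 + g : g^T) / 2]. The last term is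
    nonnegative for test fields by [tK_korn], and this passes to their limits. *)
Lemma korn (x : VV) : 2^-1 * ip (kk x).2 (kk x).2 <= ip (eV x) (eV x).
Proof.
have [s hs] := VV_dense x; have h2 := hcvg_snd hs.
have hB : 0 <= ip (kk x).2 (trY (kk x).2).
  apply: (cv_le _ (cvC 0) (hcvg_ip h2 (trY_hcvg h2))) => n; exact: tK_korn.
by rewrite symY_sq ler_pM2l ?invr_gt0 // lerDl.
Qed.

Lemma poincare (x : VV) : ip (kk x).1 (kk x).1 <= (4 * M) ^+ 2 * ip (kk x).2 (kk x).2.
Proof.
have [s hs] := VV_dense x; have h1 := hcvg_fst hs; have h2 := hcvg_snd hs.
by apply: (cv_le _ (hcvg_ip h1 h1) (cvZ _ (hcvg_ip h2 h2))) => n; exact: tK_poincare.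
Qed.

Lemma eV_coercive (x : VV) : hn x ^+ 2 <= 2 * (1 + (4 * M) ^+ 2) * hn (eV x) ^+ 2.
Proof.
rewrite !hn_sq; have hk := korn x; have hp := poincare x; have M2 := sqr_ge0 (4 * M).
have -> : ip x x = ip (kk x).1 (kk x).1 + ip (kk x).2 (kk x).2 by [].
move: (ip (kk x).1 _) (ip (kk x).2 _) (ip (eV x) _) ((4 * M) ^+ 2) hk hp M2 => a b c m hk hp m0.
have : (1 + m) * b <= (1 + m) * (2 * c) by rewrite ler_wpM2l //; lra.
by lra.
Qed.

(** The fourth power of the approximating fields is not known to converge in [L^1], so Fatou's lemma
    is used along a subsequence converging almost everywhere. A uniform bound of the tail costs an
    arbitrary [e], which is removed at the end. *)
Lemma ladyzhenskaya (x : VV) : itg nu Om (fun z => frob (val x z) ^+ 4) /\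
  Int (fun z => frob (val x z) ^+ 4) <= 16 * hn (iV x) ^+ 2 * hn x ^+ 2.
Proof.
have [s hs] := VV_dense x; have h1 := hcvg_fst hs; have h2 := hcvg_snd hs.
have [g [gn gae]] := L2_ae_subseq h1.
have cb : cv (fun n => 16 * ip (tK (s n)).1 (tK (s n)).1 * ip (tK (s n)).2 (tK (s n)).2)
  (16 * ip (kk x).1 (kk x).1 * ip (kk x).2 (kk x).2).
  by apply: cvM; [apply: cvZ; exact: hcvg_ip|exact: hcvg_ip].
have mx : measurable_fun Om (fun z => frob (val x z) ^+ 4).
  apply: measurable_funX; apply: (@meas_hn _ _ _ Om (mxphs R 2 1) (val x) mO).
  by rewrite -kk_val1; exact: L2_clean.
have key (e : R) : 0 < e -> itg nu Om (fun z => frob (val x z) ^+ 4) /\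
    Int (fun z => frob (val x z) ^+ 4) <= 16 * ip (kk x).1 (kk x).1 * ip (kk x).2 (kk x).2 + e.
  move=> e0; have [N hN] := (cvP _ _).1 cb _ e0.
  apply: (@fatou_ae _ _ _ nu Om mO (fun n z => frob (sval (s (g (N + n)%N)) z) ^+ 4)) => //.
  - move=> n; have [hm _] := tK_lady (s (g (N + n)%N)); exact: itg_meas hm.
  - by move=> z _; rewrite exprn_ge0 // sqrtr_ge0.
  - by move=> n z _; rewrite exprn_ge0 // sqrtr_ge0.
  - apply: filterS gae => z hz Oz; have := hcvg_hn (hz Oz); rewrite kk_val1 => c1.
    have c2 := cv_sub (fun n => leq_addl N n) c1.
    exact: (cvX 4 c2).
  - move=> n; have [hm hle] := tK_lady (s (g (N + n)%N)); split=> //.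
    apply: le_trans hle _; rewrite -lerBlDl; apply: le_trans (ler_norm _) _; apply: ltW; apply: hN.
    exact: leq_trans (leq_addr _ _) (gn _).
split; first by have [] := key 1 ltr01.
have : Int (fun z => frob (val x z) ^+ 4) <= 16 * ip (kk x).1 (kk x).1 * ip (kk x).2 (kk x).2.
  by apply/ler_addgt0Pr => e /key[].
move=> h; apply: le_trans h _; rewrite !hn_sq -!mulrA ler_pM2l // ler_wpM2l ?ip_ge0 //.
by rewrite [leRHS](_ : _ = ip (kk x).1 (kk x).1 + ip (kk x).2 (kk x).2) // lerDr ip_ge0.
Qed.

End Spatial.

(** * The stress and the oceanic force *)

(** Here [r1], [r2] are the norms of two vectors, [p] their inner product and [k1], [k2] their
    radial factors. As [k1 + k2 >= 2 * c], the worst case is [p = r1 * r2], that of parallel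
    vectors, where the claim is the slope bound times [r2 - r1]. *)
Lemma alg_mono (R : realFieldType) (r1 r2 p k1 k2 c : R) : 0 <= r1 -> 0 <= r2 -> p <= r1 * r2 ->
  c <= k1 -> c <= k2 -> r1 <= r2 -> c * (r2 - r1) <= r2 * k2 - r1 * k1 ->
  c * (r1 ^+ 2 - 2 * p + r2 ^+ 2) <= k1 * r1 ^+ 2 - k1 * p - (k2 * p - k2 * r2 ^+ 2).
Proof.
move=> r10 r20 pr ck1 ck2 r12 h.
have h1 : 0 <= (k1 + k2 - 2 * c) * (r1 * r2 - p) by rewrite mulr_ge0 // ?subr_ge0 //; lra.
have h2 : 0 <= (r2 - r1) * (r2 * k2 - r1 * k1 - c * (r2 - r1)) by rewrite mulr_ge0 // subr_ge0.
lra.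
Qed.

(** For vectors [a], [b]: [p = |a|], [q = |b|], [e = |a - b|], [u = f p], [v = f q], [X] is their
    cross product, [C] and [S] the cosine and sine of the turning angle. The radial part is at least
    [(u + v) / 2 * e ^+ 2], and the rotated part [(u - v) * X] is at most that in absolute value, so
    [S <= C] decides. *)
Lemma alg_ocean (R : realFieldType) (p q e u v X C S : R) : u <= v -> v - u <= q - p ->
  (u < v -> u = p) -> p <= q -> 0 <= u -> u <= p -> q - p <= e -> 0 <= e -> 0 <= p ->
  `|X| <= p * e -> 0 <= S -> S <= C ->
  0 <= C * (u * p ^+ 2 - (u + v) * ((p ^+ 2 + q ^+ 2 - e ^+ 2) / 2) + v * q ^+ 2) - S * ((u - v) * X).
Proof.
move=> uv vu hup pq u0 up qe e0 p0 hX S0 SC.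
have h0 : (u + v) / 2 * e ^+ 2 <= u * p ^+ 2 - (u + v) * ((p ^+ 2 + q ^+ 2 - e ^+ 2) / 2) + v * q ^+ 2.
  have : 0 <= (v - u) * ((q - p) * (q + p)) by rewrite !mulr_ge0 ?subr_ge0 ?addr_ge0 // (le_trans p0).
  lra.
have h1 : `|(u - v) * X| <= (u + v) / 2 * e ^+ 2.
  rewrite normrM; have [lt|ge] := ltP u v; last first.
    have -> : u = v by apply/eqP; rewrite eq_le uv ge.
    rewrite subrr normr0 mul0r mulr_ge0 ?sqr_ge0 //; lra.
  have eup := hup lt; rewrite ler0_norm ?subr_le0 // opprB.
  apply: le_trans (_ : e * (p * e) <= _); first by apply: ler_pM => //; lra.
  have : 0 <= (v - p) * e ^+ 2 by rewrite mulr_ge0 ?sqr_ge0 // subr_ge0 -eup.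
  rewrite eup; lra.
have e20 : 0 <= (u + v) / 2 * e ^+ 2 by rewrite mulr_ge0 ?sqr_ge0 //; lra.
have h2 : S * ((u - v) * X) <= S * ((u + v) / 2 * e ^+ 2).
  by rewrite ler_wpM2l //; apply: le_trans (ler_norm _) h1.
have h3 : S * ((u + v) / 2 * e ^+ 2) <= C * ((u + v) / 2 * e ^+ 2) by rewrite ler_wpM2r.
have h4 : C * ((u + v) / 2 * e ^+ 2) <=
   C * (u * p ^+ 2 - (u + v) * ((p ^+ 2 + q ^+ 2 - e ^+ 2) / 2) + v * q ^+ 2).
  by rewrite ler_wpM2l // (le_trans S0).
lra.
Qed.

(** * Radial maps with a clamped regularised denominator *)

Section ClampedNorm.
Variables (R : realType) (E : phs R) (d : R -> R) (eps ds dm : R).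
Hypotheses (eps0 : 0 < eps) (dm0 : 0 < dm) (dmd : forall r, dm <= d r <= ds).
Local Notation s r := (Num.sqrt (eps + r ^+ 2)).
Hypothesis dmono : forall r1 r2, 0 <= r1 -> r1 <= r2 -> d r1 <= d r2.
(** Covers both cut-offs at once: if [d] really increases from [r1] to [r2], the upper cut-off is
    inactive at [r1] and the lower one at [r2]. *)
Hypothesis dclamp : forall r1 r2, 0 <= r1 -> r1 <= r2 -> d r1 < d r2 -> s r1 <= d r1 /\ d r2 <= s r2.
(** The smaller of two slopes: [ds^-1] where the denominator is frozen, and [eps / ds ^+ 3]
    elsewhere, since the derivative of [r / s r] is [eps / (s r)^3]. *)
Definition cc : R := Num.min (ds^-1) (eps / ds ^+ 3).

Let d0 r : 0 < d r. Proof. by have /andP[h _] := dmd r; apply: lt_le_trans h. Qed.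
Let dsd r : d r <= ds. Proof. by have /andP[] := dmd r. Qed.
Let ds0 : 0 < ds. Proof. exact: lt_le_trans (d0 0) (dsd 0). Qed.

Lemma cc_gt0 : 0 < cc.
Proof. by rewrite lt_min invr_gt0 ds0 divr_gt0 // exprn_gt0. Qed.

Lemma s_sq r : s r ^+ 2 = eps + r ^+ 2.
Proof. by rewrite sqr_sqrtr // addr_ge0 ?sqr_ge0 // ltW. Qed.

Lemma s_gt0 r : 0 < s r.
Proof. by rewrite sqrtr_gt0 ltr_wpDr ?sqr_ge0. Qed.

Lemma s_ge r : r <= s r.
Proof.
have [r0|r0] := leP r 0; first exact: le_trans r0 (ltW (s_gt0 r)).
by rewrite -ler_sqr ?nnegrE ?(ltW (s_gt0 r)) ?(ltW r0) // s_sq lerDr ltW.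
Qed.

(** Replaces the mean value theorem by algebra: the numerator [x b - y a] of the difference of the
    fractions, times its conjugate [x b + y a], is [eps * (x ^+ 2 - y ^+ 2)]. *)
Lemma slope_sqrt (x y : R) : 0 <= y -> y <= x -> s x <= ds ->
  eps / ds ^+ 3 * (x - y) <= x / s x - y / s y.
Proof.
move=> y0 yx sx; have x0 := le_trans y0 yx.
have p := s_gt0 x; have q := s_gt0 y; have ep := s_sq x; have eq := s_sq y.
have qp : s y <= s x by rewrite -ler_sqr ?nnegrE ?(ltW p) ?(ltW q) // ep eq lerD2l ler_sqr.
move: (s x) (s y) p q ep eq qp sx => a b a0 b0 ea eb ba ad.
have h1 : eps * (x ^+ 2 - y ^+ 2) = (x * b - y * a) * (x * b + y * a).
  have -> : (x * b - y * a) * (x * b + y * a) = x ^+ 2 * b ^+ 2 - y ^+ 2 * a ^+ 2 by ring.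
  by rewrite ea eb; ring.
have D0 : x * b + y * a <= (x + y) * ds.
  by rewrite mulrDl lerD // ler_wpM2l // (le_trans ba).
have h2 : eps * (x - y) <= (x * b - y * a) * ds.
  have [xy0|xy0] := leP (x + y) 0.
    have x00 : x = 0 by lra.
    have y00 : y = 0 by lra.
    by rewrite x00 y00 !(mul0r, subr0, mulr0).
  rewrite -(ler_pM2r xy0).
  have -> : eps * (x - y) * (x + y) = eps * (x ^+ 2 - y ^+ 2) by ring.
  rewrite h1 -mulrA [ds * _]mulrC; apply: ler_wpM2l => //.
  have [k0|k0] := leP 0 (x * b - y * a) => //.
  have : 0 <= eps * (x ^+ 2 - y ^+ 2) by rewrite mulr_ge0 ?(ltW eps0) // subr_ge0 ler_sqr.
  rewrite h1 nmulr_rge0 // => h.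
  have xb : 0 <= x * b by rewrite mulr_ge0 // ltW.
  have ya : 0 <= y * a by rewrite mulr_ge0 // ltW.
  lra.
have -> : x / a - y / b = (x * b - y * a) / (a * b) by field; rewrite !gt_eqF.
rewrite ler_pdivlMr ?mulr_gt0 //.
have -> : eps / ds ^+ 3 * (x - y) * (a * b) = (eps * (x - y)) * (a * b) / ds ^+ 3 by ring.
rewrite ler_pdivrMr ?exprn_gt0 //.
have k0 : 0 <= eps * (x - y) by rewrite mulr_ge0 ?(ltW eps0) // subr_ge0.
apply: le_trans (_ : eps * (x - y) * (ds * ds) <= _).
  rewrite ler_wpM2l // ler_pM ?(ltW a0) ?(ltW b0) //; exact: le_trans ba ad.
have -> : (x * b - y * a) * ds ^+ 3 = (x * b - y * a) * ds * (ds * ds) by ring.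
by rewrite ler_wpM2r // mulr_ge0 // ltW.
Qed.

Lemma slope_clamp (r1 r2 : R) : 0 <= r1 -> r1 <= r2 -> cc * (r2 - r1) <= r2 / d r2 - r1 / d r1.
Proof.
move=> r10 r12; have r20 := le_trans r10 r12; have r0 : 0 <= r2 - r1 by rewrite subr_ge0.
have inv r : ds^-1 <= (d r)^-1 by rewrite lef_pV2 ?posrE.
have c1 : cc <= ds^-1 by rewrite ge_min lexx.
have c2 : cc <= eps / ds ^+ 3 by rewrite ge_min lexx orbT.
have := dmono r10 r12; rewrite le_eqVlt => /orP[/eqP e|lt].
  by rewrite e -mulrBl mulrC ler_wpM2l // (le_trans c1).
have [h1 h2] := dclamp r10 r12 lt.
(* The radius at which the unclamped [s] takes the value [d r2]. From [r1] to [x] the quotient is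
   compared with that of [s]; from [x] to [r2] the denominator stays at [d r2]. *)
pose x := Num.sqrt (d r2 ^+ 2 - eps).
have ge : 0 <= d r2 ^+ 2 - eps.
  have e1 : s r1 ^+ 2 <= d r2 ^+ 2 by rewrite ler_sqr ?nnegrE ?(ltW (d0 _)) ?(ltW (s_gt0 _)) // (le_trans h1) // ltW.
  by move: e1; rewrite s_sq; have := sqr_ge0 r1; lra.
have x0 : 0 <= x := sqrtr_ge0 _.
have xs : s x = d r2 by rewrite /x sqr_sqrtr // addrCA subrr addr0 sqrtr_sqr gtr0_norm.
have r1x : r1 <= x.
  rewrite -ler_sqr ?nnegrE // /x sqr_sqrtr // lerBrDl -s_sq ler_sqr ?nnegrE ?(ltW (d0 _)) ?(ltW (s_gt0 _)) //.
  by apply: le_trans h1 _; exact: ltW.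
have xr2 : x <= r2.
  rewrite -ler_sqr ?nnegrE // /x sqr_sqrtr // lerBlDl -s_sq ler_sqr ?nnegrE ?(ltW (d0 _)) ?(ltW (s_gt0 _)) //.
have := slope_sqrt r10 r1x; rewrite xs => /(_ (dsd r2)) hs.
have h3 : r1 / d r1 <= r1 / s r1 by rewrite ler_wpM2l // lef_pV2 ?posrE // s_gt0.
have h4 : cc * (r2 - x) <= r2 / d r2 - x / d r2.
  by rewrite -mulrBl mulrC ler_wpM2l ?subr_ge0 // (le_trans c1).
have h5 : cc * (x - r1) <= eps / ds ^+ 3 * (x - r1) by rewrite ler_wpM2r ?subr_ge0.
by rewrite (_ : r2 - r1 = (r2 - x) + (x - r1)); [rewrite mulrDr; lra|ring].
Qed.

Lemma d_lip (r1 r2 : R) : 0 <= r1 -> r1 <= r2 -> d r2 - d r1 <= r2 - r1.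
Proof.
move=> r10 r12; have r20 := le_trans r10 r12.
have := dmono r10 r12; rewrite le_eqVlt => /orP[/eqP ->|lt]; first by rewrite subrr subr_ge0.
have [h1 h2] := dclamp r10 r12 lt.
suff : s r2 - s r1 <= r2 - r1 by lra.
have p := s_gt0 r2; have q := s_gt0 r1; have := s_ge r1; have := s_ge r2.
have e1 := s_sq r1; have e2 := s_sq r2.
move: (s r2) (s r1) p q e1 e2 => a b a0 b0 eb ea ha hb.
have e : (a - b) * (a + b) = (r2 - r1) * (r2 + r1) by rewrite -!subr_sqr; lra.
have ab : 0 < a + b by lra.
rewrite -(ler_pM2r ab) e ler_wpM2l ?subr_ge0 //; lra.
Qed.

Lemma clamp_mono (z w : E) :
  cc * hn (z - w) ^+ 2 <= ip ((d (hn z))^-1 *: z - (d (hn w))^-1 *: w) (z - w).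
Proof.
have key (x y : E) : hn x <= hn y ->
    cc * hn (x - y) ^+ 2 <= ip ((d (hn x))^-1 *: x - (d (hn y))^-1 *: y) (x - y).
  move=> xy; have sl := slope_clamp (hn_ge0 x) xy; have cs := ip_le x y.
  have kx : cc <= (d (hn x))^-1 by apply: (@le_trans _ _ ds^-1); rewrite ?ge_min ?lexx // lef_pV2 ?posrE.
  have ky : cc <= (d (hn y))^-1 by apply: (@le_trans _ _ ds^-1); rewrite ?ge_min ?lexx // lef_pV2 ?posrE.
  rewrite hn_sq ip_sqB ipBl !ipBr !ipZl [ip y x]ipC -!hn_sq.
  by apply: alg_mono sl => //; exact: hn_ge0.
have [h|/ltW h] := leP (hn z) (hn w); first exact: key.
have := key _ _ h; rewrite hnBC; congr (_ <= _).
by rewrite -[w - z]opprB ipNr -ipNl opprB.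
Qed.

(** One [dm^-1] stems from the difference of the vectors, the other from that of the denominators,
    where [hn x <= d (hn x)] absorbs the remaining factor [hn x]. *)
Lemma clamp_lip (z w : E) :
  hn ((d (hn z))^-1 *: z - (d (hn w))^-1 *: w) <= 2 / dm * hn (z - w).
Proof.
have key (x y : E) : hn x <= hn y ->
    hn ((d (hn x))^-1 *: x - (d (hn y))^-1 *: y) <= 2 / dm * hn (x - y).
  move=> xy.
  have -> : (d (hn x))^-1 *: x - (d (hn y))^-1 *: y =
    (d (hn y))^-1 *: (x - y) + ((d (hn x))^-1 - (d (hn y))^-1) *: x.
    by rewrite scalerBr scalerBl [RHS]addrC addrA subrK.
  apply: le_trans (hnD _ _) _; rewrite !hnZ.
  have e1 : `|(d (hn y))^-1| <= dm^-1.
    by rewrite gtr0_norm ?invr_gt0 // lef_pV2 ?posrE //; have /andP[] := dmd (hn y).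
  have e2 : `|(d (hn x))^-1 - (d (hn y))^-1| * hn x <= dm^-1 * hn (x - y).
    have := dmono (hn_ge0 x) xy; rewrite le_eqVlt => /orP[/eqP ->|lt].
      by rewrite subrr normr0 mul0r mulr_ge0 ?invr_ge0 ?hn_ge0 // ltW.
    have [h1 h2] := dclamp (hn_ge0 x) xy lt.
    have h3 := d_lip (hn_ge0 x) xy.
    have h4 : hn y - hn x <= hn (x - y) by apply: le_trans (ler_norm _) _; rewrite distrC; exact: hn_distl.
    have -> : (d (hn x))^-1 - (d (hn y))^-1 = (d (hn y) - d (hn x)) / (d (hn x) * d (hn y)).
      by field; rewrite !gt_eqF.
    rewrite gtr0_norm ?divr_gt0 ?mulr_gt0 ?subr_gt0 //.
    have -> : (d (hn y) - d (hn x)) / (d (hn x) * d (hn y)) * hn x =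
      (hn x / d (hn x)) * ((d (hn y))^-1 * (d (hn y) - d (hn x))) by field; rewrite !gt_eqF.
    rewrite -[leRHS]mul1r; apply: ler_pM.
    - by rewrite divr_ge0 ?hn_ge0 // ltW.
    - by rewrite mulr_ge0 ?invr_ge0 ?subr_ge0 // ltW.
    - by rewrite ler_pdivrMr // mul1r (le_trans (s_ge _)).
    - apply: ler_pM; rewrite ?invr_ge0 ?subr_ge0 ?(ltW lt) ?(ltW (d0 _)) //; last exact: le_trans h3 h4.
      by move: e1; rewrite gtr0_norm ?invr_gt0.
  have := lerD (ler_wpM2r (hn_ge0 (x - y)) e1) e2; lra.
have [h|/ltW h] := leP (hn z) (hn w); first exact: key.
by have := key _ _ h; rewrite (hnBC (_ *: w)) (hnBC w z).
Qed.

End ClampedNorm.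

(** * The oceanic drag and its truncations *)

Section Ocean.
Variables (R : realType) (c theta : R).
Hypotheses (c0 : 0 <= c) (th : 0 <= theta <= pi / 4).
Local Notation E := (mxphs R 2 1).
Local Notation cV := 'cV[R]_2.

(* The modulations [f] for which [w |-> f |w| w_theta] is still monotone; they include the
   truncations of the identity. *)
Definition admissible (f : R -> R) : Prop := forall r s, 0 <= r -> r <= s ->
  [/\ 0 <= f r <= r, f r <= f s, f s - f r <= s - r & f r < f s -> f r = r].

Lemma adm_min k : 0 <= k -> admissible (fun r => Num.min r k).
Proof.
move=> k0 r s r0 rs; split.
- by rewrite le_min r0 k0 ge_min lexx.
- by rewrite le_min !ge_min rs lexx orbT.
- by rewrite /Num.min; case: ltP => h1; case: ltP => h2; lra.
- have [h1|h1] := leP r k; first by [].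
  by rewrite (min_r (ltW (lt_le_trans h1 rs))) ltxx.
Qed.

Lemma adm_id : admissible id.
Proof. by move=> r s r0 rs; split; rewrite ?r0 ?lexx. Qed.

(** [tau_ocean] is [tauf id] at [U - u]; a minimum in place of [id] truncates the speed factor and
    keeps the turned vector. *)
Definition tauf (f : R -> R) (w : cV) : cV := (c * f (frob w)) *: turn theta w.

Lemma perp_dot (a b : cV) : mxdot (perp a) b = a 0 0 * b 1 0 - a 1 0 * b 0 0.
Proof. by rewrite /mxdot sum_I2 !big_ord1 !mxE /=; ring. Qed.

Lemma perpL (k : R) (a b : cV) : perp (k *: a + b) = k *: perp a + perp b.
Proof. by apply/matrixP => i j; rewrite !mxE; case: ifP => _; ring. Qed.

Lemma dot2 (a b : cV) : mxdot a b = a 0 0 * b 0 0 + a 1 0 * b 1 0.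
Proof. by rewrite /mxdot sum_I2 !big_ord1. Qed.

Lemma perp_frob (a : cV) : frob (perp a) = frob a.
Proof. by congr Num.sqrt; rewrite !dot2 !mxE /=; ring. Qed.

Lemma turn_frob (a : cV) : frob (turn theta a) = frob a.
Proof.
congr Num.sqrt; rewrite !dot2 !mxE /=; have := cos2Dsin2 theta.
move: (cos theta) (sin theta) (a 0 0) (a 1 0) => x y p q e.
have -> : (x * p + y * - q) * (x * p + y * - q) + (x * q + y * p) * (x * q + y * p) =
  (x ^+ 2 + y ^+ 2) * (p * p + q * q) by ring.
by rewrite e mul1r.
Qed.

Lemma sin_le_cos : 0 <= sin theta <= cos theta.
Proof.
case/andP: th => t0 t4; have p0 := pi_gt0 R.
apply/andP; split; first by apply: sin_ge0_pi; rewrite t0 /=; lra.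
rewrite -cosBpihalf -cosN opprB leNgt ltr_cos ?in_itv /=; first by rewrite -leNgt; lra.
  by apply/andP; split; lra.
by apply/andP; split; lra.
Qed.

Local Notation n a := (frob a).

Lemma frobZ (k : R) (a : cV) : n (k *: a) = `|k| * n a. Proof. exact: (@hnZ _ E). Qed.

Lemma dotNN (a b : cV) : mxdot (- a) (- b) = mxdot a b.
Proof. by rewrite !dot2 !mxE; ring. Qed.

Lemma cross_le (a b : cV) : `|a 0 0 * b 1 0 - a 1 0 * b 0 0| <= n a * n (a - b).
Proof.
have -> : a 0 0 * b 1 0 - a 1 0 * b 0 0 = - mxdot (perp a) (a - b).
  by rewrite perp_dot !mxE; ring.
by rewrite normrN -(perp_frob a); exact: (@ip_CS _ E (perp a) (a - b)).
Qed.

Section Admissible.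
Variables (f : R -> R) (af : admissible f).

Lemma adm_ge0 (a : cV) : 0 <= f (n a).
Proof. by have [/andP[]] := af (sqrtr_ge0 _) (lexx (n a)). Qed.

Lemma adm_le (a : cV) : f (n a) <= n a.
Proof. by have [/andP[]] := af (sqrtr_ge0 _) (lexx (n a)). Qed.

Lemma tauf_mono_key (a b : cV) : n a <= n b ->
  0 <= mxdot (f (n a) *: turn theta a - f (n b) *: turn theta b) (a - b).
Proof.
move=> ab; have [_ h1 h2 h3] := af (sqrtr_ge0 _ : 0 <= n a) ab.
have fa := adm_ge0 a; have fal := adm_le a.
set X := a 0 0 * b 1 0 - a 1 0 * b 0 0; have hX : `|X| <= n a * n (a - b) := cross_le a b.
have -> : mxdot (f (n a) *: turn theta a - f (n b) *: turn theta b) (a - b) =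
   cos theta * (f (n a) * mxdot a a - (f (n a) + f (n b)) * mxdot a b + f (n b) * mxdot b b)
   - sin theta * ((f (n a) - f (n b)) * X).
  by rewrite !dot2 !mxE /= /X; ring.
have sa : mxdot a a = n a ^+ 2 by rewrite sqr_sqrtr ?mxdot_ge0.
have sb : mxdot b b = n b ^+ 2 by rewrite sqr_sqrtr ?mxdot_ge0.
have sab : mxdot a b = (n a ^+ 2 + n b ^+ 2 - n (a - b) ^+ 2) / 2.
  have e1 : n (a - b) ^+ 2 = n a ^+ 2 - 2 * mxdot a b + n b ^+ 2.
    rewrite -sa -sb sqr_sqrtr ?mxdot_ge0 // !dot2 !mxE; ring.
  by rewrite e1; field.
rewrite sa sb sab; have dn : n b - n a <= n (a - b).
  by apply: le_trans (ler_norm _) _; rewrite distrC; exact: (@hn_distl _ E).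
have := sqrtr_ge0 (mxdot a a); have := sqrtr_ge0 (mxdot (a - b) (a - b)); rewrite -!/(frob _).
have /andP[s0 sc] := sin_le_cos.
move: (n a) (n b) (n (a - b)) (f (n a)) (f (n b)) h1 h2 h3 ab fa fal dn hX => p q e u v h1 h2 h3 pq u0 up dn hX e0 p0.
move: X (cos theta) (sin theta) hX s0 sc => X C S hX s0 sc.
exact: alg_ocean h1 h2 h3 pq u0 up dn e0 p0 hX s0 sc.
Qed.

Lemma tauf_lip_key (a b : cV) : n a <= n b ->
  n (f (n a) *: a - f (n b) *: b) <= (f (n b) + f (n a)) * n (a - b).
Proof.
move=> ab; have [_ h1 h2 h3] := af (sqrtr_ge0 _ : 0 <= n a) ab.
have fa := adm_ge0 a; have fb := adm_ge0 b; have na : 0 <= n a := sqrtr_ge0 _.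
have dn : n b - n a <= n (a - b).
  by apply: le_trans (ler_norm _) _; rewrite distrC; exact: (@hn_distl _ E).
have -> : f (n a) *: a - f (n b) *: b = f (n b) *: (a - b) + (f (n a) - f (n b)) *: a.
  by rewrite scalerBr scalerBl [RHS]addrC addrA subrK.
apply: le_trans (@hnD _ E _ _) _; rewrite ![hn _]frobZ (ger0_norm fb) mulrDl lerD2l.
move: h1; rewrite le_eqVlt => /orP[/eqP ->|lt]; first by rewrite subrr normr0 mul0r mulr_ge0 ?sqrtr_ge0.
rewrite ltr0_norm ?subr_lt0 // opprB (h3 lt) mulrC ler_wpM2l //.
by move: h2; rewrite (h3 lt); lra.
Qed.

End Admissible.

Lemma tauf_mono f (a b : cV) : admissible f -> 0 <= mxdot (tauf f a - tauf f b) (a - b).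
Proof.
move=> af; have e x : tauf f x = c *: (f (n x) *: turn theta x) by rewrite scalerA.
rewrite !e -scalerBr [mxdot _ _](@ipZl _ E) mulr_ge0 //.
have [h|/ltW h] := leP (n a) (n b); first exact: tauf_mono_key.
have := tauf_mono_key af h; congr (_ <= _).
by rewrite -[in LHS]opprB -[X in mxdot _ X]opprB dotNN.
Qed.

Lemma turn_scale (k : R) (x : cV) : k *: turn theta x = turn theta (k *: x).
Proof. by apply/matrixP => i j; rewrite !mxE; case: ifP => _; ring. Qed.

Lemma turnB (x y : cV) : turn theta x - turn theta y = turn theta (x - y).
Proof. by apply/matrixP => i j; rewrite !mxE; case: ifP => _; ring. Qed.

Lemma tauf_lip f (a b : cV) : admissible f ->
  n (tauf f a - tauf f b) <= c * (f (n a) + f (n b)) * n (a - b).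
Proof.
move=> af; have e x : tauf f x = c *: turn theta (f (n x) *: x) by rewrite -turn_scale scalerA.
rewrite !e -scalerBr turnB frobZ ger0_norm // turn_frob -mulrA ler_wpM2l //.
have [h|/ltW h] := leP (n a) (n b); first by rewrite [f (n a) + _]addrC; exact: tauf_lip_key.
have := tauf_lip_key af h; rewrite [n (_ *: b - _)](@hnBC _ E) [n (b - a)](@hnBC _ E).
by [].
Qed.

Lemma tauf_frob f (a : cV) : admissible f -> n (tauf f a) = c * f (n a) * n a.
Proof.
by move=> af; rewrite frobZ turn_frob ger0_norm // mulr_ge0 // adm_ge0.
Qed.

(** The part of the speed that truncation at level [k] removes. *)
Definition rho (k r : R) : R := r - Num.min r k.

Lemma tauf_tail k (a : cV) : 0 <= k ->
  n (tauf (fun r => Num.min r k) a - tauf id a) <= c * (n a * rho k (n a)).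
Proof.
move=> k0; rewrite /tauf -scalerBl frobZ -mulrBr normrM (ger0_norm c0) -mulrA turn_frob.
rewrite ler_wpM2l // mulrC ler_wpM2l ?sqrtr_ge0 // ler0_norm ?opprB // subr_le0.
by rewrite ge_min lexx.
Qed.

End Ocean.

(** * The viscous-plastic stress *)

Section Stress.
Variables (R : realType) (lam eps dinf dsup : R).
Hypotheses (lam0 : 0 < lam) (eps0 : 0 < eps) (dd : 0 < dinf < dsup).
Local Notation Mx := 'M[R]_2.
Local Notation E := (mxphs R 2 2).

Lemma mx2P (a b : Mx) : a 0 0 = b 0 0 -> a 0 1 = b 0 1 -> a 1 0 = b 1 0 -> a 1 1 = b 1 1 -> a = b.
Proof.
by move=> ? ? ? ?; apply/matrixP => i j; case: (I2P i) => ->; case: (I2P j) => ->.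
Qed.

Lemma dot4 (a b : Mx) : mxdot a b = a 0 0 * b 0 0 + a 0 1 * b 0 1 + (a 1 0 * b 1 0 + a 1 1 * b 1 1).
Proof. by rewrite /mxdot sum_I2 !sum_I2. Qed.

Lemma tr2 (a : Mx) : \tr a = a 0 0 + a 1 1.
Proof. by rewrite /mxtrace sum_I2. Qed.

(** Polar form of [lam |Dev z|^2 + (tr z)^2]. Skew matrices lie in its kernel, which a semidefinite
    [phs] admits. *)
Definition qip (z w : Mx) : R := lam * mxdot (Dev z) (Dev w) + \tr z * \tr w.

Lemma qipE z w : qip z w = lam * (((z 0 0 - z 1 1) * (w 0 0 - w 1 1) + (z 0 1 + z 1 0) * (w 0 1 + w 1 0)) / 2)
  + (z 0 0 + z 1 1) * (w 0 0 + w 1 1).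
Proof. by rewrite /qip !tr2 dot4 !mxE /=; field. Qed.

Lemma qipDl x y z : qip (x + y) z = qip x z + qip y z.
Proof. by rewrite !qipE !mxE; field. Qed.
Lemma qipZl a x z : qip (a *: x) z = a * qip x z.
Proof. by rewrite !qipE !mxE; field. Qed.
Lemma qipC x z : qip x z = qip z x.
Proof. by rewrite !qipE; field. Qed.
Lemma qip_ge0 x : 0 <= qip x x.
Proof.
rewrite addr_ge0 //; first by rewrite mulr_ge0 ?mxdot_ge0 ?(ltW lam0).
by rewrite -expr2 sqr_ge0.
Qed.
Definition Qphs : phs R := Phs qipDl qipZl qipC qip_ge0.
Local Notation hq z := (@hn R Qphs z).

Definition Amx (z : Mx) : Mx := lam *: Dev z + (\tr z)%:M.

Lemma Amx_dot z w : mxdot (Amx z) w = qip z w.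
Proof. by rewrite qipE dot4 !mxE /= !tr2; field. Qed.

Lemma AmxL a z w : Amx (a *: z + w) = a *: Amx z + Amx w.
Proof. by apply: mx2P; rewrite !mxE /= !tr2 !mxE /=; field. Qed.

Lemma Amx_frob z : frob (Amx z) <= (lam + 2) * hq z.
Proof.
have l2 : 0 <= lam + 2 by rewrite addr_ge0 // ltW.
rewrite -ler_sqr ?nnegrE ?sqrtr_ge0 ?mulr_ge0 ?hn_ge0 // exprMn hn_sq -[ip _ _]/(qip z z) sqr_sqrtr ?mxdot_ge0 //.
rewrite dot4 qipE !mxE /= !tr2.
move: (z 0 0) (z 0 1) (z 1 0) (z 1 1) => a b c e.
set X := (a - e) ^+ 2 + (b + c) ^+ 2; set Y := (a + e) ^+ 2.
have X0 : 0 <= X by rewrite addr_ge0 ?sqr_ge0.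
have Y0 : 0 <= Y by exact: sqr_ge0.
have h : lam ^+ 2 * (X / 2) + 2 * Y <= (lam + 2) ^+ 2 * (lam * (X / 2) + Y).
  have p1 : 0 <= lam * X by rewrite mulr_ge0 // ltW.
  have p2 : 0 <= lam * Y by rewrite mulr_ge0 // ltW.
  have p3 : 0 <= lam ^+ 2 * X by rewrite mulr_ge0 ?sqr_ge0.
  have p4 : 0 <= lam ^+ 2 * Y by rewrite mulr_ge0 ?sqr_ge0.
  have p5 : 0 <= lam ^+ 3 * X by rewrite mulr_ge0 ?exprn_ge0 // ltW.
  lra.
by apply: le_trans (le_trans _ h) _; rewrite le_eqVlt; apply/orP; left; apply/eqP; rewrite /X /Y; field.
Qed.

Lemma hq_le z : hq z <= (lam + 2) * frob z.
Proof.
have l2 : 0 <= lam + 2 by rewrite addr_ge0 // ltW.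
rewrite -ler_sqr ?nnegrE ?hn_ge0 ?mulr_ge0 ?sqrtr_ge0 // exprMn hn_sq -[ip _ _]/(qip z z) sqr_sqrtr ?mxdot_ge0 //.
rewrite dot4 qipE.
move: (z 0 0) (z 0 1) (z 1 0) (z 1 1) => a b c e.
set N := a * a + b * b + (c * c + e * e).
have N0 : 0 <= N by rewrite /N -!expr2 !addr_ge0 ?sqr_ge0.
have h1 : ((a - e) * (a - e) + (b + c) * (b + c)) / 2 <= N.
  have := sqr_ge0 (a + e); have := sqr_ge0 (b - c); rewrite /N; lra.
have h2 : (a + e) * (a + e) <= 2 * N.
  have := sqr_ge0 (a - e); have := sqr_ge0 b; have := sqr_ge0 c; rewrite /N; lra.
have h3 := ler_wpM2l (ltW lam0) h1.
have p1 : 0 <= lam * N by rewrite mulr_ge0 // ltW.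
have p2 : 0 <= lam ^+ 2 * N by rewrite mulr_ge0 ?sqr_ge0.
lra.
Qed.

(** For symmetric [z] one has [|z|^2 = |Dev z|^2 + (tr z)^2 / 2], whence the constant. *)
Lemma hq_ge z : z^T = z -> Num.min lam 2 * frob z ^+ 2 <= hq z ^+ 2.
Proof.
move=> sz; have e01 : z 1 0 = z 0 1 by rewrite -[in LHS]sz mxE.
rewrite hn_sq -[ip _ _]/(qip z z) sqr_sqrtr ?mxdot_ge0 // dot4 qipE e01.
move: (z 0 0) (z 0 1) (z 1 1) => a b e.
have k1 : Num.min lam 2 <= lam by rewrite ge_min lexx.
have k2 : Num.min lam 2 <= 2 by rewrite ge_min lexx orbT.
move: (Num.min lam 2) k1 k2 => k k1 k2.
have h1 : k * ((a - e) ^+ 2 + (b + b) ^+ 2) <= lam * ((a - e) ^+ 2 + (b + b) ^+ 2).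
  by rewrite ler_wpM2r // addr_ge0 ?sqr_ge0.
have h2 : k * (a + e) ^+ 2 <= 2 * (a + e) ^+ 2 by rewrite ler_wpM2r ?sqr_ge0.
lra.
Qed.

Variable dhat : Mx -> R.
Hypothesis hd : dhat = delta_above eps lam dsup \/ dhat = delta_both eps lam dinf dsup.
Local Notation s r := (Num.sqrt (eps + r ^+ 2)).

Lemma delta_pE z : delta_p eps lam z = s (hq z).
Proof.
rewrite /delta_p hn_sq; congr Num.sqrt; rewrite -addrA; congr (_ + _).
by rewrite [RHS]/(lam * mxdot (Dev z) (Dev z) + \tr z * \tr z) sqr_sqrtr ?mxdot_ge0 // -expr2.
Qed.

Lemma s_mono r1 r2 : 0 <= r1 -> r1 <= r2 -> s r1 <= s r2.
Proof. by move=> h h'; rewrite ler_wsqrtr // lerD2l ler_sqr ?nnegrE // (le_trans h). Qed.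

(** Both choices of [dhat] are radial for [hq]. In the first one the regularisation supplies the
    lower bound, the minimum of [Num.sqrt eps] and [dsup]; in the second one [dinf] does. *)
Lemma clamp_ex : exists d : R -> R, exists2 dm : R, 0 < dm & [/\ forall z, dhat z = d (hq z),
  forall r, dm <= d r <= dsup,
  forall r1 r2, 0 <= r1 -> r1 <= r2 -> d r1 <= d r2 &
  forall r1 r2, 0 <= r1 -> r1 <= r2 -> d r1 < d r2 -> s r1 <= d r1 /\ d r2 <= s r2].
Proof.
case/andP: dd => di ds; have dsup0 := lt_trans di ds.
have se r : Num.sqrt eps <= s r by rewrite ler_wsqrtr // lerDl sqr_ge0.
case: hd => ->.
  exists (fun r => Num.min (s r) dsup), (Num.min (Num.sqrt eps) dsup); first by rewrite lt_min sqrtr_gt0 eps0.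
  split.
  - by move=> z; rewrite /delta_above delta_pE.
  - move=> r; apply/andP; split; last by rewrite ge_min lexx orbT.
    by rewrite le_min !ge_min se lexx orbT.
  - move=> r1 r2 h h'; rewrite le_min !ge_min lexx s_mono ?orbT //.
  - move=> r1 r2 h h'; have [h1|h1] := leP (s r1) dsup; first by split; rewrite ?lexx // ge_min lexx.
    by have h2 := lt_le_trans h1 (s_mono h h'); rewrite (min_r (ltW h2)) ltxx.
exists (fun r => Num.min dsup (Num.max dinf (s r))), dinf => //; split.
- by move=> z; rewrite /delta_both delta_pE.
- by move=> r; rewrite le_min ge_min lexx (ltW ds) le_max lexx.
- move=> r1 r2 h h'; rewrite le_min !ge_min lexx /= ge_max !le_max lexx s_mono ?orbT //.
- move=> r1 r2 h h'; have sm := s_mono h h'.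
  have [h1|h1] := leP (s r1) dsup; last first.
    rewrite min_l ?le_max ?(ltW h1) ?orbT // min_l ?le_max ?(le_trans (ltW h1) sm) ?orbT // ltxx.
    by [].
  rewrite [X in X < _]min_r ?ge_max ?(ltW ds) // => lt.
  split; first by rewrite min_r ?ge_max ?(ltW ds) // le_max lexx orbT.
  have [h2|h2] := leP dinf (s r2); first by rewrite ge_min lexx orbT.
  by move: lt; rewrite (max_l (ltW h2)) ltNge ge_min !le_max lexx !orbT.
Qed.

(** The estimate in the pressure makes the stress continuous in the pair [(P, z)], as strong
    measurability requires, and gives its growth by comparison with zero pressure. Symmetry in the
    monotonicity clause is that of [hq_ge]. *)
Lemma stress_ex : exists cS, exists LS : R, [/\ 0 < cS, 0 < LS,
  forall P z w, 0 <= P -> z^T = z -> w^T = w ->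
    P * cS * frob (z - w) ^+ 2 <= mxdot (stress lam dhat P z - stress lam dhat P w) (z - w),
  forall P z w, frob (stress lam dhat P z - stress lam dhat P w) <= `|P| * LS * frob (z - w) &
  forall P P' z, frob (stress lam dhat P z - stress lam dhat P' z) <= `|P - P'| * (LS * frob z + 1)].
Proof.
have [d [dm dm0 [dE dmd dmono dclamp]]] := clamp_ex.
pose B z := (dhat z)^-1 *: Amx z.
have l2 : 0 < lam + 2 by rewrite addr_gt0.
have BB z w : B z - B w = Amx ((d (hq z))^-1 *: z - (d (hq w))^-1 *: w).
  have AZ (k : R) x : Amx (k *: x) = k *: Amx x.
    by have := AmxL k x 0; rewrite addr0 => ->; rewrite [X in _ + X](_ : _ = 0) ?addr0 //; apply: mx2P; rewrite !mxE /= !tr2 !mxE /=; field.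
  rewrite /B !dE -!AZ -[in RHS]scaleN1r addrC [in RHS]addrC.
  by rewrite AmxL scaleN1r.
have Blip z w : frob (B z - B w) <= (lam + 2) ^+ 2 * (2 / dm) * frob (z - w).
  rewrite BB; apply: le_trans (Amx_frob _) _.
  have h1 := @clamp_lip R Qphs d eps dsup dm eps0 dm0 dmd dmono dclamp z w.
  have h2 := hq_le (z - w); have p : 0 <= 2 / dm by rewrite divr_ge0 // ltW.
  have h3 := ler_wpM2l p h2.
  apply: le_trans (ler_wpM2l (ltW l2) (le_trans h1 h3)) _.
  by rewrite le_eqVlt; apply/orP; left; apply/eqP; ring.
have c0 := @cc_gt0 R d eps dsup dm eps0 dm0 dmd.
have ml : 0 < Num.min lam 2 by rewrite lt_min lam0 ltr0n.
exists (cc eps dsup * Num.min lam 2 / 2), ((lam + 2) ^+ 2 * (2 / dm)).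
have L0 : 0 < (lam + 2) ^+ 2 * (2 / dm) by rewrite mulr_gt0 ?exprn_gt0 ?divr_gt0.
have sE P z : stress lam dhat P z = (P / 2) *: (B z - 1%:M) by [].
split=> //.
- by rewrite divr_gt0 // mulr_gt0.
- move=> P z w P0 sz sw; rewrite !sE -scalerBr opprB addrA subrK [mxdot _ _](@ipZl _ E).
  rewrite BB -[ip _ _]/(mxdot _ _) Amx_dot.
  have h1 := @clamp_mono R Qphs d eps dsup dm eps0 dm0 dmd dmono dclamp z w.
  have sd : (z - w)^T = z - w by rewrite linearB /= sz sw.
  have h2 := ler_wpM2l (ltW c0) (hq_ge sd).
  have := ler_wpM2l (_ : 0 <= P / 2) (le_trans h2 h1); rewrite divr_ge0 // => /(_ isT).
  by apply: le_trans; rewrite le_eqVlt; apply/orP; left; apply/eqP; ring.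
- move=> P z w; rewrite !sE -scalerBr opprB addrA subrK [frob _](@hnZ _ E) normrM.
  rewrite (ger0_norm (_ : (0 : R) <= 2^-1)) ?invr_ge0 // -[hn _]/(frob _).
  have h := Blip z w; have F0 : 0 <= frob (B z - B w) := sqrtr_ge0 _.
  rewrite -!mulrA ler_wpM2l //; lra.
- move=> P P' z; rewrite !sE -scalerBl [frob _](@hnZ _ E) -mulrBl normrM -[hn _]/(frob _).
  have n2 : `|2^-1 : R| = 2^-1 by rewrite ger0_norm // invr_ge0.
  rewrite n2.
  have B0 : B 0 = 0.
    by rewrite /B [Amx 0](_ : _ = 0) ?scaler0 //; apply: mx2P; rewrite !mxE /= !tr2 !mxE /=; field.
  have h := Blip z 0; rewrite B0 !subr0 in h.
  have h1 : frob (1%:M : Mx) <= 2.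
    rewrite -ler_sqr ?nnegrE ?sqrtr_ge0 // sqr_sqrtr ?mxdot_ge0 // dot4 !mxE /=; lra.
  have h2 : frob (B z - 1%:M) <= frob (B z) + frob (1%:M : Mx) := @hnB_le _ E _ _.
  have h3 : 2^-1 * frob (B z - 1%:M) <= (lam + 2) ^+ 2 * (2 / dm) * frob z + 1.
    have F0 : 0 <= frob (B z) := sqrtr_ge0 _.
    by move: h h1 h2 F0; move: (frob _) (frob _) (frob _) (_ * frob z) => a1 a2 a3 a4; lra.
  have h4 := ler_wpM2l (normr_ge0 (P - P')) h3; rewrite mulrA in h4.
  exact: h4.
Qed.

End Stress.

(** * Removal of the truncation *)

Lemma alg_sq2 (R : realFieldType) (a b : R) : (a + b) ^+ 2 <= 2 * a ^+ 2 + 2 * b ^+ 2.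
Proof. by have := sqr_ge0 (a - b); lra. Qed.

Lemma alg_sq3 (R : realFieldType) (a b c : R) : (a + b + c) ^+ 2 <= 3 * (a ^+ 2 + b ^+ 2 + c ^+ 2).
Proof.
by have := sqr_ge0 (a - b); have := sqr_ge0 (a - c); have := sqr_ge0 (b - c); lra.
Qed.

Lemma alg_young (R : realFieldType) (al x y k : R) : 0 < al ->
  x * y * k <= al * x ^+ 2 + (4 * al)^-1 * (y * k) ^+ 2.
Proof.
move=> al0; have := sqr_ge0 (2 * al * x - y * k) => h.
rewrite -(ler_pM2l (_ : 0 < 4 * al)) ?mulr_gt0 // mulrDr mulrA [X in _ <= _ + X]mulrA mulfV ?mul1r; last by rewrite gt_eqF ?mulr_gt0.
lra.
Qed.

Lemma sub_through (M : zmodType) (a b c d : M) : a - b = c - d - (c - a) + (d - b).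
Proof. by rewrite opprB (addrC (c - d)) !addrA subrK subrK. Qed.

Lemma sub_chain (M : zmodType) (a b c e : M) : a + b = - (- c - a) - (c - e) - (e - b).
Proof.
by rewrite !opprB opprK -(addrA a) [c + (e - c)]addrCA subrr addr0 -(addrA a) [e + (b - e)]addrCA subrr addr0.
Qed.

Lemma alg_sq5 (R : realFieldType) (a b c d e : R) :
  (a + b + (c + (d + e))) ^+ 2 <= 5 * (a ^+ 2 + b ^+ 2 + (c ^+ 2 + (d ^+ 2 + e ^+ 2))).
Proof.
have := sqr_ge0 (a - b); have := sqr_ge0 (a - c); have := sqr_ge0 (a - d); have := sqr_ge0 (a - e).
have := sqr_ge0 (b - c); have := sqr_ge0 (b - d); have := sqr_ge0 (b - e).
have := sqr_ge0 (c - d); have := sqr_ge0 (c - e); have := sqr_ge0 (d - e).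
lra.
Qed.

Lemma alg_tail (R : realFieldType) (al c b b' s y d q p1 p2 : R) : 0 < al -> 0 <= d ->
  al * d ^+ 2 <= p1 -> - p2 <= q * d -> q <= c * (b + b' + s * y) ->
  al / 2 * d ^+ 2 + (- p1 - p2) <= 3 * c ^+ 2 / (2 * al) * (b ^+ 2 + b' ^+ 2 + s ^+ 2 * y ^+ 2).
Proof.
move=> al0 d0 h1 h2 h3; have h4 := ler_wpM2r d0 h3.
have h5 := alg_young d (c * (b + b' + s * y)) 1 (divr_gt0 al0 (ltr0n _ 2)).
have h6 : 0 <= c ^+ 2 / (2 * al) by rewrite divr_ge0 ?sqr_ge0 // mulr_ge0 // ltW.
have h7 := ler_wpM2l h6 (alg_sq3 b b' (s * y)).
rewrite mulr1 (_ : (4 * (al / 2))^-1 * _ = c ^+ 2 / (2 * al) * (b + b' + s * y) ^+ 2) in h5; last by field; rewrite gt_eqF.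
rewrite exprMn in h7; rewrite -[3 * c ^+ 2 / _]mulrA; lra.
Qed.

Lemma alg_chain (R : realFieldType) (c b b' s s' x y d q q1 q2 q3 r : R) : q <= q1 + r -> r <= q2 + q3 ->
  q1 <= c * (b + s * x) -> q2 <= c * d -> q3 <= c * (b' + s' * y) ->
  q <= c * (b + b' + (s * x + (s' * y + d))).
Proof. by move=> *; lra. Qed.

Lemma alg_ee (R : realFieldType) (a b x p q r : R) : x <= (2 * p + 2 * q) * r ->
  a + b + x <= a + 2 * (p * r) + (b + 2 * (q * r)).
Proof. by move=> *; lra. Qed.

Lemma alg_sum (R : realFieldType) (k1 bk bl p q d a1 a2 : R) : a1 <= p -> a2 <= q ->
  0 <= p -> 0 <= q -> d <= k1 * (bk + 2 * p + (bl + 2 * q)) ->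
  bk + bl + (a1 + (a2 + d)) <= bk + 2 * p + (bl + 2 * q) + k1 * (bk + 2 * p + (bl + 2 * q)).
Proof. by move=> *; lra. Qed.

Lemma alg_sq5c (R : realFieldType) (k a b s x s' y e : R) :
  (k * (a + b + (s * x + (s' * y + e)))) ^+ 2 <=
  5 * k ^+ 2 * (a ^+ 2 + b ^+ 2 + (s ^+ 2 * x ^+ 2 + (s' ^+ 2 * y ^+ 2 + e ^+ 2))).
Proof.
have := ler_wpM2l (sqr_ge0 k) (alg_sq5 a b (s * x) (s' * y) e).
by rewrite !exprMn [k ^+ 2 * (5 * _)]mulrA [k ^+ 2 * 5]mulrC.
Qed.

Lemma hcauchy_sq (R : realType) (E : phs R) (u : nat -> E) (K : R) (e : nat -> R) :
  (forall n m, hn (u n - u m) ^+ 2 <= K * (e n + e m)) -> cv e 0 -> hcauchy u.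
Proof.
move=> h /cvP he eps eps0.
have K1 : 0 < `|K| + 1 by rewrite ltr_pwDr.
have [N hN] := he (eps ^+ 2 / (2 * (`|K| + 1))) (divr_gt0 (exprn_gt0 2 eps0) (mulr_gt0 (ltr0n _ 2) K1)).
exists N => n m /hN + /hN; rewrite !subr0 => hn' hm'.
rewrite -ltr_sqr ?nnegrE ?hn_ge0 ?ltW //; apply: le_lt_trans (h n m) _.
apply: le_lt_trans (ler_norm _) _; rewrite normrM.
have h1 : `|e n + e m| < eps ^+ 2 / (`|K| + 1).
  apply: le_lt_trans (ler_normD _ _) _; rewrite -[X in _ < X](_ : eps ^+ 2 / (2 * (`|K| + 1)) + eps ^+ 2 / (2 * (`|K| + 1)) = _); first exact: ltrD.
  by field; rewrite gt_eqF.
move: h1; rewrite ltr_pdivlMr // => h1; apply: le_lt_trans h1.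
by rewrite mulrC ler_wpM2l // lerDl.
Qed.

(** * Limits of Lipschitz monotone operators *)

Section NonlinearLimit.
Variables (R : realType) (T : R) (T0 : 0 < T) (V H : phs R).
Variables (cV : hcomplete V) (cH : hcomplete H) (i : V -> H) (Ci : R).
Hypothesis iL : forall (a : R) x y, i (a *: x + y) = a *: i x + i y.
Hypothesis iC : forall x, hn (i x) <= Ci * hn x.
Hypothesis iinj : forall x, hn (i x) = 0 -> hn x = 0.
Hypothesis idense : forall xi, (forall v, ip xi (i v) = 0) -> hn xi = 0.
Local Notation D := (Iv T).
Let mD : measurable D := mIv T.
Local Notation X := (L2 (leb1 R) mD V).
Local Notation Wsol := (@Wsol R T V H i).

(** [g k] stands for the operator truncated at level [k] and [gi] for the full one. The truncation
    error splits into a tail [be k] of the data and a part proportional to [hn u] with a small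
    factor [ka k]; its constant [C B] depends on a bound [B] in [H] only, whereas [L k] may blow
    up. *)
Variables (g : nat -> R -> V -> V) (gi : R -> V -> V) (al : R) (L : nat -> R) (gam : R -> R).
Variables (be : nat -> R -> R) (be0 : R -> R) (ka : nat -> R) (C : R -> R).
Hypothesis al0 : 0 < al.
Hypothesis gclean : forall k (u : X), clean D (fun t => g k t (val u t)).
Hypothesis gmon : forall k t u v, D t -> al * hn (u - v) ^+ 2 <= ip (g k t u - g k t v) (u - v).
Hypothesis glip : forall k t u v, D t -> hn (g k t u - g k t v) <= L k * hn (u - v).
Hypothesis gzero : forall k t, D t -> hn (g k t 0) <= gam t.
Hypothesis gam2 : itgT T (fun t => gam t ^+ 2).
Hypothesis be_meas : forall k, measurable_fun D (be k).
Hypothesis be_le : forall k t, D t -> 0 <= be k t <= be0 t.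
Hypothesis be02 : itgT T (fun t => be0 t ^+ 2).
Hypothesis be_cv : forall t, D t -> cv (be^~ t) 0.
Hypothesis ka_cv : cv ka 0.
Hypothesis C_ge0 : forall B, 0 <= C B.
Hypothesis gdiff : forall B k t u, D t -> hn (i u) <= B ->
  hn (g k t u - gi t u) <= C B * (be k t + ka k * hn u).
Hypothesis gilip : forall B t u v, D t -> hn (i u) <= B -> hn (i v) <= B ->
  hn (gi t u - gi t v) <= C B * hn (u - v).

Lemma glim_Xmem k (u : X) : L2mem (leb1 R) D (fun t => g k t (val u t)).
Proof.
have hg : itgT T (fun t => 2 * (L k ^+ 2 * ip (val u t) (val u t)) + 2 * gam t ^+ 2).
  apply: (itgD mD); last exact: (itgZ mD).
  by apply: (itgZ mD); apply: (itgZ mD); exact: L2_itg.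
apply: (L2mem_dom mD (gclean k u) hg) => t Dt.
have hle : hn (g k t (val u t)) <= L k * hn (val u t) + gam t.
  have -> : g k t (val u t) = (g k t (val u t) - g k t 0) + g k t 0 by rewrite subrK.
  apply: le_trans (hnD _ _) _; apply: lerD; last exact: gzero.
  by have := glip k (val u t) 0 Dt; rewrite subr0.
rewrite -!hn_sq -exprMn; apply: le_trans (alg_sq2 _ _).
by rewrite ler_sqr ?nnegrE ?hn_ge0 //; exact: le_trans (hn_ge0 _) hle.
Qed.

Definition glimX k (u : X) : X := mkL2 mD (glim_Xmem k u).

Lemma glimX_mon k u v : al * hn (u - v) ^+ 2 <= ip (glimX k u - glimX k v) (u - v).
Proof.
rewrite hn_sq !L2ipE -(IntZ mD); last exact: L2_itg.
apply: Int_le => //; [by apply: (itgZ mD); exact: L2_itg|exact: L2_itg|].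
by move=> t Dt; rewrite -hn_sq; exact: gmon.
Qed.

Lemma glimX_lip k u v : hn (glimX k u - glimX k v) <= `|L k| * hn (u - v).
Proof.
rewrite -ler_sqr ?nnegrE ?mulr_ge0 ?hn_ge0 // exprMn !hn_sq !L2ipE -(IntZ mD); last exact: L2_itg.
apply: Int_le => //; [exact: L2_itg|by apply: (itgZ mD); exact: L2_itg|].
move=> t Dt; rewrite -!hn_sq -exprMn ler_sqr ?nnegrE ?mulr_ge0 ?hn_ge0 //.
apply: le_trans (glip k (val u t) (val v t) Dt) _.
by rewrite ler_wpM2r ?hn_ge0 // ler_norm.
Qed.

(** The inequality for [g k] passes to the limit in [k], because the truncation errors at the two
    fixed points vanish; only the sign is kept. *)
Lemma gi_mono t u v : D t -> 0 <= ip (gi t u - gi t v) (u - v).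
Proof.
move=> Dt; pose B := Num.max (hn (i u)) (hn (i v)).
have bu : hn (i u) <= B by rewrite le_max lexx.
have bv : hn (i v) <= B by rewrite le_max lexx orbT.
have key k : - (C B * (be k t + ka k * hn u) * hn (u - v) + C B * (be k t + ka k * hn v) * hn (u - v)) <= ip (gi t u - gi t v) (u - v).
  have hu := gdiff k Dt bu; have hv := gdiff k Dt bv.
  have -> : gi t u - gi t v = (g k t u - g k t v) - (g k t u - gi t u) + (g k t v - gi t v).
    exact: sub_through.
  rewrite ipDl ipBl.
  have h1 := ip_le (g k t u - gi t u) (u - v).
  have h2 := ip_le (- (g k t v - gi t v)) (u - v); rewrite ipNl hnN in h2.
  have h3 := ler_wpM2r (hn_ge0 (u - v)) hu; have h4 := ler_wpM2r (hn_ge0 (u - v)) hv.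
  have h5 := gmon k u v Dt; have h6 : 0 <= al * hn (u - v) ^+ 2 by rewrite mulr_ge0 ?sqr_ge0 ?ltW.
  lra.
have cvt (w : V) : cv (fun k => C B * (be k t + ka k * hn w) * hn (u - v)) 0.
  have h1 := cvD (be_cv Dt) (cvM ka_cv (cvC (hn w))).
  have h2 := cvM (cvZ (C B) h1) (cvC (hn (u - v))).
  by rewrite mul0r addr0 mulr0 mul0r in h2.
have h := cvN (cvD (cvt u) (cvt v)); rewrite addr0 oppr0 in h.
exact: (cv_le key h (cvC _)).
Qed.

Definition glim_sol (u z : X) (U : R -> H) : Prop := Wsol u z U /\
  \forall t \ae leb1 R, D t -> hn (val z t + gi t (val u t)) = 0.

Lemma glim_unique u z U u' z' U' : glim_sol u z U -> glim_sol u' z' U' ->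
  hn (U 0 - U' 0) = 0 -> forall t, 0 <= t <= T -> hn (U t - U' t) = 0.
Proof.
move=> [W hz] [W' hz'] h0 t tT.
have [hE _] := @Wsol_good R T T0 V H cV cH i Ci iL iC iinj idense _ _ _ (WsolB iL W W').
have tT2 : t <= T by case/andP: tT.
have := hE t tT; rewrite -[ip (U 0 - U' 0) _]hn_sq h0 expr0n add0r => hE1.
have : pairT t (z - z') (u - u') <= IntT t (fun=> 0).
  apply: (@Int_le_ae _ _ _ _ _ _ _ (mIv t)); first exact: pairT_itg.
    exact: itg0.
  apply: filterS2 hz hz' => s h1 h2 Ds.
  have Ds' : D s := Iv_sub tT2 Ds.
  have h3 := gi_mono (val u s) (val u' s) Ds'; rewrite ipBl in h3.
  have e1 : ip (val z s) (val u s - val u' s) = - ip (gi s (val u s)) (val u s - val u' s).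
    by apply/eqP; rewrite -addr_eq0 -ipDl; apply/eqP/ip_hn0; exact: h1.
  have e2 : ip (val z' s) (val u s - val u' s) = - ip (gi s (val u' s)) (val u s - val u' s).
    by apply/eqP; rewrite -addr_eq0 -ipDl; apply/eqP/ip_hn0; exact: h2.
  rewrite !L2_subE ipBl e1 e2 opprK addrC subr_le0 -subr_ge0.
  exact: h3.
rewrite (Int0 _ (Iv t)) => hp; apply/eqP; rewrite -sqrf_eq0 hn_sq eq_le ip_ge0 andbT.
by move: hE1 hp => /= -> hp; lra.
Qed.

(** Monotonicity against [0] and Young's inequality. The bound [Q] involves the initial value and
    [gam] only, hence neither [k] nor [L k]. *)
Lemma glim_apriori k (h : H) u U : Wsol u (- glimX k u) U -> hn (U 0 - h) = 0 ->
  let Q := hn h ^+ 2 + al^-1 * IntT T (fun t => gam t ^+ 2) in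
  (forall t, 0 <= t <= T -> hn (U t) ^+ 2 <= Q) /\ al * hn u ^+ 2 <= Q.
Proof.
move=> W h0 Q.
have [hE _] := @Wsol_good R T T0 V H cV cH i Ci iL iC iinj idense _ _ _ W.
have key t : 0 <= t <= T -> hn (U t) ^+ 2 + al * pairT t u u <= Q.
  move=> tT; have tT2 : t <= T by case/andP: tT.
  rewrite hn_sq (hE t tT) -hn_sq (hn_eq0 h0) /Q -addrA lerD2l.
  have hi : itgT t (fun s => - al * ip (val u s) (val u s) + al^-1 * gam s ^+ 2).
    by apply: (itgD (mIv t)); apply: (itgZ (mIv t)); [exact: pairT_itg|exact: itgT_sub gam2].
  have h1 : 2 * pairT t (- glimX k u) u <= IntT t (fun s => - al * ip (val u s) (val u s) + al^-1 * gam s ^+ 2).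
    rewrite /pairT -(IntZ (mIv t)); last exact: pairT_itg.
    apply: (Int_le (mIv t)) => //; first by apply: (itgZ (mIv t)); exact: pairT_itg.
    move=> s Ds; have Ds' : D s := Iv_sub tT2 Ds.
    rewrite [ip _ _](_ : _ = - ip (g k s (val u s)) (val u s)); last exact: ipNl.
    have := gmon k (val u s) 0 Ds'; rewrite subr0 ipBl -hn_sq.
    have h2 := ip_le (- g k s 0) (val u s); rewrite ipNl hnN in h2.
    have h3 := ler_wpM2r (hn_ge0 (val u s)) (gzero k Ds').
    have := alg_young (hn (val u s)) (gam s) 2 al0.
    rewrite exprMn (_ : (4 * al)^-1 * (gam s ^+ 2 * 2 ^+ 2) = al^-1 * gam s ^+ 2); last by field; rewrite gt_eqF.
    by move: h2 h3; move: (hn _) (ip _ _) (ip _ _) => a b c; lra.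
  rewrite (IntD (mIv t)) ?(IntZ (mIv t)) in h1; last first.
  - by apply: (itgZ (mIv t)); exact: itgT_sub gam2.
  - by apply: (itgZ (mIv t)); exact: pairT_itg.
  - exact: pairT_itg.
  - exact: itgT_sub gam2.
  have h2 := IntT_abs_le tT2 gam2.
  have h3 : IntT t (fun s => gam s ^+ 2) <= IntT T (fun s => gam s ^+ 2).
    apply: le_trans (ler_norm _) (le_trans h2 _); rewrite le_eqVlt; apply/orP; left; apply/eqP.
    by apply: Int_eq => s _; rewrite ger0_norm // sqr_ge0.
  have h4 := ler_wpM2l (_ : 0 <= al^-1) h3; rewrite invr_ge0 (ltW al0) in h4; have := h4 isT.
  by move: h1; rewrite -/(pairT t u u); lra.
have p0 t : 0 <= pairT t u u by apply: Int_ge0 => s _; exact: ip_ge0.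
split=> [t tT|].
  by apply: le_trans (key t tT); rewrite lerDl mulr_ge0 ?(ltW al0).
have TT : 0 <= T <= T by rewrite lexx ltW.
by apply: le_trans (key T TT); rewrite pairT_T hn_sq lerDr sqr_ge0.
Qed.

Lemma glim_exists (h : H) : exists u z U, glim_sol u z U /\ hn (U 0 - h) = 0.
Proof.
have ex k : exists p : X * (R -> H), Wsol p.1 (- glimX k p.1) p.2 /\ hn (p.2 0 - h) = 0.
  have [u [U hU]] := @nonlinear_ex R T T0 V H cV cH i Ci iL iC iinj idense _ _ _ al0 (@glimX_mon k) (@glimX_lip k) h.
  by exists (u, U).
have [p hp] := choice ex.
pose u k := (p k).1; pose U k := (p k).2; pose z k := - glimX k (u k).
have hW k : Wsol (u k) (z k) (U k) by have [] := hp k.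
have hU0 k : hn (U k 0 - h) = 0 by have [] := hp k.
pose Q := hn h ^+ 2 + al^-1 * IntT T (fun t => gam t ^+ 2).
have hQ k := glim_apriori (hW k) (hU0 k).
pose B := Num.sqrt Q.
have Q0 : 0 <= Q by have [_] := hQ 0%N; apply: le_trans; rewrite mulr_ge0 ?sqr_ge0 ?ltW.
have uQ k : hn (u k) ^+ 2 <= Q / al by have [_ h1] := hQ k; rewrite ler_pdivlMr // mulrC.
have aeB k : \forall t \ae leb1 R, D t -> hn (i (val (u k) t)) <= B.
  have [_ h1] := hW k; apply: filterS h1 => t h1 Dt.
  rewrite -(hn_eq0 (h1 Dt)) -ler_sqr ?nnegrE ?hn_ge0 ?sqrtr_ge0 // [B ^+ 2]sqr_sqrtr //.
  have [h2 _] := hQ k; apply: h2.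
  by have /IvP/andP[/ltW -> /ltW ->] := Dt.
have be2 k : itgT T (fun t => be k t ^+ 2).
  apply: (itg_le mD _ be02); first exact: measurable_funX.
  move=> t Dt; have /andP[b0 b1] := be_le k Dt.
  by rewrite ger0_norm ?sqr_ge0 // ler_sqr ?nnegrE ?(le_trans b0).
have b2cv : cv (fun k => IntT T (fun t => be k t ^+ 2)) 0.
  have hd k t : D t -> `|be k t ^+ 2| <= be0 t ^+ 2.
    move=> Dt; have /andP[b0 b1] := be_le k Dt.
    by rewrite ger0_norm ?sqr_ge0 // ler_sqr ?nnegrE ?(le_trans b0).
  have hc t : D t -> cv (fun k => be k t ^+ 2) 0.
    by move=> Dt; have := cvX 2 (be_cv Dt); rewrite expr0n.
  have [_] := Int_dct mD (fun k => measurable_funX 2 (be_meas k)) be02 hd hc.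
  by rewrite Int0.
(* The squared truncation error at level [k] integrated in time, up to constants, with
   [hn (u k) ^+ 2] replaced by its bound [Q / al]. *)
pose e k := IntT T (fun t => be k t ^+ 2) + 2 * (ka k ^+ 2 * (Q / al)).
have ecv : cv e 0.
  have h1 := cvD b2cv (cvZ 2 (cvM (cvX 2 ka_cv) (cvC (Q / al)))).
  by rewrite expr0n mul0r mulr0 addr0 in h1.
have Qa0 : 0 <= Q / al by rewrite divr_ge0 // ltW.
have hC0 := C_ge0 B.
(* The difference of the operators is split at the common point [u l]: monotonicity of [g k] handles
   [g k (u k) - g k (u l)], and [g k (u l) - g l (u l)] is a pure truncation error, estimated
   through [gi]. *)
have ucau : exists K, forall k l, hn (u k - u l) ^+ 2 <= K * (e k + e l).
  exists (3 * C B ^+ 2 / al ^+ 2) => k l.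
  pose d := u k - u l.
  pose w t := 3 * C B ^+ 2 / (2 * al) * (be k t ^+ 2 + be l t ^+ 2 + (ka k + ka l) ^+ 2 * ip (val (u l) t) (val (u l) t)).
  have iw0 : itgT T (fun t => be k t ^+ 2 + be l t ^+ 2) by apply: (itgD mD).
  have iw1 : itgT T (fun t => (ka k + ka l) ^+ 2 * ip (val (u l) t) (val (u l) t)) by apply: (itgZ mD); exact: L2_itg.
  have iw2 : itgT T (fun t => be k t ^+ 2 + be l t ^+ 2 + (ka k + ka l) ^+ 2 * ip (val (u l) t) (val (u l) t)) by exact: (itgD mD).
  have iw : itgT T w by apply: (itgZ mD).
  have ii : itgT T (fun t => al / 2 * ip (val d t) (val d t) + ip (val (z k - z l) t) (val d t)).
    by apply: (itgD mD); [apply: (itgZ mD); exact: L2_itg|exact: L2_itg].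
  have hle : IntT T (fun t => al / 2 * ip (val d t) (val d t) + ip (val (z k - z l) t) (val d t)) <= IntT T w.
    apply: (Int_le_ae mD ii iw); apply: filterS (aeB l) => t hB Dt.
    have {}hB := hB Dt.
    set x := val (u k) t; set y := val (u l) t.
    have h1 := gdiff k Dt hB; have h2 := gdiff l Dt hB.
    have -> : val d t = x - y by [].
    have -> : val (z k - z l) t = - g k t x - - g l t y by [].
    have h3 := gmon k x y Dt.
    have h4 : ip (- g k t x - - g l t y) (x - y) = - ip (g k t x - g k t y) (x - y) - ip (g k t y - g l t y) (x - y).
      by rewrite -opprD !ipNl !ipBl; ring.
    have h5 := ip_le (- (g k t y - g l t y)) (x - y); rewrite ipNl hnN in h5.
    have h6 := hn_triB (g k t y) (gi t y) (g l t y); rewrite [hn (gi t y - _)]hnBC in h6.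
    have h7 : hn (g k t y - g l t y) <= C B * (be k t + be l t + (ka k + ka l) * hn y).
      by apply: le_trans h6 (le_trans (lerD h1 h2) _); rewrite -mulrDr; apply: ler_wpM2l => //; rewrite mulrDl addrACA.
    rewrite h4 /w -/y -!hn_sq.
    exact: alg_tail al0 (hn_ge0 _) h3 h5 h7.
  have TT : 0 <= T <= T by rewrite lexx ltW.
  have [hE _] := @Wsol_good R T T0 V H cV cH i Ci iL iC iinj idense _ _ _ (WsolB iL (hW k) (hW l)).
  have := hE T TT; rewrite pairT_T.
  have h0 : hn (U k 0 - U l 0) = 0 by apply: (hn0_tri (hU0 k)); rewrite hnBC.
  rewrite -[ip (U k 0 - _) _]hn_sq h0 expr0n add0r -/d => hE1.
  have hge : 0 <= ip (z k - z l) d by rewrite -(pmulr_rge0 _ (ltr0n R 2)) -hE1 ip_ge0.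
  rewrite (IntD mD (itgZ mD _ (L2_itg d d)) (L2_itg _ _)) (IntZ mD _ (L2_itg d d)) in hle.
  rewrite /w (IntZ mD _ iw2) (IntD mD iw0 iw1) (IntD mD (be2 k) (be2 l)) (IntZ mD _ (L2_itg (u l) (u l))) in hle.
  have h1 : IntT T (fun t => ip (val (u l) t) (val (u l) t)) <= Q / al by have := uQ l; rewrite hn_sq.
  have h2 : (ka k + ka l) ^+ 2 * IntT T (fun t => ip (val (u l) t) (val (u l) t)) <= (2 * ka k ^+ 2 + 2 * ka l ^+ 2) * (Q / al).
    apply: ler_pM => //; [exact: sqr_ge0|by apply: Int_ge0 => t _; exact: ip_ge0|exact: alg_sq2].
  have h3 : 0 <= 3 * C B ^+ 2 / (2 * al) by rewrite divr_ge0 ?mulr_ge0 ?sqr_ge0 // ltW.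
  have h4 : al / 2 * hn d ^+ 2 <= 3 * C B ^+ 2 / (2 * al) * (e k + e l).
    rewrite hn_sq; have h5 := le_trans hle (ler_wpM2l h3 (_ : _ <= e k + e l)).
    have h6 : al / 2 * IntT T (fun t => ip (val d t) (val d t)) + ip (z k - z l) d <= 3 * C B ^+ 2 / (2 * al) * (e k + e l).
      by apply: h5; rewrite /e; exact: alg_ee.
    by apply: le_trans h6; rewrite lerDl.
  have h5 := ler_wpM2l (_ : 0 <= 2 / al) h4; rewrite divr_ge0 ?(ltW al0) // in h5; have {}h5 := h5 isT.
  rewrite (_ : 2 / al * (al / 2 * hn d ^+ 2) = hn d ^+ 2) in h5; last by field; rewrite gt_eqF.
  by apply: le_trans h5 _; rewrite le_eqVlt; apply/orP; left; apply/eqP; field; rewrite gt_eqF.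
have [K hK] := ucau.
(* The time derivatives are Cauchy as well, through the Lipschitz bound of [gi] on sets bounded in
   [H]. *)
have zcau : exists K', forall k l, hn (z k - z l) ^+ 2 <= K' * (e k + e l).
  exists (5 * C B ^+ 2 * (1 + K)) => k l.
  pose d := u k - u l.
  pose w t := 5 * C B ^+ 2 * (be k t ^+ 2 + be l t ^+ 2 + (ka k ^+ 2 * ip (val (u k) t) (val (u k) t) + (ka l ^+ 2 * ip (val (u l) t) (val (u l) t) + ip (val d t) (val d t)))).
  have iq (k' : R) (x : X) : itgT T (fun t => k' * ip (val x t) (val x t)) by apply: (itgZ mD); exact: L2_itg.
  have iw0 : itgT T (fun t => be k t ^+ 2 + be l t ^+ 2) by apply: (itgD mD).
  have iw1 : itgT T (fun t => ka l ^+ 2 * ip (val (u l) t) (val (u l) t) + ip (val d t) (val d t)) by apply: (itgD mD) => //; exact: L2_itg.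
  have iw2 : itgT T (fun t => ka k ^+ 2 * ip (val (u k) t) (val (u k) t) + (ka l ^+ 2 * ip (val (u l) t) (val (u l) t) + ip (val d t) (val d t))) by apply: (itgD mD).
  have iw3 := itgD mD iw0 iw2.
  have iw : itgT T w by apply: (itgZ mD).
  have hle : ip (z k - z l) (z k - z l) <= IntT T w.
    rewrite L2ipE; apply: (Int_le_ae mD (L2_itg _ _) iw); apply: filterS2 (aeB k) (aeB l) => t hBk hBl Dt.
    have {}hBk := hBk Dt; have {}hBl := hBl Dt.
    rewrite -hn_sq /w -!hn_sq.
    set x := val (u k) t in hBk *; set y := val (u l) t in hBl *.
    have -> : val d t = x - y by [].
    have -> : val (z k - z l) t = - g k t x - - g l t y by [].
    have h1 := gdiff k Dt hBk; have h2 := gdiff l Dt hBl; have h3 := gilip Dt hBk hBl.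
    have h4 : hn (- g k t x - - g l t y) <= C B * (be k t + be l t + (ka k * hn x + (ka l * hn y + hn (x - y)))).
      rewrite -opprD hnN; have h6 := hn_triB (gi t x) (gi t y) (g l t y).
      rewrite [hn (gi t y - g l t y)]hnBC in h6.
      exact: alg_chain (hn_triB (g k t x) (gi t x) (g l t y)) h6 h1 h3 h2.
    have h5 : hn (- g k t x - - g l t y) ^+ 2 <= (C B * (be k t + be l t + (ka k * hn x + (ka l * hn y + hn (x - y))))) ^+ 2.
      by rewrite ler_sqr ?nnegrE ?hn_ge0 //; exact: le_trans (hn_ge0 _) h4.
    exact: le_trans h5 (alg_sq5c _ _ _ _ _ _ _ _).
  have sw : IntT T w = 5 * C B ^+ 2 * (IntT T (fun t => be k t ^+ 2) + IntT T (fun t => be l t ^+ 2) + (ka k ^+ 2 * ip (u k) (u k) + (ka l ^+ 2 * ip (u l) (u l) + ip d d))).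
    rewrite /w (IntZ mD) // (IntD mD) // (IntD mD) // (IntD mD) // ?(IntZ mD) ?(IntD mD) ?(IntZ mD) //; try exact: L2_itg.
  rewrite hn_sq; apply: le_trans hle _; rewrite sw -[X in _ <= X]mulrA; apply: ler_wpM2l; first by rewrite mulr_ge0 ?sqr_ge0.
  have h1 := hK k l; rewrite -/d in h1.
  have h2 := ler_wpM2l (sqr_ge0 (ka k)) (uQ k); have h3 := ler_wpM2l (sqr_ge0 (ka l)) (uQ l).
  have h4 : 0 <= ka k ^+ 2 * (Q / al) by rewrite mulr_ge0 ?sqr_ge0.
  have h5 : 0 <= ka l ^+ 2 * (Q / al) by rewrite mulr_ge0 ?sqr_ge0.
  by rewrite -!hn_sq mulrDl mul1r /e; exact: alg_sum h2 h3 h4 h5 h1.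
have [K' hK'] := zcau.
have [u' cu] : exists l : X, hcvg u l.
  by apply: (@L2_complete _ _ _ (leb1 R) D mD (Iv_fin T) V cV); exact: hcauchy_sq hK ecv.
have [z' cz] : exists l : X, hcvg z l.
  by apply: (@L2_complete _ _ _ (leb1 R) D mD (Iv_fin T) V cV); exact: hcauchy_sq hK' ecv.
have c0 : hcvg (fun n => U n 0) h.
  by apply: (hcvg_le (b := fun=> 0)) => [n|]; [rewrite hU0|exact: cvC].
have [U' [W' hU']] := @Wsol_limit R T T0 V H cV cH i Ci iL iC iinj idense u z U u' z' h hW cu cz c0.
exists u', z', U'; split=> //; split=> //.
(* Along a common subsequence converging almost everywhere in time, the equation passes to the limit
   at fixed [t]. *)
have [f [hf aeu]] := L2_ae_subseq cu.
have [f' [hf' aez]] := L2_ae_subseq (hcvg_sub hf cz).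
have aeB' : \forall t \ae leb1 R, D t -> forall k, hn (i (val (u k) t)) <= B.
  have := @ae_foralln _ _ _ (leb1 R) (fun k t => D t -> hn (i (val (u k) t)) <= B) aeB.
  by apply: filterS => t ht Dt k; exact: ht.
apply: filterS3 aeu aez aeB' => t hu hz hB Dt.
have {}hu := hcvg_sub hf' (hu Dt); have {}hz := hz Dt; have {}hB := hB Dt.
pose n k := f (f' k).
have nk k : (k <= n k)%N := leq_trans (hf' k) (hf _).
have hBl : hn (i (val u' t)) <= B.
  have hc : hcvg (fun k => i (val (u (n k)) t)) (i (val u' t)).
    apply: (hcvg_le (b := fun k => Ci * hn (val (u (n k)) t - val u' t))) => [k|].
      by rewrite -(iB iL); exact: iC.
    by have := cvZ Ci hu; rewrite mulr0.
  exact: (cv_le (fun k => hB (n k)) (hcvg_hn hc) (cvC _)).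
have key k : hn (val z' t + gi t (val u' t)) <= hn (val (z (n k)) t - val z' t) +
    C B * (be (n k) t + ka (n k) * hn (val (u (n k)) t)) + C B * hn (val (u (n k)) t - val u' t).
  have h1 := gdiff (n k) Dt (hB (n k)); have h2 := gilip Dt (hB (n k)) hBl.
  have -> : val z' t + gi t (val u' t) = - (val (z (n k)) t - val z' t) - (g (n k) t (val (u (n k)) t) - gi t (val (u (n k)) t)) - (gi t (val (u (n k)) t) - gi t (val u' t)).
    rewrite -[val (z (n k)) t]/(- g (n k) t (val (u (n k)) t)); exact: sub_chain.
  apply: le_trans (hnB_le _ _) _; apply: lerD h2; apply: le_trans (hnB_le _ _) _.
  by rewrite hnN; exact: lerD.
have c1 := cv_sub nk (be_cv Dt); have c2 := cvM (cv_sub nk ka_cv) (hcvg_hn hu).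
have c3 := cvD (cvD hz (cvZ (C B) (cvD c1 c2))) (cvZ (C B) hu).
rewrite mul0r !addr0 mulr0 !addr0 in c3.
by apply/eqP; rewrite eq_le hn_ge0 andbT; exact: (cv_le key (cvC _) c3).
Qed.

End NonlinearLimit.

Lemma rho_ge0 (R : realType) (k r : R) : 0 <= rho k r.
Proof. by rewrite subr_ge0 ge_min lexx. Qed.

Lemma rho_le (R : realType) (k r : R) : 0 <= k -> 0 <= r -> rho k r <= r.
Proof. by move=> k0 r0; rewrite gerBl le_min r0 k0. Qed.

(** The larger of [a] and [b] is at least [r / 2], so it exceeds [j] as soon as [r] exceeds [2 * j].
    Hence the truncation levels of the form [2 * j]. *)
Lemma rho_split (R : realType) (j r a b : R) : 0 <= j -> 0 <= r -> 0 <= a -> 0 <= b -> r <= a + b ->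
  r * rho (2 * j) r <= 4 * (a * rho j a) + 4 * (b * rho j b).
Proof.
move=> j0 r0 a0 b0 rab.
have key (x y : R) : 0 <= x -> r <= 2 * x -> r * rho (2 * j) r <= 4 * (x * rho j x).
  move=> x0 rx.
  have h : rho (2 * j) r <= 2 * rho j x by rewrite /rho; have [h1|h1] := leP r (2 * j); have [h2|h2] := leP x j; lra.
  apply: le_trans (ler_pM r0 (rho_ge0 _ _) rx h) _; lra.
have pa : 0 <= 4 * (a * rho j a) by rewrite !mulr_ge0 ?rho_ge0.
have pb : 0 <= 4 * (b * rho j b) by rewrite !mulr_ge0 ?rho_ge0.
have [h|h] := leP a b.
  apply: le_trans (key b a b0 _) _; last by rewrite lerDr.
  lra.
apply: le_trans (key a b a0 _) _; last by rewrite lerDl.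
lra.
Qed.

(** For [b <= j] the left side vanishes, otherwise [Num.sqrt (b / j)] is at least [1]. The power one
    half is chosen because [Num.sqrt b] lies in [L^4] when [b] lies in [L^2]. *)
Lemma rho_sqrt (R : realType) (j b : R) : 0 < j -> 0 <= b -> rho j b <= b * Num.sqrt (b / j).
Proof.
move=> j0 b0; have [h|h] := leP b j.
  by rewrite /rho min_l // subrr mulr_ge0 ?sqrtr_ge0.
apply: le_trans (rho_le (ltW j0) b0) _; rewrite -[X in X <= _]mulr1 ler_wpM2l //.
by rewrite -[X in X <= _]sqrtr1 ler_wsqrtr // ler_pdivlMr // mul1r ltW.
Qed.

(** * Integral estimates of the drag *)

Section Fourth.
Context d (S : measurableType d) (R : realType) (nu : {measure set S -> \bar R}) (D : set S).
Variable mD : measurable D.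
Local Notation Int f := (Rintegral nu D f).

(** The [L^4] norm, with two square roots in place of a power [1 / 4]. *)
Definition N4 (f : S -> R) : R := Num.sqrt (Num.sqrt (Int (fun x => f x ^+ 4))).

Lemma N4_ge0 f : 0 <= N4 f. Proof. exact: sqrtr_ge0. Qed.

Lemma N4_sq f : N4 f ^+ 2 = Num.sqrt (Int (fun x => f x ^+ 4)).
Proof. by rewrite sqr_sqrtr // sqrtr_ge0. Qed.

(** Hölder's inequality with exponents 2, 4, 4, obtained from Cauchy-Schwarz applied twice. *)
Lemma dom3 (F a b e : S -> R) : measurable_fun D F -> measurable_fun D a ->
  measurable_fun D b -> measurable_fun D e -> itg nu D (fun x => a x ^+ 2) ->
  itg nu D (fun x => b x ^+ 4) -> itg nu D (fun x => e x ^+ 4) ->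
  (forall x, D x -> `|F x| <= a x * (b x * e x)) ->
  itg nu D F /\ `|Int F| <= Num.sqrt (Int (fun x => a x ^+ 2)) * (N4 b * N4 e).
Proof.
move=> mF ma mb me ia ib ie h.
have e4 f : (fun x : S => (f x ^+ 2) ^+ 2) = (fun x => f x ^+ 4 : R).
  by apply/funext => x; rewrite -exprM.
have [i1 l1] := Int_CS mD (measurable_funX 2 mb) (measurable_funX 2 me)
  (eq_ind_r (itg nu D) ib (e4 b)) (eq_ind_r (itg nu D) ie (e4 e)).
have ebe : (fun x => (b x * e x) ^+ 2) = (fun x => b x ^+ 2 * e x ^+ 2).
  by apply/funext => x; rewrite exprMn.
have [i2 l2] := Int_CS mD ma (measurable_funM mb me) ia (eq_ind_r (itg nu D) i1 ebe).
have iF := itg_le mD mF i2 h; split=> //.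
apply: le_trans (Int_abs_le mD iF i2 h) _; apply: le_trans (ler_norm _) _.
apply: le_trans l2 _; apply: ler_wpM2l; first exact: sqrtr_ge0.
rewrite ebe /N4 -sqrtrM ?sqrtr_ge0 // ler_wsqrtr //.
by rewrite !e4 in l1; exact: le_trans (ler_norm _) l1.
Qed.

End Fourth.

Lemma alg_pow4 (R : realFieldType) (x a b : R) : 0 <= x -> x <= a + b -> x ^+ 4 <= 8 * a ^+ 4 + 8 * b ^+ 4.
Proof.
move=> x0 h; have h1 : x ^+ 2 <= 2 * a ^+ 2 + 2 * b ^+ 2.
  by have := ler_pM x0 x0 h h; rewrite -!expr2 => /le_trans; apply; exact: alg_sq2.
have := ler_pM (sqr_ge0 x) (sqr_ge0 x) h1 h1; rewrite -!exprD -expr2.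
have := sqr_ge0 (a ^+ 2 - b ^+ 2); rewrite -![_ ^+ 4]/(_ ^+ (2 + 2)) !exprD; lra.
Qed.

Lemma alg_2c (R : realFieldType) (c a b : R) : 0 <= a -> 0 <= b ->
  c ^+ 2 * (2 * a ^+ 2 + 2 * b ^+ 2) <= (2 * c * (a + b)) ^+ 2.
Proof.
move=> a0 b0; have p : 0 <= 2 * a ^+ 2 + 2 * b ^+ 2 + 8 * (a * b).
  by rewrite !addr_ge0 ?mulr_ge0 ?sqr_ge0.
by have := mulr_ge0 (sqr_ge0 c) p; lra.
Qed.

Lemma alg_tdiff (R : realFieldType) (c a b v p q r : R) : 0 <= c -> 0 <= b -> 0 <= v -> q <= b * r ->
  c * (4 * (a * p) + 4 * (b * q)) * v <= 4 * c * (a * (p * v) + b ^+ 2 * (r * v)).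
Proof.
move=> c0 b0 v0 h; have := ler_wpM2l (mulr_ge0 (mulr_ge0 c0 b0) v0) h; lra.
Qed.

Section OceanForm.
Context d (S : measurableType d) (R : realType) (nu : {measure set S -> \bar R}) (D : set S).
Variables (mD : measurable D) (c theta : R).
Hypotheses (c0 : 0 <= c) (th : 0 <= theta <= pi / 4).
Local Notation E := (mxphs R 2 1).
Local Notation H := (L2 nu mD E).
Local Notation Int f := (Rintegral nu D f).
Local Notation "'fr' w" := (fun x => @hn R E (val w x)) (at level 10, w at level 9).
Local Notation tauf := (tauf c theta).
Local Notation N4 := (N4 nu D).

Definition l4 (w : H) : Prop := itg nu D (fun x => @hn R E (val w x) ^+ 4).

Definition Tau (f : R -> R) (w v : H) : R := Int (fun x => @ip R E (tauf f (val w x)) (val v x)).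

Lemma fr_meas (w : H) : measurable_fun D (fr w).
Proof. exact: (meas_hn mD (L2_clean w)). Qed.

Lemma fr2 (w : H) : itg nu D (fun x => @hn R E (val w x) ^+ 2).
Proof. by apply: (itg_eq mD _ (L2_itg w w)) => x _; rewrite hn_sq. Qed.

Lemma fr2E (w : H) : Num.sqrt (Int (fun x => @hn R E (val w x) ^+ 2)) = hn w.
Proof. by congr Num.sqrt; apply: Int_eq => x _; rewrite hn_sq. Qed.

Lemma l4B w w' : l4 w -> l4 w' -> l4 (w - w').
Proof.
move=> h h'; apply: (itg_le mD _ (itgD mD (itgZ mD 8 h) (itgZ mD 8 h'))).
  by apply: measurable_funX; exact: fr_meas.
move=> x _; rewrite ger0_norm ?exprn_ge0 ?hn_ge0 //.
apply: alg_pow4; first exact: hn_ge0.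
exact: hnB_le.
Qed.

Lemma tauf_meas f (w v : H) : admissible f ->
  measurable_fun D (fun x => @ip R E (tauf f (val w x)) (val v x)).
Proof.
move=> af; apply: (meas_ip mD); last exact: L2_clean.
apply: (@clean_comp _ _ D E E (@hcvg R E) (@hcvg R E) (tauf f)); last exact: L2_clean.
move=> a x ax; apply: (hcvg_le (b := fun n => c * (hn (a n) + hn x) * hn (a n - x))) => [n|].
  apply: le_trans (tauf_lip theta c0 (a n) x af) _; apply: ler_wpM2r; first exact: sqrtr_ge0.
  apply: ler_wpM2l => //; apply: lerD; exact: adm_le.
by have := cvM (cvZ c (cvD (hcvg_hn ax) (cvC (hn x)))) ax; rewrite mulr0.
Qed.

Lemma tau_diff_meas f f' (w w' v : H) : admissible f -> admissible f' ->
  measurable_fun D (fun x => @ip R E (tauf f (val w x) - tauf f' (val w' x)) (val v x)).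
Proof.
move=> af af'; under eq_fun do rewrite ipBl.
by apply: measurable_funB; exact: tauf_meas.
Qed.

Lemma Tau_bound f (w v : H) : admissible f -> l4 w -> l4 v ->
  itg nu D (fun x => @ip R E (tauf f (val w x)) (val v x)) /\
  `|Tau f w v| <= c * (hn w * (N4 (fr w) * N4 (fr v))).
Proof.
move=> af lw lv; have mF := tauf_meas w v af.
have ia : itg nu D (fun x => (c * @hn R E (val w x)) ^+ 2).
  by apply: (itg_eq mD _ (itgZ mD (c ^+ 2) (fr2 w))) => x _; rewrite exprMn.
have mc : measurable_fun D (fun x => c * @hn R E (val w x)) by apply: measurable_funM => //; exact: fr_meas.
have [|i1 l1] := dom3 mD mF mc (fr_meas w) (fr_meas v) ia lw lv.
  move=> x _; apply: le_trans (ip_CS _ _) _; rewrite mulrA; apply: ler_wpM2r; first exact: hn_ge0.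
  rewrite [hn _](tauf_frob theta c0 _ af); apply: ler_wpM2r; first exact: sqrtr_ge0.
  by apply: ler_wpM2l => //; exact: adm_le.
split=> //; apply: le_trans l1 _; rewrite mulrA ler_wpM2r ?mulr_ge0 ?N4_ge0 //.
rewrite le_eqVlt; apply/orP; left; apply/eqP.
under eq_Rintegral do rewrite exprMn.
by rewrite (IntZ mD _ (fr2 w)) sqrtrM ?sqr_ge0 // sqrtr_sqr ger0_norm // fr2E.
Qed.

Lemma Tau_k_itg k (w v : H) : 0 <= k ->
  itg nu D (fun x => @ip R E (tauf (fun r => Num.min r k) (val w x)) (val v x)).
Proof.
move=> k0; have af := adm_min k0.
have [i1 _] := Int_CS mD (fr_meas w) (fr_meas v) (fr2 w) (fr2 v).
apply: (itg_le mD (tauf_meas w v af) (itgZ mD (c * k) i1)) => x _.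
apply: le_trans (ip_CS _ _) _; rewrite mulrA; apply: ler_wpM2r; first exact: hn_ge0.
rewrite [hn _](tauf_frob theta c0 _ af); apply: ler_wpM2r; first exact: sqrtr_ge0.
by apply: ler_wpM2l => //; rewrite ge_min lexx orbT.
Qed.

Lemma TauB f f' (w w' v : H) : itg nu D (fun x => @ip R E (tauf f (val w x)) (val v x)) ->
  itg nu D (fun x => @ip R E (tauf f' (val w' x)) (val v x)) ->
  Tau f w v - Tau f' w' v = Int (fun x => @ip R E (tauf f (val w x) - tauf f' (val w' x)) (val v x)).
Proof.
move=> h h'; rewrite -(IntB mD h h'); apply: Int_eq => x _; by rewrite ipBl.
Qed.

Lemma TauL f (a : R) (w v v' : H) : itg nu D (fun x => @ip R E (tauf f (val w x)) (val v x)) ->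
  itg nu D (fun x => @ip R E (tauf f (val w x)) (val v' x)) ->
  Tau f w (a *: v + v') = a * Tau f w v + Tau f w v'.
Proof.
move=> h h'; rewrite -(IntZ mD a h) -(IntD mD (itgZ mD a h) h'); apply: Int_eq => x _.
by rewrite -ipZr -ipDr.
Qed.

Lemma Tau_k_lip k (w w' v : H) : 0 <= k ->
  `|Tau (fun r => Num.min r k) w v - Tau (fun r => Num.min r k) w' v| <= 2 * c * k * (hn (w - w') * hn v).
Proof.
move=> k0; have af := adm_min k0; rewrite TauB; [|exact: Tau_k_itg|exact: Tau_k_itg].
have [i1 l1] := Int_CS mD (fr_meas (w - w')) (fr_meas v) (fr2 _) (fr2 v).
rewrite !fr2E in l1.
have i2 := itgZ mD (2 * c * k) i1.
have p : 0 <= 2 * c * k by rewrite !mulr_ge0.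
have h x : D x -> `|@ip R E (tauf (fun r => Num.min r k) (val w x) - tauf (fun r => Num.min r k) (val w' x)) (val v x)| <= 2 * c * k * (@hn R E (val (w - w') x) * @hn R E (val v x)).
  move=> _; apply: le_trans (ip_CS _ _) _; rewrite mulrA; apply: ler_wpM2r; first exact: hn_ge0.
  apply: le_trans (tauf_lip theta c0 _ _ af) _; apply: ler_wpM2r; first exact: sqrtr_ge0.
  rewrite [2 * c]mulrC -mulrA ler_wpM2l // mulrDl mul1r; apply: lerD; by rewrite ge_min lexx orbT.
apply: le_trans (Int_abs_le mD _ i2 h) _; first exact: (itg_le mD (tau_diff_meas _ _ _ af af) i2 h).
by rewrite (IntZ mD _ i1) ler_wpM2l // (le_trans (ler_norm _)).
Qed.

Lemma Tau_lip (w w' v : H) : l4 w -> l4 w' -> l4 v ->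
  `|Tau id w v - Tau id w' v| <= 2 * c * ((hn w + hn w') * (N4 (fr (w - w')) * N4 (fr v))).
Proof.
move=> lw lw' lv; have [i1 _] := Tau_bound (@adm_id R) lw lv; have [i2 _] := Tau_bound (@adm_id R) lw' lv.
rewrite TauB //; have ld := l4B lw lw'.
pose a x := c * (@hn R E (val w x) + @hn R E (val w' x)).
have ma : measurable_fun D a.
  by apply: measurable_funM => //; apply: measurable_funD; exact: fr_meas.
have i3 := itgZ mD (c ^+ 2) (itgD mD (itgZ mD 2 (fr2 w)) (itgZ mD 2 (fr2 w'))).
have ha x : a x ^+ 2 <= c ^+ 2 * (2 * @hn R E (val w x) ^+ 2 + 2 * @hn R E (val w' x) ^+ 2).
  by rewrite exprMn ler_wpM2l ?sqr_ge0 // alg_sq2.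
have ia : itg nu D (fun x => a x ^+ 2).
  by apply: (itg_le mD (measurable_funX 2 ma) i3) => x _; rewrite ger0_norm ?sqr_ge0.
have [|_ l1] := dom3 mD (tau_diff_meas w w' v (@adm_id R) (@adm_id R)) ma (fr_meas (w - w')) (fr_meas v) ia ld lv.
  move=> x _; apply: le_trans (ip_CS _ _) _; rewrite mulrA; apply: ler_wpM2r; first exact: hn_ge0.
  exact: (tauf_lip theta c0 _ _ (@adm_id R)).
apply: le_trans l1 _; rewrite mulrA ler_wpM2r ?mulr_ge0 ?N4_ge0 //.
have p : 0 <= 2 * c * (hn w + hn w') by rewrite !mulr_ge0 ?addr_ge0 ?hn_ge0.
rewrite -[X in _ <= X](ger0_norm p) -sqrtr_sqr ler_wsqrtr //.
apply: le_trans (Int_le mD ia i3 (fun x _ => ha x)) _.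
rewrite (IntZ mD _ (itgD mD (itgZ mD 2 (fr2 w)) (itgZ mD 2 (fr2 w')))) (IntD mD (itgZ mD 2 (fr2 w)) (itgZ mD 2 (fr2 w'))) !(IntZ mD _ (fr2 _)).
have e (x : H) : Int (fun z => @hn R E (val x z) ^+ 2) = hn x ^+ 2.
  by rewrite hn_sq; apply: Int_eq => z _; rewrite hn_sq.
by rewrite !e; exact: alg_2c (hn_ge0 _) (hn_ge0 _).
Qed.

Lemma Tau_mono f (w w' : H) : admissible f ->
  itg nu D (fun x => @ip R E (tauf f (val w x)) (val (w - w') x)) ->
  itg nu D (fun x => @ip R E (tauf f (val w' x)) (val (w - w') x)) ->
  0 <= Tau f w (w - w') - Tau f w' (w - w').
Proof. by move=> af h h'; rewrite TauB //; apply: Int_ge0 => x _; exact: (tauf_mono c0 th). Qed.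

Lemma rho_meas j (w : H) : measurable_fun D (fun x => rho j (@hn R E (val w x))).
Proof.
apply: measurable_funB; first exact: fr_meas.
by apply: measurable_minr => //; exact: fr_meas.
Qed.

Lemma rho4 j (w : H) : 0 <= j -> l4 w -> itg nu D (fun x => rho j (@hn R E (val w x)) ^+ 4).
Proof.
move=> j0 lw; apply: (itg_le mD _ lw); first by apply: measurable_funX; exact: rho_meas.
move=> x _; rewrite ger0_norm ?exprn_ge0 ?rho_ge0 //.
by rewrite ler_pXn2r ?nnegrE ?rho_ge0 ?hn_ge0 // rho_le ?hn_ge0.
Qed.

(* The truncation error is estimated separately where [U] dominates, by the tail of [U] in
   [L^4], and where [u] dominates, by the interpolation [u \in L^2, L^4]. *)
Lemma Tau_diff j (U u v : H) : 0 < j -> l4 U -> l4 u -> l4 v ->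
  `|Tau (fun r => Num.min r (2 * j)) (U - u) v - Tau id (U - u) v| <=
  4 * c * (hn U * (N4 (fun x => rho j (@hn R E (val U x))) * N4 (fr v)) +
           N4 (fr u) ^+ 2 * (Num.sqrt (hn u / j) * N4 (fr v))).
Proof.
move=> j0 lU lu lv; have j2 : 0 <= 2 * j by rewrite mulr_ge0 // ltW.
have af := adm_min j2; have lW := l4B lU lu.
have [i1 _] := Tau_bound (@adm_id R) lW lv; have i2 := Tau_k_itg (U - u) v j2.
rewrite TauB //.
set F := (fun x => _).
have mF : measurable_fun D F := tau_diff_meas (U - u) (U - u) v af (@adm_id R).
pose G1 x := @hn R E (val U x) * (rho j (@hn R E (val U x)) * @hn R E (val v x)).
pose G2 x := @hn R E (val u x) ^+ 2 * (Num.sqrt (@hn R E (val u x) / j) * @hn R E (val v x)).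
have mU := fr_meas U; have mu := fr_meas u; have mv := fr_meas v.
have ms : measurable_fun D (fun x => Num.sqrt (@hn R E (val u x) / j)).
  by apply: (measurableT_comp (continuous_measurable_fun (@sqrt_continuous R))); apply: measurable_funM.
have mG1 : measurable_fun D G1 by apply: measurable_funM => //; apply: measurable_funM => //; exact: rho_meas.
have mG2 : measurable_fun D G2 by apply: measurable_funM; [exact: measurable_funX|exact: measurable_funM].
have p1 x : 0 <= G1 x by rewrite !mulr_ge0 ?hn_ge0 ?rho_ge0.
have p2 x : 0 <= G2 x by rewrite !mulr_ge0 ?hn_ge0 ?sqrtr_ge0.
have [|g1 l1] := dom3 mD mG1 mU (rho_meas j U) mv (fr2 U) (rho4 (ltW j0) lU) lv.
  by move=> x _; rewrite ger0_norm.
have iu4 : itg nu D (fun x => (@hn R E (val u x) ^+ 2) ^+ 2).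
  by apply: (itg_eq mD _ lu) => x _; rewrite -exprM.
have es x : Num.sqrt (@hn R E (val u x) / j) ^+ 4 = j^-1 ^+ 2 * @hn R E (val u x) ^+ 2.
  by rewrite -[_ ^+ 4]/(_ ^+ (2 * 2)) exprM sqr_sqrtr ?divr_ge0 ?hn_ge0 ?(ltW j0) // exprMn mulrC.
have is4 : itg nu D (fun x => Num.sqrt (@hn R E (val u x) / j) ^+ 4).
  by apply: (itg_eq mD _ (itgZ mD (j^-1 ^+ 2) (fr2 u))) => x _; rewrite es.
have [|g2 l2] := dom3 mD mG2 (measurable_funX 2 mu) ms mv iu4 is4 lv.
  by move=> x _; rewrite ger0_norm.
have i3 := itgZ mD (4 * c) (itgD mD g1 g2).
have h x : D x -> `|F x| <= 4 * c * (G1 x + G2 x).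
  move=> _; apply: le_trans (ip_CS _ _) _.
  have h1 := tauf_tail theta c0 (val (U - u) x : 'cV[R]_2) j2.
  have h2 := rho_split (ltW j0) (hn_ge0 (val (U - u) x : E)) (hn_ge0 (val U x)) (hn_ge0 (val u x)) (hnB_le _ _).
  have h3 := rho_sqrt j0 (hn_ge0 (val u x : E)).
  apply: le_trans (ler_wpM2r (hn_ge0 _) (le_trans h1 (ler_wpM2l c0 h2))) _.
  exact: alg_tdiff c0 (hn_ge0 _) (hn_ge0 _) h3.
apply: le_trans (Int_abs_le mD (itg_le mD mF i3 h) i3 h) _.
rewrite (IntZ mD _ (itgD mD g1 g2)) (IntD mD g1 g2).
apply: ler_wpM2l; first by rewrite mulr_ge0.
apply: lerD; first by rewrite fr2E in l1; exact: le_trans (ler_norm _) l1.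
apply: le_trans (ler_norm _) (le_trans l2 _).
have -> : Num.sqrt (Int (fun x => (@hn R E (val u x) ^+ 2) ^+ 2)) = N4 (fr u) ^+ 2.
  by rewrite N4_sq; congr Num.sqrt; apply: Int_eq => x _; rewrite -exprM.
rewrite ler_wpM2l ?sqr_ge0 // ler_wpM2r ?N4_ge0 // /N4.
under eq_Rintegral do rewrite es.
rewrite (IntZ mD _ (fr2 u)) sqrtrM ?sqr_ge0 // sqrtr_sqr fr2E ger0_norm ?invr_ge0 ?(ltW j0) //.
by rewrite mulrC.
Qed.

End OceanForm.

Lemma min_lip (R : realDomainType) (a x y : R) : `|Num.min a x - Num.min a y| <= `|x - y|.
Proof.
have := ler_norm (x - y); have := ler_norm (y - x); rewrite (distrC y x).
case: (leP a x) => h1; case: (leP a y) => h2 n1 n2; rewrite ler_norml; apply/andP; split; lra.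
Qed.

Lemma max_lip (R : realDomainType) (a x y : R) : `|Num.max a x - Num.max a y| <= `|x - y|.
Proof.
have := ler_norm (x - y); have := ler_norm (y - x); rewrite (distrC y x).
case: (leP a x) => h1; case: (leP a y) => h2 n1 n2; rewrite ler_norml; apply/andP; split; lra.
Qed.

(** * The stress as an operator on L^2 *)

Section StressForm.
Context d (S : measurableType d) (R : realType) (nu : {measure set S -> \bar R}) (D : set S).
Variables (mD : measurable D) (fD : (nu D < +oo)%E).
Local Notation E := (mxphs R 2 2).
Local Notation Y := (L2 nu mD E).
Local Notation Int f := (Rintegral nu D f).
Variables (lam : R) (dhat : 'M[R]_2 -> R) (cS LS Pinf CP : R).
Hypotheses (cS0 : 0 < cS) (LS0 : 0 < LS) (Pinf0 : 0 < Pinf) (PinfCP : Pinf <= CP).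
Local Notation st := (stress lam dhat).
Hypothesis smon : forall P (z w : 'M[R]_2), 0 <= P -> z^T = z -> w^T = w ->
  P * cS * frob (z - w) ^+ 2 <= mxdot (st P z - st P w) (z - w).
Hypothesis slip : forall P (z w : 'M[R]_2), frob (st P z - st P w) <= `|P| * LS * frob (z - w).
Hypothesis sP : forall P P' (z : 'M[R]_2), frob (st P z - st P' z) <= `|P - P'| * (LS * frob z + 1).

Lemma LSf_ge0 (z : 'M[R]_2) : 0 <= LS * frob z + 1.
Proof. by rewrite addr_ge0 // mulr_ge0 ?sqrtr_ge0 // ltW. Qed.

(** Clamping the pressure makes the bounds of the stress valid at every point and every time; for
    the given pressure it is the identity almost everywhere. *)
Definition clampP (p : R) : R := Num.min CP (Num.max Pinf p).

Lemma clampP_bound p : Pinf <= clampP p <= CP.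
Proof. by rewrite /clampP le_min PinfCP le_max lexx /= ge_min lexx. Qed.

Lemma clampP_id p : Pinf <= p <= CP -> clampP p = p.
Proof. by case/andP => h1 h2; rewrite /clampP max_r // min_r. Qed.

Lemma clampP_lip p q : `|clampP p - clampP q| <= `|p - q|.
Proof.
exact: le_trans (min_lip _ _ _) (max_lip _ _ _).
Qed.

Lemma clampP_abs p : `|clampP p| <= CP.
Proof.
have /andP[h1 h2] := clampP_bound p.
by rewrite ger0_norm // (le_trans (ltW Pinf0)).
Qed.

Lemma st_bound p (z : 'M[R]_2) : frob (st (clampP p) z) <= CP * (LS * frob z + 1).
Proof.
have := sP (clampP p) 0 z; rewrite [st 0 z](_ : _ = 0) ?subr0; last by rewrite /stress mul0r scale0r.
move=> /le_trans; apply; apply: ler_wpM2r; last exact: clampP_abs.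
exact: LSf_ge0.
Qed.

(** An upper bound of the [L^2] norm of [LS * |y| + 1], from [(a + b)^2 <= 2 a^2 + 2 b^2]. *)
Definition Kst (y : Y) : R := Num.sqrt (Int (fun x => 2 * (LS ^+ 2 * @ip R E (val y x) (val y x)) + 2)).

Lemma Kst_itg (y : Y) : itg nu D (fun x => 2 * (LS ^+ 2 * @ip R E (val y x) (val y x)) + 2).
Proof.
apply: (itgD mD); last exact: (itg_cst mD).
by apply: (itgZ mD); apply: (itgZ mD); exact: L2_itg.
Qed.

Lemma Kst_le (y : Y) (e : R) (z : Y) : 0 <= e ->
  (\forall x \ae nu, D x -> @hn R E (val z x) <= e * (LS * @hn R E (val y x) + 1)) -> hn z <= e * Kst y.
Proof.
move=> e0 h; rewrite -[X in _ <= X * _](ger0_norm e0) -sqrtr_sqr -sqrtrM ?sqr_ge0 //.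
apply: ler_wsqrtr; rewrite -(IntZ mD _ (Kst_itg y)) L2ipE.
apply: (Int_le_ae mD (L2_itg z z) (itgZ mD _ (Kst_itg y))); apply: filterS h => x h Dx.
rewrite -!hn_sq; have {}h := h Dx.
have p : 0 <= e * (LS * @hn R E (val y x) + 1) by rewrite mulr_ge0 // addr_ge0 // mulr_ge0 ?hn_ge0 ?ltW.
have h2 : @hn R E (val z x) ^+ 2 <= (e * (LS * @hn R E (val y x) + 1)) ^+ 2 by rewrite ler_sqr ?nnegrE ?hn_ge0.
apply: le_trans h2 _; rewrite exprMn ler_wpM2l ?sqr_ge0 //.
by apply: le_trans (alg_sq2 _ _) _; rewrite exprMn expr1n mulr1.
Qed.

Definition Pres : Type := {p : S -> R | measurable_fun D p}.

Lemma SY_mem (p : Pres) (y : Y) :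
  L2mem nu D (fun x => st (clampP (sval p x)) (val y x) : E).
Proof.
have hc : clean D (fun x => st (clampP (sval p x)) (val y x) : E).
  apply: (@clean_comp2 _ _ D R E E (@cv R) (@hcvg R E) (@hcvg R E) (fun p z => st (clampP p) z)).
  - move=> a x b z ax bz.
    apply: (hcvg_le (b := fun n => CP * LS * hn (b n - z) + `|a n - x| * (LS * @hn R E z + 1))) => [n|].
      apply: le_trans (hn_triB _ (st (clampP (a n)) z : E) _) _; apply: lerD.
        apply: le_trans (slip _ _ _) _; rewrite -!mulrA ler_wpM2r ?mulr_ge0 ?sqrtr_ge0 ?(ltW LS0) //.
        exact: clampP_abs.
      apply: le_trans (sP _ _ _) _; rewrite ler_wpM2r ?clampP_lip //.
      exact: LSf_ge0.
    have h1 := cv_abs (cvB ax (cvC x)); rewrite subrr normr0 in h1.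
    by have := cvD (cvZ (CP * LS) bz) (cvM h1 (cvC (LS * @hn R E z + 1))); rewrite mulr0 mul0r addr0.
  - exact: (meas_clean_real mD (svalP p)).
  - exact: L2_clean.
have hi := itgZ mD (CP ^+ 2) (Kst_itg y).
apply: (L2mem_dom mD hc hi) => x _; rewrite -!hn_sq.
have h := st_bound (sval p x) (val y x : 'M[R]_2).
have CP0 : 0 <= CP by rewrite (le_trans (ltW Pinf0)).
have p0 : 0 <= CP * (LS * frob (val y x : 'M[R]_2) + 1) by rewrite mulr_ge0 // addr_ge0 // mulr_ge0 ?sqrtr_ge0 ?ltW.
have h2 := ler_pM (sqrtr_ge0 _) (sqrtr_ge0 _) h h; rewrite -!expr2 in h2.
apply: le_trans h2 _; rewrite exprMn ler_wpM2l ?sqr_ge0 //.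
by apply: le_trans (alg_sq2 _ _) _; rewrite exprMn expr1n mulr1.
Qed.

Definition SY p y : Y := mkL2 mD (SY_mem p y).

Lemma SY_lip (p : Pres) (y y' : Y) : hn (SY p y - SY p y') <= CP * LS * hn (y - y').
Proof.
have p0 : 0 <= CP * LS by rewrite mulr_ge0 ?(ltW LS0) // (le_trans (ltW Pinf0)).
have q0 := mulr_ge0 p0 (hn_ge0 (y - y')).
rewrite -ler_sqr ?nnegrE ?hn_ge0 // exprMn !hn_sq !L2ipE -(IntZ mD _ (L2_itg _ _)).
apply: (Int_le mD (L2_itg _ _) (itgZ mD _ (L2_itg _ _))) => x _.
rewrite -!hn_sq -exprMn ler_sqr ?nnegrE ?hn_ge0 ?(mulr_ge0 p0 (hn_ge0 _)) //.
apply: le_trans (slip _ _ _) _; apply: ler_wpM2r; first exact: sqrtr_ge0.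
by apply: ler_wpM2r; [exact: ltW|exact: clampP_abs].
Qed.

Lemma SY_p (p p' : Pres) y (e : R) : 0 <= e ->
  (\forall x \ae nu, D x -> `|sval p x - sval p' x| <= e) -> hn (SY p y - SY p' y) <= e * Kst y.
Proof.
move=> e0 h; apply: Kst_le => //; apply: filterS h => x h Dx.
apply: le_trans (sP _ _ _) _; apply: ler_wpM2r; first exact: LSf_ge0.
by apply: le_trans (clampP_lip _ _) _; exact: h.
Qed.

Lemma SY_bound p y : hn (SY p y) <= CP * Kst y.
Proof.
apply: Kst_le; first by rewrite (le_trans (ltW Pinf0)).
by apply: filterE => x _; exact: st_bound.
Qed.

Lemma SY_mono (p : Pres) (y y' : Y) : (forall x, (val y x : 'M[R]_2)^T = val y x) ->
  (forall x, (val y' x : 'M[R]_2)^T = val y' x) ->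
  Pinf * cS * hn (y - y') ^+ 2 <= ip (SY p y - SY p y') (y - y').
Proof.
move=> sy sy'; rewrite hn_sq !L2ipE -(IntZ mD _ (L2_itg _ _)).
apply: (Int_le mD (itgZ mD _ (L2_itg _ _)) (L2_itg _ _)) => x _.
have /andP[h1 _] := clampP_bound (sval p x).
apply: le_trans (smon (le_trans (ltW Pinf0) h1) (sy x) (sy' x)); rewrite -hn_sq.
by apply: ler_wpM2r; [exact: sqr_ge0|apply: ler_wpM2r => //; exact: ltW].
Qed.

End StressForm.

(** * The Coriolis term *)

Section PerpForm.
Context d (S : measurableType d) (R : realType) (nu : {measure set S -> \bar R}) (D : set S).
Variables (mD : measurable D).
Local Notation E := (mxphs R 2 1).
Local Notation H := (L2 nu mD E).

Lemma perpH_mem (w : H) : L2mem nu D (fun x => perp (val w x) : E).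
Proof.
have pB (a b : 'cV[R]_2) : perp a - perp b = perp (a - b).
  by rewrite -[- perp b]scaleN1r addrC -perpL scaleN1r addrC.
split.
  apply: (@clean_comp _ _ D E E (@hcvg R E) (@hcvg R E) (@perp R)); last exact: L2_clean.
  move=> a x ax; apply: (hcvg_le (b := fun n => hn (a n - x))) => // n.
  by rewrite pB [hn _]perp_frob.
apply: (itg_eq mD _ (L2_itg w w)) => x _; rewrite -!hn_sq; congr (_ ^+ 2).
by rewrite [RHS]perp_frob.
Qed.

Definition perpH (w : H) : H := mkL2 mD (perpH_mem w).

Lemma perpHB w w' : perpH w - perpH w' = perpH (w - w').
Proof.
apply: val_inj; apply/funext => x.
rewrite -[LHS]/(perp (val w x) - perp (val w' x)) -[RHS]/(perp (val w x - val w' x)).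
by rewrite -[- perp _]scaleN1r addrC -perpL scaleN1r addrC.
Qed.

Lemma perpH_hn w : hn (perpH w) = hn w.
Proof.
congr Num.sqrt; apply: Int_eq => x _; rewrite -!hn_sq; congr (_ ^+ 2); exact: perp_frob.
Qed.

Lemma perpH_skew w : ip (perpH w) w = 0.
Proof.
rewrite L2ipE; under eq_Rintegral do rewrite [ip _ _]perp_dot mulrC subrr.
exact: Int0.
Qed.

End PerpForm.

Lemma hn_le_dual (R : realType) (V : phs R) (p q : V) (K : R) : 0 <= K ->
  (forall v, `|ip (p - q) v| <= K * hn v) -> hn (p - q) <= K.
Proof.
move=> K0 h; have := h (p - q); rewrite ger0_norm ?ip_ge0 // -hn_sq expr2.
have := hn_ge0 (p - q); rewrite le_eqVlt => /orP[/eqP <-|x0] //.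
by rewrite ler_pM2r.
Qed.

Lemma rho_lip (R : realType) (j r s : R) : `|rho j r - rho j s| <= `|r - s|.
Proof.
have := ler_norm (r - s); have := ler_norm (s - r); rewrite (distrC s r) /rho.
case: (leP r j) => h1; case: (leP s j) => h2 n1 n2; rewrite ler_norml; apply/andP; split; lra.
Qed.

Lemma pow4_lip (R : realFieldType) (n p q : R) : 0 <= p <= n -> 0 <= q <= n ->
  `|p ^+ 4 - q ^+ 4| <= 4 * n ^+ 3 * `|p - q|.
Proof.
move=> /andP[p0 pn] /andP[q0 qn].
have -> : p ^+ 4 - q ^+ 4 = (p ^+ 3 + p ^+ 2 * q + p * q ^+ 2 + q ^+ 3) * (p - q) by ring.
have n0 := le_trans p0 pn.
rewrite normrM ler_wpM2r // ger0_norm ?addr_ge0 ?mulr_ge0 ?exprn_ge0 //.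
have p2 : p ^+ 2 <= n ^+ 2 by rewrite ler_sqr.
have q2 : q ^+ 2 <= n ^+ 2 by rewrite ler_sqr.
have h1 := ler_pM (sqr_ge0 p) p0 p2 pn; have h2 := ler_pM (sqr_ge0 p) q0 p2 qn.
have h3 := ler_pM p0 (sqr_ge0 q) pn q2; have h4 := ler_pM (sqr_ge0 q) q0 q2 qn.
by rewrite !exprS in h1 h2 h3 h4 *; lra.
Qed.

(** * Tails of the ocean velocity in L^4 *)

Section TailMeasurable.
Context d (S : measurableType d) (R : realType) (nu : {measure set S -> \bar R}) (O : set S).
Variables (mO : measurable O) (fO : (nu O < +oo)%E).
Context d' (S' : measurableType d') (D : set S') (mD : measurable D).
Local Notation E1 := (mxphs R 2 1).
Local Notation H := (L2 nu mO E1).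
Local Notation Int f := (Rintegral nu O f).
Variables (U : S' -> H) (cU : clean D U) (lU : forall t, D t -> l4 (U t)).

(** The [L^4] norm is not continuous on [H], so measurability in time cannot be read off the strong
    measurability of [U]. Cut at height [n], the integral of the fourth power becomes Lipschitz on
    [H]; dominated convergence removes the cut. *)
Lemma tail_meas j : 0 <= j ->
  measurable_fun D (fun t => N4 nu O (fun x => rho j (@hn R E1 (val (U t) x)))).
Proof.
move=> j0; pose F n (w : H) x := Num.min (rho j (@hn R E1 (val w x))) n%:R.
have F0 n w x : 0 <= F n w x <= n%:R by rewrite le_min rho_ge0 ler0n ge_min lexx orbT.
have mF n w : measurable_fun O (fun x => F n w x ^+ 4).
  by apply: measurable_funX; apply: measurable_minr => //; exact: rho_meas.
have iF n w : itg nu O (fun x => F n w x ^+ 4).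
  apply: (itg_le mO (mF n w) (itg_cst mO (n%:R ^+ 4) fO)) => x _.
  have /andP[h1 h2] := F0 n w x; rewrite ger0_norm ?exprn_ge0 //.
  by rewrite ler_pXn2r ?nnegrE ?ler0n.
pose C := Num.sqrt (Int (fun=> 1 ^+ 2)).
have qle n (a w : H) : `|Int (fun x => F n a x ^+ 4) - Int (fun x => F n w x ^+ 4)| <= 4 * n%:R ^+ 3 * (hn (a - w) * C).
  have i1 : itg nu O (fun=> (1 : R) ^+ 2) by exact: (itg_cst mO).
  have [i2 l2] := @Int_CS _ _ _ nu O (fun x => @hn R E1 (val (a - w) x)) (fun=> 1) mO (fr_meas (a - w)) (measurable_cst _) (fr2 (a - w)) i1.
  rewrite fr2E -/C in l2.
  have i3 := itgZ mO (4 * n%:R ^+ 3) i2.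
  rewrite -(IntB mO (iF n a) (iF n w)); apply: le_trans (Int_abs_le mO (itgB mO (iF n a) (iF n w)) i3 _) _.
    move=> x _; apply: le_trans (pow4_lip (F0 n a x) (F0 n w x)) _.
    apply: ler_wpM2l; first by rewrite mulr_ge0 // exprn_ge0.
    rewrite mulr1 /F ![Num.min (rho _ _) _]minC; apply: le_trans (min_lip _ _ _) _.
    by apply: le_trans (rho_lip _ _ _) _; exact: (@hn_distl R E1).
  rewrite (IntZ mO _ i2); apply: ler_wpM2l; first by rewrite mulr_ge0 // exprn_ge0.
  exact: le_trans (ler_norm _) l2.
have mq n : measurable_fun D (fun t => Int (fun x => F n (U t) x ^+ 4)).
  apply: clean_real_meas => //.
  apply: (@clean_comp _ _ D H R (@hcvg R H) (@cv R) (fun w => Int (fun x => F n w x ^+ 4))) => // a w aw.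
  apply: cv_dist (fun k => qle n (a k) w) _.
  by have := cvZ (4 * n%:R ^+ 3) (cvM aw (cvC C)); rewrite mul0r mulr0.
have mr : measurable_fun D (fun t => Int (fun x => rho j (@hn R E1 (val (U t) x)) ^+ 4)).
  apply: (meas_cv mq) => t Dt.
  have ir := rho4 j0 (lU Dt).
  have [||_] := @Int_dct _ _ _ nu O mO (fun n x => F n (U t) x ^+ 4) (fun x => rho j (@hn R E1 (val (U t) x)) ^+ 4) _ (fun n => mF n (U t)) ir; last by [].
  - move=> n x _; have /andP[h1 h2] := F0 n (U t) x; rewrite ger0_norm ?exprn_ge0 //.
    by rewrite ler_pXn2r ?nnegrE ?rho_ge0 // ge_min lexx.
  - move=> x _; apply: cvX; set r := rho j _.
    apply/cvP => e e0; exists (Num.bound r) => n hn'.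
    have : r < n%:R by apply: lt_le_trans (_ : (Num.bound r)%:R <= _); [exact: archi_boundP (rho_ge0 _ _)|rewrite ler_nat].
    by move=> /ltW h; rewrite /F -/r min_l // subrr normr0.
by apply: (measurableT_comp (continuous_measurable_fun (@sqrt_continuous R))); apply: (measurableT_comp (continuous_measurable_fun (@sqrt_continuous R))).
Qed.

Lemma tail_cv (t : S') : D t -> cv (fun k => N4 nu O (fun x => rho k.+1%:R (@hn R E1 (val (U t) x)))) 0.
Proof.
move=> Dt; have lt := lU Dt.
have mk k : measurable_fun O (fun x => rho k.+1%:R (@hn R E1 (val (U t) x)) ^+ 4).
  by apply: measurable_funX; exact: rho_meas.
have dk k x : O x -> `|rho k.+1%:R (@hn R E1 (val (U t) x)) ^+ 4| <= @hn R E1 (val (U t) x) ^+ 4.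
  move=> _; rewrite ger0_norm ?exprn_ge0 ?rho_ge0 //.
  by rewrite ler_pXn2r ?nnegrE ?rho_ge0 ?hn_ge0 // rho_le ?hn_ge0.
have ck x : O x -> cv (fun k => rho k.+1%:R (@hn R E1 (val (U t) x)) ^+ 4) 0.
  move=> _; have -> : (0 : R) = 0 ^+ 4 by rewrite expr0n.
  apply: cvX; set r := hn _; apply/cvP => e e0; exists (Num.bound r) => n hn'.
  have : r < n%:R by apply: lt_le_trans (_ : (Num.bound r)%:R <= _); [exact: archi_boundP (hn_ge0 _)|rewrite ler_nat].
  move=> /ltW h; rewrite /rho min_l ?subrr ?subr0 ?normr0 //.
  by apply: le_trans h _; rewrite ler_nat.
have [_] := Int_dct mO mk lt dk ck.
by rewrite Int0 => /cv_sqrt/cv_sqrt; rewrite !sqrtr0.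
Qed.

End TailMeasurable.

Lemma alg_psi (R : realFieldType) (a b c e A B C E v k : R) : 0 <= k -> 0 <= v ->
  `|a| <= A * v -> `|b| <= B * v -> `|c| <= C * v -> `|e| <= E * v ->
  `|k * (a - b - c - e)| <= k * (A + B + C + E) * v.
Proof.
move=> k0 v0 ha hb hc he; rewrite normrM ger0_norm // -mulrA ler_wpM2l //.
apply: le_trans (ler_normB _ _) _; rewrite mulrDl; apply: lerD he.
apply: le_trans (ler_normB _ _) _; rewrite mulrDl; apply: lerD hc.
by apply: le_trans (ler_normB _ _) _; rewrite mulrDl; apply: lerD.
Qed.

Lemma alg_psiL (R : comUnitRingType) (k o a x x' t t' q q' r r' : R) :
  k * (a * x + x' - (a * t + t') - o * (a * q + q') - (a * r + r')) =
  a * (k * (x - t - o * q - r)) + k * (x' - t' - o * q' - r').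
Proof. ring. Qed.

Lemma alg_psiB (R : comUnitRingType) (k o x x' t t' q q' r r' : R) :
  k * (x - t - o * q - r) - k * (x' - t' - o * q' - r') =
  k * (x - x' - (t - t') - o * (q - q') - (r - r')).
Proof. ring. Qed.

Lemma alg_psiB0 (R : comUnitRingType) (k o x x' t t' q q' r : R) :
  k * (x - t - o * q - r) - k * (x' - t' - o * q' - r) =
  k * (x - x' - (t - t') - o * (q - q')).
Proof. ring. Qed.

Lemma alg_good (R : realFieldType) (k a b n v : R) : k * a * b * n <= k * a * b * (2 * v) ->
  k * (a * (b * n)) <= 2 * k * a * b * v.
Proof. lra. Qed.

Lemma alg_B (R : comNzRingType) (c C n v : R) : c * (C * (n * (2 * v))) = 2 * c * C * n * v.
Proof. ring. Qed.

Lemma alg_gi (R : comNzRingType) (c C B x w : R) :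
  2 * c * ((C + B + (C + B)) * (2 * x * (2 * w))) = 16 * c * (C + B) * x * w.
Proof. ring. Qed.

Lemma alg_gdiff (R : realFieldType) (B s b k C U x v n q r : R) : 0 <= B -> 0 <= s -> 0 <= b -> 0 <= k ->
  0 <= C -> 0 <= U -> 0 <= x -> 0 <= v -> 0 <= n -> 0 <= q -> 0 <= r ->
  U <= C -> n <= 2 * v -> q <= 4 * B * x -> r <= s * k ->
  U * (b * n) + q * (r * n) <= (2 * C + 8 * B * s) * ((b + k * x) * v).
Proof.
move=> B0 s0 b0 k0 C0 U0 x0 v0 n0 q0 r0 h1 h2 h3 h4.
have e1 := ler_pM U0 (mulr_ge0 b0 n0) h1 (ler_wpM2l b0 h2).
have e2 := ler_pM q0 (mulr_ge0 r0 n0) h3 (ler_pM r0 n0 h4 h2).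
have p1 : 0 <= C * k * x * v by rewrite !mulr_ge0.
have p2 : 0 <= B * s * b * v by rewrite !mulr_ge0.
lra.
Qed.

(** * The operator of the momentum equation *)

Section Operator.
Context d (S : measurableType d) (R : realType) (nu : {measure set S -> \bar R}) (O : set S).
Variables (mO : measurable O) (fO : (nu O < +oo)%E).
Local Notation E1 := (mxphs R 2 1).
Local Notation H := (L2 nu mO E1).
Local Notation Y := (L2 nu mO (mxphs R 2 2)).
Local Notation Int f := (Rintegral nu O f).
Local Notation N4 := (N4 nu O).
Local Notation "'fr' w" := (fun x => @hn R E1 (val w x)) (at level 10, w at level 9).
Variables (lam : R) (dhat : 'M[R]_2 -> R) (cS LS Pinf CP : R).
Hypotheses (cS0 : 0 < cS) (LS0 : 0 < LS) (Pinf0 : 0 < Pinf) (PinfCP : Pinf <= CP).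
Local Notation st := (stress lam dhat).
Hypothesis smon : forall P (z w : 'M[R]_2), 0 <= P -> z^T = z -> w^T = w ->
  P * cS * frob (z - w) ^+ 2 <= mxdot (st P z - st P w) (z - w).
Hypothesis slip : forall P (z w : 'M[R]_2), frob (st P z - st P w) <= `|P| * LS * frob (z - w).
Hypothesis sP : forall P P' (z : 'M[R]_2), frob (st P z - st P' z) <= `|P - P'| * (LS * frob z + 1).
Variables (m omega c theta : R).
Hypotheses (m0 : 0 < m) (c0 : 0 <= c) (th : 0 <= theta <= pi / 4).
Variables (V : phs R) (cV : hcomplete V) (i : V -> H) (e : V -> Y) (Ke : R).
Hypothesis iL : forall (a : R) x y, i (a *: x + y) = a *: i x + i y.
Hypothesis iC : forall x, hn (i x) <= 1 * hn x.
Hypothesis eL : forall (a : R) x y, hn (e (a *: x + y) - (a *: e x + e y)) = 0.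
Hypothesis e_le : forall x, hn (e x) <= hn x.
Hypothesis e_sym : forall x z, (val (e x) z : 'M[R]_2)^T = val (e x) z.
Hypothesis Ke0 : 0 < Ke.
Hypothesis e_coercive : forall x, hn x ^+ 2 <= Ke * hn (e x) ^+ 2.
Hypothesis i_l4 : forall x, l4 (i x).
Hypothesis i_N4 : forall x, N4 (fr (i x)) ^+ 2 <= 4 * hn (i x) * hn x.
Local Notation SY := (SY fO LS0 Pinf0 PinfCP slip sP).
Local Notation Kst := (Kst LS).
Local Notation Tau := (Tau c theta).
Local Notation Pres := (Pres R O).

(** The relative velocity [W], in practice [U - i u], is an argument of its own, so that the
    estimates of the drag can be made in [W] alone. *)
Definition Phi (f : R -> R) (p : Pres) (W : H) (u v : V) : R :=
  ip (SY p (e u)) (e v) - Tau f W (i v) - (m * omega) * ip (perpH (i u)) (i v).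

Definition Psi f p W u h v : R := m^-1 * (Phi f p W u v - ip h v).

(** Total, with default [0]; it represents [F] when [F] is linear and bounded, see [repP]. *)
Definition rep (F : V -> R) : V := xget 0 [set p | forall v, F v = ip p v].

Lemma repP F (K : R) : (forall a x y, F (a *: x + y) = a * F x + F y) ->
  (forall v, `|F v| <= K * hn v) -> forall v, F v = ip (rep F) v.
Proof.
move=> FL FK; rewrite /rep; case: xgetP => [p _ //|] h; have [p hp] := riesz cV FL FK.
by have := h p hp.
Qed.

(** What is needed for the drag at [W] to be a bounded functional on [V]: true at every [W] after
    truncation, and for [id] when [W] lies in [L^4]. *)
Definition good f (W : H) : Prop :=
  (forall v : V, itg nu O (fun x => @ip R E1 (tauf c theta f (val W x)) (val (i v) x))) /\
  exists K, forall v, `|Tau f W (i v)| <= K * hn v.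

Lemma iCr x : hn (i x) <= hn x. Proof. by have := iC x; rewrite mul1r. Qed.

Lemma N4i (v : V) : N4 (fr (i v)) <= 2 * hn v.
Proof.
rewrite -ler_sqr ?nnegrE ?N4_ge0 ?mulr_ge0 ?hn_ge0 //; apply: le_trans (i_N4 v) _.
have := ler_wpM2r (hn_ge0 v) (iCr v); rewrite -mulrA exprMn expr2; lra.
Qed.

Lemma Tau0 f (v : H) : Tau f 0 v = 0.
Proof.
transitivity (Int (fun=> 0)); last exact: Int0.
apply: Int_eq => x _.
rewrite [tauf _ _ _ _](_ : _ = 0); first exact: (@ip0l R E1).
rewrite /tauf [turn _ _](_ : _ = 0) ?scaler0 //.
by apply/matrixP => a b; rewrite !mxE; case: ifP => _; rewrite ?mxE ?oppr0 !mulr0 addr0.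
Qed.

Lemma good_min k W : 0 <= k -> good (fun r => Num.min r k) W.
Proof.
move=> k0; split=> [v|]; first exact: Tau_k_itg.
exists (2 * c * k * hn W) => v.
have := Tau_k_lip theta c0 W 0 (i v) k0; rewrite Tau0 !subr0 => /le_trans; apply.
by rewrite mulrA ler_wpM2l ?iCr // !mulr_ge0 ?hn_ge0.
Qed.

Lemma good_id W : l4 W -> good id W.
Proof.
move=> lW; split=> [v|]; first by have [] := Tau_bound theta c0 (@adm_id R) lW (i_l4 v).
exists (2 * c * hn W * N4 (fr W)) => v.
have [_] := Tau_bound theta c0 (@adm_id R) lW (i_l4 v); move=> /le_trans; apply.
have h := ler_wpM2l (mulr_ge0 (mulr_ge0 c0 (hn_ge0 W)) (N4_ge0 nu O (fr W))) (N4i v).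
exact: alg_good h.
Qed.

Lemma e_ip (y : Y) a v w : ip y (e (a *: v + w)) = a * ip y (e v) + ip y (e w).
Proof. by rewrite ipC (hn_ipl_eq y (eL a v w)) ipDl ipZl !(ipC y). Qed.

Lemma PsiL f p W u h : good f W -> forall a v w, Psi f p W u h (a *: v + w) = a * Psi f p W u h v + Psi f p W u h w.
Proof.
move=> [gi _] a v w; rewrite /Psi /Phi e_ip !iL (TauL a (gi v) (gi w)).
rewrite (ipDr _ _ (perpH (i u))) (ipZr _ _ (perpH (i u))) (ipDr _ _ h) (ipZr _ _ h); exact: alg_psiL.
Qed.

Lemma Psi_le f p W u h A B C E v : `|ip (SY p (e u)) (e v)| <= A * hn v ->
  `|Tau f W (i v)| <= B * hn v -> `|(m * omega) * ip (perpH (i u)) (i v)| <= C * hn v ->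
  `|ip h v| <= E * hn v -> `|Psi f p W u h v| <= m^-1 * (A + B + C + E) * hn v.
Proof. by apply: alg_psi; rewrite ?hn_ge0 // invr_ge0 ltW. Qed.

Lemma ip_e_le (y : Y) v : `|ip y (e v)| <= hn y * hn v.
Proof. by apply: le_trans (ip_CS _ _) _; rewrite ler_wpM2l ?hn_ge0. Qed.

Lemma ip_i_le (w : H) v : `|ip w (i v)| <= hn w * hn v.
Proof. by apply: le_trans (ip_CS _ _) _; rewrite ler_wpM2l ?hn_ge0 ?iCr. Qed.

Lemma cor_le (w : H) v : `|(m * omega) * ip (perpH w) (i v)| <= `|m * omega| * hn w * hn v.
Proof. by rewrite normrM -mulrA ler_wpM2l // -(perpH_hn w); exact: ip_i_le. Qed.

Definition gg f p W u h : V := rep (Psi f p W u h).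

Lemma ggP f p W u h : good f W -> forall v, Psi f p W u h v = ip (gg f p W u h) v.
Proof.
move=> g; have [gi [K hK]] := g.
apply: (@repP _ (m^-1 * (hn (SY p (e u)) + K + `|m * omega| * hn (i u) + hn h))); first exact: PsiL.
move=> v; apply: Psi_le (ip_e_le _ _) (hK v) (cor_le _ _) (ip_CS _ _).
Qed.

Lemma gg_dist f p W u h f' p' W' u' h' (K : R) : good f W -> good f' W' -> 0 <= K ->
  (forall v, `|Tau f W (i v) - Tau f' W' (i v)| <= K * hn v) ->
  hn (gg f p W u h - gg f' p' W' u' h') <=
  m^-1 * (hn (SY p (e u) - SY p' (e u')) + K + `|m * omega| * hn (i u - i u') + hn (h - h')).
Proof.
move=> g g' K0 hK; apply: hn_le_dual.
  by rewrite mulr_ge0 ?invr_ge0 ?(ltW m0) // !addr_ge0 ?mulr_ge0 ?hn_ge0.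
move=> v; rewrite ipBl -(ggP p u h g) -(ggP p' u' h' g').
have -> : Psi f p W u h v - Psi f' p' W' u' h' v = m^-1 * (ip (SY p (e u) - SY p' (e u')) (e v) -
    (Tau f W (i v) - Tau f' W' (i v)) - (m * omega) * ip (perpH (i u - i u')) (i v) - ip (h - h') v).
  rewrite (ipBl (SY p (e u))) -(perpHB (i u)) (ipBl (perpH (i u))) (ipBl h); exact: alg_psiB.
apply: alg_psi (ip_e_le _ _) (hK v) (cor_le _ _) (ip_CS _ _); first by rewrite invr_ge0 ltW.
exact: hn_ge0.
Qed.

Lemma op_iB x y : i (x - y) = i x - i y.
Proof. by rewrite -[- y]scaleN1r addrC iL scaleN1r addrC. Qed.

Lemma eB_hn x y : hn (e (x - y) - (e x - e y)) = 0.
Proof. by have := eL (-1) y x; rewrite (scaleN1r y) (scaleN1r (e y)) [- y + x]addrC [- e y + _]addrC. Qed.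

Lemma eB_le x y : hn (e x - e y) <= hn (x - y).
Proof. by rewrite -(hn_eq0 (eB_hn x y)). Qed.

(** The drag carries a minus sign and is evaluated at [U - u], so the two reversals cancel. The
    Coriolis difference vanishes by skewness, and the stress yields the constant through
    [e_coercive]. *)
Lemma Psi_mono f p W W' u w h : admissible f -> good f W -> good f W' -> W - W' = i (w - u) ->
  m^-1 * (Pinf * cS / Ke) * hn (u - w) ^+ 2 <= Psi f p W u h (u - w) - Psi f p W' w h (u - w).
Proof.
move=> af g g' eW.
have hE : hn (u - w) ^+ 2 <= Ke * hn (e u - e w) ^+ 2.
  by have := e_coercive (u - w); rewrite (hn_eq0 (eB_hn u w)).
have h1 := SY_mono fO cS0 LS0 Pinf0 PinfCP smon slip sP p (e_sym u) (e_sym w).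
have [gi _] := g; have [gi' _] := g'.
have h2 : Tau f W (i (u - w)) - Tau f W' (i (u - w)) <= 0.
  have := @Tau_mono _ _ _ nu O mO c theta c0 th f W W' af.
  rewrite eW => /(_ (gi _) (gi' _)).
  have tN Z : good f Z -> Tau f Z (i (w - u)) = - Tau f Z (i (u - w)).
    move=> [gZ _]; have h3 := TauL (-1) (gZ (u - w)) (gZ 0); have h4 := TauL (-1) (gZ 0) (gZ 0).
    rewrite -iL scaleN1r addr0 opprB in h3; rewrite -iL scaler0 addr0 in h4.
    by rewrite h3; move: h4; move: (Tau f Z (i 0)) (Tau f Z _) => a b; lra.
  by rewrite !tN //; move: (Tau f W _) (Tau f W' _) => a b; lra.
rewrite -mulrA -[X in _ <= X](_ : m^-1 * (ip (SY p (e u) - SY p (e w)) (e (u - w)) -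
    (Tau f W (i (u - w)) - Tau f W' (i (u - w))) - (m * omega) * ip (perpH (i u - i w)) (i (u - w))) = _); last first.
  rewrite (ipBl (SY p (e u))) -(perpHB (i u)) (ipBl (perpH (i u))); exact/esym/alg_psiB0.
apply: ler_wpM2l; first by rewrite invr_ge0 ltW.
rewrite -op_iB perpH_skew mulr0 subr0 [ip _ (e (u - w))]ipC (hn_ipl_eq _ (eB_hn u w)) ipC.
have pc : 0 <= Pinf * cS / Ke by rewrite divr_ge0 ?mulr_ge0 ?ltW.
have eK : Pinf * cS / Ke * Ke = Pinf * cS by rewrite mulfVK // gt_eqF.
have h3 := ler_wpM2l pc hE; rewrite [X in _ <= X]mulrA eK in h3.
by apply: le_trans (le_trans h3 h1) _; rewrite lerDl oppr_ge0.
Qed.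

Lemma gg_mono f p W W' u w h : admissible f -> good f W -> good f W' -> W - W' = i (w - u) ->
  m^-1 * (Pinf * cS / Ke) * hn (u - w) ^+ 2 <= ip (gg f p W u h - gg f p W' w h) (u - w).
Proof.
move=> af g g' eW; have h1 := Psi_mono p h af g g' eW.
rewrite (ggP p u h g (u - w)) (ggP p w h g' (u - w)) in h1.
by rewrite ipBl.
Qed.

Variables (T : R) (T0 : 0 < T).
Local Notation D := (Iv T).
Let mD : measurable D := mIv T.
Local Notation X := (L2 (leb1 R) mD V).

(** Convergence in [L^oo] expressed through explicit bounds [ee], since [Pres] is a bare type
    without norm. *)
Definition convP (a : nat -> Pres) (x : Pres) : Prop := exists ee : nat -> R,
  [/\ cv ee 0, forall n, 0 <= ee n &
      forall n, \forall z \ae nu, O z -> `|sval (a n) z - sval x z| <= ee n].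

Variables (P : measurableTypeR R -> Pres) (U : measurableTypeR R -> H) (h : X) (CU : R).
Hypothesis cP : clean_for D convP P.
Hypothesis cU : clean D U.
Hypothesis CU0 : 0 <= CU.
Hypothesis hU : forall t, D t -> hn (U t) <= CU.
Hypothesis lU : forall t, D t -> l4 (U t).
Hypothesis iU : itgT T (fun t => N4 (fr (U t)) ^+ 2).

(** Truncation takes place at [2 * jj k], so that [rho_split] measures the tails at the positive
    level [jj k]. *)
Let jj (k : nat) : R := k.+1%:R.
Let tk k : R -> R := fun r => Num.min r (2 * jj k).
Let g k (t : R) (u : V) : V := gg (tk k) (P t) (U t - i u) u (val h t).
Let gi (t : R) (u : V) : V := gg id (P t) (U t - i u) u (val h t).

Lemma jj_gt0 k : 0 < jj k. Proof. exact: ltr0Sn. Qed.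
Lemma jj2 k : 0 <= 2 * jj k. Proof. by rewrite mulr_ge0 // ltW ?jj_gt0. Qed.
Lemma tk_adm k : admissible (tk k). Proof. exact: adm_min (jj2 k). Qed.
Lemma tk_good k W : good (tk k) W. Proof. exact: good_min (jj2 k). Qed.
Lemma id_good t u : D t -> good id (U t - i u).
Proof. by move=> Dt; apply: good_id; exact: l4B (lU Dt) (i_l4 u). Qed.

Lemma WW (w : H) x y : (w - i x) - (w - i y) = i (y - x).
Proof. by rewrite op_iB opprB addrC addrA subrK. Qed.

Lemma WW2 (a x : H) b y : (a - i b) - (x - i y) = (a - x) - i (b - y).
Proof. by rewrite op_iB !opprB [i y - x]addrC addrACA [- i b + _]addrC. Qed.

Lemma tk_lip k W W' v : `|Tau (tk k) W (i v) - Tau (tk k) W' (i v)| <= 2 * c * (2 * jj k) * hn (W - W') * hn v.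
Proof.
apply: le_trans (Tau_k_lip theta c0 W W' (i v) (jj2 k)) _; rewrite mulrA ler_wpM2l ?iCr //.
by rewrite !mulr_ge0 ?hn_ge0 // ltW ?jj_gt0.
Qed.

Lemma tk_ge0 k (x : R) : 0 <= x -> 0 <= 2 * c * (2 * jj k) * x.
Proof. by move=> x0; rewrite mulr_ge0 // mulr_ge0 ?jj2 // mulr_ge0. Qed.

Lemma gSY_le p u v : hn (SY p (e u) - SY p (e v)) <= CP * LS * hn (u - v).
Proof.
apply: le_trans (SY_lip fO LS0 Pinf0 PinfCP slip sP p (e u) (e v)) _; apply: ler_wpM2l; last exact: eB_le.
by rewrite mulr_ge0 ?(ltW LS0) // (le_trans (ltW Pinf0)).
Qed.

Lemma g_clean k (u : X) : clean D (fun t => g k t (val u t)).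
Proof.
pose J (x : Pres * H) (y : V * V) := gg (tk k) x.1 (x.2 - i y.1) y.1 y.2.
have hPU := clean_pair cP cU; have huh := clean_pair (L2_clean u) (L2_clean h).
apply: (clean_comp2 (f := J) _ hPU huh) => a x b y [[ee [ee0 eep hee]] c2] [c3 c4].
apply: (hcvg_le (b := fun n => m^-1 * (CP * LS * hn ((b n).1 - y.1) + ee n * Kst (e y.1) +
  2 * c * (2 * jj k) * (hn ((a n).2 - x.2) + hn ((b n).1 - y.1)) + `|m * omega| * hn ((b n).1 - y.1) + hn ((b n).2 - y.2)))) => [n|].
  have hW : hn (((a n).2 - i (b n).1) - (x.2 - i y.1)) <= hn ((a n).2 - x.2) + hn ((b n).1 - y.1).
    rewrite WW2; apply: le_trans (hnB_le _ _) _; rewrite lerD2l; exact: iCr.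
  apply: le_trans (gg_dist _ _ _ _ _ _ (tk_good k _) (tk_good k _) (tk_ge0 k (hn_ge0 _)) (fun v => tk_lip k _ _ v)) _.
  apply: ler_wpM2l; first by rewrite invr_ge0 ltW.
  rewrite lerD2r; apply: lerD; last by rewrite ler_wpM2l // -op_iB iCr.
  apply: lerD; last by rewrite ler_wpM2l // mulr_ge0 ?jj2 // mulr_ge0.
  apply: le_trans (hn_triB _ (SY (a n).1 (e y.1)) _) _; apply: lerD; last exact: SY_p.
  exact: gSY_le.
have h1 := cvD (cvZ (CP * LS) c3) (cvM ee0 (cvC (Kst (e y.1)))).
have h2 := cvZ (2 * c * (2 * jj k)) (cvD c2 c3).
have := cvZ m^-1 (cvD (cvD (cvD h1 h2) (cvZ `|m * omega| c3)) c4).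
by rewrite !addr0 !mulr0 !mul0r !addr0 mulr0.
Qed.

Definition al : R := m^-1 * (Pinf * cS / Ke).

Lemma al_gt0 : 0 < al.
Proof. by rewrite mulr_gt0 ?invr_gt0 // divr_gt0 // mulr_gt0. Qed.

Lemma g_mon k t u v : D t -> al * hn (u - v) ^+ 2 <= ip (g k t u - g k t v) (u - v).
Proof. by move=> Dt; apply: gg_mono (tk_good k _) (tk_good k _) (WW _ _ _); exact: tk_adm. Qed.

Definition Lk k : R := m^-1 * (CP * LS + 2 * c * (2 * jj k) + `|m * omega|).

Lemma alg_lk (k a b o x X1 X2 : R) : 0 <= k -> 0 <= o -> X1 <= a * x -> X2 <= x ->
  k * (X1 + b * x + o * X2 + 0) <= k * (a + b + o) * x.
Proof.
move=> k0 o0 h1 h2; rewrite -mulrA ler_wpM2l // addr0 !mulrDl; apply: lerD; first by rewrite lerD2r.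
exact: ler_wpM2l.
Qed.

Lemma g_lip k t u v : D t -> hn (g k t u - g k t v) <= Lk k * hn (u - v).
Proof.
move=> Dt.
have hK w : `|Tau (tk k) (U t - i u) (i w) - Tau (tk k) (U t - i v) (i w)| <= 2 * c * (2 * jj k) * hn (u - v) * hn w.
  apply: le_trans (tk_lip k _ _ w) _; rewrite WW; apply: ler_wpM2r; first exact: hn_ge0.
  by apply: ler_wpM2l; [rewrite mulr_ge0 ?jj2 // mulr_ge0|rewrite [hn (u - v)]hnBC; exact: iCr].
apply: le_trans (gg_dist _ _ _ _ _ _ (tk_good k _) (tk_good k _) (tk_ge0 k (hn_ge0 _)) hK) _.
rewrite subrr hn0 -op_iB; apply: alg_lk; [by rewrite invr_ge0 ltW|exact: normr_ge0|exact: gSY_le|exact: iCr].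
Qed.

(** Bounds the operator at rest for all truncation levels: its stress, the drag of [U] by
    [Tau_bound], and the force. A root of a sum of squares makes the integrability of its square
    immediate. *)
Definition gam (t : R) : R := m^-1 * Num.sqrt (3 * ((CP * Kst (e 0)) ^+ 2 + (2 * c * CU * N4 (fr (U t))) ^+ 2 + hn (val h t) ^+ 2)).

Lemma gam2 : itgT T (fun t => gam t ^+ 2).
Proof.
have h1 : itgT T (fun t => (2 * c * CU * N4 (fr (U t))) ^+ 2).
  by apply: (itg_eq mD _ (itgZ mD ((2 * c * CU) ^+ 2) iU)) => t _; rewrite [RHS]exprMn.
have h2 : itgT T (fun t => hn (val h t) ^+ 2).
  by apply: (itg_eq mD _ (L2_itg h h)) => t _; rewrite hn_sq.
have h3 := itgD mD (itgD mD (itg_cst mD ((CP * Kst (e 0)) ^+ 2) (Iv_fin T)) h1) h2.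
apply: (itg_eq mD _ (itgZ mD (m^-1 ^+ 2) (itgZ mD 3 h3))) => t _.
by rewrite /gam [RHS]exprMn [in RHS]sqr_sqrtr // mulr_ge0 // !addr_ge0 ?sqr_ge0.
Qed.

Lemma op_i0 : i 0 = 0.
Proof. by have := op_iB 0 0; rewrite !subrr. Qed.

Lemma g_zero k t : D t -> hn (g k t 0) <= gam t.
Proof.
move=> Dt; rewrite -[g k t 0]subr0.
pose A := CP * Kst (e 0); pose B := 2 * c * CU * N4 (fr (U t)); pose E := hn (val h t).
have A0 : 0 <= A by rewrite mulr_ge0 ?sqrtr_ge0 // (le_trans (ltW Pinf0)).
have B0 : 0 <= B by rewrite !mulr_ge0 ?N4_ge0.
apply: le_trans (_ : m^-1 * (A + B + 0 + E) <= _).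
  apply: hn_le_dual; first by rewrite mulr_ge0 ?invr_ge0 ?(ltW m0) // !addr_ge0 ?hn_ge0.
  move=> v; rewrite subr0 -(ggP _ _ _ (tk_good k _)) op_i0 subr0.
  apply: Psi_le; last exact: ip_CS.
  - by apply: le_trans (ip_e_le _ _) _; rewrite ler_wpM2r ?hn_ge0 // SY_bound.
  - have [_ h1] := Tau_bound theta c0 (tk_adm k) (lU Dt) (i_l4 v); apply: le_trans h1 _.
    have h2 := ler_pM (hn_ge0 _) (mulr_ge0 (N4_ge0 _ _ _) (N4_ge0 _ _ _)) (hU Dt) (ler_wpM2l (N4_ge0 nu O (fr (U t))) (N4i v)).
    by apply: le_trans (ler_wpM2l c0 h2) _; rewrite le_eqVlt; apply/orP; left; apply/eqP; rewrite /B; exact: alg_B.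
  - have p0 : perpH (0 : H) = 0 by have := perpHB (0 : H) 0; rewrite !subrr.
    by rewrite op_i0 p0 ip0l mulr0 normr0 mul0r lexx.
apply: ler_wpM2l; first by rewrite invr_ge0 ltW.
rewrite addr0 -[X in X <= _](ger0_norm (_ : 0 <= A + B + E)) ?addr_ge0 ?hn_ge0 // -sqrtr_sqr.
by apply: ler_wsqrtr; exact: alg_sq3.
Qed.

Definition be k (t : measurableTypeR R) : R := N4 (fun x => rho (jj k) (@hn R E1 (val (U t) x))).

Lemma be_meas k : measurable_fun D (be k).
Proof. by apply: (tail_meas fO mD cU lU); exact: ltW (jj_gt0 k). Qed.

Lemma be_le k t : D t -> 0 <= be k t <= N4 (fr (U t)).
Proof.
move=> Dt; rewrite N4_ge0 /=; do 2 apply: ler_wsqrtr.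
apply: (Int_le mO (rho4 (ltW (jj_gt0 k)) (lU Dt)) (lU Dt)) => x _.
by rewrite ler_pXn2r ?nnegrE ?rho_ge0 ?hn_ge0 // rho_le ?hn_ge0 // ltW ?jj_gt0.
Qed.

(** The factor that [rho_sqrt] extracts at the level [jj k]. *)
Definition ka k : R := Num.sqrt (jj k)^-1.

Lemma ka_cv : cv ka 0.
Proof. by have := cv_sqrt (@cv_harmonic R); rewrite sqrtr0. Qed.

(** The sum of the constants in [g_diff] and [gi_lip]; absolute values make it nonnegative for every
    [B]. *)
Definition CC (B : R) : R := m^-1 * (4 * c * (2 * CU + 8 * `|B| * Num.sqrt `|B|) +
  (CP * LS + 16 * c * (CU + `|B|) + `|m * omega|)).

Lemma CC_parts (B : R) : [/\ 0 <= CP * LS, 0 <= 16 * c * (CU + `|B|) &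
  0 <= 4 * c * (2 * CU + 8 * `|B| * Num.sqrt `|B|)].
Proof.
split; first by rewrite mulr_ge0 ?(ltW LS0) // (le_trans (ltW Pinf0)).
  by apply: mulr_ge0; [rewrite mulr_ge0|rewrite addr_ge0].
apply: mulr_ge0; first by rewrite mulr_ge0.
by apply: addr_ge0; apply: mulr_ge0; rewrite ?sqrtr_ge0 // mulr_ge0.
Qed.

Lemma CC_ge1 B : m^-1 * (4 * c * (2 * CU + 8 * `|B| * Num.sqrt `|B|)) <= CC B.
Proof.
have [p1 p2 p3] := CC_parts B; apply: ler_wpM2l; first by rewrite invr_ge0 ltW.
rewrite lerDl; apply: addr_ge0; [exact: addr_ge0|exact: normr_ge0].
Qed.

Lemma CC_ge2 B : m^-1 * (CP * LS + 16 * c * (CU + `|B|) + `|m * omega|) <= CC B.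
Proof.
by have [p1 p2 p3] := CC_parts B; apply: ler_wpM2l; [rewrite invr_ge0 ltW|rewrite lerDr].
Qed.

Lemma CC_ge0 B : 0 <= CC B.
Proof.
have [p1 p2 p3] := CC_parts B; apply: le_trans (CC_ge1 B).
by apply: mulr_ge0 => //; rewrite invr_ge0 ltW.
Qed.

(** [Tau_diff] combined with [|i u|_4^2 <= 4 B |u|_V], which makes the error linear in [hn u] and so
    square integrable in time. *)
Lemma g_diff B k t u : D t -> hn (i u) <= B -> hn (g k t u - gi t u) <= CC B * (be k t + ka k * hn u).
Proof.
move=> Dt hB; have B0 := le_trans (hn_ge0 _) hB.
have bB : `|B| = B by rewrite ger0_norm.
pose K := 4 * c * (2 * CU + 8 * B * Num.sqrt B) * (be k t + ka k * hn u).
have be0 : 0 <= be k t := N4_ge0 _ _ _.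
have ka0 : 0 <= ka k := sqrtr_ge0 _.
have K0 : 0 <= K by rewrite !mulr_ge0 // ?addr_ge0 ?mulr_ge0 ?hn_ge0 ?sqrtr_ge0.
have hK v : `|Tau (tk k) (U t - i u) (i v) - Tau id (U t - i u) (i v)| <= K * hn v.
  apply: le_trans (Tau_diff theta c0 (jj_gt0 k) (lU Dt) (i_l4 u) (i_l4 v)) _.
  rewrite (_ : K * hn v = 4 * c * ((2 * CU + 8 * B * Num.sqrt B) * ((be k t + ka k * hn u) * hn v))); last by rewrite /K !mulrA.
  apply: ler_wpM2l; first by rewrite mulr_ge0.
  have s1 : Num.sqrt (hn (i u) / jj k) <= Num.sqrt B * ka k.
    by rewrite -sqrtrM // ler_wsqrtr // ler_wpM2r // invr_ge0 ltW ?jj_gt0.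
  have n1 : N4 (fr (i u)) ^+ 2 <= 4 * B * hn u.
    by apply: le_trans (i_N4 u) _; rewrite ler_wpM2r ?hn_ge0 // ler_wpM2l.
  exact: alg_gdiff B0 (sqrtr_ge0 _) be0 ka0 CU0 (hn_ge0 _) (hn_ge0 _) (hn_ge0 _) (N4_ge0 _ _ _) (sqr_ge0 _) (sqrtr_ge0 _) (hU Dt) (N4i v) n1 s1.
apply: le_trans (gg_dist _ _ _ _ _ _ (tk_good k _) (id_good u Dt) K0 hK) _.
rewrite !subrr !hn0 mulr0 add0r !addr0 /K mulrA -{1 2}bB.
by rewrite ler_wpM2r ?addr_ge0 ?mulr_ge0 ?hn_ge0 // CC_ge1.
Qed.

Lemma gi_lip B t u v : D t -> hn (i u) <= B -> hn (i v) <= B ->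
  hn (gi t u - gi t v) <= CC B * hn (u - v).
Proof.
move=> Dt hu hv; have B0 := le_trans (hn_ge0 _) hu.
have K0 : 0 <= 16 * c * (CU + `|B|) * hn (u - v) by rewrite !mulr_ge0 ?addr_ge0 ?hn_ge0.
have hK w : `|Tau id (U t - i u) (i w) - Tau id (U t - i v) (i w)| <= 16 * c * (CU + `|B|) * hn (u - v) * hn w.
  apply: le_trans (Tau_lip theta c0 (l4B (lU Dt) (i_l4 u)) (l4B (lU Dt) (i_l4 v)) (i_l4 w)) _.
  rewrite WW ger0_norm //.
  have h1 : hn (U t - i u) <= CU + B by apply: le_trans (hnB_le _ _) _; exact: lerD (hU Dt) hu.
  have h2 : hn (U t - i v) <= CU + B by apply: le_trans (hnB_le _ _) _; exact: lerD (hU Dt) hv.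
  have h3 := N4i (v - u); rewrite [hn (v - u)]hnBC in h3.
  have h4 := ler_pM (N4_ge0 _ _ _) (N4_ge0 _ _ _) h3 (N4i w).
  have h5 := ler_pM (addr_ge0 (hn_ge0 _) (hn_ge0 _)) (mulr_ge0 (N4_ge0 _ _ _) (N4_ge0 _ _ _)) (lerD h1 h2) h4.
  have c2 : 0 <= 2 * c by rewrite mulr_ge0.
  by apply: le_trans (ler_wpM2l c2 h5) _; rewrite le_eqVlt; apply/orP; left; apply/eqP; exact: alg_gi.
apply: le_trans (gg_dist _ _ _ _ _ _ (id_good u Dt) (id_good v Dt) K0 hK) _.
apply: le_trans (_ : m^-1 * (CP * LS + 16 * c * (CU + `|B|) + `|m * omega|) * hn (u - v) <= _).
  rewrite subrr hn0 -op_iB; apply: alg_lk; [by rewrite invr_ge0 ltW|exact: normr_ge0|exact: gSY_le|exact: iCr].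
by apply: ler_wpM2r; [exact: hn_ge0|exact: CC_ge2].
Qed.

Definition ocean_eq (u z : X) (t : measurableTypeR R) : Prop := forall v : V,
  m * ip (val z t) v + Phi id (P t) (U t - i (val u t)) (val u t) v = ip (val h t) v.

Lemma ocean_eqP u z t : D t -> ocean_eq u z t <-> hn (val z t + gi t (val u t)) = 0.
Proof.
move=> Dt; have hg := ggP (P t) (val u t) (val h t) (id_good (val u t) Dt).
have E v : m * ip (val z t + gi t (val u t)) v =
    m * ip (val z t) v + Phi id (P t) (U t - i (val u t)) (val u t) v - ip (val h t) v.
  rewrite ipDl -[ip (gi t _) v]hg /Psi mulrDr mulrA mulfV ?mul1r ?gt_eqF //.
  by rewrite addrA.
split=> [h1|h1 v].
  apply/eqP; rewrite -sqrf_eq0 hn_sq -(mulrI_eq0 _ (lregP (lt0r_neq0 m0))) E h1 subrr //.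
by apply/eqP; rewrite -subr_eq0 -E ip_hn0 ?mulr0.
Qed.

Hypothesis cH : hcomplete H.
Hypothesis iinj : forall x, hn (i x) = 0 -> hn x = 0.
Hypothesis idense : forall xi, (forall v, ip xi (i v) = 0) -> hn xi = 0.

Lemma ocean_exists (u0 : H) : exists u z W, [/\ Wsol i u z W,
  \forall t \ae leb1 R, D t -> ocean_eq u z t & hn (W 0 - u0) = 0].
Proof.
have [u [z [W [[hW hae] h0]]]] := @glim_exists R T T0 V H cV cH i 1 iL iC iinj idense g gi al Lk gam be
  (fun t => N4 (fr (U t))) ka CC al_gt0 g_clean g_mon g_lip g_zero gam2 be_meas be_le iU
  (tail_cv lU) ka_cv CC_ge0 g_diff gi_lip u0.
exists u, z, W; split=> //; apply: filterS hae => t h1 Dt.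
by apply/ocean_eqP => //; exact: h1.
Qed.

Lemma ocean_unique u z W u' z' W' : Wsol i u z W -> Wsol i u' z' W' ->
  (\forall t \ae leb1 R, D t -> ocean_eq u z t) -> (\forall t \ae leb1 R, D t -> ocean_eq u' z' t) ->
  hn (W 0 - W' 0) = 0 -> forall t, 0 <= t <= T -> hn (W t - W' t) = 0.
Proof.
move=> hW hW' ha ha'; apply: (@glim_unique R T T0 V H cV cH i 1 iL iC iinj idense g gi al be ka CC
  al_gt0 g_mon (tail_cv lU) ka_cv g_diff u z W u' z' W').
- by split=> //; apply: filterS ha => t h1 Dt; apply/ocean_eqP => //; exact: h1.
- by split=> //; apply: filterS ha' => t h1 Dt; apply/ocean_eqP => //; exact: h1.
Qed.

End Operator.

(** * Bochner integrals and distributional derivatives in time *)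

Section OneDimension.
Variables (R : realType) (T : R) (T0 : 0 < T).
Local Notation D := (Iv T).
Let mD : measurable D := mIv T.
Local Notation leb := (@lebesgue_measure R).
Implicit Types phi f : R -> R.
Local Notation test1 phi := (test_fun (`]0, T[%classic : set R) phi).

Lemma test1_out phi x : test1 phi -> ~~ (0 < x < T) -> phi x = 0.
Proof. by move=> h hx; apply: (test_out h); rewrite /= in_itv /=; exact/negP. Qed.

Lemma test1_is_derive phi (x : R) : test1 phi -> is_derive x 1 phi (derive1 phi x).
Proof.
move=> [h _]; rewrite derive1E; apply: DeriveDef => //.
exact: (@Ck_derivable _ _ 0%N phi x 1 (h 1%N)).
Qed.

Lemma test1_derive phi : test1 phi -> test1 (derive1 phi).
Proof. by move=> h; have h1 v := test_derive v h; have := h1 1; rewrite (_ : (fun z => _) = derive1 phi) //; apply/funext => x; rewrite derive1E. Qed.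

Lemma cont_meas1 f : continuous f -> measurable_fun D (f : measurableTypeR R -> measurableTypeR R).
Proof. by move=> cf; apply: measurable_funTS; exact: continuous_measurable_fun. Qed.

Lemma test1_meas phi : test1 phi -> measurable_fun D (phi : measurableTypeR R -> measurableTypeR R).
Proof. by move=> h; apply: cont_meas1; exact: test_cont h. Qed.

Lemma itgT_mul_bounded phi f : test1 phi -> itgT T f -> itgT T (fun t => phi t * f t).
Proof.
move=> h hf; have [C C0 hC] := test_bounded h.
apply: (itg_le mD _ (itgZ mD C (itg_abs hf))).
  by apply: measurable_funM; [exact: test1_meas|exact: itg_meas hf].
by move=> t _; rewrite normrM ler_wpM2r.
Qed.

Lemma test1_itg phi : test1 phi -> itgT T phi.
Proof.
move=> h; have i1 : itgT T (fun=> 1) := itg_cst mD 1 (Iv_fin T).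
by apply: (itg_eq mD _ (itgT_mul_bounded h i1)) => t _; rewrite mulr1.
Qed.

Lemma test1_ftc phi s : test1 phi -> 0 <= s <= T -> IntT s (derive1 phi) = phi s.
Proof.
move=> h /andP[]; rewrite le_eqVlt => /orP[/eqP <- _|s0 sT].
  by rewrite (test1_out h) ?ltxx // /Iv set_itv_ge ?bnd_simp ?ltxx // Rintegral_set0.
have h' := test1_derive h.
have is0 : itgT s (derive1 phi) := itgT_sub sT (test1_itg h').
rewrite -(IntT_closed is0).
have ic : leb.-integrable `[0, s]%classic (EFin \o derive1 phi).
  apply: continuous_compact_integrable; first exact: segment_compact.
  by apply: continuous_subspaceT; exact: test_cont h'.
have F2 : (\int[leb]_(x in `[0%R, s]) (derive1 phi x)%:E)%E = ((phi s)%:E - (phi 0)%:E)%E.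
  apply: continuous_FTC2 => //.
  - by apply: continuous_subspaceT; exact: test_cont h'.
  - split.
    + by move=> x _; have [] := test1_is_derive x h.
    + by apply: cvg_at_right_filter; exact: (test_cont h).
    + by apply: cvg_at_left_filter; exact: (test_cont h).
rewrite (Rintegral_itv_obnd_cbnd (r := 0) (b := BRight s)); last by apply: integrableS ic => //; exact: subset_itv_oc_cc.
by rewrite /Rintegral F2 (test1_out (x := 0) h) ?ltxx // sube0.
Qed.

(* The bumps [m2 * ebump a b - m1 * ebump c d] of vanishing mean are derivatives of test
   functions. *)
Lemma bump_pair_primitive n (a b c d : R) : 0 < a -> a < b -> b < T -> 0 < c -> c < d -> d < T ->
  exists2 phi, test1 phi & forall x, derive1 phi x =
    IntT T (ebump n c d) * ebump n a b x - IntT T (ebump n a b) * ebump n c d x.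
Proof.
move=> a0 ab bT c0 cd dT.
have tb (x y : R) : 0 < x -> x < y -> y < T -> test1 (ebump n x y).
  move=> x0 xy yT; apply: ebump_test => z; rewrite /= !in_itv /= => /andP[h1 h2].
  by rewrite (lt_le_trans x0) // (le_lt_trans h2).
have t1 := tb _ _ a0 ab bT; have t2 := tb _ _ c0 cd dT.
set m1 := IntT T (ebump n a b); set m2 := IntT T (ebump n c d).
pose psi x := m2 * ebump n a b x - m1 * ebump n c d x.
have Cpsi k : is_Ck k psi.
  have -> : psi = (fun x => m2 * ebump n a b x + (- m1) * ebump n c d x).
    by apply/funext => x; rewrite /psi mulNr.
  by apply: CkD; apply: CkZ; exact: ebump_Ck.
have cpsi : continuous psi := Ck_cont (Cpsi 0%N).
pose l := Num.min a c; pose u := Num.max b d.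
have l0 : 0 < l by rewrite lt_min a0.
have uT : u < T by rewrite gt_max bT.
have out x : ~~ (l < x < u) -> psi x = 0.
  move=> hx; rewrite /psi !ebump_out ?mulr0 ?subrr //.
    apply: contra hx => /andP[h1 h2]; rewrite (le_lt_trans _ h1) ?ge_min ?lexx ?orbT //.
    by rewrite (lt_le_trans h2) // le_max lexx orbT.
  apply: contra hx => /andP[h1 h2]; rewrite (le_lt_trans _ h1) ?ge_min ?lexx ?orbT //.
  by rewrite (lt_le_trans h2) // le_max lexx.
have outD x : ~ D x -> psi x = 0.
  move=> nD; apply: out; apply/negP => /andP[h1 h2]; apply: nD; apply/IvP.
  by rewrite (lt_trans l0 h1) (lt_trans h2 uT).
have ipsi : itgT T psi.
  apply: (itgB mD); apply: (itgZ mD); exact: test1_itg.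
have ppsi : psi \_ D = psi.
  by apply/funext => x; rewrite patchE; case: ifPn => // /negP h; rewrite outD // => Dx; apply: h; rewrite inE.
have iR : leb.-integrable setT (EFin \o psi).
  by have /itgT_patch := ipsi; rewrite ppsi.
have mpsi : IntT T psi = 0.
  rewrite (IntB mD (itgZ mD m2 (test1_itg t1)) (itgZ mD m1 (test1_itg t2))) (IntZ mD _ (test1_itg t1)) (IntZ mD _ (test1_itg t2)).
  by rewrite -/m1 -/m2 mulrC subrr.
pose phi x := (\int[leb]_(t in `]-oo, x]) psi t)%R.
have dphi (x : R) : is_derive x 1 phi (psi x).
  have xx : x < x + 1 by rewrite ltrDl.
  have ix : leb.-integrable [set` Interval -oo%O (BRight (x + 1))] (EFin \o psi).
    by apply: integrableS iR => //; exact: measurable_itv.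
  have [||h1 h2] := @continuous_FTC1 R psi -oo%O x (x + 1) xx ix; [exact: ltNyr|exact: cpsi|].
  by rewrite -h2 derive1E; apply: DeriveDef.
have Cphi k : is_Ck k phi.
  by case: k => [|k]; [apply: CkS; apply: (Ck_step dphi); exact: Cpsi 0%N|apply: (Ck_step dphi); exact: Cpsi].
exists phi; last by move=> x; rewrite derive1E; have [_ ->] := dphi x.
split=> //; exists (`[l, u]%classic); split; first exact: segment_compact.
  move=> z; rewrite /= !in_itv /= => /andP[h1 h2].
  by rewrite (lt_le_trans l0) // (le_lt_trans h2).
move=> x; rewrite /= in_itv /= => /negP; rewrite negb_and -!ltNge => /orP[xl|ux].
  rewrite /phi; under eq_Rintegral => t ht.
    rewrite (out t); last first.
      move: ht; rewrite inE /= in_itv /= => tx; apply/negP => /andP[h1 _].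
      by have := lt_trans h1 (le_lt_trans tx xl); rewrite ltxx.
    over.
  exact: Int0.
rewrite /phi -mpsi IntT_patch ppsi [LHS]Rintegral_mkcond; congr (Rintegral _ _ _).
apply/funext => t; rewrite patchE; case: ifPn => // /negP ht; rewrite out //.
apply/negP => /andP[_ tu]; apply: ht; rewrite inE /= in_itv /=.
exact: ltW (lt_trans tu ux).
Qed.

Lemma IntT_cst (k s : R) : 0 < s -> IntT s (fun=> k) = k * s.
Proof.
move=> s0; have -> := @Int_cst _ _ _ (leb1 R) (Iv s).
  by rewrite leb_Iv /= max_r // ltW.
exact: mIv.
Qed.

Lemma IntT_comb (p q : R) (f1 f2 psi K : R -> R) : (forall x, psi x = p * f1 x - q * f2 x) ->
  itgT T (fun x => f1 x * K x) -> itgT T (fun x => f2 x * K x) ->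
  IntT T (fun x => psi x * K x) = p * IntT T (fun x => f1 x * K x) - q * IntT T (fun x => f2 x * K x).
Proof.
move=> h h1 h2; rewrite -(IntZ mD _ h1) -(IntZ mD _ h2) -(IntB mD (itgZ mD _ h1) (itgZ mD _ h2)).
by apply: Int_eq => x _; rewrite h mulrBl !mulrA.
Qed.

Definition cont0T (K : R -> R) : Prop := forall t, 0 <= t <= T -> forall e, 0 < e ->
  exists2 dl, 0 < dl & forall s, 0 <= s <= T -> `|s - t| < dl -> `|K s - K t| < e.

Lemma IntT_strip (a b : R) f : 0 <= a -> a <= b -> b <= T -> itgT T f ->
  IntT T (fun x => (a < x < b)%R%:R * f x) = IntT b f - IntT a f.
Proof.
move=> a0 ab bT hf; have aT := le_trans ab bT.
rewrite (IntT_cut f bT) (IntT_cut f aT) -(IntB mD); [|exact: itgT_cut|exact: itgT_cut].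
have hi : itgT T (fun x => (x < b)%R%:R * f x - (x < a)%R%:R * f x) by apply: (itgB mD); exact: itgT_cut.
apply: (Int_ae mD _ hi).
  apply: (itg_le mD _ (itg_abs hf)).
    apply: measurable_funM; last exact: itg_meas hf.
    have -> : (fun x : measurableTypeR R => ((a < x < b)%R%:R : R)) = \1_(`]a, b[%classic : set (measurableTypeR R)).
      by apply/funext => x; rewrite indicE; congr ((nat_of_bool _)%:R); apply/idP/idP; rewrite ?inE /= in_itv.
    exact: measurable_indic.
  by move=> x _; rewrite normrM; case: (_ < _ < _); rewrite ?normr1 ?normr0 ?mul1r // mul0r.
exists [set a]; split; [exact: measurable_set1|exact: lebesgue_measure_set1|].
move=> x /= hx; apply: contrapT => xa; apply: hx => Dx; rewrite -mulrBl; congr (_ * _).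
case: (ltgtP a x) xa => [ax _|xa' _|<-] //=.
- by rewrite subr0.
- by rewrite (lt_le_trans xa' ab) subrr.
Qed.

(** Primitives of bump pairs, in the limit of indicators, show that [K] has the same mean over any
    two intervals inside [(0, T)]. Shrinking the intervals turns means into values by continuity,
    which also reaches the endpoints. *)
Lemma du_bois_reymond K : cont0T K -> itgT T K ->
  (forall phi, test1 phi -> IntT T (fun t => derive1 phi t * K t) = 0) ->
  forall t, 0 <= t <= T -> K t = K 0.
Proof.
move=> cK iK hK.
have strip a b : 0 < a -> a < b -> b < T ->
    cv (fun n => IntT T (ebump n a b)) (b - a) /\ cv (fun n => IntT T (fun x => ebump n a b x * K x)) (IntT b K - IntT a K).
  move=> a0 ab bT.
  have i1 : itgT T (fun=> 1 : R) := itg_cst mD 1 (Iv_fin T).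
  have gen f : itgT T f -> cv (fun n => IntT T (fun x => ebump n a b x * f x)) (IntT b f - IntT a f).
    move=> hf; rewrite -(IntT_strip (ltW a0) (ltW ab) (ltW bT) hf).
    have mf n : measurable_fun D (fun x => ebump n a b x * f x).
      by apply: measurable_funM; [apply: measurable_funTS; exact: ebump_meas|exact: itg_meas hf].
    have df n x : D x -> `|ebump n a b x * f x| <= `|f x|.
      by move=> _; rewrite normrM ger0_norm ?ebump_ge0 // ler_piMl // ebump_le1.
    have cf x : D x -> cv (fun n => ebump n a b x * f x) ((a < x < b)%R%:R * f x).
      by move=> _; exact: cvM (ebump_cv a b x) (cvC _).
    by have [_] := Int_dct mD mf (itg_abs hf) df cf.
  split; last exact: gen.
  have := gen _ i1; have IC s : 0 < s -> IntT s (fun=> 1 : R) = s.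
    by move=> s0; rewrite IntT_cst ?mul1r.
  rewrite !IC ?(lt_trans a0 ab) //.
  by under eq_fun do (under eq_Rintegral do rewrite mulr1).
have key a b c d : 0 < a -> a < b -> b < T -> 0 < c -> c < d -> d < T ->
    (d - c) * (IntT b K - IntT a K) = (b - a) * (IntT d K - IntT c K).
  move=> a0 ab bT c0 cd dT.
  have [p1 p2] := strip a b a0 ab bT; have [p3 p4] := strip c d c0 cd dT.
  have h1 := cvM p3 p2; have h2 := cvM p1 p4.
  rewrite (_ : (fun n => IntT T (ebump n c d) * _) = (fun n => IntT T (ebump n a b) * IntT T (fun x => ebump n c d x * K x))) in h1.
    exact: cv_uniq h1 h2.
  apply/funext => n; apply/eqP; rewrite -subr_eq0; apply/eqP.
  have [phi tphi dphi] := bump_pair_primitive n a0 ab bT c0 cd dT.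
  have tb (x y : R) : 0 < x -> x < y -> y < T -> test1 (ebump n x y).
    move=> x0 xy yT; apply: ebump_test => z; rewrite /= !in_itv /= => /andP[q1 q2].
    by rewrite (lt_le_trans x0) // (le_lt_trans q2).
  have e1 := itgT_mul_bounded (tb _ _ a0 ab bT) iK; have e2 := itgT_mul_bounded (tb _ _ c0 cd dT) iK.
  have := hK phi tphi; rewrite (IntT_comb dphi e1 e2) => <-.
  by [].
have near_K (a e dl : R) : 0 < a -> 0 < dl -> a + dl < T -> (forall s, 0 <= s <= T -> `|s - a| <= dl -> `|K s - K a| < e) ->
    `|IntT (a + dl) K - IntT a K - dl * K a| <= e * dl.
  move=> a0 dl0 adT h.
  have i2 : itgT T (fun s => K s - K a) by apply: (itgB mD) => //; exact: itg_cst (Iv_fin T).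
  have ad : a <= a + dl by rewrite lerDl ltW.
  have i3 := itgT_sub (ltW adT) i2; have i4 := itgT_sub (ltW adT) iK.
  have ic : itgT (a + dl) (fun=> K a) by apply: (itg_cst (mIv _)); exact: Iv_fin.
  have -> : IntT (a + dl) K - IntT a K - dl * K a = IntT (a + dl) (fun s => K s - K a) - IntT a (fun s => K s - K a).
    rewrite (IntB (mIv _) i4 ic) (IntB (mIv _) (itgT_sub ad i4) (itgT_sub ad ic)) !IntT_cst ?addr_gt0 //; ring.
  rewrite (IntT_subE (ltW a0) ad i3).
  have me : measurable (`]a, a + dl[%classic : set (measurableTypeR R)) by exact: measurable_itv.
  have sub : (`]a, a + dl[%classic : set (measurableTypeR R)) `<=` Iv (a + dl).
    by move=> x; rewrite /= !in_itv /= => /andP[q1 q2]; apply/IvP; rewrite (lt_trans a0 q1).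
  have i5 : itg (leb1 R) (`]a, a + dl[%classic : set (measurableTypeR R)) (fun s => K s - K a) by apply: integrableS i3 => //; exact: mIv.
  have lb : leb1 R (`]a, a + dl[%classic : set (measurableTypeR R)) = dl%:E.
    by rewrite leb1_itv /= lte_fin ltrDl dl0 -EFinD; congr (_%:E); ring.
  have i6 : itg (leb1 R) (`]a, a + dl[%classic : set (measurableTypeR R)) (fun=> e).
    by apply: (itg_cst me); rewrite lb ltry.
  apply: le_trans (Int_abs_le me i5 i6 _) _; last first.
    by have -> := @Int_cst _ _ _ (leb1 R) (`]a, a + dl[%classic : set (measurableTypeR R)) me; rewrite lb.
  move=> s; rewrite /= in_itv /= => /andP[q1 q2]; apply/ltW/h.
    by rewrite (ltW (lt_trans a0 q1)) (ltW (lt_trans q2 adT)).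
  by rewrite ger0_norm ?subr_ge0 ?(ltW q1) // lerBlDl ltW.
have inner a c : 0 < a < T -> 0 < c < T -> K a = K c.
  move=> /andP[a0 aT] /andP[c0 cT]; apply/eqP; rewrite -subr_eq0 -normr_le0; apply/ler_addgt0Pl => e e0; rewrite addr0.
  have e3 : 0 < e / 2 by rewrite divr_gt0.
  have aTT : 0 <= a <= T by rewrite !ltW.
  have cTT : 0 <= c <= T by rewrite !ltW.
  have [d1 d10 h1] := cK a aTT _ e3; have [d2 d20 h2] := cK c cTT _ e3.
  (* Halves of the moduli turn strict bounds into large ones, and halves of [T - a], [T - c] keep
     both intervals inside [(0, T)]. *)
  pose dl := Num.min (Num.min (d1 / 2) (d2 / 2)) (Num.min ((T - a) / 2) ((T - c) / 2)).
  have dl0 : 0 < dl by rewrite !lt_min !divr_gt0 ?subr_gt0.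
  have [l1 l2 l3 l4] : [/\ dl <= d1 / 2, dl <= d2 / 2, dl <= (T - a) / 2 & dl <= (T - c) / 2].
    by split; rewrite !ge_min lexx ?orbT.
  have aT' : a + dl < T by move: l3 aT; lra.
  have cT' : c + dl < T by move: l4 cT; lra.
  have ad : a < a + dl by rewrite ltrDl.
  have cd : c < c + dl by rewrite ltrDl.
  have q1 : `|IntT (a + dl) K - IntT a K - dl * K a| <= e / 2 * dl.
    by apply: near_K => // s hs hd; apply: h1 => //; apply: le_lt_trans hd _; move: l1 d10; lra.
  have q2 : `|IntT (c + dl) K - IntT c K - dl * K c| <= e / 2 * dl.
    by apply: near_K => // s hs hd; apply: h2 => //; apply: le_lt_trans hd _; move: l2 d20; lra.
  have := key a (a + dl) c (c + dl) a0 ad aT' c0 cd cT'.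
  have -> : c + dl - c = dl by ring.
  have -> : a + dl - a = dl by ring.
  move=> /(mulfI (lt0r_neq0 dl0)) E; rewrite E in q1.
  rewrite -(ler_pM2r dl0) -[X in _ * X](ger0_norm (ltW dl0)) -normrM.
  have -> : (K a - K c) * dl = (IntT (c + dl) K - IntT c K - dl * K c) - (IntT (c + dl) K - IntT c K - dl * K a) by ring.
  apply: le_trans (ler_normB _ _) _; apply: le_trans (lerD q2 q1) _.
  by rewrite le_eqVlt; apply/orP; left; apply/eqP; field.
have h2 : 0 < T / 2 < T by rewrite divr_gt0 //=; have := T0; lra.
have bd t : 0 <= t <= T -> K t = K (T / 2).
  move=> tT; apply/eqP; rewrite -subr_eq0 -normr_le0; apply/ler_addgt0Pl => e e0; rewrite addr0.
  have [dl dl0 h] := cK t tT e e0.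
  have [s [s1 s2]] : exists s, 0 < s < T /\ `|s - t| < dl.
    have /andP[t0 tT'] := tT; have T0' := T0.
    have [ht|ht] := leP t (T / 2).
      exists (t + Num.min (dl / 2) (T / 4)); have m0 : 0 < Num.min (dl / 2) (T / 4) by rewrite lt_min !divr_gt0.
      have m1 : Num.min (dl / 2) (T / 4) <= dl / 2 by rewrite ge_min lexx.
      have m2 : Num.min (dl / 2) (T / 4) <= T / 4 by rewrite ge_min lexx orbT.
      split; last by rewrite addrAC subrr add0r ger0_norm ?ltW //; move: m1 dl0; lra.
      by apply/andP; split; move: m0 m2 t0 ht T0'; lra.
    exists (t - Num.min (dl / 2) (T / 4)); have m0 : 0 < Num.min (dl / 2) (T / 4) by rewrite lt_min !divr_gt0.
    have m1 : Num.min (dl / 2) (T / 4) <= dl / 2 by rewrite ge_min lexx.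
    have m2 : Num.min (dl / 2) (T / 4) <= T / 4 by rewrite ge_min lexx orbT.
    split; last by rewrite addrAC subrr add0r normrN ger0_norm ?ltW //; move: m1 dl0; lra.
    by apply/andP; split; move: m0 m2 tT' ht T0'; lra.
  have sT : 0 <= s <= T by have /andP[u1 u2] := s1; rewrite !ltW.
  by rewrite -(inner s (T / 2) s1 h2) distrC; apply/ltW; exact: h.
by move=> t tT; rewrite bd // bd ?lexx ?ltW.
Qed.

End OneDimension.

(** * Almost everywhere statements on the time interval *)

Section AlmostEverywhere.
Variables (R : realType) (T : R).
Local Notation D := (Iv T).
Let mD : measurable D := mIv T.
Local Notation leb := (leb1 R).

(* The two forms of the bound on [t] live at convertible types that [filterS] does not
   identify. *)
Lemma ae_Iv (Q : measurableTypeR R -> Prop) : (\forall t \ae leb, 0 < t < T -> Q t) ->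
  \forall t \ae leb, D t -> Q t.
Proof.
move=> [N [mN N0 h]]; exists N; split=> // t /= nq; apply: h => /= hq.
Qed.

Lemma Iv_ae (Q : measurableTypeR R -> Prop) : (\forall t \ae leb, D t -> Q t) ->
  \forall t \ae leb, 0 < t < T -> Q t.
Proof.
move=> [N [mN N0 h]]; exists N; split=> // t /= nq; apply: h => /= hq.
Qed.

Lemma ae_cover (Q : measurableTypeR R -> Prop) : (\forall t \ae leb, D t -> Q t) ->
  exists N, [/\ measurable N, leb N = 0%E & forall t, D t -> ~ N t -> Q t].
Proof.
move=> [N [mN N0 h]]; exists N; split=> // t Dt nN; apply: contrapT => nQ.
by apply: nN; apply: h => /(_ Dt).
Qed.

Lemma null_ae (N : set (measurableTypeR R)) (Q : measurableTypeR R -> Prop) : measurable N -> leb N = 0%E ->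
  (forall t, D t -> ~ N t -> Q t) -> \forall t \ae leb, D t -> Q t.
Proof.
move=> mN N0 h; exists N; split=> // t /= nq; apply: contrapT => nN; apply: nq => Dt; exact: h.
Qed.

(* No measurability of [f] is available: its values on the null set are absorbed by [+oo]. *)
Lemma ae_le_integral (f : measurableTypeR R -> \bar R) (g : R -> R) : itgT T g ->
  (forall t, D t -> 0 <= f t)%E -> (\forall t \ae leb, D t -> (f t <= (g t)%:E)%E) ->
  (\int[leb]_(t in D) f t <= (IntT T g)%:E)%E.
Proof.
move=> ig f0 [N [mN N0 hN]].
have h t : D t -> ~ N t -> (f t <= (g t)%:E)%E.
  by move=> Dt nN; apply: contrapT => nf; apply: nN; apply: hN => /(_ Dt).
pose psi t := ((g t)%:E + +oo * (\1_N t)%:E)%E.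
have psi_le t : D t -> (f t <= psi t)%E.
  move=> Dt; rewrite /psi indicE; have [/set_mem Nt|/negP nN] := boolP (t \in N).
    by rewrite mule1 addey ?leey.
  by rewrite mule0 adde0; apply: h => // Nt; apply: nN; rewrite inE.
have psi0 t : D t -> (0 <= psi t)%E by move=> Dt; exact: le_trans (f0 t Dt) (psi_le t Dt).
apply: le_trans (@ge0_le_integralW _ _ R leb D D f psi (fun _ h => h) psi0 f0 psi_le) _.
rewrite -(itg_EFin mD ig) le_eqVlt; apply/orP; left; apply/eqP.
have mg : measurable_fun D (EFin \o g) by apply/measurable_EFinP; exact: itg_meas ig.
apply: ae_eq_integral => //.
  apply: emeasurable_funD => //; apply: measurable_funeM; apply/measurable_EFinP.
  exact: measurable_indic.
exists N; split=> // t /= nq; apply: contrapT => nN; apply: nq => Dt.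
by rewrite /psi indicE memNset // mule0 adde0.
Qed.

Lemma ae_ge_integral (f : measurableTypeR R -> \bar R) (g : R -> R) : itgT T g ->
  (forall t, D t -> 0 <= f t)%E -> (forall t, D t -> 0 <= g t) ->
  (\forall t \ae leb, D t -> ((g t)%:E <= f t)%E) ->
  ((IntT T g)%:E <= \int[leb]_(t in D) f t)%E.
Proof.
move=> ig f0 g0 [N [mN N0 hN]].
have h t : D t -> ~ N t -> ((g t)%:E <= f t)%E.
  by move=> Dt nN; apply: contrapT => nf; apply: nN; apply: hN => /(_ Dt).
pose g' t := (1 - \1_N t) * g t.
have ig' : itgT T g'.
  apply: (itg_le mD _ (itg_abs ig)).
    by apply: measurable_funM; [apply: measurable_funB => //; exact: measurable_indic|exact: itg_meas ig].
  move=> t _; rewrite normrM indicE; case: (_ \in _); rewrite ?subrr ?subr0 ?normr0 ?normr1 ?mul0r ?mul1r //.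
have -> : IntT T g = IntT T g'.
  apply: (Int_ae mD ig ig'); exists N; split=> // t /= nq; apply: contrapT => nN; apply: nq => Dt.
  by rewrite /g' indicE memNset // subr0 mul1r.
rewrite -(itg_EFin mD ig'); apply: ge0_le_integralW => // t Dt.
  rewrite lee_fin mulr_ge0 ?g0 // indicE; case: (_ \in _); rewrite ?subrr ?subr0 //.
rewrite /g' indicE; have [/set_mem Nt|/negP nN] := boolP (t \in N).
  by rewrite subrr mul0r f0.
by rewrite subr0 mul1r; apply: h => // Nt; apply: nN; rewrite inE.
Qed.

Lemma Lnorm2_ae (f : measurableTypeR R -> \bar R) (g : R -> R) : itgT T (fun t => g t ^+ 2) ->
  (\forall t \ae leb, D t -> (`|f t| <= (g t)%:E)%E) -> ('N[leb]_2%:E[f \_ `]0%R, T[] < +oo)%E.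
Proof.
move=> ig h; apply/(@Lnorm_lty _ _ _ leb D 2 f) => //.
apply: le_lt_trans (ae_le_integral ig _ _) (ltry _); first by move=> t _; exact: poweR_ge0.
apply: filterS h => t h Dt; have {}h := h Dt.
have -> : (g t ^+ 2)%:E = ((g t)%:E `^ 2%:R)%E.
  rewrite poweR_EFin powR_mulrn // -lee_fin; exact: le_trans (abse_ge0 _) h.
by apply: gt0_ler_poweR => //; rewrite in_itv /= ?andbT ?leey ?abse_ge0 // (le_trans (abse_ge0 _) h).
Qed.

Lemma Lnorm_oo_ae d (S : measurableType d) (nu : {measure set S -> \bar R}) (f : S -> \bar R) :
  \forall t \ae nu, (`|f t| <= 'N[nu]_+oo[f])%E.
Proof.
rewrite unlock /Lnorm; case: ifP => [_|h]; first exact: ess_sup_inf.ess_sup_ge.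
exists setT; split=> //; apply/eqP; rewrite eq_le measure_ge0 andbT leNgt.
by rewrite h.
Qed.

End AlmostEverywhere.

(** * Bochner spaces and Bochner integrals *)

Section Bochner.
Variables (R : realType) (T : R) (T0 : 0 < T) (X : nspace R).
Local Notation D := (Iv T).
Let mD : measurable D := mIv T.
Local Notation leb := (leb1 R).
Hypothesis nm0 : nmem X 0.
Hypothesis nmL : forall (a : R) x y, nmem X x -> nmem X y -> nmem X (a *: x + y).

Lemma nm_sum (I : Type) (s : seq I) (a : I -> R) (F : I -> nsort X) : (forall i, nmem X (F i)) ->
  nmem X (\sum_(i <- s) a i *: F i).
Proof.
by move=> h; elim: s => [|i s IH]; [rewrite big_nil|rewrite big_cons; exact: nmL].
Qed.

Lemma nmB x y : nmem X x -> nmem X y -> nmem X (x - y).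
Proof. by move=> hx hy; rewrite addrC -scaleN1r; exact: nmL. Qed.

Lemma step_eval_mem (s : step_fun X) t : nmem X (step_eval s t).
Proof. by apply: nm_sum => i; exact: step_valP. Qed.

Lemma step_eval_step (s : step_fun X) : is_step (step_eval s : measurableTypeR R -> nsort X).
Proof.
pose I := {ffun 'I_(step_size s) -> bool}.
exists I, (fun t => [ffun i => `[< step_set s i t >] : bool]), (fun k : I => \sum_i (k i)%:R *: step_val s i); split.
  move=> k; rewrite (_ : _ @^-1` _ = \bigcap_(i in setT) (if k i then step_set s i else ~` step_set s i)).
    apply: fin_bigcap_measurable => [|i _]; [exact: finite_finset|]; case: (k i); [exact: step_setP|apply: measurableC; exact: step_setP].
  apply/seteqP; split=> t /=.
    by move=> <- i _; rewrite ffunE; case: asboolP.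
  move=> h; apply/ffunP => i; rewrite ffunE; have := h i Logic.I.
  by case: (k i) => /= hi; apply/asboolP.
by move=> t; apply: eq_bigr => i _; rewrite ffunE indicE; congr ((nat_of_bool _)%:R *: _); apply/idP/asboolP; rewrite inE.
Qed.

(** The null sets of membership, of approximation and of [Q] are merged into one measurable [N], on
    which the default [z] replaces the function, so that convergence holds everywhere on [D]. Target
    and convergence are left arbitrary because pressures have no Hilbert model. *)
Lemma strong_clean (E : Type) (conv : (nat -> E) -> E -> Prop) (rho : nsort X -> E) (z : E)
    (f : R -> nsort X) (Q : measurableTypeR R -> Prop) :
  (forall a x, (forall n, nmem X (a n)) -> nmem X x -> nnorm X (x - a n) @[n --> \oo] --> 0%E ->
     conv (fun n => rho (a n)) (rho x)) ->
  conv (fun=> z) z -> strongly_measurable T f -> (\forall t \ae leb, D t -> Q t) ->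
  exists N, [/\ measurable N, leb N = 0%E,
    forall t, D t -> ~ N t -> nmem X (f t) /\ Q t &
    clean_for D conv (fun t => if `[< N t >] then z else rho (f t))].
Proof.
move=> hc hz [hm [s hs]] hQ.
have [N [mN N0 hN]] : exists N, [/\ measurable N, leb N = 0%E & forall t, D t -> ~ N t ->
    (nmem X (f t) /\ Q t) /\ nnorm X (f t - step_eval (s n) t) @[n --> \oo] --> 0%E].
  apply: ae_cover; apply: filterS3 (ae_Iv hm) (ae_Iv hs) hQ => t h1 h2 h3 Dt.
  by split; [split; [exact: h1|exact: h3]|exact: h2].
exists N; split=> //; first by move=> t Dt nN; have [] := hN t Dt nN.
exists (fun n t => if `[< N t >] then z else rho (step_eval (s n) t)); split.
  move=> n; apply: step_if => //; first exact: step_cst.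
  by apply: step_comp; exact: step_eval_step.
move=> t Dt; case: asboolP => Nt //.
have [[h1 _] h2] := hN t Dt Nt; apply: hc => // n; exact: step_eval_mem.
Qed.

Section Embedding.
Variables (E : phs R) (em : E -> nsort X).
Hypothesis emL : forall (a : R) x y, em (a *: x + y) = a *: em x + em y.
Hypothesis emM : forall x, nmem X (em x).
Hypothesis emN : forall x, nnorm X (em x) = (hn x)%:E.

Lemma em0 : em 0 = 0.
Proof. by have := emL (-1) 0 0; rewrite !scaleN1r !addNr. Qed.

Lemma emB x y : em (x - y) = em x - em y.
Proof. by rewrite addrC -scaleN1r emL scaleN1r addrC. Qed.

Lemma em_sum (I : Type) (s : seq I) (a : I -> R) (F : I -> E) :
  em (\sum_(i <- s) a i *: F i) = \sum_(i <- s) a i *: em (F i).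
Proof. by elim: s => [|i s IH]; [rewrite !big_nil em0|rewrite !big_cons emL IH]. Qed.

Lemma step_to_fun (s : measurableTypeR R -> E) : is_step s -> exists sf : step_fun X,
  (forall t, step_eval sf t = em (s t)) /\
  exists J : E, step_int T sf = em J /\ forall v, ip J v = IntT T (fun t => ip (s t) v).
Proof.
move=> [I [k [v [mk hs]]]].
pose A (i : 'I_#|I|) : set (measurableTypeR R) := k @^-1` [set enum_val i].
pose sf := @StepFun R X #|I| A (fun i => em (v (enum_val i))) (fun i => mk _) (fun i => emM _).
have key (V : lmodType R) (F : I -> V) t : \sum_(i < #|I|) \1_(A i) t *: F (enum_val i) = F (k t).
  rewrite -(big_enum_val (A := I) (fun j => \1_(k @^-1` [set j]) t *: F j)) /= (bigD1 (k t)) //= big1 ?addr0.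
    by rewrite indicE mem_set // scale1r.
  by move=> j jk; rewrite indicE memNset ?scale0r // => /= e; rewrite e eqxx in jk.
exists sf; split; first by move=> t; rewrite hs -(key _ (fun j => em (v j)) t).
exists (\sum_i fine (leb (A i `&` `]0, T[)) *: v (enum_val i)); split; first by rewrite em_sum.
have iA (i : 'I_#|I|) : itgT T (\1_(A i)).
  apply: (itg_le mD _ (itg_cst mD 1 (Iv_fin T))); first by apply: measurable_indic; exact: mk.
  by move=> t _; rewrite indicE; case: (_ \in _); rewrite ?normr1 ?normr0.
move=> w; rewrite ip_suml.
transitivity (IntT T (fun t => \sum_(i < #|I|) ip (v (enum_val i)) w * \1_(A i) t)).
  rewrite (Int_sum mD) => [|i]; last exact: (itgZ mD).
  apply: eq_bigr => i _; rewrite ipZl (IntZ mD _ (iA i)) mulrC; congr (_ * _).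
  by rewrite /Rintegral integral_indic //; exact: mk.
apply: Int_eq => t _; rewrite hs.
have := key R^o (fun j => ip (v j) w) t => <-.
by apply: eq_bigr => i _; rewrite [LHS]mulrC.
Qed.

Lemma hn_cvg0 (a : nat -> E) x : hcvg a x -> (nnorm X (em x - em (a n)) @[n --> \oo] --> 0%E).
Proof.
move=> [ax]; under eq_fun do rewrite -emB emN hnBC.
by apply: cvg_EFin; [exact: nearW|exact: ax].
Qed.

(** [f t] is only required to be indistinguishable from [em (val x t)] for the norm: functionals are
    functions on a whole carrier, of which only the values on [H^1_0] are prescribed. *)
Lemma bochner_of_L2 (x : L2 leb mD E) (f : R -> nsort X) :
  (\forall t \ae leb, D t -> nmem X (f t) /\ forall y, nnorm X (f t - y) = nnorm X (em (val x t) - y)) ->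
  in_bochner T 2%:E X f.
Proof.
move=> h; split; last first.
  apply: (@Lnorm2_ae R T _ (fun t => hn (val x t))).
    by apply: (itg_eq mD _ (L2_itg x x)) => t _; rewrite hn_sq.
  apply: filterS h => t ht Dt; have [_ e] := ht Dt.
  by rewrite -[f t]subr0 e subr0 emN abse_EFin ger0_norm ?hn_ge0.
split; first by apply: Iv_ae; apply: filterS h => t ht Dt; exact: (ht Dt).1.
have [s [ss cs]] := L2_clean x.
have [sf hsf] := choice (fun n => step_to_fun (ss n)).
exists sf; apply: Iv_ae; apply: filterS h => t ht Dt.
under eq_fun => n do rewrite ((hsf n).1 t) (ht Dt).2.
by apply: hn_cvg0; exact: cs.
Qed.

Lemma bochner_int_of (x : L2 leb mD E) (f : R -> nsort X) (J : E) :
  (\forall t \ae leb, D t -> nmem X (f t) /\ forall y, nnorm X (f t - y) = nnorm X (em (val x t) - y)) ->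
  (forall y, 0 <= nnorm X y)%E ->
  (forall v, ip J v = IntT T (fun t => ip (val x t) v)) -> is_bochner_int T f (em J).
Proof.
move=> h n0 hJ; split; [by have [] := bochner_of_L2 h|exact: emM|].
have [s [ss cs _]] := step_dense (Iv_fin T) x.
have [sf hsf] := choice (fun n => step_to_fun (ss n)).
have ih n : itgT T (fun t => hn (val (x - s n) t)) by exact: (L2_hn_itg (Iv_fin T)).
(* The weight of [Int_hn_le] is the norm of the error plus [n.+1%:R^-1], hence positive even when
   that norm vanishes. *)
pose L := fine (leb D); pose b n := hn (x - s n) + (hn (x - s n) + n.+1%:R^-1) * L.
have hle n : IntT T (fun t => hn (val (x - s n) t)) <= b n.
  have n1 : 0 < n.+1%:R^-1 :> R by rewrite invr_gt0.
  have h0 := hn_ge0 (x - s n); have k0 : 0 < hn (x - s n) + n.+1%:R^-1 by exact: ltr_wpDl.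
  apply: le_trans (Int_hn_le (Iv_fin T) (x - s n) k0) _; rewrite lerD2r mulrC ler_pdivrMr // -hn_sq.
  by rewrite expr2 mulrDr lerDl mulr_ge0 // ltW.
have cb : cv b 0.
  have cs' : cv (fun n => hn (x - s n)) 0 by case: cs => cs; constructor; under eq_fun do rewrite hnBC.
  by have := cvD cs' (cvM (cvD cs' (@cv_harmonic R)) (cvC L)); rewrite !addr0 mul0r addr0.
exists sf; split.
  apply: (@squeeze_cvge _ _ _ _ (fun=> 0%E) _ (EFin \o b)).
  - apply: nearW => n; apply/andP; split; first by apply: integral_ge0 => t _.
    apply: le_trans (ae_le_integral (ih n) _ _) _; [by move=> t _|  |by rewrite lee_fin].
    by apply: filterS h => t ht Dt; rewrite ((hsf n).1 t) (ht Dt).2 -emB emN.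
  - exact: cvg_cst.
  - by apply: cvg_EFin; [exact: nearW|exact: (cv_cvg cb)].
have [Jn hJn] := choice (fun n => (hsf n).2).
under eq_fun => n do rewrite ((hJn n).1) -emB emN.
apply: cvg_EFin; [exact: nearW|].
apply: (cv_cvg (l := 0)); apply: cv_squeeze0 cb => n; rewrite hn_ge0 /=.
have h2 (y : L2 leb mD E) v : itgT T (fun t => ip (val y t) v).
  have hv : L2mem leb D (fun=> v) by apply: (L2mem_step mD (Iv_fin T)); exact: step_cst.
  exact: L2_itg y (mkL2 mD hv).
have := hn_ge0 (Jn n - J); rewrite le_eqVlt => /orP[/eqP <-|Jp].
  by apply: le_trans _ (hle n); apply: Int_ge0 => t _; exact: hn_ge0.
rewrite -(ler_pM2r Jp) -expr2 hn_sq ipBl (hJn n).2 hJ -(IntB mD (h2 _ _) (h2 _ _)).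
set v := Jn n - J.
apply: le_trans (_ : IntT T (fun t => hn (val (x - s n) t) * hn v) <= _); last first.
  rewrite (_ : IntT T (fun t => _) = hn v * IntT T (fun t => hn (val (x - s n) t))).
    by rewrite mulrC; apply: ler_wpM2r; [exact: hn_ge0|exact: hle].
  by rewrite -(IntZ mD _ (ih n)); apply: Int_eq => t _; rewrite mulrC.
apply: (Int_le mD) => [||t _].
- by apply: (itgB mD).
- by apply: (itg_eq mD _ (itgZ mD (hn v) (ih n))) => t _; rewrite mulrC.
rewrite -ipBl; apply: le_trans (ip_le _ _) _; rewrite ler_wpM2r ?hn_ge0 //.
by rewrite hnBC.
Qed.

End Embedding.

(** A bounded functional commutes with the integral: its values at [I] and at the integral of [g]
    both lie within [C] times the error of the approximating steps. *)
Lemma bochner_int_scalar (f : R -> nsort X) (I : nsort X) (ev : nsort X -> R) (C : R)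
    (g : measurableTypeR R -> R) :
  (forall y, 0 <= nnorm X y)%E -> 0 < C ->
  (forall a x y, nmem X x -> nmem X y -> ev (a *: x + y) = a * ev x + ev y) ->
  (forall y, nmem X y -> ((`|ev y|)%:E <= C%:E * nnorm X y)%E) ->
  itgT T g -> (\forall t \ae leb, D t -> ev (f t) = g t) -> is_bochner_int T f I -> ev I = IntT T g.
Proof.
move=> n0 C0 evL evC iev hg [[hm _] hI [s [c1 c2]]].
have evB x y : nmem X x -> nmem X y -> ev (x - y) = ev x - ev y.
  by move=> hx hy; rewrite addrC -scaleN1r evL // mulN1r addrC.
have ev0 : ev 0 = 0 by have := evB 0 0 nm0 nm0; rewrite !subrr.
have evS (J : Type) (r : seq J) (a : J -> R) (F : J -> nsort X) : (forall i, nmem X (F i)) ->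
    ev (\sum_(i <- r) a i *: F i) = \sum_(i <- r) a i * ev (F i).
  move=> h; elim: r => [|i r IH]; first by rewrite !big_nil.
  by rewrite !big_cons evL ?IH //; exact: nm_sum.
have iA n (i : 'I_(step_size (s n))) : itgT T (\1_(step_set (s n) i)).
  apply: (itg_le mD _ (itg_cst mD 1 (Iv_fin T))); first by apply: measurable_indic; exact: step_setP.
  by move=> t _; rewrite indicE; case: (_ \in _); rewrite ?normr1 ?normr0.
have sE n : (fun t => ev (step_eval (s n) t)) = (fun t => \sum_i ev (step_val (s n) i) * \1_(step_set (s n) i) t).
  apply/funext => t; rewrite evS; last by move=> i; exact: step_valP.
  by apply: eq_bigr => i _; rewrite mulrC.
have is_ n : itgT T (fun t => ev (step_eval (s n) t)).
  by rewrite sE; apply: (itg_sum mD) => i; exact: (itgZ mD).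
have intE n : ev (step_int T (s n)) = IntT T (fun t => ev (step_eval (s n) t)).
  rewrite sE (Int_sum mD) => [|i]; last exact: (itgZ mD).
  rewrite evS; last by move=> i; exact: step_valP.
  apply: eq_bigr => i _; rewrite (IntZ mD _ (iA n i)) mulrC; congr (_ * _).
  by rewrite /Rintegral integral_indic //; exact: step_setP.
have sIm n : nmem X (step_int T (s n)) by apply: nm_sum => i; exact: step_valP.
pose A n := (\int[leb]_(t in `]0%R, T[) nnorm X (f t - step_eval (s n) t))%E.
pose B n := nnorm X (step_int T (s n) - I).
have key n : ((`|ev I - IntT T g|)%:E <= C%:E * (B n + A n))%E.
  have b1 : ((`|ev (step_int T (s n)) - ev I|)%:E <= C%:E * B n)%E.
    by rewrite -evB //; apply: evC; exact: nmB.
  have b2 : ((`|ev (step_int T (s n)) - IntT T g|)%:E <= C%:E * A n)%E.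
    rewrite intE -(IntB mD (is_ n) iev).
    have i2 := itgB mD (is_ n) iev.
    have i3 := itgZ mD C^-1 (itg_abs i2).
    have h3 : ((IntT T (fun t => C^-1 * `|ev (step_eval (s n) t) - g t|))%:E <= A n)%E.
      apply: (ae_ge_integral i3) => //; first by move=> t _; rewrite mulr_ge0 // invr_ge0 ltW.
      apply: filterS2 (ae_Iv hm) hg => t + + Dt => /(_ Dt) hmt /(_ Dt) <-; have sm := step_eval_mem (s n) t.
      have := evC _ (nmB hmt sm); rewrite evB // distrC.
      case: (nnorm X _) (n0 (f t - step_eval (s n) t)) => [y _|_|] //; last by rewrite leey.
      by rewrite -EFinM !lee_fin ler_pdivrMl.
    apply: le_trans (lee_wpmul2l (ltW C0 : (0 <= C%:E)%E) h3).
    rewrite -EFinM lee_fin (IntZ mD _ (itg_abs i2)) mulrA mulfV ?gt_eqF // mul1r.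
    exact: (Int_abs mD).
  rewrite ge0_muleDr; [|exact: n0|by apply: integral_ge0].
  apply: le_trans (leeD b1 b2); rewrite -EFinD lee_fin.
  by rewrite (distrC (ev (step_int T (s n))) (ev I)); exact: ler_distD.
apply/eqP; rewrite -subr_eq0 -normr_le0 -lee_fin.
have lim0 : (C%:E * (B n + A n))%E @[n --> \oo] --> 0%E.
  rewrite -(mule0 C%:E); apply: cvgeZl => //.
  by rewrite -(adde0 0%E); apply: cvgeD.
by rewrite -[leRHS](cvg_lim _ lim0) //; apply: lime_ge; [apply/cvg_ex; exists 0%E|exact: nearW].
Qed.

End Bochner.

(** * Hilbert models of spaces given by representatives *)

Section Model.
Variables (R : realType) (T : R) (X : nspace R) (E : phs R) (rho : nsort X -> E).
Local Notation D := (Iv T).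
Let mD : measurable D := mIv T.
Local Notation leb := (leb1 R).
Hypothesis nm0 : nmem X 0.
Hypothesis nmL : forall (a : R) x y, nmem X x -> nmem X y -> nmem X (a *: x + y).
Hypothesis rhoN : forall x, nmem X x -> nnorm X x = (hn (rho x))%:E.
Hypothesis rhoB : forall x y, nmem X x -> nmem X y -> hn (rho (x - y) - (rho x - rho y)) = 0.

Lemma rho_cvg (a : nat -> nsort X) x : (forall n, nmem X (a n)) -> nmem X x ->
  nnorm X (x - a n) @[n --> \oo] --> 0%E -> hcvg (fun n => rho (a n)) (rho x).
Proof.
move=> ha hx h; constructor; have e : (fun n => nnorm X (x - a n)) = EFin \o (fun n => hn (rho (a n) - rho x)).
  apply/funext => n /=; rewrite rhoN; last exact: nmB.
  by rewrite (hn_eq0 (rhoB hx (ha n))) hnBC.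
by move: h; rewrite e; move/fine_cvgP => [].
Qed.

Lemma model_clean (f : R -> nsort X) (Q : measurableTypeR R -> Prop) :
  strongly_measurable T f -> (\forall t \ae leb, D t -> Q t) ->
  exists N, [/\ measurable N, leb N = 0%E,
    forall t, D t -> ~ N t -> nmem X (f t) /\ Q t &
    clean D (fun t => if `[< N t >] then 0 else rho (f t))].
Proof.
move=> hf hQ; apply: strong_clean => //; first exact: rho_cvg.
exact: hcvg_const.
Qed.

Lemma model_L2 (f : R -> nsort X) : in_bochner T 2%:E X f ->
  exists x : L2 leb mD E, \forall t \ae leb, D t -> nmem X (f t) /\ val x t = rho (f t).
Proof.
move=> [hf /(@Lnorm_lty _ _ _ leb D 2 (fun t => nnorm X (f t)) isT) hN].
have [|N [mN N0 hm cl]] := model_clean hf (Q := fun=> True); first exact: nearW.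
have hx : L2mem leb D (fun t => if `[< N t >] then 0 else rho (f t)).
  split; [exact: cl|apply: itg_ge0P => //; [exact: meas_ip|by move=> t _; exact: ip_ge0|]].
  apply: le_lt_trans hN; apply: ge0_le_integralW => // t Dt.
  - exact: poweR_ge0.
  - by rewrite lee_fin ip_ge0.
  case: asboolP => nt; first by rewrite ip0l poweR_ge0.
  have e := rhoN (hm t Dt nt).1.
  by rewrite e abse_EFin poweR_EFin ger0_norm ?hn_ge0 // powR_mulrn ?hn_ge0 // hn_sq.
exists (mkL2 mD hx); apply: null_ae mN N0 _ => t Dt nt.
by split; [exact: (hm t Dt nt).1|rewrite /=; case: asboolP].
Qed.

End Model.

(** * The dual of V and Riesz representatives *)

Section Dual.
Variables (R : realType) (Om : set (plane R)) (oO : open Om) (M : R) (M0 : 0 < M).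
Hypothesis OM : forall z, Om z -> `|z.1| < M /\ `|z.2| < M.
Local Notation V := (VV oO M0 OM).
Local Notation X := (H10 Om).

Lemma V_in (x : V) : in_H10 Om (val x). Proof. exact: sub_ofP x. Qed.

Lemma V_norm (x : V) : nnorm X (val x) = (hn x)%:E. Proof. exact: (H1_normE (kk_gr x)). Qed.

Lemma V_ball0 : nmem X (val (0 : V)) /\ (nnorm X (val (0 : V)%R) <= 1)%E.
Proof. by split; [exact: (V_in 0)|rewrite V_norm hn0 lee_fin]. Qed.

Definition toV (v : vfield R) : V :=
  if pselect (in_H10 Om v) is left h then @mkSub R _ (H10sub oO M0 OM) v h else 0.

Lemma toVE v : in_H10 Om v -> val (toV v) = v.
Proof. by rewrite /toV; case: pselect. Qed.

Lemma toVK (x : V) : toV (val x) = x.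
Proof. by apply: val_inj; rewrite toVE //; exact: V_in. Qed.

Lemma toVL (a : R) v w : in_H10 Om v -> in_H10 Om w -> toV (a *: v + w) = a *: toV v + toV w.
Proof.
move=> hv hw; apply: val_inj; rewrite toVE; last exact: (in_H10L oO M0 OM).
by rewrite -{1}(toVE hv) -{1}(toVE hw).
Qed.

Lemma toVN v : in_H10 Om v -> nnorm X v = (hn (toV v))%:E.
Proof. by move=> hv; rewrite -V_norm toVE. Qed.

Lemma H10_0 : in_H10 Om 0. Proof. exact: (V_in 0). Qed.

Lemma toVB v w : in_H10 Om v -> in_H10 Om w -> hn (toV (v - w) - (toV v - toV w)) = 0.
Proof.
move=> hv hw; have -> : v - w = (-1) *: w + v by rewrite scaleN1r addrC.
by rewrite toVL // scaleN1r [- _ + _]addrC subrr hn0.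
Qed.

(** Adding [e] allows vectors of norm zero to be normalised as well. *)
Lemma V_small (x : V) (e : R) : 0 < e -> nmem X (val ((hn x + e)^-1 *: x)) /\
  (nnorm X (val ((hn x + e)^-1 *: x)) <= 1)%E.
Proof.
move=> e0; have h : 0 < hn x + e by rewrite ltr_wpDl ?hn_ge0.
split; first exact: V_in.
rewrite V_norm hnZ lee_fin ger0_norm ?invr_ge0 ?(ltW h) // mulrC ler_pdivrMr // mul1r.
by rewrite lerDl ltW.
Qed.

Lemma dual_norm_ub (F : nsort X -> R) (v : V) (K : R) : (forall a (v w : V), F (val (a *: v + w)) = a * F (val v) + F (val w)) ->
  (dual_norm F <= K%:E)%E -> `|F (val v)| <= K * hn v.
Proof.
move=> FL FK.
have F0 : F (val (0 : V)) = 0 by have := FL (-1) 0 0; rewrite scaleN1r addNr mulN1r addNr.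
have K0 : 0 <= K.
  rewrite -lee_fin; apply: le_trans FK; apply: ereal_sup_ubound; exists (val (0 : V)); first exact: V_ball0.
  by rewrite F0 normr0.
apply/ler_addgt0Pr => e e0; have k1 : 0 < K + 1 by rewrite ltr_wpDl.
pose e' := e / (K + 1); have e'0 : 0 < e' by rewrite divr_gt0.
have h : 0 < hn v + e' by rewrite ltr_wpDl ?hn_ge0.
have := V_small v e'0 => vs.
have /le_trans/(_ FK) : (`|F (val ((hn v + e')^-1 *: v))|%:E <= dual_norm F)%E.
  by apply: ereal_sup_ubound; exists (val ((hn v + e')^-1 *: v)).
rewrite -[_ *: v]addr0 FL F0 addr0 lee_fin normrM ger0_norm ?invr_ge0 ?(ltW h) // mulrC ler_pdivrMr //.
move=> /le_trans; apply; rewrite mulrDr lerD2l /e' mulrCA ger_pMr // ler_pdivrMr // mul1r.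
by rewrite lerDl.
Qed.

(** Outside [H^1_0] the value is [0], because [toV] is [0] there; this makes the functional a
    function on the whole carrier. *)
Definition ipd (p : V) : nsort (dual X) := fun v => ip p (toV v).

Lemma rep_lin (F : vfield R -> R) (p : V) : (forall v : V, F (val v) = ip p v) ->
  forall a (v w : V), F (val (a *: v + w)) = a * F (val v) + F (val w).
Proof. by move=> hF a v w; rewrite !hF ipDr ipZr. Qed.

Lemma dual_normE (F : nsort X -> R) (p : V) : (forall v : V, F (val v) = ip p v) ->
  dual_norm F = (hn p)%:E.
Proof.
move=> hF; have FL := rep_lin hF.
apply/eqP; rewrite eq_le; apply/andP; split.
  apply: ge_ereal_sup => _ [v [hv v1] <-]; rewrite lee_fin.
  rewrite -(toVE hv) hF; apply: le_trans (ip_CS _ _) _; rewrite ler_piMr ?hn_ge0 //.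
  by rewrite -lee_fin -toVN.
have : (exists K : R, dual_norm F = K%:E) \/ dual_norm F = +oo%E.
- have : (0 <= dual_norm F)%E.
    apply: ereal_sup_ubound; exists (val (0 : V)); last by rewrite hF ip0r normr0.
    exact: V_ball0.
  by case: (dual_norm F) => [K _||] //; [left; exists K|right].
- move=> [[K hK]|->]; last by rewrite leey.
  have := @dual_norm_ub F p K FL; rewrite hK lexx => /(_ isT).
  rewrite hF ger0_norm ?ip_ge0 // -hn_sq expr2 lee_fin => h.
  have := hn_ge0 p; rewrite le_eqVlt => /orP[/eqP e|p0]; last by rewrite -(ler_pM2r p0).
  rewrite -e -lee_fin -hK; apply: ereal_sup_ubound; exists (val (0 : V)); last by rewrite hF ip0r normr0.
  exact: V_ball0.
Qed.

Lemma dual_of (F : nsort (dual X)) (p : V) : (forall v : V, F (val v) = ip p v) -> nmem (dual X) F.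
Proof.
move=> hF; split; last by rewrite (dual_normE hF) ltry.
move=> a v w hv hw; rewrite -(toVE hv) -(toVE hw).
transitivity (F (val (a *: toV v + toV w))); first by [].
exact: (rep_lin hF).
Qed.

Lemma dual_riesz (F : nsort (dual X)) : nmem (dual X) F -> exists p : V, forall v : V, F (val v) = ip p v.
Proof.
move=> [FL Foo]; have FL' a (v w : V) : F (val (a *: v + w)) = a * F (val v) + F (val w).
  by rewrite -FL //; exact: V_in.
have FK (v : V) : `|F (val v)| <= fine (dual_norm F) * hn v.
  apply: dual_norm_ub => //; move: Foo; case: (dual_norm F) => // _; exact: leNye.
by have [p hp] := riesz (@VV_complete R Om oO M M0 OM) FL' FK; exists p.
Qed.

Definition Vrep (F : nsort (dual X)) : V := xget 0 [set p : V | forall v : V, F (val v) = ip p v].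

Lemma VrepE (F : nsort (dual X)) (v : V) : nmem (dual X) F -> F (val v) = ip (Vrep F) v.
Proof.
move=> /dual_riesz[p hp]; rewrite /Vrep; case: xgetP => [q _ //|] h.
by case: (h p); exact: hp.
Qed.

Lemma Vrep_norm (F : nsort (dual X)) : nmem (dual X) F -> nnorm (dual X) F = (hn (Vrep F))%:E.
Proof. by move=> hF; apply: dual_normE => v; exact: VrepE. Qed.

Lemma dual_lin (a : R) (F G : nsort (dual X)) : nmem (dual X) F -> nmem (dual X) G ->
  nmem (dual X) (a *: F + G).
Proof.
move=> hF hG; apply: (@dual_of _ (a *: Vrep F + Vrep G)) => v.
by rewrite ipDl ipZl -!VrepE.
Qed.

Lemma dual_0 : nmem (dual X) 0.
Proof. by apply: (@dual_of _ 0) => v; rewrite ip0l. Qed.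

Lemma VrepB (F G : nsort (dual X)) : nmem (dual X) F -> nmem (dual X) G ->
  hn (Vrep (F - G) - (Vrep F - Vrep G)) = 0.
Proof.
move=> hF hG; have hFG := nmB dual_lin hF hG.
have h v : ip (Vrep (F - G) - (Vrep F - Vrep G)) v = 0.
  by rewrite !ipBl -!VrepE // subrr.
by apply/eqP; rewrite -sqrf_eq0 hn_sq h.
Qed.

Lemma ipdE (p v : V) : ipd p (val v) = ip p v.
Proof. by rewrite /ipd toVK. Qed.

Lemma ipd_mem p : nmem (dual X) (ipd p).
Proof. by apply: (@dual_of _ p) => v; exact: ipdE. Qed.

Lemma ipd_norm p : nnorm (dual X) (ipd p) = (hn p)%:E.
Proof. by apply: dual_normE => v; exact: ipdE. Qed.

Lemma ipdL (a : R) p q : ipd (a *: p + q) = a *: ipd p + ipd q.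
Proof. by apply/funext => v; rewrite /ipd ipDl ipZl. Qed.

Lemma dual_ge0 (F : nsort (dual X)) : (0 <= nnorm (dual X) F)%E.
Proof.
apply: le_trans (_ : (`|F (val (0 : V))|%:E <= _)%E); first by rewrite lee_fin.
apply: ereal_sup_ubound; exists (val (0 : V)) => //; exact: V_ball0.
Qed.

End Dual.

Lemma Lnorm_oo_le d (S : measurableType d) (R : realType) (nu : {measure set S -> \bar R})
    (f : S -> \bar R) (C : \bar R) : (0 <= C)%E ->
  (\forall t \ae nu, (`|f t| <= C)%E) -> ('N[nu]_+oo[f] <= C)%E.
Proof. by move=> C0 h; rewrite unlock /Lnorm; case: ifP => // _; apply/ess_sup_inf.ess_supP. Qed.

(** * Essential bounds *)

Section EssentialBounds.
Variables (R : realType) (Om : set (plane R)) (oO : open Om).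
Local Notation nu := (leb2 R).

Lemma LinfO_ae (f : plane R -> R) (C : R) : (LpO_norm Om +oo f <= C%:E)%E ->
  \forall x \ae nu, Om x -> `|f x| <= C.
Proof.
move=> h; apply: filterS (Lnorm_oo_ae nu ((EFin \o f) \_ Om)) => x hx Ox.
have := le_trans hx h; rewrite /patch mem_set //.
Qed.

Lemma LinfO_le (f : plane R -> R) (C : R) : 0 <= C -> (\forall x \ae nu, Om x -> `|f x| <= C) ->
  (LpO_norm Om +oo f <= C%:E)%E.
Proof.
move=> C0 h; apply: Lnorm_oo_le => //; apply: filterS h => x hx.
by rewrite /patch; case: ifPn => [/set_mem/hx //|_]; rewrite abse0 lee_fin.
Qed.

Lemma LinfO_fin (f : plane R -> R) : (LpO_norm Om +oo f < +oo)%E ->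
  exists2 C : R, 0 <= C & LpO_norm Om +oo f = C%:E.
Proof.
have : (0 <= LpO_norm Om +oo f)%E by exact: Lnorm_ge0.
by case: (LpO_norm _ _ _) => [C h _|//|//]; exists C.
Qed.

Lemma LinfO_0 : nmem (LinfO Om) 0.
Proof.
split; first exact: measurable_cst.
by apply: le_lt_trans (@LinfO_le 0 0 _ _) (ltry _) => //; apply: nearW => x _; rewrite normr0.
Qed.

Lemma LinfO_L (a : R) (f g : nsort (LinfO Om)) : nmem (LinfO Om) f -> nmem (LinfO Om) g ->
  nmem (LinfO Om) (a *: f + g).
Proof.
move=> [mf /LinfO_fin[C C0 hC]] [mg /LinfO_fin[C' C0' hC']]; split.
  by apply: measurable_funD => //; exact: measurable_funM.
apply: le_lt_trans (@LinfO_le _ (`|a| * C + C') _ _) (ltry _).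
  by rewrite addr_ge0 // mulr_ge0.
have h1 : \forall x \ae nu, Om x -> `|f x| <= C by apply: LinfO_ae; rewrite hC.
have h2 : \forall x \ae nu, Om x -> `|g x| <= C' by apply: LinfO_ae; rewrite hC'.
apply: filterS2 h1 h2 => x h1 h2 Ox; apply: le_trans (ler_normD _ _) _.
by rewrite normrM lerD ?ler_wpM2l ?h1 ?h2.
Qed.

End EssentialBounds.

Lemma bochner_oo_bound (R : realType) (T : R) (X : nspace R) (f : R -> nsort X) :
  in_bochner T +oo X f -> exists2 C : R, 0 <= C &
    \forall t \ae leb1 R, Iv T t -> (`|nnorm X (f t)| <= C%:E)%E.
Proof.
move=> [_]; set g := (_ \_ _); have := Lnorm_oo_ae (leb1 R) g.
have := Lnorm_ge0 (leb1 R) +oo%E g; set N := Lnorm _ _ _; case: N => [C C0 h _|//|//]; exists C => //.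
by apply: filterS h => t; rewrite /g /patch => ht Dt; move: ht; rewrite mem_set.
Qed.

(** * Data redefined so that bounds hold at every time *)

Section OceanData.
Variables (R : realType) (Om : set (plane R)) (oO : open Om) (M : R) (M0 : 0 < M).
Hypothesis OM : forall z, Om z -> `|z.1| < M /\ `|z.2| < M.
Variables (T : R) (T0 : 0 < T).
Local Notation nu := (leb2 R).
Local Notation D := (Iv T).
Let mD : measurable D := mIv T.
Let mO : measurable Om := open_plane_measurable oO.
Let fO : (nu Om < +oo)%E := Om_fin oO OM.
Local Notation H := (LL oO 2 1).
Local Notation V := (VV oO M0 OM).
Local Notation iV := (@iV R Om oO M M0 OM).
Local Notation E1 := (mxphs R 2 1).
Local Notation Int f := (Rintegral nu Om f).
Local Notation "'fr' w" := (fun x => @hn R E1 (val w x)) (at level 10, w at level 9).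
Local Notation X2 := (LpO Om 2%:E).

Definition toH (u : vfield R) : H :=
  if pselect (in_LpO Om 2%:E u) is left h then mkL2 mO ((LpO_mem oO u).1 h) else 0.

Lemma toHE u : in_LpO Om 2%:E u -> val (toH u) = u.
Proof. by rewrite /toH; case: pselect. Qed.

Lemma toHK (w : H) : toH (val w) = w.
Proof. by apply: LL_inj; rewrite toHE //; apply/(LpO_mem oO); exact: L2val. Qed.

Lemma toHN u : in_LpO Om 2%:E u -> nnorm X2 u = (hn (toH u))%:E.
Proof. by move=> hu; rewrite -LpO_normE toHE. Qed.

Lemma LpO_0 : nmem X2 0.
Proof. by apply/(LpO_mem oO); exact: L2mem0. Qed.

Lemma LpO_L (a : R) (u v : nsort X2) : nmem X2 u -> nmem X2 v -> nmem X2 (a *: u + v).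
Proof. by move=> /(LpO_mem oO) hu /(LpO_mem oO) hv; apply/(LpO_mem oO); exact: (L2memL mO). Qed.

Lemma toHB u v : nmem X2 u -> nmem X2 v -> hn (toH (u - v) - (toH u - toH v)) = 0.
Proof.
move=> hu hv; have -> : toH (u - v) = toH u - toH v; last by rewrite subrr hn0.
have e : in_LpO Om 2%:E (u - v) := nmB LpO_L hu hv.
by apply: LL_inj; rewrite (toHE e) -{1}(toHE hu) -{1}(toHE hv).
Qed.

Lemma LpO4_l4 (u : vfield R) (w : H) : nmem (LpO Om 4%:E) u -> val w = u ->
  l4 w /\ ((N4 nu Om (fr w) ^+ 2)%:E <= `|nnorm (LpO Om 4%:E) u| `^ 2%:R)%E.
Proof.
move=> [_ u4] e.
have mf : measurable_fun Om (fun x => frob (u x)) by rewrite -e; exact: fr_meas w.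
have i4 := (Lnorm_pow_lty nu mO (k := 4) isT mf).1 u4.
have iw : l4 w by apply: (itg_eq mO _ i4) => x _; rewrite -e ger0_norm ?sqrtr_ge0.
split=> //.
have e4 : (\int[nu]_(x in Om) (`|(EFin \o (fun x => frob (u x))) x| `^ 4%:R))%E = (Int (fun x => (fr w) x ^+ 4))%:E.
  rewrite -(itg_EFin mO iw); apply: eq_integral => x _.
  by rewrite /= -e ger0_norm ?sqrtr_ge0 // powR_mulrn ?sqrtr_ge0.
have -> : nnorm (LpO Om 4%:E) u = ((Int (fun x => (fr w) x ^+ 4))%:E `^ 4%:R^-1)%E.
  by rewrite -e4; exact: (@Lnorm_int _ _ _ nu Om 4).
set I := Int _; have I0 : 0 <= I by apply: Int_ge0 => x _; rewrite exprn_ge0 ?hn_ge0.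
rewrite (poweR_EFin I) abse_EFin (poweR_EFin `|_|%R) lee_fin ger0_norm ?powR_ge0 // -powRrM.
rewrite N4_sq (_ : 4%:R^-1 * 2%:R = 2^-1 :> R); last by field.
by rewrite powR12_sqrt.
Qed.

(** Both memberships of [U] are read off one null set, on which [Uc] is [0]. Measurability of the
    [L^4] norm in time is [tail_meas] at level [0], where nothing is cut away from a nonnegative
    speed. *)
Lemma data_U (U : R -> vfield R) : in_bochner T +oo X2 U -> in_bochner T 2%:E (LpO Om 4%:E) U ->
  exists (Uc : measurableTypeR R -> H) (CU : R), [/\ clean D Uc,
    0 <= CU /\ (forall t, D t -> hn (Uc t) <= CU), forall t, D t -> l4 (Uc t),
    itgT T (fun t => N4 nu Om (fr (Uc t)) ^+ 2) &
    \forall t \ae leb1 R, D t -> val (Uc t) = U t].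
Proof.
move=> hU [[m4 _] n4]; have [CU CU0 hCU] := bochner_oo_bound hU.
have /(@Lnorm_lty _ _ _ (leb1 R) D 2 (fun t => nnorm (LpO Om 4%:E) (U t)) isT) n4' := n4.
have [|N [mN N0 hm cl]] := model_clean LpO_0 LpO_L toHN toHB hU.1
  (Q := fun t => nmem (LpO Om 4%:E) (U t) /\ (`|nnorm X2 (U t)| <= CU%:E)%E).
  by apply: filterS2 (ae_Iv m4) hCU => t h1 h2 Dt; split; [exact: h1|exact: h2].
pose Uc t : H := if `[< N t >] then 0 else toH (U t).
have l4U t : D t -> l4 (Uc t) /\ ((N4 nu Om (fr (Uc t)) ^+ 2)%:E <= `|nnorm (LpO Om 4%:E) (U t)| `^ 2%:R)%E.
  move=> Dt; rewrite /Uc; case: asboolP => nt.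
    have l0 : l4 (0 : H).
      apply: (itg_eq mO _ (itg0 nu Om)) => x _; rewrite /= (@hn0 R E1) expr0n //.
    split=> //; rewrite (_ : N4 _ _ _ ^+ 2 = 0) ?poweR_ge0 //.
    rewrite N4_sq (_ : Int _ = 0) ?sqrtr0 // -[RHS](@Int0 _ _ _ nu Om); apply: Int_eq => x _.
    by rewrite /= (@hn0 R E1) expr0n.
  by have [h1 [h2 _]] := hm t Dt nt; apply: LpO4_l4 h2 (toHE h1).
exists Uc, CU; split=> //.
- split=> // t Dt; rewrite /Uc; case: asboolP => nt; first by rewrite hn0.
  have [h1 [_ h2]] := hm t Dt nt; move: h2; rewrite toHN // abse_EFin lee_fin ger0_norm ?hn_ge0 //.
- by move=> t /l4U[].
- apply: itg_ge0P => //.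
  + apply: measurable_funX; have := tail_meas fO mD (U := Uc) cl (fun t Dt => (l4U t Dt).1) (lexx 0).
    apply: eq_measurable_fun => t _; congr (Num.sqrt (Num.sqrt _)); apply: Int_eq => x _.
    by rewrite /rho min_r ?subr0 // hn_ge0.
  + by move=> t _; exact: sqr_ge0.
  + apply: le_lt_trans n4'; apply: ge0_le_integralW => // t Dt; first exact: poweR_ge0.
      by rewrite lee_fin sqr_ge0.
    exact: (l4U t Dt).2.
- apply: null_ae mN N0 _ => t Dt nt; rewrite /Uc; case: asboolP => // _.
  by rewrite toHE //; exact: (hm t Dt nt).1.
Qed.

Definition toP (f : plane R -> R) : Pres R Om :=
  if pselect (measurable_fun Om f) is left h then exist _ f h else exist _ (fun=> 0) (measurable_cst (0 : measurableTypeR R)).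

Lemma toPE (f : plane R -> R) : measurable_fun Om f -> sval (toP f) = f.
Proof. by rewrite /toP; case: pselect. Qed.

Lemma data_P (P : R -> plane R -> R) (Pinf : R) : in_bochner T +oo (LinfO Om) P ->
  (\forall t \ae leb1 R, 0 < t < T -> \forall x \ae nu, Om x -> Pinf <= P t x) ->
  exists (Pc : measurableTypeR R -> Pres R Om) (CP : R), [/\ Pinf <= CP,
    clean_for D (@convP _ _ R nu Om) Pc &
    \forall t \ae leb1 R, D t -> sval (Pc t) = P t /\
      \forall x \ae nu, Om x -> Pinf <= P t x <= CP].
Proof.
move=> hP hinf; have [CP CP0 hCP] := bochner_oo_bound hP.
have hQ : \forall t \ae leb1 R, D t -> (\forall x \ae nu, Om x -> Pinf <= P t x) /\
    (`|nnorm (LinfO Om) (P t)| <= CP%:E)%E.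
  by apply: filterS2 (ae_Iv hinf) hCP => t h1 h2 Dt; split; [exact: h1|exact: h2].
have cv0 : convP nu (fun=> toP 0) (toP 0).
  exists (fun=> 0); split=> //; first exact: cvC.
  by move=> n; apply: nearW => x _; rewrite subrr normr0.
have hc (a : nat -> nsort (LinfO Om)) x : (forall n, nmem (LinfO Om) (a n)) -> nmem (LinfO Om) x ->
    nnorm (LinfO Om) (x - a n) @[n --> \oo] --> 0%E -> convP nu (fun n => toP (a n)) (toP x).
  move=> ha hx h; have fin n := LinfO_fin (nmB (@LinfO_L R Om) hx (ha n)).2.
  exists (fun n => fine (nnorm (LinfO Om) (x - a n))); split.
  - by constructor; move/fine_cvgP : h => [].
  - by move=> n; rewrite fine_ge0 //; exact: Lnorm_ge0.
  move=> n; have [C C0 hC] := fin n.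
  have : \forall z \ae nu, Om z -> `|(x - a n) z| <= fine (nnorm (LinfO Om) (x - a n)).
    by apply: LinfO_ae; rewrite /= hC.
  apply: filterS => z hz Oz; by rewrite (toPE hx.1) (toPE (ha n).1) distrC; exact: hz.
have [N [mN N0 hm cl]] := @strong_clean R T (LinfO Om) (@LinfO_0 R Om) (@LinfO_L R Om) _ _ _ _ _ _ hc cv0 hP.1 hQ.
(* The maximum gives [Pinf <= CP] without evaluating the pressure anywhere. *)
eexists; exists (Num.max Pinf CP); split; [by rewrite le_max lexx|exact: cl|].
apply: null_ae mN N0 _ => t Dt nt; have [h1 [h2 h3]] := hm t Dt nt.
case: asboolP => // _; split; first by apply: toPE; exact: h1.1.
have h4 : \forall x \ae nu, Om x -> `|P t x| <= CP.
  by apply: LinfO_ae; apply: le_trans h3; exact: lee_abs.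
apply: filterS2 h2 h4 => x h2 h4 Ox; rewrite h2 //= le_max; apply/orP; right.
exact: le_trans (ler_norm _) (h4 Ox).
Qed.

End OceanData.

(** * The weak formulation in terms of the operator *)

Section OceanOperator.
Variables (R : realType) (Om : set (plane R)) (oO : open Om) (M : R) (M0 : 0 < M).
Hypothesis OM : forall z, Om z -> `|z.1| < M /\ `|z.2| < M.
Local Notation nu := (leb2 R).
Let mO : measurable Om := open_plane_measurable oO.
Let fO : (nu Om < +oo)%E := Om_fin oO OM.
Local Notation H := (LL oO 2 1).
Local Notation V := (VV oO M0 OM).
Local Notation iV := (@iV R Om oO M M0 OM).
Local Notation eV := (@eV R Om oO M M0 OM).
Local Notation E1 := (mxphs R 2 1).
Local Notation Int f := (Rintegral nu Om f).
Local Notation "'fr' w" := (fun x => @hn R E1 (val w x)) (at level 10, w at level 9).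

Lemma iV_val (x : V) : val (iV x) = val x.
Proof. exact: kk_val1. Qed.

Lemma eVL (a : R) (x y : V) : hn (eV (a *: x + y) - (a *: eV x + eV y)) = 0.
Proof.
have sL g h : symY (a *: g + h) = a *: symY g + symY h :> LL oO 2 2.
  rewrite /symY trY_lin scalerA mulrC -scalerA -scalerDr; congr (_ *: _).
  by rewrite scalerDr addrACA.
rewrite /eV -sL -symYB; apply/eqP; rewrite eq_le hn_ge0 andbT; apply: le_trans (symY_le _) _.
by apply: le_trans (prod_hn2 (kk (a *: x + y) - (a *: kk x + kk y))) _; rewrite kkL.
Qed.

Lemma eV_sym (x : V) z : (val (eV x) z : 'M[R]_2)^T = val (eV x) z.
Proof. by rewrite eV_val /sym_grad; apply/matrixP => i j; rewrite !mxE addrC. Qed.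

Lemma iV_l4 (x : V) : l4 (iV x).
Proof. by have [h _] := ladyzhenskaya x; apply: (itg_eq mO _ h) => z _; rewrite iV_val. Qed.

Lemma iV_N4 (x : V) : N4 nu Om (fr (iV x)) ^+ 2 <= 4 * hn (iV x) * hn x.
Proof.
have [_ h] := ladyzhenskaya x; rewrite N4_sq iV_val.
have e : 16 * hn (iV x) ^+ 2 * hn x ^+ 2 = (4 * hn (iV x) * hn x) ^+ 2 by ring.
rewrite -[leRHS]ger0_norm ?mulr_ge0 ?hn_ge0 // -sqrtr_sqr -e; exact: ler_wsqrtr.
Qed.

Variables (lam : R) (dhat : 'M[R]_2 -> R) (LS Pinf CP : R).
Hypotheses (LS0 : 0 < LS) (Pinf0 : 0 < Pinf) (PinfCP : Pinf <= CP).
Local Notation st := (stress lam dhat).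
Hypothesis slip : forall P (z w : 'M[R]_2), frob (st P z - st P w) <= `|P| * LS * frob (z - w).
Hypothesis sP : forall P P' (z : 'M[R]_2), frob (st P z - st P' z) <= `|P - P'| * (LS * frob z + 1).
Variables (m omega c theta : R).
Hypotheses (c0 : 0 <= c) (th : 0 <= theta <= pi / 4).

Lemma st_meas (f : plane R -> R) (y w : LL oO 2 2) : measurable_fun Om f ->
  measurable_fun Om (fun x => mxdot (st (f x) (val y x)) (val w x : 'M[R]_2)).
Proof.
move=> mf; have cl : clean Om (fun x => st 1 (val y x) : mxphs R 2 2).
  apply: (@clean_comp _ _ Om _ _ (@hcvg R (mxphs R 2 2)) (@hcvg R (mxphs R 2 2)) (st 1)).
    move=> a x ax; apply: (@hcvg_le R (mxphs R 2 2)) (fun n => slip 1 (a n) x) _.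
    by have := cvZ (`|1| * LS) ax; rewrite mulr0.
  exact: L2_clean.
have := measurable_funM mf (meas_ip mO cl (L2_clean w)).
apply: eq_measurable_fun => x _; transitivity (f x * mxdot (st 1 (val y x)) (val w x : 'M[R]_2)) => //.
by rewrite -mxdotZl /stress scalerA mul1r.
Qed.

Local Notation Phi := (@Phi _ _ R nu Om mO fO lam dhat LS Pinf CP LS0 Pinf0 PinfCP slip sP m omega c theta V iV eV).

Lemma PhiE (p : Pres R Om) (W : H) (u v : V) :
  (\forall x \ae nu, Om x -> Pinf <= sval p x <= CP) ->
  Phi id p (W - iV u) u v =
    Int (fun x => mxdot (st (sval p x) (sym_grad Om (val u) x)) (sym_grad Om (val v) x))
    - Int (fun x => mxdot (tau_ocean c theta (val W x) (val u x)) (val v x))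
    - Int (fun x => mxdot ((m * omega) *: perp (val u x)) (val v x)).
Proof.
move=> hp; apply: (congr2 (fun a b : R => a - b)); first apply: (congr2 (fun a b : R => a - b)).
- rewrite -!eV_val; apply: (congr1 fine); apply: ae_eq_integral => //.
  + apply/measurable_EFinP; apply: (meas_ip mO); exact: L2_clean.
  + by apply/measurable_EFinP; apply: st_meas; exact: svalP p.
  by apply: filterS hp => x hx Ox /=; rewrite clampP_id //; exact: hx.
- by apply: Int_eq => x _; rewrite /tau_ocean /tauf iV_val /= iV_val.
rewrite -!iV_val L2ipE -(IntZ mO); last exact: L2_itg.
by apply: Int_eq => x _; rewrite -[LHS](@ipZl R E1).
Qed.

End OceanOperator.

(** * Means and products of vector-valued functions *)

Section VectorTime.
Variables (R : realType) (T : R).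
Local Notation D := (Iv T).
Let mD : measurable D := mIv T.
Local Notation leb := (leb1 R).

Lemma L2_mean (E : phs R) (cE : hcomplete E) (x : L2 leb mD E) :
  exists J : E, forall v, ip J v = IntT T (fun t => ip (val x t) v).
Proof.
have hi v : itgT T (fun t => ip (val x t) v).
  have hv : L2mem leb D (fun=> v) by apply: (L2mem_step mD (Iv_fin T)); exact: step_cst.
  exact: L2_itg x (mkL2 mD hv).
have ih := L2_hn_itg (Iv_fin T) x.
have FL a v w : IntT T (fun t => ip (val x t) (a *: v + w)) =
    a * IntT T (fun t => ip (val x t) v) + IntT T (fun t => ip (val x t) w).
  rewrite -(IntZ mD _ (hi v)) -(IntD mD (itgZ mD a (hi v)) (hi w)).
  by apply: Int_eq => t _; rewrite ipDr ipZr.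
have FK v : `|IntT T (fun t => ip (val x t) v)| <= IntT T (fun t => hn (val x t)) * hn v.
  rewrite mulrC -(IntZ mD _ ih); apply: (Int_abs_le mD (hi v) (itgZ mD _ ih)) => t _.
  by rewrite mulrC; exact: ip_CS.
by have [J hJ] := riesz cE FL FK; exists J => v; rewrite hJ.
Qed.

Lemma L2mem_mul (E : phs R) (phi : R -> R) (C : R) (x : L2 leb mD E) :
  measurable_fun D (phi : measurableTypeR R -> R) -> (forall t, `|phi t| <= C) ->
  L2mem leb D (fun t => phi t *: val x t).
Proof.
move=> mp hC; have cl : clean D (fun t => phi t *: val x t).
  apply: (@clean_comp2 _ _ D R E E (@cv R) (@hcvg R E) (@hcvg R E) (fun a y => a *: y) phi (val x)).
  - move=> a p b y ap by_; apply: (hcvg_le (b := fun n => `|a n| * hn (b n - y) + `|a n - p| * hn y)) => [n|].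
      have -> : a n *: b n - p *: y = a n *: (b n - y) + (a n - p) *: y by rewrite scalerBr scalerBl subrKA.
      by apply: le_trans (hnD _ _) _; rewrite !hnZ.
    have h1 := cv_abs (cvB ap (cvC p)); rewrite subrr normr0 in h1.
    by have := cvD (cvM (cv_abs ap) by_) (cvM h1 (cvC (hn y))); rewrite mulr0 mul0r addr0.
  - exact: meas_clean_real.
  - exact: L2_clean.
apply: (L2mem_dom mD cl (itgZ mD (C ^+ 2) (L2_itg x x))) => t _.
rewrite ipZl ipZr mulrA -expr2 ler_wpM2r ?ip_ge0 // -(real_normK (num_real (phi t))).
by rewrite ler_pXn2r ?nnegrE ?(le_trans (normr_ge0 (phi t)) (hC t)).
Qed.

Lemma L2mem_lip (E F : phs R) (f : E -> F) (K : R) (x : L2 leb mD E) : 0 <= K ->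
  (forall a b, hn (f a - f b) <= K * hn (a - b)) -> hn (f 0) = 0 ->
  L2mem leb D (fun t => f (val x t)).
Proof.
move=> K0 fK f0; have cl : clean D (fun t => f (val x t)).
  apply: (clean_comp (cE := @hcvg R E) (cF := @hcvg R F)) (L2_clean x) => a y ay.
  apply: (hcvg_le (fun n => fK (a n) y)).
  by have := cvZ K ay; rewrite mulr0.
apply: (L2mem_dom mD cl (itgZ mD (K ^+ 2) (L2_itg x x))) => t _.
rewrite -!hn_sq -exprMn ler_pXn2r ?nnegrE ?mulr_ge0 ?hn_ge0 //.
have := fK (val x t) 0; rewrite subr0; apply: le_trans.
by have := hn_triB (f (val x t)) (f 0) 0; rewrite !subr0 f0 addr0.
Qed.

End VectorTime.

Lemma alg_abs_sq (R : realFieldType) (k x : R) : 0 < k -> `|x| <= k * x ^+ 2 + k^-1.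
Proof.
move=> k0; rewrite -(ler_pM2l k0) mulrDr mulfV ?gt_eqF // -(real_normK (num_real x)).
have := sqr_ge0 (k * `|x|); have := sqr_ge0 (k * `|x| - 1); have := normr_ge0 x.
by move: `|x| => y y0; lra.
Qed.

(** * Distributional derivatives and the integrated equation *)

Section WeakDerivative.
Variables (R : realType) (T : R) (T0 : 0 < T).
Local Notation D := (Iv T).
Let mD : measurable D := mIv T.
Local Notation leb := (leb1 R).
Local Notation test1 phi := (test_fun (`]0, T[%classic : set R) phi).

Lemma itg_ae (f g : measurableTypeR R -> R) : measurable_fun D f -> itgT T g ->
  (\forall t \ae leb, D t -> g t = f t) -> itgT T f.
Proof.
move=> mf ig h; apply/integrableP; split; first exact/measurable_EFinP.
have /integrableP[mg] := ig; apply: le_lt_trans; rewrite le_eqVlt; apply/orP; left; apply/eqP.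
apply: ae_eq_integral => //; try by apply: measurableT_comp => //; exact/measurable_EFinP.
by apply: filterS h => t h Dt /=; rewrite h.
Qed.

(** From [|g| <= k g^2 + 1 / k] the increment over [(a, b)] is at most [k Q + (b - a) / k]; first
    [k] is chosen to make [k Q] small, then the length of the interval. *)
Lemma IntT_cont0T (g : measurableTypeR R -> R) : itgT T g -> itgT T (fun t => g t ^+ 2) ->
  cont0T T (fun t => IntT t g).
Proof.
move=> ig ig2; set Q := IntT T (fun t => g t ^+ 2).
have Q0 : 0 <= Q by apply: Int_ge0 => t _; exact: sqr_ge0.
have i1 : itgT T (fun=> 1) := itg_cst mD 1 (Iv_fin T).
have IE (a : R) : 0 <= a -> IntT a (fun=> 1) = a.
  rewrite le_eqVlt => /orP[/eqP <-|a0]; last by rewrite IntT_cst // mul1r.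
  by rewrite /Iv set_itv_ge ?bnd_simp ?ltxx // Rintegral_set0.
have key (k a b : R) : 0 < k -> 0 <= a -> a <= b -> b <= T ->
    `|IntT b g - IntT a g| <= k * Q + k^-1 * (b - a).
  move=> k0 a0 ab bT; have b0 := le_trans a0 ab.
  pose c (x : measurableTypeR R) : R := (a < x < b)%R%:R.
  have ci f : itgT T f -> itgT T (fun x => c x * f x).
    move=> hf; apply: (itg_le mD _ (itg_abs hf)).
      apply: measurable_funM; last exact: itg_meas hf.
      rewrite (_ : c = \1_(`]a, b[%classic : set (measurableTypeR R))); first exact: measurable_indic.
      by apply/funext => x; rewrite indicE /c; congr (nat_of_bool _)%:R; apply/idP/idP; rewrite inE /= in_itv.
    by move=> x _; rewrite normrM /c; case: (_ && _); rewrite ?normr1 ?normr0 ?mul1r ?mul0r.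
  have e1 := @IntT_strip R T a b g a0 ab bT ig; have e2 := @IntT_strip R T a b (fun=> 1) a0 ab bT i1.
  rewrite !IE // in e2; rewrite -e1 -e2 -(IntZ mD k ig2) -(IntZ mD k^-1 (ci _ i1)).
  have i3 := itgZ mD k ig2; have i4 := itgZ mD k^-1 (ci _ i1).
  rewrite -(IntD mD i3 i4); apply: (Int_abs_le mD (ci _ ig) (itgD mD i3 i4)) => x _.
  rewrite /c; case: (_ && _); last by rewrite !mul0r mulr0 normr0 addr0 mulr_ge0 ?sqr_ge0 // ltW.
  by rewrite !mul1r mulr1; exact: alg_abs_sq.
move=> t /andP[t0 tT] e e0; pose k := e / (2 * (Q + 1)).
have Q1 : 0 < Q + 1 by lra.
have k0 : 0 < k by rewrite divr_gt0 // mulr_gt0.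
have kQ : k * Q < e / 2.
  by rewrite /k -mulrA invfM ltr_pM2l // -mulrA gtr_pMr ?invr_gt0 // ltr_pdivrMl // mulr1 ltrDl.
exists (k * e / 2); first by rewrite divr_gt0 // mulr_gt0.
move=> s /andP[s0 sT] st.
have h (x : R) : `|x| < k * e / 2 -> k^-1 * `|x| < e / 2.
  by move=> hx; rewrite ltr_pdivrMl // mulrA.
have [ts|st'] := leP t s.
  apply: le_lt_trans (key k _ _ k0 t0 ts sT) _; have := h _ st; rewrite ger0_norm ?subr_ge0 //; lra.
rewrite distrC; apply: le_lt_trans (key k _ _ k0 s0 (ltW st') tT) _.
by have := h _ st; rewrite distrC ger0_norm ?subr_ge0 ?ltW //; lra.
Qed.

Lemma cont0T_meas (K : R -> R) : cont0T T K -> measurable_fun D (K : measurableTypeR R -> R).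
Proof.
move=> h; apply: open_continuous_measurable_fun; first exact: interval_open.
move=> t /set_mem/IvP/andP[t0 tT]; apply/cvgrPdist_lt => e e0.
have t0T : 0 <= t <= T by rewrite !ltW.
have [dl dl0 hd] := h t t0T e e0.
near=> s; rewrite distrC; apply: hd.
  by apply/andP; split; apply: ltW; near: s; [exact: lt_nbhsr|exact: lt_nbhsl].
rewrite distrC; near: s; exact: cvgr_dist_lt.
Unshelve. all: by end_near. Qed.

(** [IntT_mul] for the derivative of [phi] and for [g]: the product on its left side vanishes since
    [phi T = 0]. *)
Lemma test1_ibp (phi g : R -> R) : test1 phi -> itgT T g ->
  itgT T (fun t => derive1 phi t * IntT t g) /\
  IntT T (fun t => derive1 phi t * IntT t g) = - IntT T (fun t => phi t * g t).
Proof.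
move=> hp ig; have ip' := test1_itg (test1_derive hp).
have [i1 i2] := IntT_mul ip' ig.
have T1 : 0 <= T <= T by rewrite lexx ltW.
rewrite (test1_ftc hp T1) (test1_out hp) ?ltxx ?andbF // mul0r => e; split=> //.
apply/eqP; rewrite -addr_eq0 e eq_sym; apply/eqP; congr (_ + _).
apply: Int_eq => s /IvP/andP[s0 sT]; rewrite (test1_ftc hp) ?ltW // 1?mulrC //.
Qed.

Variables (V H : phs R) (i : V -> H) (Ci : R).
Hypothesis iL : forall (a : R) x y, i (a *: x + y) = a *: i x + i y.
Hypothesis iC : forall x, hn (i x) <= Ci * hn x.
Hypothesis Ci0 : 0 <= Ci.
Local Notation X := (L2 leb mD V).

Lemma i_comp_mem (u : X) : L2mem leb D (fun t => i (val u t)).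
Proof.
apply: (@L2mem_lip _ _ V H i Ci u Ci0) => [a b|]; last by rewrite (i0 iL) hn0.
by rewrite -(iB iL).
Qed.

Lemma i_comp_itg (u : X) w : itgT T (fun t => ip (i (val u t)) (i w)).
Proof. exact: L2_itg (mkL2 mD (i_comp_mem u)) (cstX T (i w)). Qed.

Lemma X_itg (z : X) w : itgT T (fun t => ip (val z t) w).
Proof. exact: L2_itg z (cstX T w). Qed.

Lemma Wsol_test (u z : X) (W : R -> H) : Wsol i u z W -> forall phi w, test1 phi ->
  IntT T (fun t => derive1 phi t * ip (i (val u t)) (i w)) = - IntT T (fun t => phi t * ip (val z t) w).
Proof.
move=> [h1 h2] phi w hp; have [j1 j2] := test1_ibp hp (X_itg z w).
have k1 := itgT_mul_bounded (test1_derive hp) (i_comp_itg u w).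
have k2 := itgZ mD (ip (W 0) (i w)) (test1_itg (test1_derive hp)).
have I0 : IntT T (derive1 phi) = 0 by rewrite (test1_ftc hp) ?(test1_out hp) ?ltxx ?andbF ?lexx ?ltW.
have -> : - IntT T (fun t => phi t * ip (val z t) w) = ip (W 0) (i w) * IntT T (derive1 phi) +
    IntT T (fun t => derive1 phi t * IntT t (fun s => ip (val z s) w)) by rewrite I0 mulr0 add0r j2.
rewrite -(IntZ mD _ (test1_itg (test1_derive hp))) -(IntD mD k2 j1); apply: (Int_ae mD k1 (itgD mD k2 j1)).
apply: filterS h2 => t h2 Dt; have /IvP/andP[t0 tT] := Dt.
rewrite -(hn_ipl_eq (i w) (h2 Dt)) h1 ?ltW //; first by rewrite mulrDr mulrC.
Qed.

(** [G] is the composite of [V], [H] and the dual of [V], read in [V] by Riesz. It turns the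
    functional attached to [u t] into a function with values in [V]. *)
Lemma gram_ex (cV : hcomplete V) : exists G : V -> V, forall x v, ip (G x) v = ip (i x) (i v).
Proof.
have ex (x : V) : exists y : V, forall v, ip y v = ip (i x) (i v).
  have FL a (v w : V) : ip (i x) (i (a *: v + w)) = a * ip (i x) (i v) + ip (i x) (i w).
    by rewrite iL ipDr ipZr.
  have FK (v : V) : `|ip (i x) (i v)| <= hn (i x) * Ci * hn v.
    by apply: le_trans (ip_CS _ _) _; rewrite -mulrA ler_wpM2l ?hn_ge0.
  by have [y hy] := riesz cV FL FK; exists y => v; rewrite hy.
by have [G hG] := choice ex; exists G.
Qed.

Lemma Wsol_mean (cV : hcomplete V) (u z : X) (W : R -> H) phi : Wsol i u z W -> test1 phi ->
  exists (x1 x2 : X) (J : V), [/\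
    forall t v, ip (val x1 t) v = derive1 phi t * ip (i (val u t)) (i v),
    forall t, val x2 t = phi t *: val z t,
    forall v, ip J v = IntT T (fun t => ip (val x1 t) v) &
    forall v, ip (- J) v = IntT T (fun t => ip (val x2 t) v)].
Proof.
move=> hW hp; have [G hG] := gram_ex cV.
have G_lip a b : hn (G a - G b) <= Ci * Ci * hn (a - b).
  apply: hn_le_dual => [|v]; first by rewrite !mulr_ge0 ?hn_ge0.
  rewrite ipBl !hG -ipBl -(iB iL); apply: le_trans (ip_CS _ _) _.
  have -> : Ci * Ci * hn (a - b) * hn v = Ci * hn (a - b) * (Ci * hn v) by ring.
  exact: ler_pM (hn_ge0 _) (hn_ge0 _) (iC _) (iC _).
have G0 : hn (G 0) = 0 by apply/eqP; rewrite -sqrf_eq0 hn_sq hG (i0 iL) ip0l.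
pose u1 : X := mkL2 mD (L2mem_lip u (mulr_ge0 Ci0 Ci0) G_lip G0).
have [C1 _ hC1] := test_bounded (test1_derive hp); have [C2 _ hC2] := test_bounded hp.
pose x1 : X := mkL2 mD (L2mem_mul u1 (test1_meas (test1_derive hp)) hC1).
pose x2 : X := mkL2 mD (L2mem_mul z (test1_meas hp) hC2).
have hx1 t v : ip (val x1 t) v = derive1 phi t * ip (i (val u t)) (i v) by rewrite -hG -ipZl.
have [J hJ] := L2_mean cV x1; exists x1, x2, J; split=> // v.
rewrite ipNl hJ (@Int_eq _ _ _ leb D _ _ (fun t _ => hx1 t v)) (Wsol_test hW v hp) opprK.
by apply: Int_eq => t _; rewrite -ipZl.
Qed.

(** For each [w], the continuous function [ip (W t) (i w)] minus the primitive of [ip (z t) w] is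
    annihilated by all derivatives of test functions, hence constant. *)
Lemma Wsol_of_test (u z : X) (W : R -> H) : Hcont T W ->
  (\forall t \ae leb, D t -> hn (W t - i (val u t)) = 0) ->
  (forall phi w, test1 phi -> IntT T (fun t => derive1 phi t * ip (i (val u t)) (i w)) =
     - IntT T (fun t => phi t * ip (val z t) w)) -> Wsol i u z W.
Proof.
move=> hc hae ht; split=> // t tT w.
have cW : cont0T T (fun t => ip (W t) (i w)).
  move=> s sT e e0; have k0 : 0 < hn (i w) + 1 by rewrite ltr_wpDl ?hn_ge0.
  have [dl dl0 hd] := hc s sT (e / (hn (i w) + 1)) (divr_gt0 e0 k0).
  exists dl => // r rT rs; rewrite -ipBl; apply: le_lt_trans (ip_CS _ _) _.
  have := hd r rT rs; rewrite ltr_pdivlMr //; apply: le_lt_trans.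
  by rewrite ler_wpM2l ?hn_ge0 // lerDl.
have iW : itgT T (fun t => ip (W t) (i w)).
  apply: (itg_ae (cont0T_meas cW) (i_comp_itg u w)); apply: filterS hae => s hs Ds.
  by rewrite (hn_ipl_eq (i w) (hs Ds)).
have iz := X_itg z w.
have iz2 : itgT T (fun t => ip (val z t) w ^+ 2).
  apply: (itg_le mD _ (itgZ mD (hn w ^+ 2) (L2_itg z z))).
    by apply: measurable_funX; exact: itg_meas iz.
  move=> s _; rewrite ger0_norm ?sqr_ge0 // -hn_sq -exprMn -real_normK ?num_real //.
  by rewrite ler_pXn2r ?nnegrE ?mulr_ge0 ?hn_ge0 // mulrC; exact: ip_CS.
have cz := IntT_cont0T iz iz2.
have iIz : itgT T (fun t => IntT t (fun s => ip (val z s) w)).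
  have [h _ _] := IntT_mul (itg_cst mD 1 (Iv_fin T)) iz.
  by apply: (itg_eq mD _ h) => s _; rewrite mul1r.
pose K s := ip (W s) (i w) - IntT s (fun s => ip (val z s) w).
have cK : cont0T T K.
  move=> s sT e e0; have e2 : 0 < e / 2 by rewrite divr_gt0.
  have [d1 d10 h1] := cW s sT _ e2; have [d2 d20 h2] := cz s sT _ e2.
  exists (Num.min d1 d2); first by rewrite lt_min d10.
  move=> r rT; rewrite lt_min => /andP[r1 r2].
  have -> (a b c d : R) : a - b - (c - d) = a - c - (b - d) by ring.
  by apply: le_lt_trans (ler_normB _ _) _; rewrite (splitr e) ltrD ?h1 ?h2.
have := du_bois_reymond T0 cK (itgB mD iW iIz).
have tK phi : test1 phi -> IntT T (fun t => derive1 phi t * K t) = 0.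
  move=> hp; have [j1 j2] := test1_ibp hp iz.
  have k1 := itgT_mul_bounded (test1_derive hp) iW.
  transitivity (IntT T (fun t => derive1 phi t * ip (W t) (i w) - derive1 phi t * IntT t (fun s => ip (val z s) w))).
    by apply: Int_eq => s _; rewrite mulrBr.
  rewrite (IntB mD k1 j1) j2 -[RHS](subrr (- IntT T (fun t => phi t * ip (val z t) w))); congr (_ - _).
  rewrite -ht //; apply: (Int_ae mD k1 (itgT_mul_bounded (test1_derive hp) (i_comp_itg u w))).
  by apply: filterS hae => s hs Ds; rewrite (hn_ipl_eq (i w) (hs Ds)).
move=> /(_ tK t tT); rewrite /K /pairT.
have -> : IntT 0 (fun s => ip (val z s) w) = 0 by rewrite /Iv set_itv_ge ?bnd_simp ?ltxx // Rintegral_set0.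
by rewrite subr0 => <-; rewrite subrK.
Qed.

End WeakDerivative.

(** * Passage between weak solutions and the abstract equation *)

Section Representatives.
Variables (R : realType) (Om : set (plane R)) (oO : open Om) (M : R) (M0 : 0 < M).
Hypothesis OM : forall z, Om z -> `|z.1| < M /\ `|z.2| < M.
Variables (T : R) (T0 : 0 < T).
Local Notation nu := (leb2 R).
Local Notation D := (Iv T).
Let mD : measurable D := mIv T.
Local Notation leb := (leb1 R).
Local Notation H := (LL oO 2 1).
Local Notation V := (VV oO M0 OM).
Local Notation iV := (@iV R Om oO M M0 OM).
Local Notation X := (L2 leb mD V).
Local Notation X2 := (LpO Om 2%:E).
Local Notation Vd := (dual (H10 Om)).
Local Notation toV := (@toV R Om oO M M0 OM).
Local Notation toH := (@toH R Om oO).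
Local Notation ipd := (@ipd R Om oO M M0 OM).
Local Notation Vrep := (@Vrep R Om oO M M0 OM).

Lemma gelfandE (u : vfield R) (w : V) : in_LpO Om 2%:E u -> gelfand Om u (val w) = ip (toH u) (iV w).
Proof. by move=> hu; rewrite L2ipE iV_val toHE. Qed.

Lemma toH_iV (x : V) : toH (val x) = iV x.
Proof. by rewrite -iV_val; exact: toHK. Qed.

Lemma H10_LpO (u : vfield R) : in_H10 Om u -> in_LpO Om 2%:E u.
Proof. by move=> [[]]. Qed.

Lemma dual_ext (F G : nsort Vd) : (forall v, in_H10 Om v -> F v = G v) -> dual_norm F = dual_norm G.
Proof.
move=> h; rewrite /dual_norm; congr ereal_sup; apply/seteqP; split=> _ [v [hv v1] <-];
  by exists v => //; rewrite h.
Qed.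

Lemma hn_toHB (u v : vfield R) (a b : H) : hn (toH u - a) = 0 -> hn (toH v - b) = 0 ->
  hn (toH u - toH v) = hn (a - b).
Proof.
move=> h1 h2; apply: hn_eq0; have := hn0_lin (-1) h2 h1.
by rewrite !scaleN1r [- toH v + _]addrC [- b + _]addrC.
Qed.

Lemma regular_of_Wsol (ux zx : X) (W : R -> H) : Wsol iV ux zx W -> Hcont T W ->
  exists us : R -> vfield R, [/\ in_C T X2 us, in_bochner T 2%:E (H10 Om) us,
    in_bochner T 2%:E Vd (fun t => ipd (val zx t)),
    is_time_deriv Om T us (fun t => ipd (val zx t)) &
    (\forall t \ae leb, D t -> us t = val (val ux t)) /\ forall t, hn (toH (us t) - W t) = 0].
Proof.
move=> hW hc; pose us t : vfield R := if `[< hn (W t - iV (val ux t)) = 0 >] then val (val ux t) else val (W t).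
have ae_us : \forall t \ae leb, D t -> us t = val (val ux t).
  by apply: filterS hW.2 => t h Dt; rewrite /us asboolT //; exact: h.
have hL t : in_LpO Om 2%:E (us t).
  rewrite /us; case: asboolP => _; first exact: H10_LpO (V_in _).
  by apply/(LpO_mem oO); exact: L2val.
have hus t : hn (toH (us t) - W t) = 0.
  by rewrite /us; case: asboolP => h; [rewrite toH_iV hnBC|rewrite toHK subrr hn0].
exists us; split=> //.
- move=> t tT; split; first exact: hL.
  have e : (fun s => nnorm X2 (us s - us t)) = EFin \o (fun s => hn (W s - W t)).
    apply/funext => s; rewrite (toHN oO); last exact: (nmB (LpO_L oO) (hL s) (hL t)).
    by rewrite (hn_eq0 (toHB _ (hL s) (hL t))) (hn_toHB (hus s) (hus t)).
  rewrite e; apply: cvg_EFin; first exact: nearW.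
  apply/cvgrPdist_lt => k k0; have [dl dl0 hd] := hc t tT k k0.
  rewrite near_withinE; near=> s => sT; rewrite /= sub0r normrN ger0_norm ?hn_ge0 //.
  apply: hd; first by move: sT; rewrite /= in_itv.
  by rewrite distrC; near: s; exact: cvgr_dist_lt.
- apply: (@bochner_of_L2 R T (H10 Om) V (fun x : V => val x) _ (@V_in _ _ _ _ _ _) (@V_norm _ _ _ _ _ _) ux) => //.
  by apply: filterS ae_us => t h Dt; rewrite (h Dt); split=> //; exact: V_in.
- apply: (@bochner_of_L2 R T Vd V ipd (@ipdL _ _ _ _ _ _) (@ipd_mem _ _ _ _ _ _) (@ipd_norm _ _ _ _ _ _) zx).
  by apply: nearW => t Dt; split=> //; exact: ipd_mem.
move=> phi hp; have [x1 [x2 [J [hx1 hx2 hJ hJ2]]]] := Wsol_mean T0 (@iVL _ _ _ _ _ _)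
  (@iV_le _ _ _ _ _ _) ler01 (@VV_complete R Om oO M M0 OM) hW hp.
exists (ipd J); split.
  apply: (@bochner_int_of R T Vd V ipd (@ipdL _ _ _ _ _ _) (@ipd_mem _ _ _ _ _ _) (@ipd_norm _ _ _ _ _ _) x1 _ J) => //.
    apply: filterS ae_us => t h Dt.
    have e (v : V) : (derive1 phi t *: gelfand Om (us t) : nsort Vd) (val v) = ip (val x1 t) v.
      by rewrite hx1 -toH_iV -(h Dt) -gelfandE.
    split; first exact: dual_of e.
    move=> y; apply: dual_ext => v hv; rewrite -(toVE oO M0 OM hv).
    by transitivity (ip (val x1 t) (toV v) - y (val (toV v))); [rewrite -e|rewrite -ipdE].
  exact: (@dual_ge0 R Om oO M M0 OM).
have -> : - ipd J = ipd (- J) by apply/funext => v; rewrite /ipd ipNl.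
apply: (@bochner_int_of R T Vd V ipd (@ipdL _ _ _ _ _ _) (@ipd_mem _ _ _ _ _ _) (@ipd_norm _ _ _ _ _ _) x2 _ (- J)) => //.
  apply: nearW => t Dt; have -> : phi t *: ipd (val zx t) = ipd (val x2 t).
    by rewrite hx2; apply/funext => v; rewrite /ipd ipZl.
  by split=> //; exact: ipd_mem.
exact: (@dual_ge0 R Om oO M M0 OM).
Unshelve. all: by end_near. Qed.

(** Evaluation at a fixed [w] is a bounded functional on the dual, so the identity between Bochner
    integrals becomes the scalar one required by [Wsol_of_test]. *)
Lemma Wsol_of_regular (us : R -> vfield R) (du : R -> nsort Vd) : in_C T X2 us ->
  in_bochner T 2%:E (H10 Om) us -> in_bochner T 2%:E Vd du -> is_time_deriv Om T us du ->
  exists ux zx : X, Wsol iV ux zx (fun t => toH (us t)) /\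
    \forall t \ae leb, D t -> [/\ in_H10 Om (us t), val ux t = toV (us t), nmem Vd (du t) &
      val zx t = Vrep (du t)].
Proof.
move=> hC hV hdu hder.
have d0 := @dual_0 R Om oO M M0 OM; have dL := @dual_lin R Om oO M M0 OM.
have [ux hux] := @model_L2 R T (H10 Om) V toV (H10_0 oO M0 OM) (in_H10L oO M0 OM) (@toVN R Om oO M M0 OM) (@toVB R Om oO M M0 OM) us hV.
have [zx hzx] := @model_L2 R T Vd V Vrep d0 dL (@Vrep_norm R Om oO M M0 OM) (@VrepB R Om oO M M0 OM) du hdu.
exists ux, zx; split; last first.
  apply: filterS2 hux hzx => t h1 h2 Dt; have [a1 a2] := h1 Dt; have [b1 b2] := h2 Dt.
  by split.
have L2u t : 0 <= t <= T -> in_LpO Om 2%:E (us t) by move=> /hC[].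
apply: (Wsol_of_test T0 (@iVL R Om oO M M0 OM) (@iV_le R Om oO M M0 OM) ler01).
- move=> t tT e e0; have [ht /fine_cvgP[_ /cvgrPdist_lt/(_ e e0)]] := hC t tT.
  rewrite near_withinE => /nbhs_ballP[dl /= dl0 hd]; exists dl => // s sT st.
  have := hd s; rewrite /ball /= distrC => /(_ st); rewrite in_itv /= => /(_ sT).
  rewrite sub0r normrN -[LpO_norm _ _ _]/(nnorm X2 (us s - us t)) (toHN oO); last exact: (nmB (LpO_L oO) (L2u s sT) (L2u t tT)).
  by rewrite /= ger0_norm ?hn_ge0 // (hn_eq0 (toHB _ (L2u s sT) (L2u t tT))).
- apply: filterS hux => t h Dt; have [a1 ->] := h Dt.
  by rewrite -toH_iV toVE // subrr hn0.
move=> phi w hp; have [I [b1 b2]] := hder phi hp.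
pose ev (F : nsort Vd) : R := F (val w).
have C0 : 0 < hn w + 1 by rewrite ltr_wpDl ?hn_ge0.
have evL (a : R) (F G : nsort Vd) : nmem Vd F -> nmem Vd G -> ev (a *: F + G) = a * ev F + ev G by [].
have evC (F : nsort Vd) : nmem Vd F -> (`|ev F|%:E <= (hn w + 1)%:E * nnorm Vd F)%E.
  move=> hF; rewrite (Vrep_norm oO M0 OM hF) -EFinM lee_fin /ev (VrepE _ hF).
  by apply: le_trans (ip_CS _ _) _; rewrite mulrC ler_wpM2r ?hn_ge0 // lerDl.
have i1 := itgT_mul_bounded (test1_derive hp) (i_comp_itg (@iVL R Om oO M M0 OM) (@iV_le R Om oO M M0 OM) ler01 ux w).
have i2 := itgT_mul_bounded hp (X_itg zx w).
have e1 := @bochner_int_scalar R T Vd d0 dL _ I ev _ _ (@dual_ge0 R Om oO M M0 OM) C0 evL evC i1 _ b1.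
have e2 := @bochner_int_scalar R T Vd d0 dL _ (- I) ev _ _ (@dual_ge0 R Om oO M M0 OM) C0 evL evC i2 _ b2.
rewrite -e1; last first.
  apply: filterS hux => t h Dt; have [a1 ->] := h Dt; have /IvP/andP[t0 tT] := Dt.
  have tT' : 0 <= t <= T by rewrite !ltW.
  by rewrite -toH_iV toVE // -gelfandE //; exact: L2u.
rewrite -e2 ?opprK //; apply: filterS hzx => t h Dt; have [a1 ->] := h Dt.
by rewrite -VrepE.
Qed.

End Representatives.

(** * Weak solutions *)

Section OceanSolution.
Variables (R : realType) (Om : set (plane R)) (oO : open Om) (M : R) (M0 : 0 < M).
Hypothesis OM : forall z, Om z -> `|z.1| < M /\ `|z.2| < M.
Variables (T : R) (T0 : 0 < T).
Local Notation nu := (leb2 R).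
Local Notation D := (Iv T).
Let mO : measurable Om := open_plane_measurable oO.
Let fO : (nu Om < +oo)%E := Om_fin oO OM.
Local Notation leb := (leb1 R).
Local Notation H := (LL oO 2 1).
Local Notation V := (VV oO M0 OM).
Local Notation iV := (@iV R Om oO M M0 OM).
Local Notation eV := (@eV R Om oO M M0 OM).
Local Notation X := (L2 leb (mIv T) V).
Local Notation Vd := (dual (H10 Om)).
Local Notation toV := (@toV R Om oO M M0 OM).
Local Notation toH := (@toH R Om oO).
Local Notation ipd := (@ipd R Om oO M M0 OM).
Local Notation Vrep := (@Vrep R Om oO M M0 OM).
Variables (lam : R) (dhat : 'M[R]_2 -> R) (cS LS Pinf CP : R).
Hypotheses (cS0 : 0 < cS) (LS0 : 0 < LS) (Pinf0 : 0 < Pinf) (PinfCP : Pinf <= CP).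
Local Notation st := (stress lam dhat).
Hypothesis smon : forall P (z w : 'M[R]_2), 0 <= P -> z^T = z -> w^T = w ->
  P * cS * frob (z - w) ^+ 2 <= mxdot (st P z - st P w) (z - w).
Hypothesis slip : forall P (z w : 'M[R]_2), frob (st P z - st P w) <= `|P| * LS * frob (z - w).
Hypothesis sP : forall P P' (z : 'M[R]_2), frob (st P z - st P' z) <= `|P - P'| * (LS * frob z + 1).
Variables (m omega c theta : R).
Hypotheses (m0 : 0 < m) (c0 : 0 <= c) (th : 0 <= theta <= pi / 4).
Variables (Pc : measurableTypeR R -> Pres R Om) (Uc : measurableTypeR R -> H) (hX : X) (CU : R).
Hypothesis cP : clean_for D (@convP _ _ R nu Om) Pc.
Hypothesis cU : clean D Uc.
Hypothesis CU0 : 0 <= CU.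
Hypothesis hUc : forall t, D t -> hn (Uc t) <= CU.
Hypothesis lU : forall t, D t -> l4 (Uc t).
Hypothesis iU : itgT T (fun t => N4 nu Om (fun x => @hn R (mxphs R 2 1) (val (Uc t) x)) ^+ 2).
Variables (U : R -> vfield R) (h : R -> nsort Vd) (P : R -> plane R -> R).
Hypothesis aeU : \forall t \ae leb, D t -> val (Uc t) = U t.
Hypothesis aeP : \forall t \ae leb, D t -> sval (Pc t) = P t /\
  \forall x \ae nu, Om x -> Pinf <= P t x <= CP.
Hypothesis aeh : \forall t \ae leb, D t -> nmem Vd (h t) /\ val hX t = Vrep (h t).

Local Notation oeq := (@ocean_eq _ _ R nu Om mO fO lam dhat LS Pinf CP LS0 Pinf0 PinfCP slip sP
  m omega c theta V iV eV T Pc Uc hX).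

Definition weak_at (u : vfield R) (du : nsort Vd) (t : R) : Prop :=
  forall v : vfield R, in_H10 Om v ->
    m * du v
    + \int[@leb2 R]_(x in Om) mxdot (st (P t x) (sym_grad Om u x)) (sym_grad Om v x)
    - \int[@leb2 R]_(x in Om) mxdot (tau_ocean c theta (U t x) (u x)) (v x)
    - \int[@leb2 R]_(x in Om) mxdot ((m * omega) *: perp (u x)) (v x)
    = h t v.

(** The null set is fixed before [u] and [du], so one statement serves the constructed solution and
    an arbitrary one, whose derivative is known only on [H^1_0]. *)
Lemma weak_atE (ux zx : X) : \forall t \ae leb, D t -> forall (u : vfield R) (du : nsort Vd),
  u = val (val ux t) -> (forall v : V, du (val v) = ip (val zx t) v) ->
  (oeq ux zx t <-> weak_at u du t).
Proof.
apply: filterS3 aeU aeP aeh => t h1 h2 h3 Dt u du -> hdu.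
have {}h1 := h1 Dt; have [p1 p2] := h2 Dt; have [a1 a2] := h3 Dt.
have hp : \forall x \ae nu, Om x -> Pinf <= sval (Pc t) x <= CP by rewrite p1.
have E v := @PhiE R Om oO M M0 OM lam dhat LS Pinf CP LS0 Pinf0 PinfCP slip sP m omega c theta (Pc t) (Uc t) (val ux t) v hp.
have A v : h t (val v) = ip (val hX t) v by rewrite a2 -VrepE.
rewrite p1 h1 in E; split=> [ho v hv|hw v].
  by rewrite -(toVE oO M0 OM hv) hdu A -(ho (toV v)) E !addrA.
by rewrite -A -(hw _ (V_in v)) hdu E !addrA.
Qed.

Let Ke0 : 0 < 2 * (1 + (4 * M) ^+ 2).
Proof. by rewrite mulr_gt0 // ltr_pwDl // sqr_ge0. Qed.

Lemma hn_toH_ae (u v : vfield R) : in_LpO Om 2%:E u -> in_LpO Om 2%:E v ->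
  hn (toH u - toH v) = 0 <-> \forall x \ae nu, Om x -> u x = v x.
Proof.
move=> hu hv; rewrite L2_hn0P; split; apply: filterS => x hx Ox.
  have := hx Ox; rewrite L2_subE !toHE // => h0.
  apply/eqP; rewrite -subr_eq0; apply/eqP/matrixP => i j; rewrite [RHS]mxE.
  by apply/eqP; rewrite -normr_le0 -h0; exact: entry_le.
by rewrite L2_subE !toHE // hx // subrr (@hn0 R (mxphs R 2 1)).
Qed.

Lemma weak_solution_exists (u0 : vfield R) : in_LpO Om 2%:E u0 ->
  exists u : R -> vfield R, weak_solution m omega lam c theta dhat Om T U h P u0 u.
Proof.
move=> hu0.
have [ux [zx [W [hW ho h0]]]] := @ocean_exists _ _ R nu Om mO fO lam dhat cS LS Pinf CP cS0 LS0 Pinf0 PinfCP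
  smon slip sP m omega c theta m0 c0 th V (@VV_complete R Om oO M M0 OM) iV eV _ (@iVL R Om oO M M0 OM)
  (@iV_le R Om oO M M0 OM) (@eVL R Om oO M M0 OM) (@eV_le R Om oO M M0 OM) (@eV_sym R Om oO M M0 OM) Ke0
  (@eV_coercive R Om oO M M0 OM) (@iV_l4 R Om oO M M0 OM) (@iV_N4 R Om oO M M0 OM) T T0 Pc Uc hX CU
  cP cU CU0 hUc lU iU (@LL_complete R Om oO M OM 2 1) (@iV_inj R Om oO M M0 OM) (@iV_dense R Om oO M M0 OM) (toH u0).
have [_ hc] := Wsol_good T0 (@VV_complete R Om oO M M0 OM) (@LL_complete R Om oO M OM 2 1) (@iVL R Om oO M M0 OM)
  (@iV_le R Om oO M M0 OM) (@iV_inj R Om oO M M0 OM) (@iV_dense R Om oO M M0 OM) hW.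
have [us [u1 u2 u3 u4 [u5 u6]]] := regular_of_Wsol T0 hW hc.
exists us; split=> //.
  exists (fun t => ipd (val zx t)); split=> //.
  apply: Iv_ae; apply: filterS3 u5 ho (weak_atE ux zx) => t h1 h2 h3 Dt.
  exact: (h3 Dt (us t) (ipd (val zx t)) (h1 Dt) (ipdE (val zx t))).1 (h2 Dt).
have t0 : 0 <= (0 : R) <= T by rewrite lexx ltW.
exact: (hn_toH_ae (u1 0 t0).1 hu0).1 (hn0_tri (u6 0) h0).
Qed.

Lemma weak_solution_rep (u0 : vfield R) (u : R -> vfield R) : in_LpO Om 2%:E u0 ->
  weak_solution m omega lam c theta dhat Om T U h P u0 u -> exists ux zx : X,
  [/\ Wsol iV ux zx (fun t => toH (u t)), \forall t \ae leb, D t -> oeq ux zx t &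
      hn (toH (u 0) - toH u0) = 0].
Proof.
move=> hu0 [u1 u2 [du [d1 d2 d3]] u4]; have [ux [zx [hW hr]]] := Wsol_of_regular oO M0 OM T0 u1 u2 d1 d2.
have t0 : 0 <= (0 : R) <= T by rewrite lexx ltW.
exists ux, zx; split=> //; last exact: (hn_toH_ae (u1 0 t0).1 hu0).2 u4.
apply: filterS3 hr (ae_Iv d3) (weak_atE ux zx) => t h1 h2 h3 Dt; have [a1 a2 a3 a4] := h1 Dt.
apply/(h3 Dt (u t) (du t)); [by rewrite a2 toVE|by move=> v; rewrite a4 -VrepE|exact: h2].
Qed.

Lemma weak_solution_unique (u0 : vfield R) (u w : R -> vfield R) : in_LpO Om 2%:E u0 ->
  weak_solution m omega lam c theta dhat Om T U h P u0 u ->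
  weak_solution m omega lam c theta dhat Om T U h P u0 w ->
  forall t, 0 <= t <= T -> \forall x \ae nu, Om x -> u t x = w t x.
Proof.
move=> hu0 su sw t tT.
have [ux [zx [hW ho h0]]] := weak_solution_rep hu0 su; have [ux' [zx' [hW' ho' h0']]] := weak_solution_rep hu0 sw.
have [u1 _ _ _] := su; have [w1 _ _ _] := sw.
apply: (hn_toH_ae (u1 t tT).1 (w1 t tT).1).1.
apply: (@ocean_unique _ _ R nu Om mO fO lam dhat cS LS Pinf CP cS0 LS0 Pinf0 PinfCP
  smon slip sP m omega c theta m0 c0 th V (@VV_complete R Om oO M M0 OM) iV eV _ (@iVL R Om oO M M0 OM)
  (@iV_le R Om oO M M0 OM) (@eVL R Om oO M M0 OM) (@eV_le R Om oO M M0 OM) (@eV_sym R Om oO M M0 OM) Ke0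
  (@eV_coercive R Om oO M M0 OM) (@iV_l4 R Om oO M M0 OM) (@iV_N4 R Om oO M M0 OM) T T0 Pc Uc hX CU
  CU0 hUc lU (@LL_complete R Om oO M OM 2 1) (@iV_inj R Om oO M M0 OM) (@iV_dense R Om oO M M0 OM)
  ux zx (fun t => toH (u t)) ux' zx' (fun t => toH (w t)) hW hW' ho ho' _ t tT).
by apply: hn0_tri h0 _; rewrite hnBC.
Qed.

End OceanSolution.

Theorem mainTheorem2 (R : realType)
    (m omega ebar lambda c_ocean theta dinf dsup eps T Pinf : R)
    (Om : set (plane R)) (dhat : 'M[R]_2 -> R)
    (u0 : vfield R) (U : R -> vfield R) (h : R -> nsort (dual (H10 Om)))
    (P : R -> plane R -> R) :
  0 < m -> 0 < ebar -> lambda = 2 / ebar ^+ 2 -> 0 <= c_ocean ->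
  0 <= theta <= pi / 4 -> 0 < dinf < dsup ->
  bounded_lipschitz_domain Om ->
  0 < eps ->
  (dhat = delta_above eps lambda dsup \/
   dhat = delta_both eps lambda dinf dsup) ->
  0 < T ->
  in_LpO Om 2%:E u0 ->
  in_bochner T +oo (LpO Om 2%:E) U ->
  in_bochner T 2%:E (LpO Om 4%:E) U ->
  in_bochner T 2%:E (dual (H10 Om)) h ->
  in_bochner T +oo (LinfO Om) P ->
  0 < Pinf ->
  (\forall t \ae @leb1 R, 0 < t < T ->
     \forall x \ae @leb2 R, Om x -> Pinf <= P t x) ->
  (exists u : R -> vfield R,
     weak_solution m omega lambda c_ocean theta dhat Om T U h P u0 u) /\
  (forall u w : R -> vfield R,
     weak_solution m omega lambda c_ocean theta dhat Om T U h P u0 u ->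
     weak_solution m omega lambda c_ocean theta dhat Om T U h P u0 w ->
     forall t, 0 <= t <= T -> \forall x \ae @leb2 R, Om x -> u t x = w t x).
Proof.
move=> m0 e0 hlam c0 th dd [_ oO _ bO _] eps0 hd T0 hu0 hU hU4 hh hP P0 hPinf.
have lam0 : 0 < lambda by rewrite hlam divr_gt0 // exprn_gt0.
have [M M0 OM] := bounded_plane bO.
have [cS [LS [cS0 LS0 smon slip sP]]] := stress_ex lam0 eps0 dd hd.
have [Pc [CP [PinfCP cP aeP]]] := data_P hP hPinf.
have [Uc [CU [cU [CU0 hUc] lU iU aeU]]] := data_U oO OM hU hU4.
have [hX aeh] := model_L2 (@dual_0 R Om oO M M0 OM) (@dual_lin R Om oO M M0 OM)
  (@Vrep_norm R Om oO M M0 OM) (@VrepB R Om oO M M0 OM) hh.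
split; first exact: (weak_solution_exists T0 cS0 LS0 P0 PinfCP smon slip sP omega m0 c0 th cP cU CU0 hUc lU iU aeU aeP aeh).
move=> u w su sw t tT.
exact: (weak_solution_unique T0 cS0 LS0 P0 PinfCP smon slip sP m0 c0 th CU0 hUc lU aeU aeP aeh hu0 su sw tT).
Qed.
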